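(* Suppose that the counting function satisfies $N_L(x)\sim\varphi(x)$ as $x\to+\infty$ for some continuous, increasing function $\varphi:\mathbb{R}_+\to\mathbb{R}_+$ such that $$\varphi'\in L^\infty_{\rm loc}(\mathbb{R}_+),\qquad \mathrm{ess}\text{-}\limsup_{x\to+\infty}\varphi'(x)/\varphi(x)=0.$$ Let $\mathcal{A}_L$ be the Lipschitz algebra of $L$ and $A$ its norm closure in $\mathcal{B}(h)$. Then: (1.a) For $s>1$, $\varphi(L)^{-s}$ is trace class and $\lim_{s\downarrow1}(s-1)\,\mathrm{Tr}(\varphi(L)^{-s})=1$. (1.b) For $a\in\mathcal{A}_L$, $\lim_{s\downarrow1}(s-1)\,\mathrm{Tr}\big(\big|[a,\varphi(L)^{-s}]\big|\big)=0$. (1.c) For $a\in\mathcal{A}_L$ and $b\in\mathcal{B}(h)$, $\lim_{s\downarrow1}(s-1)\,\mathrm{Tr}\big((ab-ba)\varphi(L)^{-s}\big)=0$. (2) For $s>1$ define linear functionals on $\mathcal{B}(h)$ by $\omega_s(b):=(s-1)\mathrm{Tr}(b\,\varphi(L)^{-s})$. As $s\downarrow1$, the set of (weak$^*$) limit points of $\{\omega_s\in\mathcal{B}(h)^*:s>1\}$ is not empty, and any such limit linear form $\tau$ is a state on $\mathcal{B}(h)$ with the following properties: (2.a) $\tau$ vanishes on the algebra $\mathcal{K}(h)$ of compact operators; (2.b) $\tau$ is a hypertrace on $A$: $\tau(ba)=\tau(ab)$ for all $a\in A$, $b\in\mathcal{B}(h)$; (2.c) the restriction of $\tau$ to $A$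 is a tracial state. (3) For every Dixmier ultrafilter $\omega$, the volume form $\Omega_L(b)=\mathrm{Tr}_\omega(b\,\rho(L))$ on $\mathcal{B}(h)$ is a hypertrace on $A$ (i.e. $\Omega_L(ba)=\Omega_L(ab)$ for $a\in A$, $b\in\mathcal{B}(h)$), and it is a tracial state on $A$.
   Context: Let $h$ be a Hilbert space and $(L,D(L))$ a densely defined, nonnegative, unbounded self-adjoint operator on $h$ with spectral measure $E^L$, having discrete spectrum off its kernel: $sp(L)\setminus\{0\}$ is discrete in the sense that $L^{-1}$ (defined as $0$ on $\ker L$ and as the inverse of $L$ on $(\ker L)^\perp$) is compact. Convention: for measurable $f:\mathbb{R}_+\to\mathbb{R}_+$, the operator $f(L)$ is $0$ on $\ker L$ and given by the usual functional calculus on $(\ker L)^\perp$; likewise for $s>0$ and a nonnegative self-adjoint $T$, $T^{-s}$ is $0$ on $\ker T$ and the usual power on $(\ker T)^\perp$ (this applies to $\varphi(L)^{-s}$). The derivative $\varphi'$ is the weak derivative, so $\varphi'\in L^\infty_{\rm loc}$ means that $\varphi$ is locally Lipschitz. Write $0<\widetilde\lambda_1<\widetilde\lambda_2<\cdots$ for the distinct nonzero eigenvalues of $L$ (tending to $+\infty$), $m_k=\mathrm{Tr}(E^L(\{\widetilde\lambda_k\}))$, $M_k=\sum_{j=1}^k m_j$. The eigenvalue counting function is $N_L(x)=\mathrm{Tr}(E^L((0,x]))$. The spectral weight of $L$ is $\rho(L):=N_L(L)^{-1}$, i.e. the operator that is $0$ on $\ker L$ and $1/M_k$ on the eigenspace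 of $\widetilde\lambda_k$. The Lipschitz algebra is $\mathcal{A}_L=\{a\in\mathcal{B}(h): [a,L]\text{ is bounded}\}$ (i.e. $aD(L)\subset D(L)$ and $aL-La$, defined on $D(L)$, extends to a bounded operator). The dual Macaev ideal, which contains $\rho(L)$, is $\mathcal{L}^{(1,\infty)}(h)=\{T \text{ compact}:\sup_{N\ge2}\frac{1}{\log N}\sum_{n=1}^N\mu_n(T)<+\infty\}$, where $\mu_n(T)$, $n\ge1$, are the singular values of $T$ in decreasing order. A Dixmier ultrafilter is given by a state $\omega$ on $L^\infty(\mathbb{R}_+^* )$ (write $\omega\text{-}\lim_{t\to+\infty}f(t)=\omega(f)$) such that for all $f$ and $s>0$: $\mathrm{ess}\liminf_{t\to+\infty}f\le\omega(f)\le\mathrm{ess}\limsup_{t\to+\infty}f$; $\omega\text{-}\lim f(st)=\omega\text{-}\lim f(t)$; $\omega\text{-}\lim f(t^s)=\omega\text{-}\lim f(t)$; $\omega\text{-}\lim\frac1{\log t}\int_1^tf(u)\frac{du}{u}=\omega\text{-}\lim f(t)$. On $\ell^\infty(\mathbb{N})$ put $\omega\text{-}\lim_{n\to\infty}f(n):=\omega\text{-}\lim_{t\to+\infty}f([t])$, $[t]$ the integer part. The Dixmier trace is $\mathrm{Tr}_\omega(T)=\omega\text{-}\lim_{N\to\infty}\frac1{\log N}\sum_{n=1}^N\mu_n(T)$ for $0\le T\in\mathcal{L}^{(1,\infty)}(h)$, extended linearly. *)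

(* Defs.v *)
From HB Require Import structures.
From mathcomp Require Import all_boot all_order all_algebra.
From mathcomp Require Import all_classical all_reals all_analysis.
From mathcomp Require Import ess_sup_inf complex.

Set Implicit Arguments.
Unset Strict Implicit.
Unset Printing Implicit Defensive.

Import Order.TTheory GRing.Theory Num.Theory numFieldNormedType.Exports.

Local Open Scope classical_set_scope.
Local Open Scope ring_scope.
Local Open Scope complex_scope.

(* A Hilbert space is a complete normed module [h] over [R[i]] with a dot
   product [ip] (linear in the first variable) inducing its norm. *)
Definition is_hilbert (R : realType) (h : completeNormedModType R[i])
    (ip : {dot h for Num.conj}) : Prop :=
  forall x : h, `|x| ^+ 2 = ip x x.

(* Partially defined operators; the values of [pfun T] off [pdom T] are
   irrelevant. *)
Record partial_op (h : Type) := PartialOp { pdom : set h ; pfun :> h -> h }.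

HB.instance Definition _ (h : Type) := gen_eqMixin (partial_op h).
HB.instance Definition _ (h : Type) := gen_choiceMixin (partial_op h).

Section Operators.
Context (R : realType) (h : completeNormedModType R[i])
        (ip : {dot h for Num.conj}).
Implicit Types (T L : partial_op h) (a b K P : h -> h) (x y z e : h).

Definition hnorm x : R := complex.Re `|x|.

Definition bounded_op b : Prop := linear b /\ continuous b.

Definition opnorm b : R := sup [set hnorm (b x) | x in [set x | `|x| <= 1]].

Definition compact_op K : Prop :=
  linear K /\ precompact (K @` [set x | `|x| <= 1]).

Definition positive_op P : Prop :=
  bounded_op P /\ forall x, 0 <= ip (P x) x.

Definition adjoint b : h -> h :=
  fun y => xget 0 [set z | forall x, ip (b x) y = ip x z].

Definition op_abs b : h -> h :=
  xget (fun=> 0) [set P | positive_op P /\ P \o P = adjoint b \o b].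

Definition commutator a b : h -> h := (a \o b) \- (b \o a).

Definition orthonormal_basis (B : set h) : Prop :=
  (forall e e', B e -> B e' -> ip e e' = (e == e')%:R) /\
  (forall x, (forall e, B e -> ip x e = 0) -> x = 0).

Definition onb : set h := xget set0 orthonormal_basis.

(* the trace of a positive operator, possibly infinite *)
Definition pos_trace P : \bar R :=
  \esum_(e in onb) (complex.Re (ip (P e) e))%:E.

Definition trace_class b : Prop :=
  bounded_op b /\ (pos_trace (op_abs b) < +oo)%E.

(* the unordered sum of an absolutely summable real family *)
Definition real_sum (B : set h) (f : h -> R) : R :=
  fine (\esum_(e in B) (Num.max (f e) 0)%:E) -
  fine (\esum_(e in B) (Num.max (- f e) 0)%:E).

Definition trace b : R[i] :=
  real_sum onb (fun e => complex.Re (ip (b e) e)) +i*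
  real_sum onb (fun e => complex.Im (ip (b e) e)).

Definition has_dim (V : set h) (n : nat) : Prop :=
  exists v : 'I_n -> h,
    (forall c : 'I_n -> R[i], \sum_i c i *: v i = 0 -> forall i, c i = 0) /\
    V = [set x | exists c : 'I_n -> R[i], x = \sum_i c i *: v i].

Definition eigenspace b (t : R) : set h := [set x | b x = t%:C *: x].

(* [mu n] is the (n+1)-th eigenvalue of |b|, in decreasing order, counted with
   multiplicity, continued by 0 when |b| has finite rank. *)
Definition is_singular_seq b (mu : nat -> R) : Prop :=
  [/\ forall m n : nat, (m <= n)%N -> mu n <= mu m,
      forall n, 0 <= mu n &
      forall t : R, 0 < t -> exists k : nat,
        has_dim (eigenspace (op_abs b) t) k /\
        ([set n | mu n = t] #= `I_k)%card].

Definition singular_value b : nat -> R := xget (fun=> 0) (is_singular_seq b).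

(* sigma_N(b) / log N, where sigma_N is the sum of the N first singular values;
   the value for N < 2 is 0. *)
Definition log_mean_sv b (N : nat) : R :=
  (\sum_(n < N) singular_value b n) / ln N%:R.

Definition dual_macaev : set (h -> h) :=
  [set b | compact_op b /\
           exists C : R, forall N : nat, (2 <= N)%N -> log_mean_sv b N <= C].

Definition partial_linear T : Prop :=
  pdom T 0 /\ forall (c : R[i]) x y, pdom T x -> pdom T y ->
    pdom T (c *: x + y) /\ T (c *: x + y) = c *: T x + T y.

(* the last clause states T^* = T, domains included *)
Definition selfadjoint T : Prop :=
  [/\ partial_linear T, closure (pdom T) = setT &
      forall y z, (forall x, pdom T x -> ip (T x) y = ip x z) <->
                  pdom T y /\ T y = z].

Definition nonnegative T : Prop := forall x, pdom T x -> 0 <= ip (T x) x.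

Definition unbounded T : Prop :=
  ~ exists C : R, forall x, pdom T x -> hnorm (T x) <= C * hnorm x.

Definition kernel T : set h := [set x | pdom T x /\ T x = 0].

Definition orthogonal_to (V : set h) : set h :=
  [set x | forall y, V y -> ip x y = 0].

(* K is T^-1, extended by 0 on ker T. *)
Definition inverse_off_kernel T K : Prop :=
  (forall x, kernel T x -> K x = 0) /\
  (forall y, orthogonal_to (kernel T) y ->
     [/\ orthogonal_to (kernel T) (K y), pdom T (K y) & T (K y) = y]).

Definition discrete_off_kernel T : Prop :=
  exists K, compact_op K /\ inverse_off_kernel T K.

Definition orthogonal_projection P : Prop :=
  [/\ linear P, P \o P = P & forall x y, ip (P x) y = ip x (P y)].

Definition projection_valued_measure (E : set R -> h -> h) : Prop :=
  [/\ forall A, measurable A -> orthogonal_projection (E A),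
      E setT = id,
      forall A B, measurable A -> measurable B -> E (A `&` B) = E A \o E B &
      forall (F : nat -> set R) x,
        (forall n, measurable (F n)) -> trivIset setT F ->
        (fun n => \sum_(k < n) E (F k) x) @ \oo --> E (\bigcup_k F k) x].

(* the measure A |-> <E(A) x, x> *)
Definition vector_measure (E : set R -> h -> h) x : set R -> \bar R :=
  fun A => (complex.Re (ip (E A x) x))%:E.

(* S is the operator int f dE: its domain consists of the x with
   int f^2 d<E x, x> < +oo. By polarization the last clause determines
   <S x, y> for all x and y in the domain. *)
Definition is_spectral_integral (E : set R -> h -> h) (f : R -> R)
    (S : partial_op h) : Prop :=
  [/\ pdom S = [set x | (integral (vector_measure E x) setT
                           (fun t => ((f t) ^+ 2)%:E) < +oo)%E],
      partial_linear S &
      forall x, pdom S x ->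
        ip (S x) x = (fine (integral (vector_measure E x) setT
                              (fun t => (f t)%:E)))%:C].

Definition is_spectral_measure T (E : set R -> h -> h) : Prop :=
  projection_valued_measure E /\ is_spectral_integral E id T.

Definition spectral_measure T : set R -> h -> h :=
  xget (fun _ _ => 0) (is_spectral_measure T).

(* f(T) for a nonnegative self-adjoint T, with the convention that f(T) is 0 on
   ker T = ran E({0}): only the values of f on ]0, +oo[ matter. *)
Definition functional_calculus T (f : R -> R) : partial_op h :=
  xget (PartialOp set0 id)
    (is_spectral_integral (spectral_measure T)
       (fun t => if 0 < t then f t else 0)).

Definition negative_power T (s : R) : partial_op h :=
  functional_calculus T (fun t => t `^ (- s)).

Definition counting_function L (r : R) : \bar R :=
  pos_trace (spectral_measure L `]0, r]).

(* N_L(L)^-1, the operator 1/M_k on the k-th nonzero eigenspace *)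
Definition spectral_weight L : partial_op h :=
  negative_power (functional_calculus L (fun r => fine (counting_function L r)))
    1.

Definition lipschitz_algebra L : set (h -> h) :=
  [set a | [/\ bounded_op a, forall x, pdom L x -> pdom L (a x) &
     exists d, bounded_op d /\
       forall x, pdom L x -> d x = a (L x) - L (a x)]].

Definition norm_closure (A : set (h -> h)) : set (h -> h) :=
  [set b | bounded_op b /\
     forall eps : R, 0 < eps -> exists a, A a /\ opnorm (b \- a) < eps].

Definition linear_on (A : set (h -> h)) (tau : (h -> h) -> R[i]) : Prop :=
  forall (c : R[i]) a b, A a -> A b ->
    tau ((c \*: a) \+ b) = c * tau a + tau b.

(* elements of B(h)^* ; only the values on B(h) are relevant *)
Definition bounded_functional (tau : (h -> h) -> R[i]) : Prop :=
  linear_on bounded_op tau /\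
  exists C : R, forall b, bounded_op b -> `|tau b| <= (C * opnorm b)%:C.

Definition state_on (A : set (h -> h)) (tau : (h -> h) -> R[i]) : Prop :=
  [/\ linear_on A tau,
      forall b, A b -> positive_op b -> 0 <= tau b &
      tau id = 1].

Definition tracial_state_on (A : set (h -> h)) (tau : (h -> h) -> R[i]) : Prop :=
  state_on A tau /\
  forall a b, A a -> A b -> tau (a \o b) = tau (b \o a).

Definition hypertrace_on (A : set (h -> h)) (tau : (h -> h) -> R[i]) : Prop :=
  forall a b, A a -> bounded_op b -> tau (b \o a) = tau (a \o b).

(* tau is a weak-* limit point of [om s] as s decreases to 1: the weak-*
   topology is the topology of pointwise convergence on B(h). *)
Definition weak_star_limit_point (om : R -> (h -> h) -> R[i])
    (tau : (h -> h) -> R[i]) : Prop :=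
  let on_bounded (t : (h -> h) -> R[i]) :
      {ptws {b : h -> h | bounded_op b} -> R[i]^o} :=
      fun b : {b : h -> h | bounded_op b} => t (sval b) in
  cluster ((fun s => on_bounded (om s)) @ 1^'+) (on_bounded tau).

End Operators.

Section RealFunctions.
Context (R : realType).
Implicit Types (f g phi : R -> R) (x t s : R).

Definition lebesgue_above t :=
  mrestr (@lebesgue_measure R) (measurable_itv `]t, +oo[).

Definition ess_limsup f : \bar R :=
  ereal_inf [set ess_sup (lebesgue_above t) (EFin \o f) | t in setT].

Definition ess_liminf f : \bar R :=
  ereal_sup [set ess_inf (lebesgue_above t) (EFin \o f) | t in setT].

Definition C1_test_function (psi : R -> R) : Prop :=
  [/\ forall x, derivable psi x 1, continuous (derive1 psi) &
      exists u v : R, [/\ 0 < u, u < v &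
        forall x, ~ (u <= x <= v) -> psi x = 0]].

Definition weak_derivative phi dphi : Prop :=
  forall psi, C1_test_function psi ->
    Rintegral lebesgue_measure `]0, +oo[ (fun x => phi x * derive1 psi x) =
    - Rintegral lebesgue_measure `]0, +oo[ (fun x => dphi x * psi x).

Definition locally_ess_bounded f : Prop :=
  measurable_fun (`[0, +oo[ : set R) f /\
  forall M : R, exists C : R,
    {ae lebesgue_measure, forall x, 0 <= x <= M -> `|f x| <= C}.

(* Representatives of the real-valued elements of L^oo(R_+^* ): a state is
   determined by its values on these. *)
Definition Linfty : set (R -> R) :=
  [set f : R -> R | measurable_fun (`]0, +oo[ : set R) f /\
           (ess_sup (lebesgue_above 0) (fun t => `|f t|%:E) < +oo)%E].

Definition log_cesaro f t : R :=
  (ln t)^-1 *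
  (if 1 <= t then Rintegral lebesgue_measure `[1, t] (fun u => f u / u)
   else - Rintegral lebesgue_measure `[t, 1] (fun u => f u / u)).

(* The first block says that w is a state on L^oo(R_+^* ); its values outside
   Linfty are irrelevant. *)
Definition dixmier_ultrafilter (w : (R -> R) -> R) : Prop :=
  [/\ forall f g, Linfty f -> Linfty g ->
        {ae lebesgue_above 0, forall t, f t = g t} -> w f = w g,
      forall (c : R) f g, Linfty f -> Linfty g ->
        w ((c \*: f) \+ g) = c * w f + w g,
      forall f, Linfty f ->
        {ae lebesgue_above 0, forall t, 0 <= f t} -> 0 <= w f &
      w (fun=> 1) = 1] /\
  [/\ forall f, Linfty f -> (ess_liminf f <= (w f)%:E <= ess_limsup f)%E,
      forall f s, Linfty f -> 0 < s -> w (fun t => f (s * t)) = w f,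
      forall f s, Linfty f -> 0 < s -> w (fun t => f (t `^ s)) = w f &
      forall f, Linfty f -> w (log_cesaro f) = w f].

Definition seq_limit (w : (R -> R) -> R) (u : nat -> R) : R :=
  w (fun t => u (Num.truncn t)).

Context (h : completeNormedModType R[i]) (ip : {dot h for Num.conj}).

Definition is_dixmier_trace (w : (R -> R) -> R) (Tr : (h -> h) -> R[i]) : Prop :=
  linear_on (dual_macaev ip) Tr /\
  forall b, dual_macaev ip b -> positive_op ip b ->
    Tr b = (seq_limit w (log_mean_sv ip b))%:C.

(* The linear extension to the dual Macaev ideal of the limit defining Tr_w on
   positive operators. *)
Definition dixmier_trace (w : (R -> R) -> R) : (h -> h) -> R[i] :=
  xget (fun=> 0) (is_dixmier_trace w).

End RealFunctions.

(* Main.v *)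
(* In an orthonormal eigenbasis e_n of L with eigenvalues lam_n, ordered increasingly, an
   operator a with [a, L] = d bounded has matrix entries with d_in = (lam_n - lam_i) a_in.
   Since phi'/phi tends to 0, the weights p_n = phi(lam_n)^(-s/2) satisfy
   |p_n - p_i| <= eps |lam_n - lam_i| max(p_n, p_i) up to finitely many indices, hence
   [a, phi(L)^(-s/2)] is eps-small in Hilbert-Schmidt norm relatively to phi(L)^(-s/2), up to
   a bounded error. Writing phi(L)^(-s) as a square and using Cauchy-Schwarz,
   |Tr([a, b] phi(L)^(-s))| <= |b| (eps sum_n (n+1)^(-s) + C), uniformly for 1 < s <= 2, and
   likewise for Tr |[a, phi(L)^(-s)]|, while N_L ~ phi makes phi(lam_n) comparable to n. As
   (s - 1) sum_n (n+1)^(-s) tends to 1, this gives (1), and (2) by weak-* compactness. For the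
   Dixmier trace, Tr_omega(b rho(L)) is the omega-limit of
   (log N)^(-1) sum_(n < N) rho_n <b e_n, e_n>, to which the same estimate applies. *)
Require Import Defs.
From HB Require Import structures.
From mathcomp Require Import all_boot all_order all_algebra.
From mathcomp Require Import all_classical all_reals all_analysis.
From mathcomp Require Import ess_sup_inf complex.
From mathcomp Require Import ring lra measurable_realfun.

Set Implicit Arguments.
Unset Strict Implicit.
Unset Printing Implicit Defensive.

Import Order.TTheory GRing.Theory Num.Theory numFieldNormedType.Exports.

Local Open Scope classical_set_scope.
Local Open Scope ring_scope.
Local Open Scope complex_scope.

(** * Complex numbers through their real and imaginary parts *)

Section ComplexNumbers.
Context (R : realType).
Implicit Types (z w : R[i]) (r : R).
Local Notation Re := (@complex.Re R).
Local Notation Im := (@complex.Im R).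

(** Several objects of the statement are obtained by choice: spectral measure, basis of the trace,
    absolute value, singular values, Dixmier trace. Each has to be pinned down by a uniqueness or
    independence argument before an estimate can be read on the eigenbasis. Compactness of the
    inverse supplies that basis, and unboundedness makes it infinite. The obstacle in the estimate
    itself is truncation: traces are limits of partial sums, and setting the weights to 0 from an
    index [M] on creates a jump that no spectral gap pays for. The weights are therefore lowered to
    [p n - p M], at a cost controlled by [M * p M ^+ 2], which is bounded uniformly in [s >= 1]. The
    exponent [s / 2] is at most 1, so the weights vary relatively no faster than [phi]. The
    resulting inequality holds for partial sums uniformly on [1 <= s <= 2], endpoint included:
    multiplied by [s - 1] it gives the limits at 1, and at [s = 1], divided by [ln N], it gives the
    Dixmier trace. The weak derivative is exploited by testing it against quadratic splines. *)

Definition cj z : R[i] := conjc z.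
(** A real polynomial, because the norm of [R[i]] takes its values in [R[i]] itself, while the
    inequalities are solved over [R]. *)
Definition nsq z : R := Re z ^+ 2 + Im z ^+ 2.

Lemma ReD z w : Re (z + w) = Re z + Re w. Proof. by case: z w => ? ? []. Qed.
Lemma ImD z w : Im (z + w) = Im z + Im w. Proof. by case: z w => ? ? []. Qed.
Lemma ReN z : Re (- z) = - Re z. Proof. by case: z. Qed.
Lemma ImN z : Im (- z) = - Im z. Proof. by case: z. Qed.
Lemma ReM z w : Re (z * w) = Re z * Re w - Im z * Im w.
Proof. by case: z w => ? ? []. Qed.
Lemma ImM z w : Im (z * w) = Re z * Im w + Im z * Re w.
Proof. by case: z w => ? ? []. Qed.
Lemma ReJ z : Re (cj z) = Re z. Proof. by case: z. Qed.
Lemma ImJ z : Im (cj z) = - Im z. Proof. by case: z. Qed.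

Definition cE := (ReD, ImD, ReN, ImN, ReM, ImM, ReJ, ImJ).

Lemma complex_ext z w : Re z = Re w -> Im z = Im w -> z = w.
Proof. by case: z w => ? ? [? ?] /= -> ->. Qed.

Lemma conjM z w : cj (z * w) = cj z * cj w.
Proof. by apply: complex_ext; rewrite !cE; ring. Qed.
Lemma conjD z w : cj (z + w) = cj z + cj w.
Proof. by apply: complex_ext; rewrite !cE; ring. Qed.
Lemma conjR r : cj r%:C = r%:C.
Proof. by apply: complex_ext; rewrite !cE /= ?oppr0. Qed.
Lemma cjK z : cj (cj z) = z. Proof. exact: conjcK. Qed.
Lemma cj0 : cj 0 = 0. Proof. exact: conjc0. Qed.
Lemma cj1 : cj 1 = 1. Proof. exact: conjc1. Qed.
Lemma conjN z : cj (- z) = - cj z. Proof. by case: z. Qed.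
Lemma conj_sum I (s : seq I) P (F : I -> R[i]) :
  cj (\sum_(i <- s | P i) F i) = \sum_(i <- s | P i) cj (F i).
Proof. by apply: (big_morph cj conjD cj0). Qed.
Lemma realM r s : (r * s)%:C = r%:C * s%:C :> R[i].
Proof. by apply: complex_ext; rewrite !cE /=; ring. Qed.
Lemma realD r s : (r + s)%:C = r%:C + s%:C :> R[i].
Proof. by apply: complex_ext; rewrite !cE /= ?addr0. Qed.

Lemma Re_sum I (s : seq I) P (F : I -> R[i]) :
  Re (\sum_(i <- s | P i) F i) = \sum_(i <- s | P i) Re (F i).
Proof. by apply: (big_morph Re ReD). Qed.
Lemma Im_sum I (s : seq I) P (F : I -> R[i]) :
  Im (\sum_(i <- s | P i) F i) = \sum_(i <- s | P i) Im (F i).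
Proof. by apply: (big_morph Im ImD). Qed.

Lemma nsq_ge0 z : 0 <= nsq z. Proof. by rewrite addr_ge0 ?sqr_ge0. Qed.
Lemma nsq0 : nsq 0 = 0. Proof. by rewrite /nsq /= expr0n /= addr0. Qed.
Lemma nsqM z w : nsq (z * w) = nsq z * nsq w.
Proof. by rewrite /nsq !cE; ring. Qed.
Lemma nsqJ z : nsq (cj z) = nsq z. Proof. by rewrite /nsq !cE sqrrN. Qed.
Lemma nsqN z : nsq (- z) = nsq z. Proof. by rewrite /nsq !cE !sqrrN. Qed.
Lemma nsqR r : nsq r%:C = r ^+ 2. Proof. by rewrite /nsq /= expr0n addr0. Qed.
Lemma nsq_eq0 z : nsq z = 0 -> z = 0.
Proof.
move/eqP; rewrite paddr_eq0 ?sqr_ge0// !sqrf_eq0 => /andP[/eqP a /eqP b].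
by apply: complex_ext; rewrite ?a ?b.
Qed.
Lemma nsqE z : (nsq z)%:C = z * cj z.
Proof. by apply: complex_ext; rewrite ?cE /nsq /=; ring. Qed.
Lemma norm_nsq z : `|z| = (Num.sqrt (nsq z))%:C.
Proof. exact: normc_def. Qed.
Lemma Re_le_nsq z : Re z ^+ 2 <= nsq z. Proof. by rewrite lerDl sqr_ge0. Qed.
Lemma Im_le_nsq z : Im z ^+ 2 <= nsq z. Proof. by rewrite lerDr sqr_ge0. Qed.
Lemma nsqD_le z w : nsq (z + w) <= 2 * nsq z + 2 * nsq w.
Proof.
rewrite /nsq !cE; have := sqr_ge0 (Re z - Re w); have := sqr_ge0 (Im z - Im w).
nra.
Qed.
End ComplexNumbers.

(** * Inner product, norm convergence and bounded operators *)

Section Hilbert.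
Context (R : realType) (h : completeNormedModType R[i])
        (ip : {dot h for Num.conj}) (hilb : is_hilbert ip).
Implicit Types (x y z : h) (c : R[i]) (b : h -> h) (u v : nat -> h).
Local Notation Re := (@complex.Re R).
Local Notation Im := (@complex.Im R).

Lemma ipDl x y z : ip (x + y) z = ip x z + ip y z. Proof. exact: linearDl. Qed.
Lemma ipDr x y z : ip z (x + y) = ip z x + ip z y. Proof. exact: linearDr. Qed.
Lemma ipNl x z : ip (- x) z = - ip x z. Proof. exact: linearNl. Qed.
Lemma ipNr x z : ip z (- x) = - ip z x. Proof. exact: linearNr. Qed.
Lemma ipBl x y z : ip (x - y) z = ip x z - ip y z. Proof. exact: linearBl. Qed.
Lemma ipBr x y z : ip z (x - y) = ip z x - ip z y. Proof. exact: linearBr. Qed.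
Lemma ip0l x : ip 0 x = 0. Proof. exact: linear0l. Qed.
Lemma ip0r x : ip x 0 = 0. Proof. exact: linear0r. Qed.
Lemma ipZl c x y : ip (c *: x) y = c * ip x y.
Proof. by rewrite linearZl_LR. Qed.
Lemma ipZr c x y : ip x (c *: y) = cj c * ip x y.
Proof. by rewrite linearZr_LR. Qed.
Lemma ipC x y : ip x y = cj (ip y x).
Proof. by rewrite hermC expr0 mul1r. Qed.
Lemma ip_suml I (s : seq I) P (F : I -> h) x :
  ip (\sum_(i <- s | P i) F i) x = \sum_(i <- s | P i) ip (F i) x.
Proof. by apply: (big_morph (ip^~ x)) => [? ?|]; rewrite ?ipDl ?ip0l. Qed.
Lemma ip_sumr I (s : seq I) P (F : I -> h) x :
  ip x (\sum_(i <- s | P i) F i) = \sum_(i <- s | P i) ip x (F i).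
Proof. by apply: (big_morph (ip x)) => [? ?|]; rewrite ?ipDr ?ip0r. Qed.

Definition sqnorm x : R := Re (ip x x).

Lemma sqE x : ip x x = (sqnorm x)%:C.
Proof.
have := dnorm_ge0 ip x; rewrite /sqnorm; case: (ip x x) => a b.
by rewrite lecE /= => /andP[/eqP -> _].
Qed.
Lemma sq_ge0 x : 0 <= sqnorm x.
Proof. by have := dnorm_ge0 ip x; rewrite sqE ler0c. Qed.
Lemma sq0 : sqnorm 0 = 0. Proof. by rewrite /sqnorm ip0l. Qed.
Lemma sq_eq0 x : sqnorm x = 0 -> x = 0.
Proof. by move=> x0; apply/eqP; rewrite -(dnorm_eq0 ip) sqE x0. Qed.
Lemma sq_gt0 x : x != 0 -> 0 < sqnorm x.
Proof.
by move=> x0; rewrite lt_neqAle sq_ge0 andbT eq_sym; apply: contra x0 => /eqP/sq_eq0 ->.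
Qed.
Lemma sqZ c x : sqnorm (c *: x) = nsq c * sqnorm x.
Proof. by rewrite /sqnorm ipZl ipZr mulrA -nsqE sqE !cE /= mul0r subr0. Qed.
Lemma sqN x : sqnorm (- x) = sqnorm x. Proof. by rewrite /sqnorm ipNl ipNr opprK. Qed.
Lemma sqD x y : sqnorm (x + y) = sqnorm x + sqnorm y + 2 * Re (ip x y).
Proof. by rewrite /sqnorm !(ipDl, ipDr) !cE (ipC y x) !cE; ring. Qed.
Lemma sqB x y : sqnorm (x - y) = sqnorm x + sqnorm y - 2 * Re (ip x y).
Proof. by rewrite sqD sqN ipNr cE mulrN. Qed.
(** Nonnegativity of the squared distance from [x] to its projection on the line of [y], multiplied
    by [sqnorm y]. *)
Lemma CauchySchwarz x y : nsq (ip x y) <= sqnorm x * sqnorm y.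
Proof.
have [->|/sq_gt0 y0] := eqVneq y 0; first by rewrite ip0r nsq0 sq0 mulr0.
have := sq_ge0 (x - (ip x y * (sqnorm y)^-1%:C) *: y).
rewrite sqB sqZ ipZr nsqM nsqR !cE /= => H.
rewrite -subr_ge0; have -> : sqnorm x * sqnorm y - nsq (ip x y) = sqnorm y *
   (sqnorm x + nsq (ip x y) * (sqnorm y)^-1 ^+ 2 * sqnorm y - 2 * (nsq (ip x y) / sqnorm y)).
  by field; rewrite gt_eqF.
apply: mulr_ge0; first exact: sq_ge0.
by apply: le_trans H _; rewrite /nsq; lra.
Qed.

Lemma sqD_le x y : sqnorm (x + y) <= 2 * sqnorm x + 2 * sqnorm y.
Proof. by have := sq_ge0 (x - y); rewrite sqB sqD; lra. Qed.

Lemma hnorm_ge0 x : 0 <= hnorm x.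
Proof. by have := normr_ge0 x; rewrite lecE /hnorm => /andP[_]. Qed.
Lemma normE x : `|x| = (hnorm x)%:C.
Proof.
have := normr_ge0 x; rewrite lecE /hnorm => /andP[/eqP a _].
by apply: complex_ext.
Qed.
Lemma hnormE x : hnorm x ^+ 2 = sqnorm x.
Proof. by rewrite /sqnorm -hilb normE -rmorphXn. Qed.
Lemma hnorm_sqrt x : hnorm x = Num.sqrt (sqnorm x).
Proof. by rewrite -hnormE sqrtr_sqr ger0_norm // hnorm_ge0. Qed.
Lemma hnorm0 : hnorm (0 : h) = 0. Proof. by rewrite /hnorm normr0. Qed.
Lemma hnormD x y : hnorm (x + y) <= hnorm x + hnorm y.
Proof. by have := ler_normD x y; rewrite !normE -rmorphD lecR. Qed.
Lemma hnormN x : hnorm (- x) = hnorm x. Proof. by rewrite /hnorm normrN. Qed.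
Lemma hnormB x y : hnorm (x - y) <= hnorm x + hnorm y.
Proof. by rewrite (le_trans (hnormD _ _))// hnormN. Qed.
Lemma hnormBC x y : hnorm (x - y) = hnorm (y - x).
Proof. by rewrite -hnormN opprB. Qed.
Lemma hnormZ c x : hnorm (c *: x) = Num.sqrt (nsq c) * hnorm x.
Proof. by rewrite /hnorm normrZ norm_nsq cE /= mul0r subr0. Qed.
Lemma hnorm_eq0 x : hnorm x = 0 -> x = 0.
Proof. by move=> H; apply: normr0_eq0; rewrite normE H. Qed.
Lemma hnorm_le x r : 0 <= r -> (hnorm x <= r) = (sqnorm x <= r ^+ 2).
Proof. by move=> r0; rewrite -hnormE ler_sqr // nnegrE ?hnorm_ge0. Qed.
Lemma hnorm_lt x r : 0 <= r -> (hnorm x < r) = (sqnorm x < r ^+ 2).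
Proof. by move=> r0; rewrite -hnormE ltr_sqr // nnegrE ?hnorm_ge0. Qed.
Lemma ip_le x y : Num.sqrt (nsq (ip x y)) <= hnorm x * hnorm y.
Proof.
by rewrite !hnorm_sqrt -sqrtrM ?sq_ge0// ler_wsqrtr // CauchySchwarz.
Qed.
Lemma Re_ip_le_norm x y : `|Re (ip x y)| <= hnorm x * hnorm y.
Proof.
by apply: le_trans (ip_le x y); rewrite -sqrtr_sqr ler_wsqrtr // Re_le_nsq.
Qed.
Lemma Im_ip_le_norm x y : `|Im (ip x y)| <= hnorm x * hnorm y.
Proof.
by apply: le_trans (ip_le x y); rewrite -sqrtr_sqr ler_wsqrtr // Im_le_nsq.
Qed.

Lemma ip_inj x y : (forall z, ip x z = ip y z) -> x = y.
Proof.
move=> H; apply/eqP; rewrite -subr_eq0; apply/eqP/sq_eq0.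
by rewrite /sqnorm ipBl H subrr.
Qed.
Lemma ip_injr x y : (forall z, ip z x = ip z y) -> x = y.
Proof. by move=> H; apply: ip_inj => z; rewrite ipC H -ipC. Qed.

Definition hcv (u : nat -> h) x : Prop :=
  forall eps : R, 0 < eps -> exists N, forall n, (N <= n)%N -> hnorm (u n - x) < eps.

Lemma ball_hnorm x y (e : R) : ball x e%:C y <-> hnorm (y - x) < e.
Proof. by rewrite -ball_normE /= hnormBC normE ltcR. Qed.

(** Turns the complex radii of balls into real ones. *)
Lemma lt0_real (e : R[i]) : 0 < e -> exists2 r : R, 0 < r & e = r%:C.
Proof.
by case: e => a b; rewrite ltcE /= => /andP[/eqP -> ?]; exists a.
Qed.

Lemma nbhs_hnorm x (A : set h) :
  nbhs x A <-> exists2 e : R, 0 < e & forall y, hnorm (y - x) < e -> A y.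
Proof.
rewrite -nbhs_ballE; split.
  move=> [e /= /lt0_real[r r0 ->] H]; exists r => // y xy; apply: H.
  by apply/ball_hnorm.
move=> [e e0 H]; exists e%:C; first by rewrite /= ltcR.
by move=> y /ball_hnorm; apply: H.
Qed.

Lemma hcvP (u : nat -> h) x : hcv u x <-> u @ \oo --> x.
Proof.
split.
  move=> H A /nbhs_hnorm[e e0 HA]; have [N HN] := H e e0.
  by exists N => // n /= nN; apply/HA/HN.
move=> H e e0; have [] := H [set y | hnorm (y - x) < e].
  by apply/nbhs_hnorm; exists e.
by move=> N _ HN; exists N => n nN; exact: (HN n).
Qed.

Lemma hcauchy (u : nat -> h) :
  (forall eps : R, 0 < eps -> exists N, forall m n, (N <= m)%N -> (N <= n)%N ->
     hnorm (u m - u n) < eps) -> exists x, hcv u x.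
Proof.
move=> H; have : cvg (u @ \oo).
  apply/cauchy_cvgP; apply: cauchy_exP => e /lt0_real[r r0 ->].
  have [N HN] := H r r0; exists (u N); exists N => // n nN /=.
  by apply/ball_hnorm; apply: HN nN _.
by move=> /cvg_ex[x /hcvP]; exists x.
Qed.

Lemma hcv_le u x (r : R) : hcv u x -> (forall n, hnorm (u n) <= r) -> hnorm x <= r.
Proof.
move=> ux ur; apply/ler_addgt0Pr => e e0; have [N HN] := ux e e0.
have -> : x = u N - (u N - x) by rewrite opprB addrC subrK.
by rewrite (le_trans (hnormB _ _))// lerD// ltW// HN.
Qed.

Lemma hcv_Re u x y : hcv u x -> (fun n => Re (ip (u n) y)) @ \oo --> Re (ip x y).
Proof.
move=> ux; apply/cvgrPdist_lt => e e0.
have y1 : 0 < hnorm y + 1 by rewrite ltr_wpDl ?hnorm_ge0.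
have [N HN] := ux (e / (hnorm y + 1)) (divr_gt0 e0 y1).
exists N => // n nN /=; rewrite distrC -ReN -ReD -ipBl.
rewrite (le_lt_trans (Re_ip_le_norm _ _))//.
have := HN n nN; rewrite ltr_pdivlMr// => H; apply: le_lt_trans H.
by rewrite ler_wpM2l ?hnorm_ge0// lerDl.
Qed.

Lemma hcv_Im u x y : hcv u x -> (fun n => Im (ip (u n) y)) @ \oo --> Im (ip x y).
Proof.
move=> ux; have := hcv_Re (y := 'i *: y) ux.
have E z : Re (ip z ('i *: y)) = Im (ip z y) by rewrite ipZr !cE /=; ring.
by rewrite E; under eq_fun do rewrite E.
Qed.

Lemma hcv_uniq u x y : hcv u x -> hcv u y -> x = y.
Proof.
move=> ux uy; apply/eqP; rewrite -subr_eq0; apply/eqP/hnorm_eq0/eqP.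
rewrite eq_le hnorm_ge0 andbT; apply/ler_addgt0Pr => e e0; rewrite add0r.
have e2 : 0 < e / 2 by rewrite divr_gt0.
have [N HN] := ux _ e2; have [M HM] := uy _ e2.
have := HN (maxn N M) (leq_maxl _ _); have := HM (maxn N M) (leq_maxr _ _).
have -> : x - y = (u (maxn N M) - y) - (u (maxn N M) - x).
  by rewrite opprB [RHS]addrC addrA subrK.
by move=> A B; rewrite (le_trans (hnormB _ _)) //; lra.
Qed.

Lemma hcvD u v x y : hcv u x -> hcv v y -> hcv (fun n => u n + v n) (x + y).
Proof. by move=> /hcvP ux /hcvP vy; apply/hcvP; apply: cvgD. Qed.
Lemma hcvZ c u x : hcv u x -> hcv (fun n => c *: u n) (c *: x).
Proof. by move=> /hcvP ux; apply/hcvP; apply: cvgZr. Qed.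
Lemma hcv_cst x : hcv (fun=> x) x.
Proof. by move=> e e0; exists 0%N => n _; rewrite subrr hnorm0. Qed.

Definition bounded_by (b : h -> h) (C : R) := forall x, hnorm (b x) <= C * hnorm x.

Lemma linD (b : h -> h) : linear b -> {morph b : x y / x + y}.
Proof. by move=> lb x y; have := lb 1 x y; rewrite !scale1r. Qed.
Lemma lin0 (b : h -> h) : linear b -> b 0 = 0.
Proof. by move=> lb; have := lb (-1) 0 0; rewrite scaler0 addr0 scaleN1r addNr. Qed.
Lemma linZ (b : h -> h) : linear b -> forall c x, b (c *: x) = c *: b x.
Proof. by move=> lb c x; have := lb c x 0; rewrite !addr0 lin0 ?addr0. Qed.
Lemma linN (b : h -> h) : linear b -> {morph b : x / - x}.
Proof. by move=> lb x; rewrite -scaleN1r linZ// scaleN1r. Qed.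
Lemma linB (b : h -> h) : linear b -> {morph b : x y / x - y}.
Proof. by move=> lb x y; rewrite linD// linN. Qed.
Lemma lin_sum (b : h -> h) I (s : seq I) P F : linear b ->
  b (\sum_(i <- s | P i) F i) = \sum_(i <- s | P i) b (F i).
Proof. by move=> lb; apply: (big_morph b (linD lb) (lin0 lb)). Qed.

Lemma bounded_opI b C : linear b -> bounded_by b C -> bounded_op b.
Proof.
move=> lb bC; split=> // x A /nbhs_hnorm[e e0 HA].
have C0 : 0 < `|C| + 1 by rewrite ltr_wpDl.
apply/nbhs_hnorm; exists (e / (`|C| + 1)); first by rewrite divr_gt0.
move=> y yx; apply: HA; rewrite -linB// (le_lt_trans (bC _))//.
move: yx; rewrite ltr_pdivlMr// => yx; apply: le_lt_trans yx.
by rewrite mulrC ler_wpM2l ?hnorm_ge0// (le_trans (ler_norm _))// lerDl.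
Qed.

(** Continuity at 0 gives a radius [e] whose ball is mapped into the unit ball; rescaling each
    vector to length [e / 2] gives the constant [2 / e]. *)
Lemma bounded_opE b : bounded_op b -> exists2 C, 0 < C & bounded_by b C.
Proof.
move=> [lb cb]; have := cb 0 [set y | hnorm (y - b 0) < 1].
rewrite nbhs_simpl /= => /(_ _)/nbhs_hnorm[|e e0 He].
  by apply/nbhs_hnorm; exists 1.
exists (2 / e); first by rewrite divr_gt0.
move=> x; have [->|x0] := eqVneq x 0; first by rewrite lin0// hnorm0 mulr0.
have nx : 0 < hnorm x.
  by rewrite lt_neqAle hnorm_ge0 andbT eq_sym; apply: contra x0 => /eqP/hnorm_eq0 ->.
set r := e / (2 * hnorm x); have r0 : 0 < r by rewrite divr_gt0// mulr_gt0.
have := He (r%:C *: x); rewrite subr0 hnormZ nsqR sqrtr_sqr gtr0_norm//.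
have -> : r * hnorm x = e / 2 by rewrite /r; field; rewrite gt_eqF.
move=> /(_ ltac:(by lra)) /=; rewrite lin0// subr0 linZ// hnormZ nsqR sqrtr_sqr gtr0_norm//.
rewrite /r => H; rewrite -(ler_pM2l r0) /r; apply: le_trans (ltW H) _.
by rewrite le_eqVlt; apply/orP; left; apply/eqP; field; rewrite !gt_eqF.
Qed.

Lemma bounded_lin b : bounded_op b -> linear b. Proof. by case. Qed.

Lemma bounded_hcv b u x : bounded_op b -> hcv u x -> hcv (b \o u) (b x).
Proof.
move=> [lb cb] /hcvP ux; apply/hcvP; apply: continuous_cvg => //; exact: cb.
Qed.

Lemma opnorm_has_sup b : bounded_op b ->
  has_sup [set hnorm (b x) | x in [set x : h | `|x| <= 1]].
Proof.
move=> /bounded_opE[C C0 bC]; split; first by exists (hnorm (b 0)), 0 => //=; rewrite normr0.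
exists C => _ [x /= x1 <-]; rewrite (le_trans (bC x))// ler_piMr ?(ltW C0)//.
by move: x1; rewrite normE -lecR.
Qed.

Lemma opnorm_ge0 b : bounded_op b -> 0 <= opnorm b.
Proof.
move=> bb; apply: le_trans (hnorm_ge0 (b 0)) _; apply: ub_le_sup.
  by case: (opnorm_has_sup bb).
by exists 0 => //=; rewrite normr0.
Qed.

Lemma opnormP b : bounded_op b -> bounded_by b (opnorm b).
Proof.
move=> bb x; have lb := bounded_lin bb.
have [->|x0] := eqVneq x 0; first by rewrite lin0// hnorm0 mulr0.
have nx : 0 < hnorm x.
  by rewrite lt_neqAle hnorm_ge0 andbT eq_sym; apply: contra x0 => /eqP/hnorm_eq0 ->.
rewrite -ler_pdivrMr//; apply: ub_le_sup; first by case: (opnorm_has_sup bb).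
exists ((hnorm x)^-1%:C *: x).
  rewrite /= normE hnormZ nsqR sqrtr_sqr gtr0_norm ?invr_gt0// mulVf ?gt_eqF//.
by rewrite linZ// hnormZ nsqR sqrtr_sqr gtr0_norm ?invr_gt0// mulrC.
Qed.

Lemma opnorm_le b C : bounded_op b -> 0 <= C -> bounded_by b C -> opnorm b <= C.
Proof.
move=> bb C0 bC; apply: ge_sup; first by case: (opnorm_has_sup bb).
move=> _ [x /= x1 <-]; rewrite (le_trans (bC x))// ler_piMr //.
by move: x1; rewrite normE -lecR.
Qed.

End Hilbert.

(** * Projection, Riesz representation and adjoints *)

Section Hilbert2.
Context (R : realType) (h : completeNormedModType R[i])
        (ip : {dot h for Num.conj}) (hilb : is_hilbert ip).
Implicit Types (x y z : h) (c : R[i]) (b : h -> h) (u : nat -> h).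
Local Notation Re := (@complex.Re R).
Local Notation Im := (@complex.Im R).
Local Notation sq := (sqnorm ip).

Lemma parallelogram x y : sq (x + y) + sq (x - y) = 2 * sq x + 2 * sq y.
Proof. by rewrite sqD sqB; ring. Qed.

Lemma invS_lt (e : R) : 0 < e ->
  exists N, forall n, (N <= n)%N -> n.+1%:R^-1 < e.
Proof. by move=> e0; have [N _ HN] := near_infty_natSinv_lt (PosNum e0); exists N. Qed.

Definition subspace (V : set h) :=
  V 0 /\ forall c x y, V x -> V y -> V (c *: x + y).

(** [V] is not assumed closed, so the projection [y] comes as the limit of a sequence of [V]. Points
    of [V] nearly minimizing the distance to [x] form a Cauchy sequence by the parallelogram
    identity, and minimality in the limit gives orthogonality. *)
Lemma projection (V : set h) x : subspace V ->
  exists y u, [/\ forall n, V (u n), hcv u y & forall v, V v -> ip (x - y) v = 0].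
Proof.
move=> [V0 VD].
pose D := [set sq (x - v) | v in V]; pose d := inf D.
have D0 : has_inf D.
  split; first by exists (sq (x - 0)), 0.
  by exists 0 => _ [v _ <-]; exact: sq_ge0.
have dV v : V v -> d <= sq (x - v) by move=> Vv; apply: ge_inf; [case: D0 | exists v].
have e0 n : 0 < n.+1%:R^-1 :> R by rewrite invr_gt0.
have /choice[u Hu] : forall n, exists v, V v /\ sq (x - v) < d + n.+1%:R^-1.
  by move=> n; have [_ [v Vv <-] H] := inf_adherent (e0 n) D0; exists v.
have Cu m n : sq (u m - u n) <= 2 * m.+1%:R^-1 + 2 * n.+1%:R^-1.
  have [Vm Hm] := Hu m; have [Vn Hn] := Hu n.
  have := parallelogram (x - u n) (x - u m).
  have -> : (x - u n) - (x - u m) = u m - u n.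
    by rewrite opprB [LHS]addrC addrA subrK.
  have -> : (x - u n) + (x - u m) = 2%:R *: (x - (2^-1%:C *: (u m + u n))).
    rewrite scalerBr scalerA scaler_nat mulr2n.
    have -> : 2 * 2^-1%:C = 1 :> R[i].
      by apply: complex_ext; rewrite ?cE /=; field.
    by rewrite scale1r addrACA -opprD (addrC (u m)).
  rewrite sqZ (_ : nsq _ = 4); last by rewrite /nsq /=; ring.
  have Vmn : V (2^-1%:C *: (u m + u n)).
    by have := VD 1 _ _ Vm Vn; rewrite scale1r => H; have := VD 2^-1%:C _ _ H V0; rewrite addr0.
  move: (dV _ Vmn) Hm Hn; move: (m.+1%:R^-1) (n.+1%:R^-1) => p q; lra.
have [y uy] : exists y, hcv u y.
  apply: hcauchy => e e1.
  have [N HN] := invS_lt (divr_gt0 (exprn_gt0 2 e1) (ltr0n _ 4)).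
  exists N => m n Nm Nn; rewrite (hnorm_lt hilb) ?ltW//; apply: le_lt_trans (Cu _ _) _.
  by move: (HN _ Nm) (HN _ Nn); move: (m.+1%:R^-1) (n.+1%:R^-1) => p q; lra.
exists y, u; split => // [n|v Vv]; first by case: (Hu n).
(* The perturbation [c *: v + u n] stays in [V], hence at squared distance at least [d] from [x];
   then [n] tends to infinity. *)
have key c : 2 * Re (ip (x - y) (c *: v)) <= nsq c * sq v.
  have H n : 2 * Re (ip (x - u n) (c *: v)) <= n.+1%:R^-1 + nsq c * sq v.
    have [Vn Hn] := Hu n; have := dV (c *: v + u n) (VD _ _ _ Vv Vn).
    by rewrite opprD addrCA addrC sqB sqZ; move: Hn; move: (n.+1%:R^-1) => p; lra.
  apply/ler_addgt0Pr => e e1; have e2 : 0 < e / 2 by rewrite divr_gt0.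
  have [N HN] := invS_lt e2.
  have d0 : 0 < e / (4 * (hnorm (c *: v) + 1)).
    by rewrite divr_gt0// mulr_gt0// ltr_wpDl ?hnorm_ge0.
  have [M HM] := uy _ d0; set n := maxn N M.
  have := HN n (leq_maxl _ _); have := HM n (leq_maxr _ _); have := H n.
  have -> : Re (ip (x - y) (c *: v)) = Re (ip (x - u n) (c *: v)) + Re (ip (u n - y) (c *: v)).
    by rewrite -ReD -ipDl addrA subrK.
  have := Re_ip_le_norm hilb (u n - y) (c *: v).
  set A := Re (ip (u n - y) _); move=> HA H1 H2 H3.
  have : `|A| <= e / 4.
    apply: le_trans HA _; have := hnorm_ge0 (c *: v) => cv0.
    apply: (@le_trans _ _ (e / (4 * (hnorm (c *: v) + 1)) * hnorm (c *: v))).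
      by rewrite ler_wpM2r// ltW.
    rewrite invfM -!mulrA ler_pM2l// ler_piMr ?invr_ge0// mulrC ler_pdivrMr ?mul1r ?lerDl//.
    by rewrite ltr_wpDl.
  move: H1 H3; move: (n.+1%:R^-1) => q; have := ler_norm A; lra.
apply: nsq_eq0; apply/eqP; rewrite eq_le nsq_ge0 andbT.
set p := ip _ _; have s1 : 0 < sq v + 1 by rewrite ltr_wpDl ?sq_ge0.
(* With [c] proportional to [p] both sides of [key] are multiples of [nsq p], and comparing them
   forces [p = 0]. The [+ 1] keeps the denominator positive when [v = 0]. *)
have := key (p * (sq v + 1)^-1%:C).
rewrite ipZr nsqM nsqR !cE -/p /= => H0.
have H : 2 * (nsq p / (sq v + 1)) <= nsq p * (sq v + 1)^-1 ^+ 2 * sq v.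
  by apply: le_trans H0; rewrite /nsq le_eqVlt; apply/orP; left; apply/eqP; ring.
have : (sq v + 1) ^+ 2 * (2 * (nsq p / (sq v + 1))) <=
                 (sq v + 1) ^+ 2 * (nsq p * (sq v + 1)^-1 ^+ 2 * sq v).
  by rewrite ler_pM2l ?exprn_gt0.
have -> : (sq v + 1) ^+ 2 * (2 * (nsq p / (sq v + 1))) = 2 * nsq p * (sq v + 1).
  by field; rewrite gt_eqF.
have -> : (sq v + 1) ^+ 2 * (nsq p * (sq v + 1)^-1 ^+ 2 * sq v) = nsq p * sq v.
  by field; rewrite gt_eqF.
by have := sq_ge0 ip v; have := nsq_ge0 p; nra.
Qed.

(** A vector off the kernel of [f], minus its projection on that kernel, represents [f] up to a
    scalar. The bound on [f] makes it vanish on the projection, which is a limit of kernel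
    vectors. *)
Lemma riesz (f : h -> R[i]) C : (forall c x y, f (c *: x + y) = c * f x + f y) ->
  (forall x, nsq (f x) <= C * sq x) -> exists z, forall x, f x = ip x z.
Proof.
move=> lf bf.
have fD x y : f (x + y) = f x + f y by have := lf 1 x y; rewrite scale1r mul1r.
have f0 : f 0 = 0 by have := lf (-1) 0 0; rewrite scaler0 addr0 mulN1r addNr.
have fZ c x : f (c *: x) = c * f x by have := lf c x 0; rewrite addr0 f0 addr0.
have fB x y : f (x - y) = f x - f y by rewrite fD -scaleN1r fZ mulN1r.
have [|/existsNP[x0 fx0]] := pselect (forall x, f x = 0).
  by move=> f00; exists 0 => x; rewrite f00 ip0r.
have [|y [u [fu uy yo]]] := @projection [set x | f x = 0] x0.
  by split=> // c x y /= fx fy; rewrite lf fx fy mulr0 addr0.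
have fy : f y = 0.
  apply: nsq_eq0; apply/eqP; rewrite eq_le nsq_ge0 andbT.
  have C0 : 0 < `|C| + 1 by rewrite ltr_wpDl.
  apply/ler_addgt0Pr => e e0; rewrite add0r.
  have q0 : 0 < e / (`|C| + 1) by rewrite divr_gt0.
  have [N HN] := uy _ (ltac:(by rewrite sqrtr_gt0) : 0 < Num.sqrt (e / (`|C| + 1))).
  have := HN N (leqnn _); rewrite (hnorm_lt hilb) ?sqrtr_ge0// (sqr_sqrtr (ltW q0)).
  rewrite ltr_pdivlMr// => H; have := bf (u N - y); rewrite fB fu sub0r nsqN => /le_trans; apply.
  apply: le_trans (ltW H); rewrite mulrC ler_wpM2l ?sq_ge0//.
  by rewrite (le_trans (ler_norm _))// lerDl.
set w := x0 - y in yo; have fw : f w != 0 by rewrite fB fy subr0; apply/eqP.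
have w0 : sq w != 0 by apply: contra fw => /eqP/sq_eq0 ->; rewrite f0.
exists ((cj (f w) * (sq w)^-1%:C) *: w) => x.
have : ip w (x - (f x / f w) *: w) = 0.
  by apply: yo => /=; rewrite fB fZ -mulrA mulVf// mulr1 subrr.
rewrite ipC => /(congr1 (@cj R)); rewrite cjK cj0 ipBl ipZl sqE => /eqP.
rewrite subr_eq0 => /eqP Hx; rewrite ipZr Hx conjM cjK conjR.
by rewrite mulrACA -realM mulVf// mulr1 mulrC -mulrA mulVf// mulr1.
Qed.

(** Riesz representation shows that the choice in [adjoint] never falls on its default. *)
Lemma adjointP b : bounded_op b -> forall x y, ip (b x) y = ip x (adjoint ip b y).
Proof.
move=> bb x y; have lb := bounded_lin bb; have [C C0 bC] := bounded_opE bb.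
have : exists z, forall x, ip (b x) y = ip x z.
  apply: (@riesz _ (C ^+ 2 * sq y)) => [c u v|u]; first by rewrite lb ipDl ipZl.
  apply: le_trans (CauchySchwarz _ _ _) _; rewrite mulrAC ler_wpM2r ?sq_ge0//.
  by rewrite -!(hnormE hilb) -exprMn ler_sqr ?nnegrE ?bC ?mulr_ge0 ?hnorm_ge0 ?ltW.
by move=> /(@xgetPex _ 0); apply.
Qed.

Lemma bounded_by_sq b C : 0 <= C -> bounded_by b C -> forall x, sq (b x) <= C ^+ 2 * sq x.
Proof.
move=> C0 bC x; rewrite -!(hnormE hilb) -exprMn ler_sqr ?nnegrE ?hnorm_ge0//.
by rewrite mulr_ge0 ?hnorm_ge0.
Qed.

(** With [z] the image of [y], [sq z = Re (ip (b z) y)] is at most [C * hnorm z * hnorm y]. *)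
Lemma adjoint_bounded_by b C : 0 <= C -> bounded_op b -> bounded_by b C ->
  bounded_by (adjoint ip b) C.
Proof.
move=> C0 bb bC y; set z := adjoint ip b y.
have H : sq z <= C * hnorm z * hnorm y.
  have := adjointP bb z y; rewrite -/z => /(congr1 Re); rewrite -/(sq z) => <-.
  apply: le_trans (ler_norm _) _; apply: le_trans (Re_ip_le_norm hilb _ _) _.
  by rewrite ler_wpM2r ?hnorm_ge0.
have [z0|z0] := eqVneq (hnorm z) 0; first by rewrite z0 mulr_ge0 ?hnorm_ge0.
have zp : 0 < hnorm z by rewrite lt_neqAle eq_sym z0 hnorm_ge0.
by rewrite -(ler_pM2l zp) -expr2 (hnormE hilb) (le_trans H)// mulrCA mulrA.
Qed.

Lemma adjoint_linear b : bounded_op b -> linear (adjoint ip b).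
Proof.
move=> bb c x y; apply: (ip_injr (ip := ip)) => z.
by rewrite -adjointP// !(ipDr, ipZr) -!adjointP.
Qed.

Lemma adjoint_bounded b : bounded_op b -> bounded_op (adjoint ip b).
Proof.
move=> bb; have [C C0 bC] := bounded_opE bb.
apply: bounded_opI (adjoint_linear bb) (adjoint_bounded_by (ltW C0) bb bC).
Qed.

Lemma adjointPr b x y : bounded_op b -> ip x (b y) = ip (adjoint ip b x) y.
Proof. by move=> bb; rewrite ipC adjointP// -ipC. Qed.

Lemma adjointE b a : bounded_op b -> (forall x y, ip (b x) y = ip x (a y)) ->
  adjoint ip b = a.
Proof.
by move=> bb H; apply/funext => y; apply: (ip_injr (ip := ip)) => z; rewrite -adjointP.
Qed.

Lemma bounded_comp a b : bounded_op a -> bounded_op b -> bounded_op (a \o b).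
Proof.
move=> [la ca] [lb cb]; split; first by move=> c x y /=; rewrite lb la.
by move=> x; apply: continuous_comp; [exact: cb|exact: ca].
Qed.
Lemma bounded_lincomb c a b : bounded_op a -> bounded_op b ->
  bounded_op ((c \*: a) \+ b).
Proof.
move=> [la ca] [lb cb]; split.
  move=> k x y /=; rewrite la lb !scalerDr !scalerA (mulrC c k) addrACA //.
by move=> x; apply: cvgD; [apply: cvgZr; exact: ca|exact: cb].
Qed.
Lemma bounded_id : bounded_op (id : h -> h).
Proof. by split=> // x. Qed.
Lemma bounded0 : bounded_op (fun _ : h => 0 : h).
Proof. by split; [move=> c x y; rewrite scaler0 addr0 | move=> x; exact: cvg_cst]. Qed.
Lemma boundedZ c b : bounded_op b -> bounded_op (c \*: b).
Proof.
move=> bb; rewrite (_ : _ \*: _ = (c \*: b) \+ (fun=> 0)); last by apply/funext => x /=; rewrite addr0.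
exact: bounded_lincomb bb bounded0.
Qed.
Lemma boundedD a b : bounded_op a -> bounded_op b -> bounded_op (a \+ b).
Proof.
move=> ba bb; rewrite (_ : _ \+ _ = (1 \*: a) \+ b); last by apply/funext => x /=; rewrite scale1r.
exact: bounded_lincomb.
Qed.
Lemma boundedB a b : bounded_op a -> bounded_op b -> bounded_op (a \- b).
Proof.
move=> ba bb; rewrite (_ : _ \- _ = (-1 \*: b) \+ a); first exact: bounded_lincomb.
by apply/funext => x /=; rewrite scaleN1r addrC.
Qed.

End Hilbert2.

(** * Orthonormal bases, Parseval's identity and series over a basis *)

Section Bessel.
Context (R : realType) (h : completeNormedModType R[i])
        (ip : {dot h for Num.conj}) (hilb : is_hilbert ip).
Implicit Types (x y z : h) (c : R[i]) (b : h -> h).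
Local Notation Re := (@complex.Re R).
Local Notation Im := (@complex.Im R).
Local Notation sq := (sqnorm ip).

Section FiniteFamily.
Context (I : eqType) (s : seq I) (e : I -> h) (us : uniq s).
Hypothesis oe : {in s &, forall i j, i != j -> ip (e i) (e j) = 0}.

Lemma ip_sum_ortho (c : I -> R[i]) i : i \in s ->
  ip (\sum_(j <- s) c j *: e j) (e i) = c i * (sq (e i))%:C.
Proof.
move=> si; rewrite ip_suml (bigD1_seq i)//= ipZl -sqE big_seq_cond big1 ?addr0//.
by move=> j /andP[sj ji]; rewrite ipZl oe ?mulr0.
Qed.

Lemma sq_sum_ortho (c : I -> R[i]) :
  sq (\sum_(i <- s) c i *: e i) = \sum_(i <- s) nsq (c i) * sq (e i).
Proof.
rewrite {1}/sqnorm ip_sumr Re_sum big_seq [RHS]big_seq; apply: eq_bigr => i si.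
rewrite ipZr ip_sum_ortho// /nsq !cE /=; ring.
Qed.

Hypothesis e1 : {in s, forall i, sq (e i) <= 1}.

(** Norms are only assumed to be at most 1, so that zero vectors may occur in the family. *)
Lemma bessel_seq x : \sum_(i <- s) nsq (ip x (e i)) <= sq x.
Proof.
have := sq_ge0 ip (x - \sum_(i <- s) ip x (e i) *: e i).
rewrite sqB sq_sum_ortho ip_sumr Re_sum.
have -> : \sum_(i <- s) Re (ip x (ip x (e i) *: e i)) = \sum_(i <- s) nsq (ip x (e i)).
  by apply: eq_bigr => i _; rewrite ipZr !cE /nsq; ring.
have : \sum_(i <- s) nsq (ip x (e i)) * sq (e i) <= \sum_(i <- s) nsq (ip x (e i)).
  by rewrite big_seq [leRHS]big_seq; apply: ler_sum => i si; rewrite ler_piMr ?nsq_ge0 ?e1.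
lra.
Qed.

End FiniteFamily.

(** Zorn's lemma on orthonormal sets: a nonzero vector orthogonal to a maximal one could be
    normalized and added. *)
Lemma onb_exists : exists B, orthonormal_basis ip B.
Proof.
pose P (B : set h) := forall e e', B e -> B e' -> ip e e' = (e == e')%:R.
have [|A [PA maxA]] := @Zorn_bigcup h P.
  move=> F FP tF e e' [X FX Xe] [Y FY Ye'].
  by have [XY|YX] := tF _ _ FX FY; [apply: (FP Y FY) => //; exact: XY | apply: (FP X FX) => //; exact: YX].
exists A; split=> // x xA; apply/eqP/negPn/negP => x0.
have sx := sq_gt0 ip x0; pose f := (Num.sqrt (sq x))^-1%:C *: x.
have ff : ip f f = 1.
  rewrite sqE sqZ nsqR exprVn sqr_sqrtr ?sq_ge0// mulVf ?gt_eqF//.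
have fA e : A e -> ip f e = 0 by move=> Ae; rewrite ipZl xA ?mulr0.
have nAf : ~ A f by move=> Af; have := fA _ Af; rewrite ff => /eqP; rewrite oner_eq0.
apply: (maxA (A `|` [set f])).
  by split; [move=> ? ?; left | move=> /(_ f (or_intror erefl))].
move=> e e' [Ae|->] [Ae'|->]; [exact: PA| | |by rewrite ff eqxx].
  by rewrite ipC fA// cj0; case: eqP => // E; case: nAf; rewrite -E.
by rewrite fA//; case: eqP => // E; case: nAf; rewrite E.
Qed.

Lemma onbP : orthonormal_basis ip (onb ip).
Proof. by have [B HB] := onb_exists; rewrite /onb; apply: xgetPex; exists B. Qed.

Lemma onb_ortho (s : seq h) : {in s, forall e, onb ip e} ->
  {in s &, forall e f, e != f -> ip e f = 0}.
Proof.
by have [H _] := onbP; move=> S e f se sf ef; rewrite (H _ _ (S _ se) (S _ sf)) (negbTE ef).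
Qed.
Lemma onb_sq e : onb ip e -> sq e = 1.
Proof. by have [H _] := onbP; move=> Be; rewrite /sqnorm H// eqxx. Qed.

(** The space may be nonseparable, so the sum is unordered. One inequality is Bessel's. For the
    other, finite combinations of the basis come arbitrarily close to [x]: the difference between
    [x] and its projection on their closure is orthogonal to the whole basis. *)
Lemma parseval x : (\esum_(e in onb ip) (nsq (ip x e))%:E = (sq x)%:E)%E.
Proof.
have HB := onbP; apply/eqP; rewrite eq_le; apply/andP; split.
  apply: ge_ereal_sup => _ [F [finF FB] <-]; rewrite fsbig_finite//= sumEFin lee_fin.
  have FS : {in finmap.enum_fset (fset_set F), forall e, onb ip e}.
    by move=> e; rewrite in_fset_set// inE => /FB.
  apply: bessel_seq; [exact: finmap.fset_uniq | exact: onb_ortho |].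
  by move=> e /FS/onb_sq ->.
apply/lee_addgt0Pr => d d0.
pose V v := exists2 l : seq (R[i] * h), (forall p, p \in l -> onb ip p.2) &
  v = \sum_(p <- l) p.1 *: p.2.
have SV : subspace V.
  split; first by exists [::]; rewrite ?big_nil.
  move=> c u v [l Hl ->] [m Hm ->]; exists ([seq (c * p.1, p.2) | p <- l] ++ m).
    by move=> p; rewrite mem_cat => /orP[/mapP[q ql ->]|]; [exact: (Hl q)|exact: Hm].
  rewrite big_cat big_map scaler_sumr; congr (_ + _).
  by apply: eq_bigr => p _; rewrite scalerA.
have [y [u [Vu uy yo]]] := projection hilb x SV.
have xy : x = y.
  apply/eqP; rewrite -subr_eq0; apply/eqP; apply: HB.2 => e Be; apply: yo.
  by exists [:: (1, e)]; [move=> p; rewrite inE => /eqP -> | rewrite big_seq1 scale1r].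
have [N HN] := uy _ (ltac:(by rewrite sqrtr_gt0) : 0 < Num.sqrt d).
have := HN N (leqnn _); rewrite (hnorm_lt hilb) ?sqrtr_ge0// (sqr_sqrtr (ltW d0)) -xy.
have [l Hl ->] := Vu N => Hd.
(* The combination [l] may use a basis vector several times; the Fourier sum [px] runs over the
   distinct ones. *)
pose s := undup [seq p.2 | p <- l].
have FS : {in s, forall e, onb ip e}.
  by move=> e; rewrite mem_undup => /mapP[p pl ->]; exact: Hl.
have O := onb_ortho FS; have us : uniq s := undup_uniq _.
pose px := \sum_(e <- s) ip x e *: e.
have pxo e : e \in s -> ip (x - px) e = 0.
  move=> es; have eb := FS _ es.
  by rewrite ipBl (ip_sum_ortho us (e := id) O) //= onb_sq// mulr1 subrr.
have Hle : sq x - \sum_(e <- s) nsq (ip x e) <= d.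
  have <- : sq (x - px) = sq x - \sum_(e <- s) nsq (ip x e).
    rewrite sqB (sq_sum_ortho us (e := id) O) ip_sumr Re_sum.
    have -> : \sum_(e <- s) nsq (ip x e) * sq e = \sum_(e <- s) nsq (ip x e).
      by rewrite big_seq [RHS]big_seq; apply: eq_bigr => e /FS/onb_sq ->; rewrite mulr1.
    have -> : \sum_(i <- s) Re (ip x (ip x i *: i)) = \sum_(i <- s) nsq (ip x i).
      by apply: eq_bigr => i _; rewrite ipZr !cE /nsq; ring.
    by ring.
  (* [px] is at least as close to [x] as the combination [v], because [px - x] is orthogonal to
     [v - px]. *)
  apply: le_trans (ltW Hd); set v := \sum_(p <- l) _.
  have -> : v - x = (px - x) + (v - px) by rewrite [RHS]addrC addrA subrK.
  rewrite [leRHS]sqD -(sqN _ (px - x)) opprB -addrA lerDl.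
  suff -> : ip (px - x) (v - px) = 0 by rewrite /= mulr0 addr0 sq_ge0.
  rewrite -opprB ipNl ipBr ip_sumr big_seq big1.
    rewrite ip_sumr big_seq big1 ?subr0 ?oppr0// => e es.
    by rewrite ipZr pxo ?mulr0.
  move=> p pl; rewrite ipZr pxo ?mulr0// mem_undup; apply/mapP; by exists p.
apply: (@le_trans _ _ ((\sum_(e <- s) nsq (ip x e))%:E + d%:E)%E).
  by rewrite -EFinD lee_fin -lerBlDl.
rewrite leeD2r//; apply: esum_ge; exists [set` s] => //.
  by split; [exact: finite_seq | move=> e /= /FS].
by rewrite -fsbig_seq// sumEFin.
Qed.

(** Both sides are unordered sums over the set of index pairs, up to swapping the two components. *)
Lemma esum_exchange (T : choiceType) (B : set T) (f : T -> nat -> R) :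
  (forall e n, 0 <= f e n) ->
  (\esum_(e in B) \sum_(n <oo) (f e n)%:E = \sum_(n <oo) \esum_(e in B) (f e n)%:E)%E.
Proof.
move=> f0; have f0' e n : (0 <= (f e n)%:E)%E by rewrite lee_fin.
rewrite nneseries_esumT; last by move=> n; apply: esum_ge0.
under eq_esum do rewrite nneseries_esumT//.
rewrite (@esum_esum _ _ _ B (fun=> setT) (fun e n => (f e n)%:E))//.
rewrite (@esum_esum _ _ _ setT (fun=> B) (fun n e => (f e n)%:E))//.
rewrite (@reindex_esum _ _ _ (setT `*`` (fun=> B)) (B `*`` (fun=> setT))
  (fun p => (p.2, p.1)) (fun k => (f k.1 k.2)%:E))//.
split; first by move=> [n e] [_ Be].
  by move=> [n e] [m f'] _ _ [-> ->].
by move=> [e n] [Be _]; exists (n, e).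
Qed.

(** The square root of the weight [t n] is absorbed into the vector [z n], to which Parseval's
    identity applies. *)
Lemma esum_onb_series (t : nat -> R) (z : nat -> h) : (forall n, 0 <= t n) ->
  (\esum_(e in onb ip) \sum_(n <oo) (t n * nsq (ip (z n) e))%:E =
   \sum_(n <oo) (t n * sq (z n))%:E)%E.
Proof.
move=> t0; rewrite esum_exchange; last by move=> e n; rewrite mulr_ge0 ?nsq_ge0.
apply: eq_eseriesr => n _.
have E (w : R[i]) : t n * nsq w = nsq ((Num.sqrt (t n))%:C * w).
  by rewrite nsqM nsqR sqr_sqrtr.
transitivity (sq ((Num.sqrt (t n))%:C *: z n))%:E; last by rewrite sqZ nsqR sqr_sqrtr.
by rewrite -parseval; apply: eq_esum => e _; rewrite ipZl E.
Qed.

(* Polarization writes the summands of a trace as a difference of two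
   nonnegative double series, to which Parseval's identity applies. *)
Lemma trace_series (t : nat -> R) (x y : nat -> h) (C : R) (A : h -> R) :
  (forall n, 0 <= t n) -> cvgn (series t) ->
  (forall n, sq (x n) <= C) -> (forall n, sq (y n) <= C) ->
  (forall e, onb ip e ->
    (fun N => \sum_(n < N) t n * Re (ip e (x n) * ip (y n) e)) @ \oo --> A e) ->
  (fun N => \sum_(n < N) t n * Re (ip (y n) (x n))) @ \oo --> real_sum (onb ip) A.
Proof.
move=> t0 ct xC yC HA.
pose p n := 4^-1 * t n * sq (y n + x n); pose m n := 4^-1 * t n * sq (y n - x n).
have t4 n : 0 <= 4^-1 * t n by rewrite mulr_ge0.
have C0 : 0 <= C by exact: le_trans (sq_ge0 _ _) (xC 0%N).
have bnd n : sq (y n + x n) <= 4 * C /\ sq (y n - x n) <= 4 * C.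
  have := sqD_le ip (y n) (x n); have := sqD_le ip (y n) (- x n); rewrite sqN.
  have := xC n; have := yC n; lra.
have cp : cvgn (series p).
  apply: (series_le_cvg (v_ := fun n => C *: t n)) => [n|n|n|]; last exact: is_cvg_seriesZ.
  - by rewrite mulr_ge0 ?sq_ge0.
  - by rewrite mulr_ge0.
  - rewrite /p -[leRHS]/(C * t n); have [B1 B2] := bnd n; have tn := t0 n; nra.
have cm : cvgn (series m).
  apply: (series_le_cvg (v_ := fun n => C *: t n)) => [n|n|n|]; last exact: is_cvg_seriesZ.
  - by rewrite mulr_ge0 ?sq_ge0.
  - by rewrite mulr_ge0.
  - rewrite /m -[leRHS]/(C * t n); have [B1 B2] := bnd n; have tn := t0 n; nra.
pose f (z : nat -> h) e n := 4^-1 * t n * nsq (ip (z n) e).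
have f0 (z : nat -> h) e n : 0 <= f z e n by rewrite mulr_ge0 ?nsq_ge0.
pose u n := y n + x n; pose v n := y n - x n.
pose g (z : nat -> h) e := (\sum_(n <oo) (f z e n)%:E)%E.
have fsum (r : nat -> R) : (forall n, 0 <= r n) -> cvgn (series r) ->
    (\sum_(n <oo) (r n)%:E = (limn (series r))%:E)%E.
  move=> r0 cr; rewrite -EFin_lim//; apply: congr_lim.
  by apply/funext => n /=; rewrite /series/= sumEFin.
have gp : (\esum_(e in onb ip) g u e = (limn (series p))%:E)%E.
  by rewrite esum_onb_series// fsum// => n; rewrite mulr_ge0 ?sq_ge0.
have gm : (\esum_(e in onb ip) g v e = (limn (series m))%:E)%E.
  by rewrite esum_onb_series// fsum// => n; rewrite mulr_ge0 ?sq_ge0.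
have g0 (z : nat -> h) e : (0 <= g z e)%E by apply: nneseries_ge0 => n _ _; rewrite lee_fin.
have sp : summable (onb ip) (g u).
  rewrite /summable; under eq_esum do rewrite gee0_abs//; by rewrite gp ltry.
have sm : summable (onb ip) (g v).
  rewrite /summable; under eq_esum do rewrite gee0_abs//; by rewrite gm ltry.
have fz (z : nat -> h) e : onb ip e -> summable (onb ip) (g z) -> cvgn (series (f z e)).
  move=> Be sz; apply: nondecreasing_is_cvgn.
    by apply: nondecreasing_series => n _ _; exact: f0.
  have := summable_pinfty sz Be; rewrite gee0_abs// => gy.
  exists (fine (g z e)) => _ [n _ <-].
  rewrite -lee_fin fineK ?ge0_fin_numE// /series/= -sumEFin big_mkord.
  rewrite -(big_mkord xpredT (fun k => (f z e k)%:E)).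
  by apply: nneseries_lim_ge => k _; rewrite lee_fin.
have AE e : onb ip e -> A e = fine (g u e - g v e)%E.
  move=> Be; have c1 := fz _ _ Be sp; have c2 := fz _ _ Be sm.
  rewrite /g !fsum// -EFinB /=.
  rewrite -(cvg_lim _ (HA e Be))//; apply: cvg_lim => //.
  have -> : (fun N => \sum_(n < N) t n * Re (ip e (x n) * ip (y n) e)) =
      (fun N => series (f u e) N - series (f v e) N).
    apply/funext => N; rewrite /series/= !big_mkord -sumrB; apply: eq_bigr => n _.
    rewrite /f /u /v ipDl ipBl (ipC ip e) /nsq !cE; by field.
  exact: (cvgB c1 c2).
(* [real_sum] separates the positive and negative parts of [A], while [A] is known as the difference
   of [g u] and [g v]; both are summable, so the two decompositions have the same total. *)
have -> : real_sum (onb ip) A = limn (series p) - limn (series m).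
  rewrite /real_sum.
  have gf (z : nat -> h) e : summable (onb ip) (g z) -> onb ip e -> g z e \is a fin_num.
    by move=> sz Be; rewrite ge0_fin_numE//; have := summable_pinfty sz Be; rewrite gee0_abs.
  have E1 e : onb ip e -> ((Num.max (A e) 0)%:E =
     ((g u \- g v)^\+ e))%E.
    by move=> Be; rewrite AE// funeposE EFin_max fineK// fin_numB !gf.
  have E2 e : onb ip e -> ((Num.max (- A e) 0)%:E =
     ((g u \- g v)^\- e))%E.
    by move=> Be; rewrite AE// funenegE EFin_max EFinN fineK// fin_numB !gf.
  rewrite (eq_esum E1) (eq_esum E2).
  have := @esumB _ _ (onb ip) _ _ sp sm (fun e _ => g0 _ e) (fun e _ => g0 _ e).
  rewrite gp gm -EFinB.
  have S1 := summable_funepos (summableB sp sm).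
  have S2 := summable_funeneg (summableB sp sm).
  rewrite summableE (eq_esum (fun e _ => gee0_abs (funepos_ge0 _ e))) in S1.
  rewrite summableE (eq_esum (fun e _ => gee0_abs (funeneg_ge0 _ e))) in S2.
  by rewrite -(fineK S1) -(fineK S2) -EFinB => -[].
have -> : (fun N => \sum_(n < N) t n * Re (ip (y n) (x n))) =
   (fun N => series p N - series m N).
  apply/funext => N; rewrite /series/= !big_mkord -sumrB; apply: eq_bigr => n _.
  by rewrite /p /m sqB sqD; field.
exact: (cvgB cp cm).
Qed.
End Bessel.

(** * Componentwise convergence of complex sequences *)

Section ComplexLimits.
Context (R : realType).
Implicit Types (z w : nat -> R[i]) (a b : R[i]).

Definition ccv z a : Prop :=
  ((fun n => complex.Re (z n)) @ \oo --> complex.Re a) /\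
  ((fun n => complex.Im (z n)) @ \oo --> complex.Im a).

Lemma ccv_uniq z a b : ccv z a -> ccv z b -> a = b.
Proof.
move=> [Ra Ia] [Rb Ib]; apply: complex_ext.
  by rewrite -(cvg_lim _ Ra)// -(cvg_lim _ Rb).
by rewrite -(cvg_lim _ Ia)// -(cvg_lim _ Ib).
Qed.
Lemma ccv_cst a : ccv (fun=> a) a. Proof. by split; exact: cvg_cst. Qed.
Lemma ccv_near z w a : (exists N, forall n, (N <= n)%N -> z n = w n) -> ccv z a -> ccv w a.
Proof.
move=> [N HN] [Ra Ia]; split; [apply: cvg_trans Ra | apply: cvg_trans Ia];
  by apply: near_eq_cvg; exists N => // n /= nN; rewrite HN.
Qed.
Lemma ccvJ z a : ccv z a -> ccv (fun n => cj (z n)) (cj a).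
Proof.
move=> [Ra Ia]; split; rewrite cE; under eq_fun do rewrite cE; first by [].
exact: cvgN.
Qed.
End ComplexLimits.

(** * Orthogonal series and diagonal operators between two systems *)

Section HilbertSums.
Context (R : realType) (h : completeNormedModType R[i])
        (ip : {dot h for Num.conj}) (hilb : is_hilbert ip).
Implicit Types (x y z : h) (c : R[i]) (b : h -> h).
Local Notation Re := (@complex.Re R).
Local Notation Im := (@complex.Im R).
Local Notation sq := (sqnorm ip).

Lemma hcv_ip (u : nat -> h) x y : hcv u x -> ccv (fun n => ip (u n) y) (ip x y).
Proof. by move=> ux; split; [apply: hcv_Re ux|apply: hcv_Im ux]. Qed.

(* Orthonormal up to some zero vectors, so that operators of finite rank need no
   separate treatment. *)
Definition osys (e : nat -> h) : Prop :=
  (forall i j, i != j -> ip (e i) (e j) = 0) /\ (forall i, sq (e i) = 1 \/ e i = 0).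

Lemma osys_le1 e i : osys e -> sq (e i) <= 1.
Proof. by move=> [_ /(_ i)[->|->]]; rewrite ?sq0. Qed.

Lemma osys_bessel e x N : osys e -> \sum_(n < N) nsq (ip x (e n)) <= sq x.
Proof.
move=> oe; rewrite -(big_mkord xpredT (fun n => nsq (ip x (e n)))).
apply: bessel_seq; first exact: iota_uniq.
  by move=> i j _ _; case: oe => oe _; exact: oe.
by move=> i _; exact: osys_le1.
Qed.

Lemma ip_sum_osys e (c : nat -> R[i]) N m : osys e -> (m < N)%N ->
  ip (\sum_(n < N) c n *: e n) (e m) = c m * (sq (e m))%:C.
Proof.
move=> oe mN; rewrite -(big_mkord xpredT (fun n => c n *: e n)) ip_sum_ortho//.
- exact: iota_uniq.
- by move=> i j _ _; case: oe => oe _; exact: oe.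
- by rewrite mem_index_iota.
Qed.

(** By orthogonality a block of the series has squared norm at most the same block of the sum of the
    [nsq (c n)], and those blocks are Cauchy. *)
Lemma hsum_cvg e (c : nat -> R[i]) C : osys e -> (forall N, \sum_(n < N) nsq (c n) <= C) ->
  exists x, hcv (fun N => \sum_(n < N) c n *: e n) x.
Proof.
move=> oe cC; pose S N := \sum_(n < N) nsq (c n).
have Snd : {homo S : m n / (m <= n)%N >-> m <= n}.
  apply/nondecreasing_seqP => n; rewrite /S big_ord_recr/= lerDl; exact: nsq_ge0.
have cS : cvgn S by apply: nondecreasing_is_cvgn => //; exists C => _ [n _ <-]; exact: cC.
apply: hcauchy => e0 e0p.
have /cvgrPdist_lt/(_ (e0 ^+ 2 / 2) (divr_gt0 (exprn_gt0 _ e0p) (ltr0n _ 2)))[N _ HN] := cS.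
have main m n : (N <= m)%N -> (m <= n)%N ->
    hnorm (\sum_(k < m) c k *: e k - \sum_(k < n) c k *: e k) < e0.
  move=> Nm mn; rewrite hnormBC -!(big_mkord xpredT (fun k => c k *: e k)).
  rewrite (big_cat_nat (m := 0) (n := m) (p := n))//= addrAC subrr add0r (hnorm_lt hilb) ?(ltW e0p)//.
  rewrite sq_sum_ortho ?iota_uniq//; last by move=> i j _ _; case: oe => oe _; exact: oe.
  apply: (@le_lt_trans _ _ (S n - S m)).
    rewrite /S -!(big_mkord xpredT (fun k => nsq (c k))) (big_cat_nat (m := 0) (n := m) (p := n))//=.
    rewrite addrAC subrr add0r; apply: ler_sum => k _.
    by rewrite ler_piMr ?nsq_ge0// osys_le1.
  have := HN _ Nm; have := HN _ (leq_trans Nm mn); rewrite /= !ltr_norml; lra.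
exists N => m n Nm Nn; have [mn|/ltnW nm] := leqP m n; first exact: main.
by rewrite hnormBC; exact: main.
Qed.

Definition hsum (e : nat -> h) (c : nat -> R[i]) : h :=
  xget 0 [set x | hcv (fun N => \sum_(n < N) c n *: e n) x].

Lemma hsumP e (c : nat -> R[i]) C : osys e -> (forall N, \sum_(n < N) nsq (c n) <= C) ->
  hcv (fun N => \sum_(n < N) c n *: e n) (hsum e c).
Proof. by move=> oe cC; have := hsum_cvg oe cC; exact: xgetPex. Qed.

(** With [f = g] these are the bounded functions of a diagonal operator; with two systems and
    coefficients 1, the partial isometry of a polar decomposition. *)
Definition dop (f g : nat -> h) (d : nat -> R[i]) : h -> h :=
  fun x => hsum g (fun n => d n * ip x (f n)).

Section DiagonalOperator.
Variables (f g : nat -> h) (d : nat -> R[i]) (D : R).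
Hypotheses (of_ : osys f) (og : osys g) (dD : forall n, nsq (d n) <= D).

Let D0 : 0 <= D. Proof. exact: le_trans (nsq_ge0 _) (dD 0%N). Qed.

Lemma dop_coef_le x N : \sum_(n < N) nsq (d n * ip x (f n)) <= D * sq x.
Proof.
apply: le_trans (_ : D * \sum_(n < N) nsq (ip x (f n)) <= _); last first.
  by rewrite ler_wpM2l// osys_bessel.
by rewrite mulr_sumr; apply: ler_sum => n _; rewrite nsqM ler_wpM2r ?nsq_ge0.
Qed.

Lemma dop_cvg x : hcv (fun N => \sum_(n < N) (d n * ip x (f n)) *: g n) (dop f g d x).
Proof. exact: hsumP (dop_coef_le x). Qed.

Lemma dop_linear : linear (dop f g d).
Proof.
move=> c x y; apply: hcv_uniq (dop_cvg _) _.
have := hcvD (hcvZ c (dop_cvg x)) (dop_cvg y); congr hcv.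
apply/funext => N; rewrite scaler_sumr -big_split/=; apply: eq_bigr => n _.
by rewrite scalerA -scalerDl ipDl ipZl; congr (_ *: _); ring.
Qed.

Lemma dop_bounded_by : bounded_by (dop f g d) (Num.sqrt D).
Proof.
move=> x; rewrite [hnorm x](hnorm_sqrt hilb) -sqrtrM//.
apply: hcv_le (dop_cvg x) _ => N.
rewrite (hnorm_le hilb) ?sqrtr_ge0// sqr_sqrtr ?mulr_ge0 ?sq_ge0//.
rewrite -(big_mkord xpredT (fun n => (d n * ip x (f n)) *: g n)).
rewrite sq_sum_ortho ?iota_uniq//; last by move=> i j _ _; case: og => H _; exact: H.
apply: le_trans (dop_coef_le x N); rewrite big_mkord; apply: ler_sum => n _.
by rewrite ler_piMr ?nsq_ge0// osys_le1.
Qed.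

Lemma dop_bounded : bounded_op (dop f g d).
Proof. exact: bounded_opI dop_linear dop_bounded_by. Qed.

Lemma dop_ip x y :
  ccv (fun N => \sum_(n < N) d n * ip x (f n) * ip (g n) y) (ip (dop f g d x) y).
Proof.
have := hcv_ip y (dop_cvg x); congr ccv; apply/funext => N.
by rewrite ip_suml; apply: eq_bigr => n _; rewrite ipZl.
Qed.

(** The last factor is 1, or 0 at the zero vectors that [osys] allows. *)
Lemma dop_coef x m : ip (dop f g d x) (g m) = d m * ip x (f m) * (sq (g m))%:C.
Proof.
apply: ccv_uniq (hcv_ip _ (dop_cvg x)) _; apply: ccv_near (ccv_cst _).
by exists m.+1 => n mn; rewrite (ip_sum_osys (fun n => d n * ip x (f n))).
Qed.

Lemma dop_orth x y : (forall n, ip (g n) y = 0) -> ip (dop f g d x) y = 0.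
Proof.
move=> H; apply: ccv_uniq (dop_ip x y) _; apply: ccv_near (ccv_cst _).
by exists 0%N => n _; rewrite big1// => i _; rewrite H mulr0.
Qed.

Lemma dop_eig m : dop f g d (f m) = (d m * (sq (f m))%:C) *: g m.
Proof.
apply: hcv_uniq (dop_cvg _) _ => e e0; exists m.+1 => n mn.
rewrite (bigD1 (Ordinal mn))//= big1 ?addr0 -?sqE ?subrr ?hnorm0// => i im.
by case: of_ => H _; rewrite H ?mulr0 ?scale0r// eq_sym; apply: contra im => /eqP im; apply/eqP/val_inj.
Qed.

Lemma dop_null x : (forall n, ip x (f n) = 0) -> dop f g d x = 0.
Proof.
move=> H; apply: hcv_uniq (dop_cvg _) _ => e e0; exists 0%N => n _.
by rewrite big1 ?subrr ?hnorm0// => i _; rewrite H mulr0 scale0r.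
Qed.

End DiagonalOperator.

Lemma dop_adj f g d D : osys f -> osys g -> (forall n, nsq (d n) <= D) ->
  forall x y, ip (dop f g d x) y = ip x (dop g f (fun n => cj (d n)) y).
Proof.
move=> of_ og dD x y; have dD' n : nsq (cj (d n)) <= D by rewrite nsqJ.
apply: ccv_uniq (dop_ip of_ og dD x y) _; rewrite ipC.
have := ccvJ (dop_ip og of_ dD' y x); congr ccv; apply/funext => N.
rewrite conj_sum; apply: eq_bigr => n _.
by rewrite !conjM cjK -!ipC; ring.
Qed.

End HilbertSums.

(** * Compact operators through finite nets *)

Section CompactOperators.
Context (R : realType) (h : completeNormedModType R[i])
        (ip : {dot h for Num.conj}) (hilb : is_hilbert ip).
Implicit Types (x y z : h) (c : R[i]) (b K X : h -> h).
Local Notation Re := (@complex.Re R).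
Local Notation Im := (@complex.Im R).
Local Notation sq := (sqnorm ip).

Lemma norm_le1 x : (`|x| <= 1) = (hnorm x <= 1).
Proof. by rewrite normE -lecR. Qed.

Lemma compact_cluster K (u : nat -> h) : compact_op K -> (forall n, hnorm (u n) <= 1) ->
  exists y, forall (e : R) N, 0 < e -> exists2 n, (N <= n)%N & hnorm (K (u n) - y) < e.
Proof.
move=> [_ pK] u1; rewrite precompactE in pK.
have [|y [_ cy]] := pK ((K \o u) @ \oo) _.
  exists 0%N => // n _ /=; apply: subset_closure; exists (u n) => //=.
  by rewrite norm_le1.
exists y => e N e0.
have := cy [set z | exists2 n, (N <= n)%N & z = K (u n)] [set z | hnorm (z - y) < e].
case.
- by exists N => // n Nn; exists n.
- by apply/nbhs_hnorm; exists e.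
- by move=> z [/= [n Nn ->]]; exists n.
Qed.

(** Total boundedness of the image of the unit ball, the form in which compactness passes to sums,
    compositions and norm limits. *)
Definition net_op K := forall e : R, 0 < e ->
  exists s : seq h, forall x, hnorm x <= 1 -> exists2 y, y \in s & hnorm (K x - y) < e.

Lemma compact_linear K : compact_op K -> linear K. Proof. by case. Qed.

(** Without a finite net at scale [e] one could pick points one after another with images at
    distance at least [e] from all earlier ones, and such a sequence of images has no cluster
    point. *)
Lemma compact_net K : compact_op K -> net_op K.
Proof.
move=> cK e e0; apply: contrapT => noS.
have /choice[f Hf] : forall s : seq h, exists x, hnorm x <= 1 /\
    forall y, y \in s -> e <= hnorm (K x - K y).
  move=> s; apply: contrapT => H; apply: noS; exists [seq K y | y <- s] => x x1.
  apply: contrapT => H2; apply: H; exists x; split => // y ys.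
  rewrite leNgt; apply/negP => H3; apply: H2; exists (K y) => //.
  by apply/mapP; exists y.
(* [S n] lists the first [n] chosen points; [f] supplies a point far from a given list. *)
pose S n := iter n (fun s => f s :: s) [::]; pose u n := f (S n).
have uS m n : (m < n)%N -> u m \in S n.
  elim: n => // n IH; rewrite ltnS leq_eqVlt => /orP[/eqP ->|/IH]; rewrite inE ?eqxx// => ->.
  by rewrite orbT.
have [y Hy] := compact_cluster cK (fun n => (Hf (S n)).1).
have e2 : 0 < e / 2 by rewrite divr_gt0.
have [n _ Hn] := Hy _ 0%N e2; have [m nm Hm] := Hy _ n.+1 e2.
have := (Hf (S m)).2 (u n) (uS _ _ nm); rewrite leNgt => /negP; apply.
have -> : K (f (S m)) - K (u n) = (K (u m) - y) - (K (u n) - y).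
  by rewrite opprB addrA subrK.
by rewrite (le_lt_trans (hnormB _ _))//; lra.
Qed.

Lemma ultra_seq (F : set_system h) (s : seq h) (B : h -> set h) : UltraFilter F ->
  F [set x | exists2 y, y \in s & B y x] -> exists2 y, y \in s & F (B y).
Proof.
move=> UF; elim: s => [|y s IH] H.
  have /filter_ex[x [y]] := H; by rewrite in_nil.
have [By|nBy] := in_ultra_setVsetC (B y) UF; first by exists y => //; rewrite inE eqxx.
have [|z zs Bz] := IH; last by exists z => //; rewrite inE zs orbT.
apply: filterS (filterI H nBy) => x [[z]]; rewrite inE => /orP[/eqP ->|zs] Bz nB //.
by exists z.
Qed.

(** An ultrafilter on the closure of the image contains one of the finitely many balls around a net,
    at every radius; it is therefore Cauchy and converges by completeness. *)
Lemma net_compact K : linear K -> net_op K -> compact_op K.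
Proof.
move=> lK nK; split => //; rewrite precompactE compact_ultra => F UF FA.
have FP := @ultra_proper _ _ UF.
have [p Fp] : exists p : h, F --> p.
  suff cF : cvg F by exists (lim F).
  apply/cauchy_cvgP; apply: cauchy_exP => e /lt0_real[r r0 ->].
  have r2 : 0 < r / 2 by rewrite divr_gt0.
  have [s Hs] := nK _ r2.
  have [|y ys Fy] := @ultra_seq F s (fun y => ball y r%:C) UF; last by exists y.
  apply: filterS FA => z cz.
  have [|w [/= [x x1 <-] wz]] := cz [set w | hnorm (w - z) < r / 2].
    by apply/nbhs_hnorm; exists (r / 2).
  rewrite norm_le1 in x1; have [y ys Hy] := Hs x x1; exists y => //.
  apply/ball_hnorm; have -> : z - y = (K x - y) - (K x - z) by rewrite opprB [RHS]addrC addrA subrK.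
  by rewrite (le_lt_trans (hnormB _ _))//; lra.
exists p; split => //.
suff : closure (closure (K @` [set x : h | `|x| <= 1])) p.
  rewrite -(proj1 (closure_id _))//; exact: closed_closure.
move=> B nB; have FI : F (closure (K @` [set x : h | `|x| <= 1]) `&` B).
  by apply: filterI FA _; exact: Fp.
by have [z zz] := @filter_ex _ F FP _ FI; exists z.
Qed.

Lemma compact_bounded K : compact_op K -> bounded_op K.
Proof.
move=> cK; have lK := compact_linear cK; have [s Hs] := compact_net cK ltr01.
apply: (@bounded_opI _ _ _ (1 + \sum_(y <- s) hnorm y)) => // x.
have [->|x0] := eqVneq x 0; first by rewrite lin0// hnorm0 mulr0.
have nx : 0 < hnorm x.
  by rewrite lt_neqAle hnorm_ge0 andbT eq_sym; apply: contra x0 => /eqP/hnorm_eq0 ->.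
have [|y ys Hy] := Hs ((hnorm x)^-1%:C *: x).
  by rewrite hnormZ nsqR sqrtr_sqr gtr0_norm ?invr_gt0// mulVf ?gt_eqF.
rewrite -ler_pdivrMr//.
have -> : hnorm (K x) / hnorm x = hnorm (K ((hnorm x)^-1%:C *: x)).
  by rewrite linZ// hnormZ nsqR sqrtr_sqr gtr0_norm ?invr_gt0// mulrC.
have -> : K ((hnorm x)^-1%:C *: x) = (K ((hnorm x)^-1%:C *: x) - y) + y by rewrite subrK.
apply: le_trans (hnormD _ _) _; apply: lerD; first exact: ltW.
rewrite (big_rem y)//= lerDl; apply: sumr_ge0 => z _; exact: hnorm_ge0.
Qed.

Lemma compact_compl a K : bounded_op a -> compact_op K -> compact_op (a \o K).
Proof.
move=> ba cK; have lK := compact_linear cK; have la := bounded_lin ba.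
have [C C0 aC] := bounded_opE ba.
apply: net_compact => [c x y /=|e e0]; first by rewrite lK la.
have [s Hs] := compact_net cK (divr_gt0 e0 C0).
exists [seq a y | y <- s] => x /Hs[y ys Hy]; exists (a y); first by apply/mapP; exists y.
rewrite /= -linB//; apply: le_lt_trans (aC _) _.
by rewrite mulrC -ltr_pdivlMr.
Qed.

Lemma compact_compr K b : compact_op K -> bounded_op b -> compact_op (K \o b).
Proof.
move=> cK bb; have lK := compact_linear cK; have lb := bounded_lin bb.
have [C C0 bC] := bounded_opE bb.
apply: net_compact => [c x y /=|e e0]; first by rewrite lb lK.
have [s Hs] := compact_net cK (divr_gt0 e0 C0).
exists [seq C%:C *: y | y <- s] => x x1.
have [|y ys Hy] := Hs (C^-1%:C *: b x).
  rewrite hnormZ nsqR sqrtr_sqr gtr0_norm ?invr_gt0// mulrC ler_pdivrMr// mul1r.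
  by apply: le_trans (bC x) _; rewrite ler_piMr// ltW.
exists (C%:C *: y); first by apply/mapP; exists y.
have -> : (K \o b) x - C%:C *: y = C%:C *: (K (C^-1%:C *: b x) - y).
  rewrite scalerBr (linZ lK) scalerA -realM mulfV ?gt_eqF// scale1r //.
by rewrite hnormZ nsqR sqrtr_sqr gtr0_norm// mulrC -ltr_pdivlMr.
Qed.

Lemma compact_approx K : linear K ->
  (forall e : R, 0 < e -> exists2 K', compact_op K' &
     forall x, hnorm x <= 1 -> hnorm (K x - K' x) < e) -> compact_op K.
Proof.
move=> lK H; apply: net_compact => // e e0; have e2 : 0 < e / 2 by rewrite divr_gt0.
have [K' cK' HK] := H _ e2; have [s Hs] := compact_net cK' e2.
exists s => x x1; have [y ys Hy] := Hs x x1; exists y => //.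
have -> : K x - y = (K x - K' x) + (K' x - y) by rewrite addrA subrK.
by rewrite (le_lt_trans (hnormD _ _))//; have := HK x x1; lra.
Qed.

Lemma compactD K1 K2 : compact_op K1 -> compact_op K2 -> compact_op (K1 \+ K2).
Proof.
move=> c1 c2; have l1 := compact_linear c1; have l2 := compact_linear c2.
apply: net_compact => [c x y /=|e e0]; first by rewrite l1 l2 scalerDr addrACA.
have e2 : 0 < e / 2 by rewrite divr_gt0.
have [s Hs] := compact_net c1 e2; have [t Ht] := compact_net c2 e2.
exists [seq y + z | y <- s, z <- t] => x x1.
have [y ys Hy] := Hs x x1; have [z zt Hz] := Ht x x1.
exists (y + z); first by apply/allpairsP; exists (y, z).
have -> : (K1 \+ K2) x - (y + z) = (K1 x - y) + (K2 x - z) by rewrite /= opprD addrACA.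
by rewrite (le_lt_trans (hnormD _ _))//; lra.
Qed.

Lemma compactZ c K : compact_op K -> compact_op (c \*: K).
Proof.
move=> cK; have bc : bounded_op (c \*: (id : h -> h)) by apply: boundedZ; exact: bounded_id.
exact: compact_compl bc cK.
Qed.

Lemma compact0 : compact_op (fun _ : h => 0 : h).
Proof.
apply: net_compact => [c x y|e e0]; first by rewrite scaler0 addr0.
by exists [:: 0] => x _; exists 0; rewrite ?inE ?eqxx// subrr hnorm0.
Qed.

Lemma compactB K1 K2 : compact_op K1 -> compact_op K2 -> compact_op (K1 \- K2).
Proof.
move=> c1 c2; rewrite (_ : _ \- _ = K1 \+ (-1 \*: K2)); first exact: compactD (compactZ _ _).
by apply/funext => x /=; rewrite scaleN1r.
Qed.

Lemma real_grid (M d : R) : 0 < d -> exists s : seq R,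
  forall a, `|a| <= M -> exists2 r, r \in s & `|a - r| <= d.
Proof.
move=> d0; pose B := Num.truncn (2 * M / d).
exists [seq k%:R * d - M | k <- iota 0 B.+1] => a; rewrite ler_norml => /andP[a1 a2].
pose k := Num.truncn ((a + M) / d).
have aM : 0 <= (a + M) / d by rewrite divr_ge0 ?(ltW d0)//; lra.
exists (k%:R * d - M).
  apply/mapP; exists k => //; rewrite mem_iota add0n ltnS.
  by apply: le_truncn; rewrite ler_pM2r ?invr_gt0//; lra.
have /andP[k1 k2] := truncn_itv aM.
move: k1 k2; rewrite -/k ler_pdivlMr// ltr_pdivrMr// -natr1 mulrDl mul1r => k1 k2.
rewrite ler_norml; lra.
Qed.

(** On the unit ball the coefficient [ip x y] stays in a bounded square, so a finite grid of
    coefficients yields a net. *)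
Lemma rank_one_compact y z : compact_op (fun x => ip x y *: z).
Proof.
have bnd x : hnorm (ip x y *: z) <= hnorm y * hnorm z * hnorm x.
  rewrite hnormZ mulrAC ler_wpM2r ?hnorm_ge0// mulrC; exact: ip_le.
apply: net_compact => [c u v|e e0]; first by rewrite ipDl ipZl scalerDl scalerA.
have Z1 : 0 < 2 * (hnorm z + 1) by rewrite mulr_gt0// ltr_wpDl ?hnorm_ge0.
have [s Hs] := real_grid (hnorm y) (divr_gt0 e0 (mulr_gt0 (ltr0n R 2) Z1)).
exists [seq (p +i* q) *: z | p <- s, q <- s] => x x1.
have xy : hnorm x * hnorm y <= hnorm y by rewrite ler_piMl ?hnorm_ge0.
have [p sp Ha] := Hs _ (le_trans (Re_ip_le_norm hilb x y) xy).
have [q sq' Hb] := Hs _ (le_trans (Im_ip_le_norm hilb x y) xy).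
exists ((p +i* q) *: z); first by apply/allpairsP; exists (p, q).
rewrite -scalerBl hnormZ.
set d := e / _ in Ha Hb; have d0 : 0 < d by rewrite divr_gt0// mulr_gt0.
have : Num.sqrt (nsq (ip x y - p +i* q)) <= 2 * d.
  have d2 : 0 <= 2 * d by rewrite mulr_ge0// ltW.
  apply: (@le_trans _ _ (Num.sqrt ((2 * d) ^+ 2))); last by rewrite sqrtr_sqr ger0_norm.
  apply: ler_wsqrtr.
  rewrite /nsq !cE /= -(real_normK (num_real (Re _ - p))) -(real_normK (num_real (Im _ - q))).
  have A1 := normr_ge0 (Re (ip x y) - p); have A2 := normr_ge0 (Im (ip x y) - q); nra.
move=> H; apply: le_lt_trans (ler_wpM2r (hnorm_ge0 _) H) _.
rewrite /d; have z0 := hnorm_ge0 z.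
have -> : 2 * (e / (2 * (2 * (hnorm z + 1)))) * hnorm z = e * (hnorm z / (2 * (hnorm z + 1))).
  by field; rewrite gt_eqF ?ltr_wpDl.
rewrite gtr_pMr// ltr_pdivrMr//; lra.
Qed.

(** The first [N] terms form an operator of finite rank, and the norm of the rest is bounded by the
    coefficients from [N] on. *)
Lemma dop_compact f g (d : nat -> R[i]) : osys ip f -> osys ip g ->
  (forall e : R, 0 < e -> exists N, forall n, (N <= n)%N -> nsq (d n) < e) ->
  compact_op (dop ip f g d).
Proof.
move=> of_ og dlim.
have [D dD] : exists D, forall n, nsq (d n) <= D.
  have [N HN] := dlim 1 ltr01; exists (1 + \sum_(k < N) nsq (d k)) => n.
  have S0 : 0 <= \sum_(k < N) nsq (d k) by apply: sumr_ge0 => k _; exact: nsq_ge0.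
  have [/HN/ltW H|nN] := leqP N n; first by rewrite (le_trans H)// lerDl.
  rewrite (bigD1 (Ordinal nN))//= addrCA lerDl addr_ge0//.
  by apply: sumr_ge0 => k _; exact: nsq_ge0.
have ld : linear (dop ip f g d) := dop_linear hilb of_ og dD.
apply: compact_approx => // e e0.
have [N HN] := dlim (e ^+ 2 / 4) (divr_gt0 (exprn_gt0 _ e0) (ltr0n _ 4)).
exists (fun x => \sum_(n < N) (d n * ip x (f n)) *: g n).
  elim: (N) => [|n IH].
    by rewrite (_ : (fun _ => _) = fun=> 0); [exact: compact0 | apply/funext => x; rewrite big_ord0].
  rewrite (_ : (fun _ => _) = (fun x => \sum_(k < n) (d k * ip x (f k)) *: g k) \+
    (d n \*: (fun x => ip x (f n) *: g n))); first exact: compactD IH (compactZ _ (rank_one_compact _ _)).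
  by apply/funext => x; rewrite big_ord_recr /= scalerA.
move=> x x1; pose d' n := if (n < N)%N then 0 else d n.
have d'D n : nsq (d' n) <= e ^+ 2 / 4.
  rewrite /d'; case: ltnP => [_|/HN/ltW//]; by rewrite nsq0 divr_ge0 ?sqr_ge0.
have -> : dop ip f g d x - \sum_(n < N) (d n * ip x (f n)) *: g n = dop ip f g d' x.
  apply: (@hcv_uniq _ _ (fun M => \sum_(n < M) (d' n * ip x (f n)) *: g n)); last exact: (dop_cvg hilb of_ og d'D).
  have := hcvD (dop_cvg hilb of_ og dD x) (@hcv_cst _ _ (- \sum_(n < N) (d n * ip x (f n)) *: g n)).
  move=> H r r0; have [M HM] := H r r0; exists (maxn M N) => n; rewrite geq_max => /andP[Mn Nn].
  have := HM n Mn; congr (hnorm (_ - _) < r).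
  rewrite -!(big_mkord xpredT (fun n => (d n * ip x (f n)) *: g n)).
  rewrite -!(big_mkord xpredT (fun n => (d' n * ip x (f n)) *: g n)).
  rewrite !(big_cat_nat (m := 0%N) (n := N) (p := n))//= addrAC subrr add0r.
  rewrite [X in _ = X + _]big_nat_cond [X in _ = X + _]big1 ?add0r.
    by apply: eq_big_nat => k /andP[Nk _]; rewrite /d' ltnNge Nk.
  by move=> k /andP[/andP[_ kN] _]; rewrite /d' kN mul0r scale0r.
apply: le_lt_trans (dop_bounded_by hilb of_ og d'D x) _.
apply: (@le_lt_trans _ _ (Num.sqrt (e ^+ 2 / 4))); first by rewrite ler_piMr ?sqrtr_ge0.
have -> : e ^+ 2 / 4 = (e / 2) ^+ 2 by field.
rewrite sqrtr_sqr ger0_norm; lra.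
Qed.

End CompactOperators.

(** * Spectral theorem for compact positive operators *)

Section Diagonalization.
Context (R : realType) (h : completeNormedModType R[i])
        (ip : {dot h for Num.conj}) (hilb : is_hilbert ip).
Implicit Types (x y z : h) (c : R[i]) (b K X : h -> h) (p : R * h).
Local Notation Re := (@complex.Re R).
Local Notation Im := (@complex.Im R).
Local Notation sq := (sqnorm ip).

Definition qform X x : R := Re (ip (X x) x).

Lemma quad_real X x : positive_op ip X -> ip (X x) x = (qform X x)%:C.
Proof.
move=> [_ /(_ x)]; rewrite lecE /qform /= => /andP[/eqP I _].
by apply: complex_ext; rewrite ?I.
Qed.
Lemma qf_ge0 X x : positive_op ip X -> 0 <= qform X x.
Proof. by move=> pX; have [_ /(_ x)] := pX; rewrite quad_real// ler0c. Qed.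

(** Polarization with [x + y] and [x + 'i *: y]: over the complex field a real quadratic form comes
    from a symmetric operator. *)
Lemma real_qf_sym X : linear X -> (forall x, Im (ip (X x) x) = 0) ->
  forall x y, ip (X x) y = ip x (X y).
Proof.
move=> lX HX x y.
have H1 := HX (x + y); have H2 := HX (x + 'i *: y).
rewrite !(linD lX) !(ipDl, ipDr) !cE !HX in H1 H2.
rewrite (linZ lX) !(ipZl, ipZr) !cE /= ?HX in H2.
rewrite [ip x _]ipC; apply: complex_ext; rewrite cE; lra.
Qed.

Lemma positive_sym X : positive_op ip X -> forall x y, ip (X x) y = ip x (X y).
Proof.
move=> pX; apply: real_qf_sym; first by case: pX => [[]].
by move=> x; rewrite quad_real.
Qed.

Lemma sym_ext X Y : linear X -> linear Y -> (forall x, ip (X x) x = ip (Y x) x) -> X = Y.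
Proof.
move=> lX lY H; apply/funext => x; apply: (ip_inj (ip := ip)) => y.
have R1 := congr1 Re (H (x + y)); have I1 := congr1 Im (H (x + y)).
have R2 := congr1 Re (H (x + 'i *: y)); have I2 := congr1 Im (H (x + 'i *: y)).
rewrite !(linD lX) !(linD lY) !(ipDl, ipDr) !H !cE in R1 I1 R2 I2.
rewrite (linZ lX) (linZ lY) !(ipZl, ipZr) !cE /= in R2 I2.
have Hy := congr1 Re (H y); have Iy := congr1 Im (H y).
apply: complex_ext; lra.
Qed.

(* Cauchy-Schwarz for the form [<X x, y>], at [y = X x]. *)
Lemma positive_sq_le X mu : positive_op ip X -> 0 < mu ->
  (forall x, qform X x <= mu * sq x) -> forall x, sq (X x) <= mu * qform X x.
Proof.
move=> pX mu0 Hmu x; have [[lX _] _] := pX.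
have := qf_ge0 (x - mu^-1%:C *: X x) pX.
rewrite /qform (linB lX) (linZ lX) !(ipBl, ipBr) !(ipZl, ipZr).
rewrite (positive_sym pX (X x) x) conjR !cE /= -/(qform X x) -/(qform X (X x)) -/(sq (X x)).
have := Hmu (X x); move=> H1 H2.
have mi : 0 < mu^-1 by rewrite invr_gt0.
have H3 : mu^-1 * (mu^-1 * qform X (X x)) <= mu^-1 * sq (X x).
  by rewrite ler_pM2l// -(ler_pM2l mu0) mulrA mulfV ?gt_eqF// mul1r.
have : mu^-1 * sq (X x) <= qform X x by move: H2 H3; rewrite /qform; lra.
by rewrite -(ler_pM2l mu0) mulrA mulfV ?gt_eqF// mul1r.
Qed.

Lemma qf_le_norm X : bounded_op X -> exists C, forall x, hnorm x <= 1 -> qform X x <= C.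
Proof.
move=> bX; have [C C0 XC] := bounded_opE bX; exists C => x x1.
apply: le_trans (ler_norm _) _; apply: le_trans (Re_ip_le_norm hilb _ _) _.
apply: (@le_trans _ _ (hnorm (X x))); first by rewrite ler_piMr ?hnorm_ge0.
by apply: le_trans (XC x) _; rewrite ler_piMr// ltW.
Qed.

(** An eigenpair whose eigenvalue dominates the form. The pair [(0, 0)] occurs for the zero
    operator, so that deflation can be iterated forever. *)
Definition top_pair X (p : R * h) : Prop :=
  [/\ X p.2 = p.1%:C *: p.2, forall x, qform X x <= p.1 * sq x &
      (0 < p.1 /\ sq p.2 = 1) \/ (p.1 = 0 /\ p.2 = 0)].

(** The supremum [mu] of the form on the unit ball is an eigenvalue: by [positive_sq_le] a
    maximizing sequence consists of approximate eigenvectors, and compactness gives their images a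
    cluster point [y], which is an eigenvector. *)
Lemma top_pair_exists X : compact_op X -> positive_op ip X -> exists p, top_pair X p.
Proof.
move=> cX pX; have [bX _] := pX; have lX := bounded_lin bX.
pose S := [set qform X x | x in [set x | hnorm x <= 1]].
have hS : has_sup S.
  split; first by exists (qform X 0), 0 => //=; rewrite hnorm0.
  by have [C HC] := qf_le_norm bX; exists C => _ [x /= x1 <-]; exact: HC.
pose mu := sup S.
have mu0 : 0 <= mu.
  apply: le_trans (qf_ge0 0 pX) _; apply: ub_le_sup; first by case: hS.
  by exists 0 => //=; rewrite hnorm0.
have qmu x : qform X x <= mu * sq x.
  have [->|x0] := eqVneq x 0; first by rewrite /qform ip0r sq0 mulr0.
  have sx := sq_gt0 ip x0; pose r := (Num.sqrt (sq x))^-1.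
  have r2 : r ^+ 2 = (sq x)^-1 by rewrite exprVn sqr_sqrtr ?sq_ge0.
  have : qform X (r%:C *: x) <= mu.
    apply: ub_le_sup; first by case: hS.
    exists (r%:C *: x) => //=; rewrite (hnorm_le hilb)// sqZ nsqR r2 mulVf ?gt_eqF//.
    by rewrite expr1n.
  have -> : qform X (r%:C *: x) = r ^+ 2 * qform X x.
    by rewrite /qform (linZ lX) ipZl ipZr conjR !cE /=; ring.
  by rewrite r2 mulrC ler_pdivrMr.
have [mu00|mup] := eqVneq mu 0.
  exists (0, 0); split => /=; [by rewrite lin0// scaler0 | by rewrite -mu00 | by right].
have {}mup : 0 < mu by rewrite lt_neqAle eq_sym mup mu0.
have sqle := positive_sq_le pX mup qmu.
have e0 n : 0 < n.+1%:R^-1 :> R by rewrite invr_gt0.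
have /choice[u Hu] : forall n, exists x, hnorm x <= 1 /\ mu - n.+1%:R^-1 < qform X x.
  by move=> n; have [_ [x /= x1 <-] H] := sup_adherent (e0 n) hS; exists x.
(* Expanding, [sq (X u) <= mu * qform X u] and [sq u <= 1] leave at most [mu * (mu - qform X u)]. *)
have near_eig n : sq (X (u n) - mu%:C *: u n) <= mu * n.+1%:R^-1.
  have [u1 qu] := Hu n; rewrite sqB sqZ nsqR ipZr conjR !cE /= mul0r subr0 -/(qform X (u n)).
  have := sqle (u n); rewrite (hnorm_le hilb)// expr1n in u1.
  move: qu; move: (n.+1%:R^-1) => d; have := sq_ge0 ip (u n); nra.
have [y Hy] := compact_cluster cX (fun n => (Hu n).1).
have [C C0 XC] := bounded_opE bX.
have Ey : X y = mu%:C *: y.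
  apply/eqP; rewrite -subr_eq0; apply/eqP/hnorm_eq0/eqP.
  rewrite eq_le hnorm_ge0 andbT; apply/ler_addgt0Pr => e e1; rewrite add0r.
  (* Three errors occur, two of size [C * d] and one of size [mu * d]; with this [d] they add up to
     less than [e]. *)
  pose d := e / (2 * (C + 1 + mu)); have D0 : 0 < C + 1 + mu by lra.
  have d0 : 0 < d by rewrite divr_gt0// mulr_gt0.
  have [N HN] := invS_lt (divr_gt0 (exprn_gt0 2 d0) mup).
  have [n Nn Hn] := Hy d N d0; set x := u n in Hn.
  have Hx : hnorm (X x - mu%:C *: x) <= d.
    rewrite (hnorm_le hilb) ?(ltW d0)//; apply: le_trans (near_eig n) _.
    by rewrite mulrC -ler_pdivlMr// ltW// HN.
  have -> : X y - mu%:C *: y = X (y - X x) + X (X x - mu%:C *: x) + mu%:C *: (X x - y).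
    rewrite !(linB lX) (linZ lX) scalerBr !addrA !subrK //.
  apply: le_trans (hnormD _ _) _; rewrite hnormZ nsqR sqrtr_sqr gtr0_norm//.
  have A1 : hnorm (X (y - X x) + X (X x - mu%:C *: x)) <= C * d + C * d.
    apply: le_trans (hnormD _ _) _; apply: lerD.
      by apply: le_trans (XC _) _; rewrite ler_pM2l// hnormBC ltW.
    by apply: le_trans (XC _) _; rewrite ler_pM2l.
  have A2 : mu * hnorm (X x - y) <= mu * d by rewrite ler_pM2l// ltW.
  have : C * d + C * d + mu * d <= 2 * (C + 1 + mu) * d by nra.
  have -> : 2 * (C + 1 + mu) * d = e by rewrite /d mulrC divfK ?gt_eqF ?mulr_gt0.
  by lra.
(* Otherwise some [X (u n)] would have norm below [mu / 2] while its form at [u n] exceeds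
   [mu / 2]. *)
have y0 : y != 0.
  apply/eqP => y0.
  have mu2 : 0 < mu / 2 by rewrite divr_gt0.
  have [N HN] := invS_lt mu2; have [n Nn] := Hy (mu / 2) N mu2.
  rewrite y0 subr0 => Hn; have [u1 qu] := Hu n; have := HN n Nn.
  have : qform X (u n) <= hnorm (X (u n)).
    apply: le_trans (ler_norm _) _; apply: le_trans (Re_ip_le_norm hilb _ _) _.
    by rewrite ler_piMr ?hnorm_ge0.
  by move: qu; move: (n.+1%:R^-1) => d; lra.
have sy := sq_gt0 ip y0; pose r := (Num.sqrt (sq y))^-1.
exists (mu, r%:C *: y); split => //=.
  by rewrite (linZ lX) Ey !scalerA mulrC.
left; split => //; rewrite sqZ nsqR exprVn sqr_sqrtr ?sq_ge0// mulVf ?gt_eqF//.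
Qed.

(** Bundled so that deflation is a self-map and can be iterated. *)
Record posc := PosC { pop :> h -> h; pop_compact : compact_op pop; pop_pos : positive_op ip pop }.

Definition deflate (X : h -> h) (p : R * h) : h -> h :=
  fun x => X x - (p.1%:C * ip x p.2) *: p.2.

Lemma deflateE X p x : linear X -> top_pair X p -> deflate X p x = X (x - ip x p.2 *: p.2).
Proof.
by move=> lX [Xe _ _]; rewrite /deflate (linB lX) (linZ lX) Xe scalerA mulrC.
Qed.

Lemma defl_sq p x : sq p.2 = 1 \/ p.2 = 0 -> sq (x - ip x p.2 *: p.2) <= sq x.
Proof.
move=> [p1|->]; last by rewrite scaler0 subr0.
rewrite sqB sqZ p1 ipZr !cE /nsq; have := sqr_ge0 (Re (ip x p.2)).
have := sqr_ge0 (Im (ip x p.2)); lra.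
Qed.

(** Deflation keeps positivity for this reason: [X] preserves the orthogonal complement of its
    eigenvector. *)
Lemma deflate_qf X p x : positive_op ip X -> top_pair X p ->
  ip (deflate X p x) x = ip (X (x - ip x p.2 *: p.2)) (x - ip x p.2 *: p.2).
Proof.
move=> pX tp; have [[lX _] _] := pX; rewrite deflateE//; have [Xe _ p1] := tp.
set y := x - _.
have yp : ip y p.2 = 0.
  rewrite /y ipBl ipZl; case: p1 => [[_ p1]|[_ ->]]; last by rewrite !ip0r mulr0 subr0.
  by rewrite sqE p1 mulr1 subrr.
have -> : ip (X y) x = ip (X y) (y + ip x p.2 *: p.2) by rewrite subrK.
by rewrite ipDr ipZr (positive_sym pX y p.2) Xe ipZr yp !mulr0 addr0.
Qed.

Lemma deflate_posc X p : compact_op X -> positive_op ip X -> top_pair X p ->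
  compact_op (deflate X p) /\ positive_op ip (deflate X p).
Proof.
move=> cX pX tp; have lX := compact_linear cX.
have cD : compact_op (deflate X p).
  rewrite (_ : deflate X p = X \- (p.1%:C \*: (fun x => ip x p.2 *: p.2))).
    by apply: compactB => //; apply: compactZ; exact: rank_one_compact.
  by apply/funext => x /=; rewrite scalerA.
split => //; split; first exact: compact_bounded.
by move=> x; rewrite (deflate_qf _ pX tp); case: pX => _.
Qed.

Definition top (X : posc) : R * h := projT1 (cid (top_pair_exists (pop_compact X) (pop_pos X))).
Lemma topP (X : posc) : top_pair X (top X).
Proof. exact: projT2 (cid _). Qed.
Definition dfl (X : posc) : posc :=
  let H := deflate_posc (pop_compact X) (pop_pos X) (topP X) in
  PosC (proj1 H) (proj2 H).

(** Zero vectors of [e] carry the weight 0, so operators of finite rank are included. *)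
Definition diagonal X (mu : nat -> R) (e : nat -> h) : Prop :=
  [/\ osys ip e /\ (forall n, e n = 0 -> mu n = 0),
      forall n, 0 <= mu n, forall m n, (m <= n)%N -> mu n <= mu m,
      mu @ \oo --> (0 : R) &
      forall x, hcv (fun N => \sum_(n < N) ((mu n)%:C * ip x (e n)) *: e n) (X x)].

(** Repeated deflation: the form of the n-th remainder is at most [mu n], so its norm is too, and
    [mu] tends to 0. *)
Lemma diag_exists X : compact_op X -> positive_op ip X -> exists mu e, diagonal X mu e.
Proof.
move=> cX pX; have lX := compact_linear cX.
pose Xs n := iter n dfl (PosC cX pX); pose mu n := (top (Xs n)).1; pose e n := (top (Xs n)).2.
have tp n : top_pair (Xs n) (mu n, e n) by have := topP (Xs n); rewrite /mu /e; case: (top _).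
have XS n x : Xs n.+1 x = Xs n x - ((mu n)%:C * ip x (e n)) *: e n by [].
have lXs n : linear (Xs n) := compact_linear (pop_compact _).
have Xe n : Xs n (e n) = (mu n)%:C *: e n by have [] := tp n.
have e01 n : (0 < mu n /\ sq (e n) = 1) \/ (mu n = 0 /\ e n = 0) by have [] := tp n.
have Xsum n x : Xs n x = X x - \sum_(k < n) ((mu k)%:C * ip x (e k)) *: e k.
  elim: n => [|n IH]; first by rewrite big_ord0 subr0.
  by rewrite XS IH big_ord_recr/= opprD addrA.
(* Vectors already split off lie in the kernel of every later remainder, whence the orthogonality of
   the system. *)
have ker k n : (k < n)%N -> Xs n (e k) = 0.
  elim: n => // n IH; rewrite ltnS leq_eqVlt => /orP[/eqP ->|kn].
    rewrite XS Xe; case: (e01 n) => [[_ s1]|[-> ->]]; last by rewrite !scaler0 subr0.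
    by rewrite sqE s1 mulr1 subrr.
  rewrite XS IH// sub0r; case: (e01 n) => [[mn s1]|[-> ->]]; last by rewrite scaler0 oppr0.
  suff -> : (mu n)%:C * ip (e k) (e n) = 0 by rewrite scale0r oppr0.
  by rewrite -[(mu n)%:C]conjR -ipZr -Xe -(positive_sym (pop_pos (Xs n))) IH// ip0l.
have orth k n : (k < n)%N -> ip (e k) (e n) = 0.
  move=> kn; case: (e01 n) => [[mn s1]|[_ ->]]; last by rewrite ip0r.
  have : (mu n)%:C * ip (e k) (e n) = 0.
    by rewrite -[(mu n)%:C]conjR -ipZr -Xe -(positive_sym (pop_pos (Xs n))) ker// ip0l.
  move/eqP; rewrite mulf_eq0 => /orP[/eqP/(congr1 Re)/= m0|/eqP//].
  by move: mn; rewrite m0 ltxx.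
have oe : osys ip e.
  split; last by move=> i; case: (e01 i) => [[_]|[_]]; [left|right].
  move=> i j; case: (ltngtP i j) => // ij _; first exact: orth.
  by rewrite ipC orth// cj0.
have mu0 n : 0 <= mu n by case: (e01 n) => [[/ltW]|[->]].
have qle n x : qform (Xs n) x <= mu n * sq x by have [] := tp n.
have mudec n : mu n.+1 <= mu n.
  case: (e01 n.+1) => [[mn s1]|[-> _]]; last exact: mu0.
  have <- : qform (Xs n.+1) (e n.+1) = mu n.+1.
    by rewrite /qform Xe ipZl sqE s1 mulr1.
  rewrite /qform -[Xs n.+1 _]/(deflate (Xs n) (top (Xs n)) _) (deflate_qf _ (pop_pos _) (topP _)).
  apply: le_trans (qle n _) _; rewrite -[leRHS]mulr1 ler_wpM2l// -s1; apply: defl_sq.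
  by case: (e01 n) => [[_]|[_]]; [left|right].
have mumono m n : (m <= n)%N -> mu n <= mu m.
  by move/subnKC => <-; elim: (n - m)%N => [|k IH]; rewrite ?addn0// addnS (le_trans (mudec _)).
have XeE n : X (e n) = (mu n)%:C *: e n.
  rewrite -Xe Xsum big1 ?subr0// => k _; by rewrite (ipC ip) orth// cj0 mulr0 scale0r.
(* If all eigenvalues were at least [d], the images of two distinct [e n] would be at squared
   distance at least [2 * d ^+ 2], against compactness. *)
have mulim : mu @ \oo --> (0 : R).
  apply/cvgrPdist_lt => d d0; apply: contrapT => nlim.
  have big n : d <= mu n.
    rewrite leNgt; apply/negP => H; apply: nlim; exists n => // m /= nm.
    by rewrite sub0r normrN ger0_norm// (le_lt_trans (mumono _ _ nm)).
  have s1 n : sq (e n) = 1.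
    case: (e01 n) => [[_]//|[m0 _]]; have := big n; rewrite m0; lra.
  have [|y Hy] := compact_cluster cX (u := e).
    by move=> n; rewrite (hnorm_le hilb)// s1 expr1n.
  have d2 : 0 < d / 2 by rewrite divr_gt0.
  have [n _ Hn] := Hy _ 0%N d2; have [m nm Hm] := Hy _ n.+1 d2.
  have : hnorm (X (e m) - X (e n)) < d.
    have -> : X (e m) - X (e n) = (X (e m) - y) - (X (e n) - y) by rewrite opprB addrA subrK.
    by rewrite (le_lt_trans (hnormB _ _))//; lra.
  have o : ip (e m) (e n) = 0 by rewrite ipC orth// cj0.
  rewrite (hnorm_lt hilb) ?(ltW d0)// !XeE sqB !sqZ !nsqR !s1 ipZl ipZr o.
  rewrite !mulr0 !mulr1 subr0.
  have := big n; have := big m; nra.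
exists mu, e; split => //.
  split => // n en; case: (e01 n) => [[_]|[]//]; by rewrite en sq0 => /eqP; rewrite eq_sym oner_eq0.
move=> x d d0.
have [->|x0] := eqVneq x 0.
  exists 0%N => n _; have -> : X 0 = 0 by exact: lin0.
  rewrite subr0 big1 ?hnorm0// => k _.
  by rewrite ip0l mulr0 scale0r.
have sx := sq_gt0 ip x0.
(* Chosen so that [dd * hnorm x < d]; the left side bounds the remainder at [x]. *)
pose dd := d / (2 * (hnorm x + 1)).
have hx1 : 0 < 2 * (hnorm x + 1) by rewrite mulr_gt0// ltr_wpDl ?hnorm_ge0.
have dd0 : 0 < dd by rewrite divr_gt0.
have /cvgrPdist_lt/(_ dd dd0)[N _ HN] := mulim.
exists N => n Nn; have := HN n Nn; rewrite /= sub0r normrN ger0_norm// => mun.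
rewrite hnormBC -Xsum.
have H2 y : qform (Xs n) y <= dd * sq y.
  by apply: le_trans (qle n y) _; rewrite ler_wpM2r ?sq_ge0// ltW.
have := positive_sq_le (pop_pos (Xs n)) dd0 H2 x => H3.
rewrite (hnorm_lt hilb) ?(ltW d0)//.
apply: (@le_lt_trans _ _ (dd * (dd * sq x))).
  by apply: le_trans H3 _; rewrite ler_pM2l.
have dd1 := ltW dd0.
rewrite -(hnormE hilb) mulrA -expr2 -exprMn ltr_sqr ?nnegrE ?mulr_ge0 ?hnorm_ge0 ?(ltW d0)//.
rewrite /dd mulrAC ltr_pdivrMr//; have := hnorm_ge0 x; nra.
by rewrite invr_ge0 ltW.
Qed.
End Diagonalization.

Lemma cvg_eq (R : realType) (u v : nat -> R) (l : R) :
  (forall n, u n = v n) -> u @ \oo --> l -> v @ \oo --> l.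
Proof. by move=> /funext ->. Qed.

(** * Absolute value and singular values computed from a diagonalization *)

Section SingularValues.
Context (R : realType) (h : completeNormedModType R[i])
        (ip : {dot h for Num.conj}) (hilb : is_hilbert ip).
Implicit Types (x y z : h) (c : R[i]) (b K X P Q : h -> h) (mu : nat -> R) (e : nat -> h).
Local Notation Re := (@complex.Re R).
Local Notation Im := (@complex.Im R).
Local Notation sq := (sqnorm ip).
Local Notation qf := (qform ip).
Local Notation diag := (diagonal ip).

Definition rdop e mu : h -> h := dop ip e e (fun n => (mu n)%:C).

Lemma rdop_bound mu : (forall n, 0 <= mu n) -> (forall m n, (m <= n)%N -> mu n <= mu m) ->
  forall n, nsq (mu n)%:C <= mu 0%N ^+ 2.
Proof. by move=> m0 md n; rewrite nsqR ler_sqr ?nnegrE ?m0 ?md. Qed.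

Lemma diag_rdop mu e : osys ip e -> (forall n, e n = 0 -> mu n = 0) ->
  (forall n, 0 <= mu n) -> (forall m n, (m <= n)%N -> mu n <= mu m) ->
  mu @ \oo --> (0 : R) -> diag (rdop e mu) mu e.
Proof. by move=> oe ez m0 md ml; split => //; exact: dop_cvg (rdop_bound m0 md). Qed.

Lemma diagE X mu e : diag X mu e -> X = rdop e mu.
Proof.
move=> [[oe _] m0 md _ HX]; apply/funext => x; apply: hcv_uniq (HX x) _.
exact: dop_cvg (rdop_bound m0 md) x.
Qed.

Lemma qf_ip X x : qf X x = Re (ip (X x) x). Proof. by []. Qed.

Lemma rdop_pos mu e D : osys ip e -> (forall n, 0 <= mu n) ->
  (forall n, nsq (mu n)%:C <= D) -> positive_op ip (rdop e mu).
Proof.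
move=> oe m0 mD; split; first exact: dop_bounded mD.
move=> x; have [cR cI] := dop_ip hilb oe oe mD x x.
have E N : \sum_(n < N) (mu n)%:C * ip x (e n) * ip (e n) x =
    (\sum_(n < N) mu n * nsq (ip x (e n)))%:C.
  rewrite rmorph_sum /=; apply: eq_bigr => n _.
  by rewrite (ipC ip (e n)) -mulrA -nsqE -realM.
rewrite lecE /=; apply/andP; split.
  apply/eqP; rewrite -(cvg_lim _ cI)//; under eq_fun do rewrite E /=.
  exact: lim_cst.
rewrite -(cvg_lim _ cR)//; under eq_fun do rewrite E /=.
apply: limr_ge; first by apply/cvg_ex; exists (Re (ip (rdop e mu x) x)); move: cR; under eq_fun do rewrite E.
by near=> N; apply: sumr_ge0 => n _; rewrite mulr_ge0 ?nsq_ge0.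
Unshelve. all: by end_near. Qed.

Lemma diag_pos X mu e : diag X mu e -> positive_op ip X.
Proof.
by move=> dX; rewrite (diagE dX); have [[oe _] m0 md _ _] := dX; apply: rdop_pos (rdop_bound m0 md).
Qed.

Lemma diag_compact X mu e : diag X mu e -> compact_op X.
Proof.
move=> dX; rewrite (diagE dX); have [[oe _] m0 md ml _] := dX.
apply: dop_compact => // d d0.
have /cvgrPdist_lt/(_ (Num.sqrt d) (ltac:(by rewrite sqrtr_gt0)))[N _ HN] := ml.
exists N => n Nn; rewrite nsqR; have := HN n Nn; rewrite /= sub0r normrN => H.
rewrite -(sqr_sqrtr (ltW d0)) -real_normK ?num_real// ltr_sqr ?nnegrE ?sqrtr_ge0//.
Qed.

Lemma diag_eig X mu e n : diag X mu e -> X (e n) = (mu n)%:C *: e n.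
Proof.
move=> dX; have [[oe ez] m0 md _ _] := dX; rewrite (diagE dX).
rewrite /rdop (dop_eig hilb oe oe (rdop_bound m0 md)).
by case: (oe) => _ /(_ n)[->|->]; rewrite ?mulr1// !scaler0.
Qed.

Lemma diag_null X mu e x : diag X mu e -> (forall n, ip x (e n) = 0) -> X x = 0.
Proof.
move=> dX H; have [[oe ez] m0 md _ _] := dX; rewrite (diagE dX).
by apply: dop_null (rdop_bound m0 md) _ H.
Qed.

Lemma diag_qf X mu e x : diag X mu e ->
  (fun N => \sum_(n < N) mu n * nsq (ip x (e n))) @ \oo --> qf X x.
Proof.
move=> dX; have [[oe ez] m0 md _ _] := dX; rewrite (diagE dX).
have [cR _] := dop_ip hilb oe oe (rdop_bound m0 md) x x.
apply: cvg_eq cR => N; rewrite Re_sum; apply: eq_bigr => n _.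
by rewrite (ipC ip (e n)) -mulrA -nsqE !cE /= mul0r subr0.
Qed.

(** Uniqueness of the positive square root. At [e n] with [mu n > 0], the difference [y] of the two
    roots satisfies [P y = - mu n y], which positivity allows only for [y = 0]. Then [z = P x - Q x]
    is orthogonal to all [e n], both roots vanish at [z], and symmetry gives [z = 0]. *)
Lemma diag_sq_uniq P Q mu e : positive_op ip P -> diag Q mu e -> P \o P = Q \o Q -> P = Q.
Proof.
move=> pP dQ PQ; have pQ := diag_pos dQ.
have PQE x : P (P x) = Q (Q x) by have := congr1 (@^~ x) PQ.
have [[lP _] _] := pP; have [[lQ _] _] := pQ.
have nullP x : P (P x) = 0 -> P x = 0.
  by move=> H; apply: (sq_eq0 (ip := ip)); rewrite /sqnorm (positive_sym pP) H ip0r.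
have eigP n : P (e n) = Q (e n).
  have [_ m0 _ _ _] := dQ; have Qe := diag_eig n dQ.
  have [mz|mz] := eqVneq (mu n) 0.
    by rewrite Qe mz scale0r; apply: nullP; rewrite PQE Qe mz scale0r lin0.
  have mp : 0 < mu n by rewrite lt_neqAle eq_sym mz m0.
  set y := P (e n) - Q (e n).
  have Py : P y = - (mu n)%:C *: y.
    rewrite /y (linB lP) PQE Qe (linZ lQ) (linZ lP) Qe scaleNr scalerBr opprB //.
  have : qf P y = - (mu n) * sq y by rewrite qf_ip Py ipZl sqE !cE /= mulr0 subr0.
  have := qf_ge0 y pP; have := sq_ge0 ip y; move=> s0 q0 E.
  have : sq y = 0 by nra.
  by move=> /sq_eq0/eqP; rewrite subr_eq0 => /eqP.
apply/funext => x; apply/eqP; rewrite -subr_eq0; apply/eqP.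
set z := P x - Q x.
have zo n : ip z (e n) = 0.
  by rewrite /z ipBl (positive_sym pP) (positive_sym pQ) eigP subrr.
have Qz : Q z = 0 := diag_null dQ zo.
have Pz : P z = 0 by apply: nullP; rewrite PQE Qz lin0.
apply: (sq_eq0 (ip := ip)); rewrite /sqnorm {1}/z ipBl (positive_sym pP) (positive_sym pQ).
by rewrite Pz Qz subrr.
Qed.

Lemma pos_adjoint X : positive_op ip X -> adjoint ip X = X.
Proof. by move=> pX; apply: adjointE => //; [case: pX | exact: positive_sym]. Qed.

(** Makes the choice in [op_abs] computable: any diagonalized square root is the chosen one. *)
Lemma op_abs_eq b P mu e : diag P mu e -> P \o P = adjoint ip b \o b -> op_abs ip b = P.
Proof.
move=> dP HP; have : [set Q | positive_op ip Q /\ Q \o Q = adjoint ip b \o b] (op_abs ip b).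
  by apply: xgetPex; exists P; split => //; exact: diag_pos dP.
by move=> [pQ HQ]; apply: diag_sq_uniq dP _ => //; rewrite HQ HP.
Qed.

Lemma op_abs_pos X mu e : diag X mu e -> op_abs ip X = X.
Proof.
by move=> dX; have H := pos_adjoint (diag_pos dX); apply: op_abs_eq dX _; rewrite H.
Qed.

Lemma adj_comp_pos b : bounded_op b -> positive_op ip (adjoint ip b \o b).
Proof.
move=> bb; split; first exact: bounded_comp (adjoint_bounded hilb bb) bb.
by move=> x /=; rewrite -adjointPr// sqE ler0c sq_ge0.
Qed.

Lemma op_abs_diag b : compact_op b -> exists mu e,
  diag (op_abs ip b) mu e /\ op_abs ip b \o op_abs ip b = adjoint ip b \o b.
Proof.
move=> cb; have bb := compact_bounded cb.
have cB : compact_op (adjoint ip b \o b) := compact_compl (adjoint_bounded hilb bb) cb.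
have [nu [e dB]] := diag_exists hilb cB (adj_comp_pos bb).
have [[oe ez] n0 nd nl _] := dB.
pose mu n := Num.sqrt (nu n).
have dP : diag (rdop e mu) mu e.
  apply: diag_rdop => //.
  - by move=> n /ez; rewrite /mu => ->; rewrite sqrtr0.
  - by move=> n; rewrite sqrtr_ge0.
  - by move=> m n mn; rewrite ler_wsqrtr// nd.
  - rewrite -(@sqrtr0 R); apply: continuous_cvg => //; exact: sqrt_continuous.
have PP : rdop e mu \o rdop e mu = adjoint ip b \o b.
  have [[_ _] p0 pd _ _] := dP; have [bP _] := diag_pos dP; have lP := bounded_lin bP.
  apply/funext => x; have [_ _ _ _ HB] := dB; apply: (hcv_uniq _ (HB x)) => /=.
  have [_ _ _ _ HP] := dP; have := bounded_hcv bP (HP x); congr hcv.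
  apply/funext => N /=; rewrite (lin_sum _ _ _ lP); apply: eq_bigr => n _.
  rewrite (linZ lP) (diag_eig n dP) scalerA; congr (_ *: _).
  by rewrite mulrAC -realM -expr2 sqr_sqrtr.
by exists mu, e; rewrite (op_abs_eq dP PP).
Qed.

(** With more vectors than generators, the coefficient matrix has a nonzero vector in its left
    kernel, that is, a linear relation. *)
Lemma lin_indep_le n m (v : 'I_n -> h) (w : 'I_m -> h) :
  (forall a : 'I_n -> R[i], \sum_i a i *: v i = 0 -> forall i, a i = 0) ->
  (forall i, exists a : 'I_m -> R[i], v i = \sum_j a j *: w j) -> (n <= m)%N.
Proof.
move=> vi /choice[a Ha]; rewrite leqNgt; apply/negP => mn.
pose A := \matrix_(i, j) a i j.
have /rowV0Pn[r rA r0] : kermx A != 0.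
  by rewrite kermx_eq0 /row_free neq_ltn (leq_ltn_trans (rank_leq_col _) mn).
have rA0 : r *m A = 0 by apply/sub_kermxP.
have r00 i : r ord0 i = 0.
  apply: (vi (fun i => r ord0 i)).
  rewrite (eq_bigr (fun i => \sum_j (r ord0 i * a i j) *: w j)); last first.
    by move=> i' _; rewrite Ha scaler_sumr; apply: eq_bigr => j _; rewrite scalerA.
  rewrite exchange_big/= big1// => j _; rewrite -scaler_suml.
  have E := congr1 (fun M : 'rV_m => M ord0 j) rA0; rewrite !mxE in E.
  suff -> : \sum_i r ord0 i * a i j = 0 by rewrite scale0r.
  by rewrite -[RHS]E; apply: eq_bigr => k _; rewrite mxE.
by move/eqP: r0; apply; apply/rowP => i; rewrite r00 mxE.
Qed.

Lemma has_dim_uniq (V : set h) n m : has_dim V n -> has_dim V m -> n = m.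
Proof.
move=> [v [vi VE]] [w [wi WE]]; apply/eqP; rewrite eqn_leq; apply/andP; split.
  apply: (lin_indep_le vi (w := w)) => i.
  suff : V (v i) by rewrite WE.
  rewrite VE; exists (fun j => (j == i)%:R).
  by rewrite (bigD1 i)//= eqxx scale1r big1 ?addr0// => j /negbTE ->; rewrite scale0r.
apply: (lin_indep_le wi (w := v)) => i.
suff : V (w i) by rewrite VE.
rewrite WE; exists (fun j => (j == i)%:R).
by rewrite (bigD1 i)//= eqxx scale1r big1 ?addr0// => j /negbTE ->; rewrite scale0r.
Qed.

(** For [t > 0] the eigenspace is spanned by the finitely many [e n] with [mu n = t], since by
    symmetry an eigenvector has no weighted component on the others. *)
Lemma diag_singular_seq b mu e : diag (op_abs ip b) mu e -> is_singular_seq ip b mu.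
Proof.
move=> dP; have [[oe ez] m0 md ml HP] := dP; split => // t t0.
have [N HN] : exists N, forall n, (N <= n)%N -> mu n < t.
  have /cvgrPdist_lt/(_ t t0)[N _ HN] := ml; exists N => n Nn.
  by have := HN n Nn; rewrite /= sub0r normrN ger0_norm.
have fA : finite_set [set n | mu n = t].
  apply: (@sub_finite_set _ _ `I_N); last exact: finite_II.
  by move=> n /= mn; rewrite ltnNge; apply/negP => /HN; rewrite mn ltxx.
pose s : seq nat := finmap.enum_fset (fset_set [set n | mu n = t]).
have us : uniq s := finmap.fset_uniq _.
have ms n : (n \in s) = (mu n == t).
  by rewrite in_fset_set//; apply/idP/eqP => [/set_mem//|H]; apply: mem_set.
exists (size s); split; last first.
  by have /finite_setP[k Hk] := fA; rewrite /s (card_fset_set Hk).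
have lts n : n \in s -> (n < N)%N.
  by rewrite ms => /eqP mn; rewrite ltnNge; apply/negP => /HN; rewrite mn ltxx.
pose g (i : 'I_(size s)) := nth 0%N s i.
have gs i : g i \in s by rewrite mem_nth.
have ginj : injective g.
  by move=> i j /eqP; rewrite nth_uniq// => /eqP ?; apply: val_inj.
have s1 n : n \in s -> sq (e n) = 1.
  rewrite ms => /eqP mn; case: (oe) => _ /(_ n)[//|/ez]; rewrite mn => tt.
  by move: t0; rewrite tt ltxx.
exists (fun i => e (g i)); split.
  move=> c H i; have := congr1 (ip ^~ (e (g i))) H; rewrite ip0l ip_suml (bigD1 i)//=.
  rewrite ipZl sqE s1// mulr1 big1 ?addr0// => j ji.
  by rewrite ipZl (proj1 oe) ?mulr0//; apply: contra ji => /eqP/ginj ->.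
have sumg (F : nat -> h) : \sum_(i < size s) F (g i) = \sum_(n <- s) F n.
  by rewrite [RHS](big_nth 0%N) big_mkord.
apply/seteqP; split => x /=; last first.
  move=> [c ->]; rewrite /Defs.eigenspace /= (lin_sum _ _ _ (bounded_lin (proj1 (diag_pos dP)))).
  rewrite scaler_sumr; apply: eq_bigr => i _.
  rewrite (linZ (bounded_lin (proj1 (diag_pos dP)))) (diag_eig _ dP) !scalerA mulrC.
  by have := gs i; rewrite ms => /eqP ->.
rewrite /Defs.eigenspace/= => Px.
have xn n : n \notin s -> (mu n)%:C * ip x (e n) = 0.
  rewrite ms => mt.
  have : ip (op_abs ip b x) (e n) = (mu n)%:C * ip x (e n).
    by rewrite (positive_sym (diag_pos dP)) (diag_eig _ dP) ipZr conjR.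
  rewrite Px ipZl => /eqP; rewrite -subr_eq0 -mulrBl mulf_eq0 => /orP[|/eqP ->].
    rewrite subr_eq0 => /eqP/complexI tm; by rewrite tm eqxx in mt.
  by rewrite mulr0.
exists (fun i => ip x (e (g i))).
rewrite (sumg (fun n => ip x (e n) *: e n)).
have : op_abs ip b x = t%:C *: \sum_(n <- s) ip x (e n) *: e n.
  apply: hcv_uniq (HP x) _ => d d0; exists N => n Nn.
  rewrite -(big_mkord xpredT (fun n => ((mu n)%:C * ip x (e n)) *: e n)).
  rewrite (bigID (mem s))/= [X in _ + X - _]big1 ?addr0; last by move=> k /xn ->; rewrite scale0r.
  rewrite -big_filter (perm_big s)/=.
    rewrite scaler_sumr big_seq [X in _ - X]big_seq.
    rewrite (eq_bigr (fun k => t%:C *: (ip x (e k) *: e k))) ?subrr ?hnorm0//.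
    by move=> k; rewrite ms => /eqP ->; rewrite scalerA.
  apply: uniq_perm => //; first by rewrite filter_uniq// iota_uniq.
  move=> k; rewrite mem_filter mem_index_iota /=; apply: andb_idr => /lts kN.
  exact: leq_trans kN Nn.
rewrite Px => /eqP; rewrite -subr_eq0 -scalerBr scaler_eq0 => /orP[/eqP/(congr1 Re)/= tt|].
  by move: t0; rewrite tt ltxx.
by rewrite subr_eq0 => /eqP.
Qed.

Lemma card_II_sub (A B : set nat) k : (A #= `I_k)%card -> (B #= `I_k)%card ->
  B `<=` A -> A `<=` B.
Proof.
move=> Ak Bk BA.
have fA : finite_set A by apply/finite_setP; exists k.
have fB : finite_set B by apply/finite_setP; exists k.
pose s (C : set nat) : seq nat := finmap.enum_fset (fset_set C).
have sBA : {subset s B <= s A}.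
  by move=> x; rewrite !in_fset_set// => /set_mem/BA/mem_set.
have sz : (size (s A) <= size (s B))%N by rewrite /s (card_fset_set Ak) (card_fset_set Bk).
have [_ H] := uniq_min_size (finmap.fset_uniq _) sBA sz.
by move=> x Ax; have := H x; rewrite !in_fset_set// (mem_set Ax) => /set_mem.
Qed.

(** If [nu n < mu n], the indices where [nu] takes the value [mu n] are all below [n], where the
    sequences agree. They are as many as the indices where [mu] takes that value, both numbers being
    the dimension of one eigenspace, so they cannot miss [n]. *)
Lemma singular_seq_le b mu nu : is_singular_seq ip b mu -> is_singular_seq ip b nu ->
  forall n, (forall k, (k < n)%N -> mu k = nu k) -> mu n <= nu n.
Proof.
move=> [md m0 mt] [nd n0 nt] n H; rewrite leNgt; apply/negP => lt.
have t0 : 0 < mu n by exact: le_lt_trans (n0 n) lt.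
have [k [dk ck]] := mt _ t0; have [j [dj cj]] := nt _ t0.
rewrite -(has_dim_uniq dk dj) in cj.
have BA : [set k | nu k = mu n] `<=` [set k | mu k = mu n].
  move=> i /= ni; have [ltin|lein] := ltnP i n; first by rewrite H.
  by have := nd _ _ lein; rewrite ni leNgt lt.
have := card_II_sub ck cj BA (erefl (mu n)); move=> /= E.
by move: lt; rewrite E ltxx.
Qed.

Lemma singular_seq_uniq b mu nu : is_singular_seq ip b mu -> is_singular_seq ip b nu -> mu = nu.
Proof.
move=> Hm Hn; apply/funext => n; elim/ltn_ind: n => n IH; apply/eqP.
rewrite eq_le (singular_seq_le Hm Hn)//=; apply: (singular_seq_le Hn Hm) => k kn.
by rewrite IH.
Qed.

Lemma singular_value_diag b mu e : diag (op_abs ip b) mu e -> singular_value ip b = mu.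
Proof.
move=> /diag_singular_seq Hm; apply: (singular_seq_uniq _ Hm).
by apply: (@xgetPex _ _ (is_singular_seq ip b)); exists mu.
Qed.

Lemma singular_value_pos X mu e : diag X mu e -> singular_value ip X = mu.
Proof. by move=> dX; apply: (@singular_value_diag _ _ e); rewrite (op_abs_pos dX). Qed.

End SingularValues.

(** * Ky Fan inequalities for sums of eigenvalues *)

Section KyFan.
Context (R : realType) (h : completeNormedModType R[i])
        (ip : {dot h for Num.conj}) (hilb : is_hilbert ip).
Implicit Types (x y z : h) (c : R[i]) (b K X Y P Q W : h -> h).
Implicit Types (mu nu ka : nat -> R) (e f g u w : nat -> h).
Local Notation Re := (@complex.Re R).
Local Notation Im := (@complex.Im R).
Local Notation sq := (sqnorm ip).
Local Notation qf := (qform ip).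
Local Notation diag := (diagonal ip).

Lemma nsq_ipC x y : nsq (ip x y) = nsq (ip y x).
Proof. by rewrite ipC nsqJ. Qed.

(** Eigenvalues of index at least [n] are replaced by [mu n], and Bessel bounds the total mass; the
    remaining coefficients [mu k - mu n] are nonnegative. *)
Lemma diag_qf_le X mu e n x : diag X mu e ->
  qf X x <= \sum_(k < n) (mu k - mu n) * nsq (ip x (e k)) + mu n * sq x.
Proof.
move=> dX; have [[oe _] m0 md _ _] := dX.
have := diag_qf (x := x) hilb dX => cq.
rewrite -(cvg_lim _ cq)//; apply: limr_le; first by apply/cvg_ex; exists (qf X x).
exists n => // N /= nN.
rewrite -!(big_mkord xpredT (fun k => mu k * nsq (ip x (e k)))).
rewrite (big_cat_nat (m := 0%N) (n := n) (p := N))//=.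
have H1 : \sum_(n <= k < N) mu k * nsq (ip x (e k)) <= mu n * \sum_(n <= k < N) nsq (ip x (e k)).
  rewrite mulr_sumr big_nat_cond [leRHS]big_nat_cond; apply: ler_sum => k /andP[/andP[nk _] _].
  by rewrite ler_wpM2r ?nsq_ge0// md.
have H2 : \sum_(0 <= k < n) nsq (ip x (e k)) + \sum_(n <= k < N) nsq (ip x (e k)) <= sq x.
  by rewrite -big_cat_nat//= big_mkord; exact: osys_bessel.
have -> : \sum_(k < n) (mu k - mu n) * nsq (ip x (e k)) =
  \sum_(0 <= k < n) mu k * nsq (ip x (e k)) - mu n * \sum_(0 <= k < n) nsq (ip x (e k)).
  rewrite mulr_sumr !big_mkord -sumrB; apply: eq_bigr => k _; ring.
have := m0 n; nra.
Qed.

(** Weaker than orthonormality, and preserved by adjoints of contractions, as [sig_conj]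
    requires. *)
Definition bessel N u := forall x, \sum_(k < N) nsq (ip x (u k)) <= sq x.

Lemma osys_besselN e N : osys ip e -> bessel N e.
Proof. by move=> oe x; exact: osys_bessel. Qed.

Lemma bessel_sq N u k : bessel N u -> (k < N)%N -> sq (u k) <= 1.
Proof.
move=> bu kN; have := bu (u k); rewrite (bigD1 (Ordinal kN))//= => H.
have : nsq (ip (u k) (u k)) <= sq (u k).
  apply: le_trans H; rewrite lerDl; apply: sumr_ge0 => i _; exact: nsq_ge0.
rewrite sqE nsqR; have := sq_ge0 ip (u k); nra.
Qed.

Definition sig mu N : R := \sum_(k < N) mu k.

Lemma sig_mono mu m n : (forall k, 0 <= mu k) -> (m <= n)%N -> sig mu m <= sig mu n.
Proof.
move=> m0 /subnKC <-; rewrite /sig -!(big_mkord xpredT mu) [leRHS](big_cat_nat (m := 0%N) (n := m))//= ?leq_addr//.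
by rewrite lerDl sumr_ge0.
Qed.

(** Ky Fan's maximum principle. Summing [diag_qf_le] over [k], the Bessel property of [u] at [e j]
    lets each [mu j - mu N] count at most once, and [sq (u k) <= 1] bounds the rest by
    [mu N * N]. *)
Theorem kyfan_le X mu e N u : diag X mu e -> bessel N u ->
  \sum_(k < N) qf X (u k) <= sig mu N.
Proof.
move=> dX bu; have [[oe _] m0 md _ _] := dX.
apply: (@le_trans _ _ (\sum_(k < N) (\sum_(j < N) (mu j - mu N) * nsq (ip (u k) (e j)) + mu N * sq (u k)))).
  by apply: ler_sum => k _; exact: diag_qf_le.
rewrite big_split/= exchange_big/= -mulr_sumr.
have -> : sig mu N = \sum_(j < N) (mu j - mu N) + mu N * N%:R.
  by rewrite sumrB sumr_const card_ord -mulr_natr /sig; ring.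
apply: lerD.
  apply: ler_sum => j _; rewrite -mulr_sumr ler_piMr ?subr_ge0 ?md ?(ltnW (ltn_ord j))//.
  under eq_bigr do rewrite nsq_ipC.
  by apply: le_trans (bu _) _; exact: osys_le1.
rewrite ler_wpM2l//; apply: (@le_trans _ _ (\sum_(k < N) 1)).
  by apply: ler_sum => k _; exact: bessel_sq bu (ltn_ord k).
by rewrite sumr_const card_ord.
Qed.

Lemma kyfan_eq X mu e N : diag X mu e -> \sum_(k < N) qf X (e k) = sig mu N.
Proof.
move=> dX; apply: eq_bigr => k _; have [[[_ oe] ez] _ _ _ _] := dX.
rewrite qf_ip (diag_eig hilb _ dX) ipZl sqE !cE /= mulr0 subr0.
by case: (oe k) => [->|E]; rewrite ?mulr1// (ez _ E) mul0r.
Qed.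

Lemma qfD X Y x : qf (X \+ Y) x = qf X x + qf Y x.
Proof. by rewrite !qf_ip /= ipDl cE. Qed.

(** The maximum principle for each summand, tested at the eigenvectors of the sum. *)
Lemma sig_subadd X Y mu nu ka e f g N : diag X mu e -> diag Y nu f ->
  diag (X \+ Y) ka g -> sig ka N <= sig mu N + sig nu N.
Proof.
move=> dX dY dZ; rewrite -(kyfan_eq N dZ).
under eq_bigr do rewrite qfD; rewrite big_split/=.
have [[og _] _ _ _ _] := dZ; have bg := osys_besselN N og.
by apply: lerD; apply: kyfan_le bg; eassumption.
Qed.

(** A vector depending on those already treated contributes a zero vector, so the system keeps the
    length of the list. *)
Lemma gram_schmidt (l : seq h) : exists w, osys ip w /\
  (forall j, (size l <= j)%N -> w j = 0) /\
  (forall x, x \in l -> x = \sum_(j < size l) ip x (w j) *: w j).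
Proof.
elim: l => [|x l [w [ow [w0 wl]]]].
  exists (fun=> 0); split; last by split.
  by split => [i j _|i]; [rewrite ip0l|right].
set m := size l in w0 wl *.
pose y := x - \sum_(j < m) ip x (w j) *: w j.
pose v := if y == 0 then 0 else (Num.sqrt (sq y))^-1%:C *: y.
have v01 : sq v = 1 \/ v = 0.
  rewrite /v; case: eqVneq => [_|/(sq_gt0 ip) y0]; [by right|left].
  by rewrite sqZ nsqR exprVn sqr_sqrtr ?sq_ge0// mulVf ?gt_eqF.
have yE : y = ip y v *: v.
  rewrite /v; case: eqVneq => [->|/(sq_gt0 ip) y0]; first by rewrite scaler0.
  rewrite ipZr sqE scalerA conjR mulrAC -realM -realM -expr2 exprVn sqr_sqrtr ?sq_ge0//.
  by rewrite mulVf ?gt_eqF// scale1r.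
have yw j : (j < m)%N -> ip y (w j) = 0.
  move=> jm; rewrite /y ipBl (ip_sum_osys (fun j => ip x (w j)) ow jm).
  by case: (ow) => _ /(_ j)[->|->]; rewrite ?mulr1 ?subrr// !ip0r mul0r subrr.
have vw j : (j < m)%N -> ip v (w j) = 0.
  by move=> jm; rewrite /v; case: eqP => _; rewrite ?ip0l// ipZl yw ?mulr0.
pose w' j := if j == m then v else w j.
have w'w (j : 'I_m) : w' j = w j by rewrite /w' ltn_eqF.
have w'm : w' m = v by rewrite /w' eqxx.
have ow' : osys ip w'.
  split; last by move=> i; rewrite /w'; case: eqP => // _; case: ow.
  have vwall j : j != m -> ip v (w j) = 0.
    by move=> jm; have [/vw//|mj] := ltnP j m; rewrite w0// ip0r.
  move=> i j; rewrite /w'; case: ifP => [/eqP ->|/negbT im]; case: ifP => [/eqP ->|/negbT jm].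
  - by rewrite eqxx.
  - by move=> _; exact: vwall.
  - by move=> _; rewrite ipC vwall// cj0.
  - by case: ow => ow _; exact: ow.
exists w'; split => //; split => [j|z] /=.
  by move=> mj; rewrite /w' gtn_eqF// w0// ltnW.
have vx : ip y v = ip x v.
  rewrite /y ipBl ip_suml big1 ?subr0// => j _.
  by rewrite ipZl (ipC ip (w j)) vw// cj0 mulr0.
rewrite big_ord_recr/= w'm; under eq_bigr do rewrite w'w.
rewrite inE => /orP[/eqP ->|zl].
  by rewrite -vx -yE /y addrC subrK.
suff E : ip z v = 0 by rewrite E scale0r addr0; exact: wl.
rewrite {1}(wl z zl) ip_suml big1// => j _.
by rewrite ipZl (ipC ip (w j)) vw// cj0 mulr0.
Qed.

(** Both families lie in the span of [w], so [z] and its projection on that span have the same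
    coefficients; Bessel is applied to the projection. *)
Lemma gram_schmidt_bessel e f N : osys ip e -> osys ip f ->
  exists2 w, bessel (N + N) w & forall z,
   \sum_(k < N) nsq (ip z (e k)) <= \sum_(j < N + N) nsq (ip z (w j)) /\
   \sum_(k < N) nsq (ip z (f k)) <= \sum_(j < N + N) nsq (ip z (w j)).
Proof.
move=> oe of_; have [w [ow [_ wl]]] := gram_schmidt (mkseq e N ++ mkseq f N).
rewrite size_cat !size_mkseq in wl.
exists w; first exact: osys_besselN.
have main u z : osys ip u -> (forall k, (k < N)%N -> u k = \sum_(j < N + N) ip (u k) (w j) *: w j) ->
    \sum_(k < N) nsq (ip z (u k)) <= \sum_(j < N + N) nsq (ip z (w j)).
  move=> ou uw; pose pz := \sum_(j < N + N) ip z (w j) *: w j.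
  have E k : (k < N)%N -> ip z (u k) = ip pz (u k).
    move=> kN; rewrite (uw k kN) !ip_sumr; apply: eq_bigr => j _; rewrite !ipZr.
    rewrite /pz (ip_sum_osys (fun j => ip z (w j)) ow (ltn_ord j)).
    by case: (ow) => _ /(_ j)[->|->]; rewrite ?mulr1// !ip0r mul0r.
  rewrite (eq_bigr (fun k : 'I_N => nsq (ip pz (u k)))); last by move=> k _; rewrite E.
  apply: le_trans (osys_bessel pz N ou) _.
  rewrite /pz -(big_mkord xpredT (fun j => ip z (w j) *: w j)).
  rewrite sq_sum_ortho ?iota_uniq//; last by move=> i j _ _; case: ow => H _; exact: H.
  rewrite big_mkord; apply: ler_sum => j _.
  by rewrite ler_piMr ?nsq_ge0// osys_le1.
move=> z; split; apply: main => // k kN; apply: wl; rewrite mem_cat; apply/orP; [left|right];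
  by apply/mapP; exists k => //; rewrite mem_iota.
Qed.

(** The hypothesis compares two sums of rank-one projections as operators. Expanding the forms in
    the eigenbasis of [X], it is used at each [z = e i]. *)
Lemma qf_bessel_mono X mu e N M u w : diag X mu e ->
  (forall z, \sum_(k < N) nsq (ip z (u k)) <= \sum_(j < M) nsq (ip z (w j))) ->
  \sum_(k < N) qf X (u k) <= \sum_(j < M) qf X (w j).
Proof.
move=> dX H; have [_ m0 _ _ _] := dX.
have cU (k0 : nat) (v : nat -> h) : (fun n => \sum_(k < k0) \sum_(i < n) mu i * nsq (ip (v k) (e i))) @ \oo -->
    \sum_(k < k0) qf X (v k).
  elim: k0 => [|k0 IH].
    by rewrite big_ord0; apply: cvg_eq (cvg_cst _) => n; rewrite big_ord0.
  rewrite big_ord_recr/=; apply: cvg_eq (cvgD IH (diag_qf (x := v k0) hilb dX)) => n.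
  by rewrite big_ord_recr.
rewrite -(cvg_lim _ (cU N u))// -(cvg_lim _ (cU M w))//.
apply: ler_lim; [by apply/cvg_ex; eexists; exact: cU|by apply/cvg_ex; eexists; exact: cU|].
near=> n; rewrite exchange_big [leRHS]exchange_big/=; apply: ler_sum => i _.
rewrite -!mulr_sumr ler_wpM2l//.
under eq_bigr do rewrite nsq_ipC; under [leRHS]eq_bigr do rewrite nsq_ipC; exact: H.
Unshelve. all: by end_near. Qed.

(** The [N] top eigenvectors of each summand lie in a common space of dimension at most [N + N], on
    which the sum is tested. *)
Lemma sig_superadd X Y mu nu ka e f g N : diag X mu e -> diag Y nu f ->
  diag (X \+ Y) ka g -> sig mu N + sig nu N <= sig ka (N + N).
Proof.
move=> dX dY dZ; rewrite -(kyfan_eq N dX) -(kyfan_eq N dY).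
have [[oe _] _ _ _ _] := dX; have [[of_ _] _ _ _ _] := dY.
have [w bw H] := gram_schmidt_bessel N oe of_.
apply: le_trans (kyfan_le dZ bw); under [leRHS]eq_bigr do rewrite qfD.
rewrite big_split/=; apply: lerD.
  by apply: qf_bessel_mono dX _ => z; case: (H z).
by apply: qf_bessel_mono dY _ => z; case: (H z).
Qed.

(** The adjoint of [W], divided by [C], sends the eigenvectors [f k] to a family satisfying Bessel,
    and the maximum principle for [X] applies to it. *)
Lemma sig_conj X W mu nu e f C N : diag X mu e -> bounded_op W -> 0 < C ->
  bounded_by W C -> diag (W \o X \o adjoint ip W) nu f -> sig nu N <= C ^+ 2 * sig mu N.
Proof.
move=> dX bW C0 WC dY; rewrite -(kyfan_eq N dY).
pose u k := C^-1%:C *: adjoint ip W (f k).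
have [[of_ _] _ _ _ _] := dY.
have lX := bounded_lin (proj1 (diag_pos hilb dX)).
have -> : \sum_(k < N) qf (W \o X \o adjoint ip W) (f k) = C ^+ 2 * \sum_(k < N) qf X (u k).
  rewrite mulr_sumr; apply: eq_bigr => k _; rewrite !qf_ip /= /u (linZ lX) ipZl ipZr conjR adjointP//.
  by rewrite !cE /=; field; rewrite gt_eqF.
rewrite ler_wpM2l ?sqr_ge0//; apply: kyfan_le dX _ => x.
rewrite (eq_bigr (fun k : 'I_N => C^-1 ^+ 2 * nsq (ip (W x) (f k)))); last first.
  by move=> k _; rewrite /u ipZr conjR nsqM nsqR -adjointP.
rewrite -mulr_sumr; apply: (@le_trans _ _ (C^-1 ^+ 2 * sq (W x))).
  by rewrite ler_wpM2l ?sqr_ge0// osys_bessel.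
rewrite exprVn ler_pdivrMl ?exprn_gt0//.
exact: bounded_by_sq (ltW C0) WC x.
Qed.

(** The images [W (e k)] divided by the square roots of [mu k] are orthonormal and serve as test
    vectors for the other product. Applied to [W] and to its adjoint, it shows that both products
    have the same sums of eigenvalues. *)
Lemma sig_star W mu nu e f N : bounded_op W -> diag (adjoint ip W \o W) mu e ->
  diag (W \o adjoint ip W) nu f -> sig mu N <= sig nu N.
Proof.
move=> bW dX dY; have [[oe ez] m0 _ _ _] := dX; have lW := bounded_lin bW.
pose u k := (Num.sqrt (mu k))^-1%:C *: W (e k).
have WW k j : ip (W (e k)) (W (e j)) = (mu k)%:C * ip (e k) (e j).
  by have := diag_eig hilb k dX => /(congr1 (ip ^~ (e j))) /=; rewrite ipZl -adjointPr// => <-.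
have ou : osys ip u.
  split; first by move=> i j ij; rewrite /u ipZl ipZr WW (proj1 oe)// !mulr0.
  move=> i; have [mi|mi] := eqVneq (mu i) 0.
    by right; rewrite /u mi sqrtr0 invr0 scale0r.
  left; rewrite /u sqZ nsqR exprVn sqr_sqrtr//.
  have -> : sq (W (e i)) = mu i * sq (e i).
    by rewrite /sqnorm WW sqE !cE /= mulr0 subr0.
  case: (oe) => _ /(_ i)[->|/ez m]; first by rewrite mulr1 mulVf.
  by rewrite m eqxx in mi.
rewrite -[leLHS]addr0; apply: le_trans (kyfan_le dY (osys_besselN N ou)).
rewrite addr0; apply: ler_sum => k _.
have [mk|mk] := eqVneq (mu k) 0; first by rewrite mk; apply: qf_ge0; exact: diag_pos dY.
have mp : 0 < mu k by rewrite lt_neqAle eq_sym mk m0.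
have lA := bounded_lin (adjoint_bounded hilb bW).
have AW : adjoint ip W (W (e k)) = (mu k)%:C *: e k := diag_eig hilb k dX.
have sk : sq (e k) = 1.
  by case: (oe) => _ /(_ k)[//|/ez m]; rewrite m eqxx in mk.
rewrite qf_ip /= adjointP// -/(sqnorm ip _) /u (linZ lA) AW scalerA sqZ sk -realM nsqR.
by rewrite mulr1 exprMn exprVn sqr_sqrtr// expr2 mulKf.
Qed.
End KyFan.

(** * Limits of sequences along a Dixmier ultrafilter *)

Section Ultrafilter.
Context (R : realType).
Implicit Types (f g : R -> R) (u v : nat -> R) (t s : R).

Lemma ae_above t (P : R -> Prop) : (forall x, t < x -> P x) ->
  {ae lebesgue_above t, forall x, P x}.
Proof.
move=> HP; exists `]-oo, t]%classic; split.
- exact: measurable_itv.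
- rewrite /lebesgue_above /mrestr (_ : _ `&` _ = set0) ?measure0//.
  apply/seteqP; split => // x [] /=; rewrite !in_itv/= andbT => xt tx.
  by have := le_lt_trans xt tx; rewrite ltxx.
- move=> x /= nP; rewrite in_itv/= leNgt; apply/negP => tx; exact/nP/HP.
Qed.

Lemma measurable_trunc u s : 0 < s ->
  measurable_fun (`]0, +oo[ : set R) (fun t => u (Num.truncn (s * t))).
Proof.
move=> s0 mD B mB.
rewrite (_ : _ `&` _ = \bigcup_(n in [set n | B (u n)])
    (`]0, +oo[ `&` `[n%:R / s, n.+1%:R / s[)).
  by apply: bigcup_measurable => n _; apply: measurableI.
apply/seteqP; split => x /=.
  move=> [xD Bx]; exists (Num.truncn (s * x)) => //; split => //=.
  move: xD; rewrite /= !in_itv/= andbT => x0.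
  have /truncn_itv/andP[h1 h2] : 0 <= s * x by rewrite mulr_ge0 ?ltW.
  by rewrite ler_pdivrMr// ltr_pdivlMr// ![x * s]mulrC h1.
move=> [n /= Bn [xD]]; rewrite /= in_itv/= ler_pdivrMr// ltr_pdivlMr// ![x * s]mulrC => H.
by split => //; rewrite (truncn_def H).
Qed.

Definition bseq u := exists C, forall n, `|u n| <= C.

Lemma Linfty_trunc u s : 0 < s -> bseq u -> Linfty (fun t => u (Num.truncn (s * t))).
Proof.
move=> s0 [C HC]; split; first exact: measurable_trunc.
apply: (@le_lt_trans _ _ C%:E); last by rewrite ltry.
by apply/ess_supP; apply: ae_above => x _; rewrite lee_fin.
Qed.

Lemma Linfty_trunc1 u : bseq u -> Linfty (fun t => u (Num.truncn t)).
Proof.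
move=> bu; have := Linfty_trunc ltr01 bu.
by rewrite (_ : (fun t => _) = (fun t => u (Num.truncn t))) //; apply/funext => t; rewrite mul1r.
Qed.

Lemma bseq_cvg u (l : R) : u @ \oo --> l -> bseq u.
Proof.
move=> ul; have /cvg_seq_bounded[M [_ /(_ (M + 1))]] : cvgn u by apply/cvg_ex; exists l.
by rewrite ltrDl ltr01 => /(_ erefl) H; exists (M + 1) => n; exact: H.
Qed.

Context (w : (R -> R) -> R) (hw : dixmier_ultrafilter w).

Lemma w_lin c f g : Linfty f -> Linfty g -> w ((c \*: f) \+ g) = c * w f + w g.
Proof. by have [[_ H _ _] _] := hw; exact: H. Qed.

Lemma w_ge0 f : Linfty f -> (forall t, 0 < t -> 0 <= f t) -> 0 <= w f.
Proof. by move=> Lf f0; have [[_ _ H _] _] := hw; apply: H => //; exact: ae_above. Qed.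

Lemma w_le f g : Linfty f -> Linfty g -> Linfty ((-1 \*: f) \+ g) ->
  (forall t, 0 < t -> f t <= g t) -> w f <= w g.
Proof.
move=> Lf Lg Lfg H; have := w_lin (-1) Lf Lg; rewrite mulN1r => E.
rewrite -subr_ge0 addrC -E; apply: w_ge0 => // t t0 /=.
by rewrite scaleN1r addrC subr_ge0 H.
Qed.

Lemma bseqD u v : bseq u -> bseq v -> bseq (fun n => u n + v n).
Proof.
move=> [C HC] [D HD]; exists (C + D) => n.
by rewrite (le_trans (ler_normD _ _))// lerD.
Qed.
Lemma bseqZ c u : bseq u -> bseq (fun n => c * u n).
Proof.
by move=> [C HC]; exists (`|c| * C) => n; rewrite normrM ler_wpM2l.
Qed.

Lemma seq_limitD u v : bseq u -> bseq v ->
  seq_limit w (fun n => u n + v n) = seq_limit w u + seq_limit w v.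
Proof.
move=> bu bv; rewrite /seq_limit -[w (fun t => u _)]mul1r -w_lin; [|exact: Linfty_trunc1..].
by congr w; apply/funext => t /=; rewrite scale1r.
Qed.

Lemma seq_limit0 : seq_limit w (fun=> 0) = 0.
Proof.
have b0 : bseq (fun=> 0) by exists 0 => n; rewrite normr0.
have := seq_limitD b0 b0; rewrite (_ : (fun n => 0 + 0) = fun=> 0); last by apply/funext => n; rewrite addr0.
by move/eqP; rewrite -{1}[seq_limit _ _]addr0 (inj_eq (addrI _)) => /eqP <-.
Qed.

Lemma seq_limitZ c u : bseq u -> seq_limit w (fun n => c * u n) = c * seq_limit w u.
Proof.
move=> bu; have b0 : bseq (fun=> 0) by exists 0 => n; rewrite normr0.
have := @w_lin c (fun t => u (Num.truncn t)) (fun=> 0) (Linfty_trunc1 bu) (Linfty_trunc1 b0).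
rewrite -/(seq_limit w u) -[w (fun=> 0)]/(seq_limit w (fun=> 0)) seq_limit0 addr0 => <-.
by congr w; apply/funext => t /=; rewrite addr0.
Qed.

Lemma seq_limit_le u v : bseq u -> bseq v -> (forall n, u n <= v n) ->
  seq_limit w u <= seq_limit w v.
Proof.
move=> bu bv uv; apply: w_le => [| | |t _]; [exact: Linfty_trunc1..| |exact: uv].
have := Linfty_trunc1 (bseqD (bseqZ (-1) bu) bv); congr Linfty.
Qed.

(** The limit lies between the essential lower and upper limits, both estimated beyond the index
    from which [u] is close to [l]. *)
Lemma seq_limit_cvg u (l : R) : u @ \oo --> l -> seq_limit w u = l.
Proof.
move=> ul; have bu := bseq_cvg ul; have Lu := Linfty_trunc1 bu.
have [_ [/(_ _ Lu)/andP[H1 H2] _ _ _]] := hw.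
apply/eqP; rewrite eq_le; apply/andP; split; apply/ler_addgt0Pr => e e0.
  have /cvgrPdist_le/(_ e e0)[N _ HN] := ul.
  rewrite -lee_fin; apply: le_trans H2 _; apply: ge_ereal_inf.
  exists (ess_sup (lebesgue_above N%:R) (EFin \o (fun t => u (Num.truncn t)))); first by exists N%:R.
  apply/ess_supP; apply: ae_above => x Nx; rewrite /= lee_fin.
  have : (N <= Num.truncn x)%N by rewrite truncn_ge_nat ?(ltW Nx)// (le_trans _ (ltW Nx)).
  by move=> /HN /=; rewrite ler_norml => /andP[? ?]; lra.
have /cvgrPdist_le/(_ e e0)[N _ HN] := ul.
rewrite -lerBlDr -lee_fin; apply: le_trans _ H1; apply: le_ereal_sup_tmp.
exists (ess_inf (lebesgue_above N%:R) (EFin \o (fun t => u (Num.truncn t)))); first by exists N%:R.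
apply/ess_infP; apply: ae_above => x Nx; rewrite /= lee_fin.
have : (N <= Num.truncn x)%N by rewrite truncn_ge_nat ?(ltW Nx)// (le_trans _ (ltW Nx)).
by move=> /HN /=; rewrite ler_norml => /andP[? ?]; lra.
Qed.

(** Dilation invariance allows comparing [u] at the integer part of [t] with [v] at the integer part
    of [2 * t]. *)
Lemma seq_limit_double u v : bseq u -> bseq v ->
  (forall t, 0 < t -> u (Num.truncn t) <= v (Num.truncn (2 * t))) ->
  seq_limit w u <= seq_limit w v.
Proof.
move=> bu bv uv; have Lv := Linfty_trunc1 bv.
have [_ [_ H _ _]] := hw; have := H _ 2 Lv (ltr0n _ 2); rewrite -/(seq_limit w v) => <-.
apply: w_le => //; [exact: Linfty_trunc1 | exact: Linfty_trunc |].
have [C HC] := bu; have [D HD] := bv; split.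
  apply: measurable_funD; last exact: measurable_trunc.
  apply: measurable_funM; first exact: measurable_cst.
  rewrite (_ : (fun t => u (Num.truncn t)) = fun t => u (Num.truncn (1 * t))); first exact: measurable_trunc.
  by apply/funext => t; rewrite mul1r.
apply: (@le_lt_trans _ _ (C + D)%:E); last by rewrite ltry.
apply/ess_supP; apply: ae_above => x _; rewrite lee_fin /= scaleN1r.
by rewrite (le_trans (ler_normD _ _))// normrN lerD.
Qed.

Lemma seq_limit_diff u v (l : R) : bseq v -> (fun n => u n - v n) @ \oo --> l ->
  bseq u /\ seq_limit w u = seq_limit w v + l.
Proof.
move=> bv cl; have bd := bseq_cvg cl.
have E : u = fun n => v n + (u n - v n) by apply/funext => n; rewrite addrC subrK.
split; first by rewrite E; exact: bseqD.
by rewrite {1}E seq_limitD// (seq_limit_cvg cl).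
Qed.

End Ultrafilter.

(** * Additivity of the Dixmier trace on positive operators *)

Section DixmierTrace.
Context (R : realType) (h : completeNormedModType R[i])
        (ip : {dot h for Num.conj}) (hilb : is_hilbert ip).
Context (w : (R -> R) -> R) (hw : dixmier_ultrafilter w).
Implicit Types (x y z : h) (c : R[i]) (b K X Y P Q W V : h -> h).
Implicit Types (mu nu ka : nat -> R) (e f g : nat -> h) (u v : R[i]).
Local Notation Re := (@complex.Re R).
Local Notation Im := (@complex.Im R).
Local Notation sq := (sqnorm ip).
Local Notation qf := (qform ip).
Local Notation diag := (diagonal ip).
Local Notation lm := (log_mean_sv ip).

Definition pos_macaev X := positive_op ip X /\ dual_macaev ip X.
Definition dix_trace X := seq_limit w (lm X).

Lemma lnN_ge0 (N : nat) : 0 <= ln (N%:R : R).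
Proof. by case: N => [|N]; [rewrite ln0 | rewrite ln_ge0// ler1n]. Qed.

Lemma lnN_small (N : nat) : (N < 2)%N -> ln (N%:R : R) = 0.
Proof. by case: N => [|[|]]// _; [exact: ln0 | exact: ln1]. Qed.

Lemma lm_small b N : (N < 2)%N -> lm b N = 0.
Proof. by move=> N2; rewrite /log_mean_sv lnN_small// invr0 mulr0. Qed.

Lemma cvg_lnV (c : R) : (fun n => c / ln (n%:R : R)) @ \oo --> (0 : R).
Proof.
apply/cvgrPdist_lt => d d0.
pose K := (`|c| + 1) / d; have K0 : 0 < K by rewrite divr_gt0// ltr_wpDl.
exists (Num.truncn (expR K)).+1 => // n /= nK.
have n0 : expR K < n%:R by apply: lt_le_trans (truncnS_gt _) _; rewrite ler_nat.
have lnn : K < ln (n%:R : R).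
  by rewrite -(expRK K) ltr_ln ?posrE ?expR_gt0// (lt_trans (expR_gt0 K)).
rewrite sub0r normrN normrM normfV [`|ln _|]ger0_norm ?lnN_ge0//.
rewrite ltr_pdivrMr ?(lt_trans K0)//.
apply: (@lt_le_trans _ _ (d * K)); last by rewrite ler_pM2l// ltW.
by rewrite /K mulrC divfK ?gt_eqF// ltrDl.
Qed.

Lemma Mp_diag X : pos_macaev X -> exists mu e, diag X mu e.
Proof. by move=> [pX [cX _]]; exact: diag_exists. Qed.

Lemma lm_diag X mu e N : diag X mu e -> lm X N = sig mu N / ln N%:R.
Proof. by move=> dX; rewrite /log_mean_sv (singular_value_pos hilb dX). Qed.

Lemma sig_ge0 mu N : (forall n, 0 <= mu n) -> 0 <= sig mu N.
Proof. by move=> m0; exact: sumr_ge0. Qed.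

Lemma lm_ge0 X N : pos_macaev X -> 0 <= lm X N.
Proof.
move=> /Mp_diag[mu [e dX]]; rewrite (lm_diag _ dX); have [_ m0 _ _ _] := dX.
by rewrite divr_ge0 ?sig_ge0 ?lnN_ge0.
Qed.

Lemma Mp_bound X : pos_macaev X -> exists2 C, 0 <= C & forall N, lm X N <= C.
Proof.
move=> MX; have [_ [_ [C HC]]] := MX; exists `|C| => // N.
have [N2|N2] := leqP 2 N; first by rewrite (le_trans (HC N N2))// ler_norm.
by rewrite lm_small.
Qed.

Lemma lm_bseq X : pos_macaev X -> bseq (lm X).
Proof.
move=> MX; have [C _ HC] := Mp_bound MX; exists C => N.
by rewrite ger0_norm ?lm_ge0.
Qed.

Lemma MpI X mu e (C : R) : diag X mu e -> (forall N, (2 <= N)%N -> sig mu N / ln N%:R <= C) -> pos_macaev X.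
Proof.
move=> dX H; split; first exact (diag_pos hilb dX).
split; first exact (diag_compact hilb dX).
by exists C => N N2; rewrite (lm_diag _ dX) H.
Qed.

Lemma positiveD X Y : positive_op ip X -> positive_op ip Y -> positive_op ip (X \+ Y).
Proof.
move=> [bX pX] [bY pY]; split; first exact: boundedD.
by move=> x /=; rewrite ipDl addr_ge0.
Qed.

Lemma diagD X Y : pos_macaev X -> pos_macaev Y -> exists mu nu ka e f g,
  [/\ diag X mu e, diag Y nu f & diag (X \+ Y) ka g].
Proof.
move=> MX MY; have [mu [e dX]] := Mp_diag MX; have [nu [f dY]] := Mp_diag MY.
have [ka [g dZ]] := diag_exists hilb (compactD MX.2.1 MY.2.1) (positiveD MX.1 MY.1).
by exists mu, nu, ka, e, f, g.
Qed.

Lemma lm_subadd X Y N : pos_macaev X -> pos_macaev Y -> lm (X \+ Y) N <= lm X N + lm Y N.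
Proof.
move=> MX MY; have [mu [nu [ka [e [f [g [dX dY dZ]]]]]]] := diagD MX MY.
rewrite (lm_diag _ dX) (lm_diag _ dY) (lm_diag _ dZ) -mulrDl.
by rewrite ler_wpM2r ?invr_ge0 ?lnN_ge0// (sig_subadd hilb N dX dY dZ).
Qed.

Lemma MpD X Y : pos_macaev X -> pos_macaev Y -> pos_macaev (X \+ Y).
Proof.
move=> MX MY; split; first exact: positiveD MX.1 MY.1.
split; first exact: compactD MX.2.1 MY.2.1.
have [C _ HC] := Mp_bound MX; have [D _ HD] := Mp_bound MY.
by exists (C + D) => N _; apply: le_trans (lm_subadd N MX MY) _; exact: lerD.
Qed.

(** Subadditivity of the eigenvalue sums gives one inequality. For the other, superadditivity
    doubles the number of terms; [seq_limit_double] absorbs this, because the logarithms of the two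
    lengths differ by a bounded amount. *)
Lemma twD X Y : pos_macaev X -> pos_macaev Y -> dix_trace (X \+ Y) = dix_trace X + dix_trace Y.
Proof.
move=> MX MY; have MZ := MpD MX MY.
have bX := lm_bseq MX; have bY := lm_bseq MY; have bZ := lm_bseq MZ.
rewrite /dix_trace -(seq_limitD hw)//; apply/eqP; rewrite eq_le; apply/andP; split.
  by apply: (seq_limit_le hw) => //; [exact: bseqD | move=> N; exact: lm_subadd].
have [C C0 HC] := Mp_bound MZ.
(* The error made by replacing [ln M] by [ln N], with [M <= 3 * N]; it tends to 0. *)
have cr := @cvg_lnV (C * ln 3).
have br : bseq (fun n => -1 * (C * ln 3 / ln (n%:R : R))) := bseqZ (-1) (bseq_cvg cr).
rewrite -[leLHS]addr0 -(mulr0 (-1)) -(seq_limit_cvg hw cr) -(seq_limitZ hw); last exact: bseq_cvg cr.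
rewrite -(seq_limitD hw) //; last exact: bseqD.
apply: (seq_limit_double hw) => //; first exact: bseqD (bseqD _ _) br.
move=> t t0 /=; set N := Num.truncn t; set M := Num.truncn (2 * t).
have [N2|N2] := leqP 2 N; last first.
  rewrite (lnN_small N2) invr0 !mulr0 (lm_small X N2) (lm_small Y N2); have := lm_ge0 M MZ; lra.
have NM : (N + N <= M)%N.
  rewrite truncn_ge_nat; last by rewrite mulr_ge0 ?(ltW t0).
  have := truncn_le t; rewrite (ltW t0) natrD -/N; lra.
(* The integer part of [2 * t] is at most [2 * N + 1], hence at most [3 * N] as [N >= 2]. *)
have MN : (M <= 3 * N)%N.
  have : (M%:R : R) < 2 * N%:R + 2.
    have := truncn_le (2 * t); have -> : 0 <= 2 * t by rewrite mulr_ge0 ?(ltW t0).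
    by have := truncnS_gt t; rewrite -/N -/M -natr1; lra.
  rewrite -natrM -natrD ltr_nat => MN.
  apply: leq_trans (_ : (2 * N).+1 <= _)%N; first by rewrite -ltnS (leq_trans MN)// addn2.
  by rewrite mulnC [(3 * _)%N]mulnC !mulnS muln0 addn0 addnA -addn1 leq_add2l (leq_trans _ N2).
have [mu [nu [ka [e [f [g [dX dY dZ]]]]]]] := diagD MX MY.
have [_ k0 _ _ _] := dZ.
have lnN : 0 < ln (N%:R : R) by rewrite ln_gt0// ltr1n.
have M0 : (0 < M)%N by apply: leq_trans NM; rewrite addn_gt0 (leq_trans _ N2).
have N0 : (0 < N)%N by exact: leq_trans N2.
have lnM : ln (M%:R : R) <= ln 3 + ln N%:R.
  rewrite -lnM ?posrE ?ltr0n// -natrM ler_ln ?posrE ?ltr0n ?ler_nat// muln_gt0 N0//.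
have lnM0 : 0 < ln (M%:R : R) by rewrite ln_gt0// ltr1n (leq_trans _ NM)// (leq_trans N2)// leq_addr.
rewrite (lm_diag _ dX) (lm_diag _ dY) -mulrDl.
have H1 : sig mu N + sig nu N <= sig ka M.
  by apply: le_trans (sig_superadd hilb N dX dY dZ) _; exact: sig_mono.
have E : sig ka M = lm (X \+ Y) M * ln M%:R.
  by rewrite (lm_diag _ dZ) divfK// gt_eqF.
have H2 : sig ka M <= lm (X \+ Y) M * ln N%:R + C * ln 3.
  rewrite E; apply: (@le_trans _ _ (lm (X \+ Y) M * (ln 3 + ln N%:R))).
    by rewrite ler_wpM2l ?lm_ge0.
  rewrite mulrDr addrC lerD2l ler_wpM2r//; exact: (lnN_ge0 3).
rewrite mulN1r lerBlDr -(ler_pM2r lnN) divfK ?gt_eqF// mulrDl divfK ?gt_eqF//.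
exact: le_trans H1 H2.
Qed.

Lemma positiveZ (r : R) X : 0 <= r -> positive_op ip X -> positive_op ip (r%:C \*: X).
Proof.
move=> r0 [bX pX]; split; first exact: boundedZ.
by move=> x /=; rewrite ipZl mulr_ge0// ler0c.
Qed.

Lemma diagZ (r : R) X mu e : 0 <= r -> diag X mu e ->
  diag (r%:C \*: X) (fun n => r * mu n) e.
Proof.
move=> r0 [[oe ez] m0 md ml HX]; split.
- by split => // n /ez ->; rewrite mulr0.
- by move=> n; rewrite mulr_ge0.
- by move=> m n mn; rewrite ler_wpM2l// md.
- by rewrite -(mulr0 r); apply: cvgMr.
- move=> x; have := hcvZ r%:C (HX x); congr hcv; apply/funext => N.
  by rewrite scaler_sumr; apply: eq_bigr => n _; rewrite scalerA mulrA realM.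
Qed.

Lemma lmZ (r : R) X N : 0 <= r -> pos_macaev X -> lm (r%:C \*: X) N = r * lm X N.
Proof.
move=> r0 /Mp_diag[mu [e dX]]; rewrite (lm_diag _ dX) (lm_diag _ (diagZ r0 dX)).
by rewrite mulrA /sig mulr_sumr.
Qed.

Lemma MpZ (r : R) X : 0 <= r -> pos_macaev X -> pos_macaev (r%:C \*: X).
Proof.
move=> r0 MX; have [C C0 HC] := Mp_bound MX; split; first exact: positiveZ MX.1.
split; first exact: compactZ MX.2.1.
by exists (r * C) => N _; rewrite lmZ// ler_wpM2l.
Qed.

Lemma twZ (r : R) X : 0 <= r -> pos_macaev X -> dix_trace (r%:C \*: X) = r * dix_trace X.
Proof.
move=> r0 MX; rewrite /dix_trace -(seq_limitZ hw); last exact: lm_bseq.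
by congr (seq_limit w _); apply/funext => N; rewrite lmZ.
Qed.

Lemma Mp_conj W X : bounded_op W -> pos_macaev X -> pos_macaev (W \o X \o adjoint ip W).
Proof.
move=> bW MX; have [mu [e dX]] := Mp_diag MX; have [C C0 WC] := bounded_opE bW.
have pY : positive_op ip (W \o X \o adjoint ip W).
  split; first exact: bounded_comp (bounded_comp bW MX.1.1) (adjoint_bounded hilb bW).
  by move=> x /=; rewrite adjointP//; case: MX => [[_ H] _].
have cY : compact_op (W \o X \o adjoint ip W).
  exact: compact_compr (compact_compl bW MX.2.1) (adjoint_bounded hilb bW).
have [nu [f dY]] := diag_exists hilb cY pY.
have [D D0 HD] := Mp_bound MX.
apply: (@MpI _ _ _ (C ^+ 2 * D) dY) => N _.
apply: (@le_trans _ _ (C ^+ 2 * sig mu N / ln N%:R)).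
  by rewrite ler_wpM2r ?invr_ge0 ?lnN_ge0// (sig_conj hilb N dX bW C0 WC dY).
by rewrite -mulrA -(lm_diag _ dX) ler_wpM2l ?sqr_ge0.
Qed.

(** The linear extension as a relation: [RT_uniq] shows that the value does not depend on the four
    positive operators, and [macaev_RT] that the ideal is covered. *)
Definition has_dix_trace b (v : R[i]) := exists P1 P2 P3 P4,
  [/\ pos_macaev P1 /\ pos_macaev P2, pos_macaev P3 /\ pos_macaev P4,
      forall x, b x = (P1 x - P2 x) + 'i *: (P3 x - P4 x) &
      v = (dix_trace P1 - dix_trace P2) +i* (dix_trace P3 - dix_trace P4)].

Lemma Mp_lin X : pos_macaev X -> linear X. Proof. by case=> [[[]]]. Qed.

(** Equality of the forms means [P1 + Q2 = Q1 + P2], and additivity applies to both sides. *)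
Lemma Mp_cancel P1 P2 Q1 Q2 : pos_macaev P1 -> pos_macaev P2 -> pos_macaev Q1 -> pos_macaev Q2 ->
  (forall x, qf P1 x - qf P2 x = qf Q1 x - qf Q2 x) -> dix_trace P1 - dix_trace P2 = dix_trace Q1 - dix_trace Q2.
Proof.
move=> M1 M2 N1 N2 H; have E : P1 \+ Q2 = Q1 \+ P2.
  apply: (@sym_ext _ _ ip).
  - exact: Mp_lin (MpD M1 N2).
  - exact: Mp_lin (MpD N1 M2).
  - move=> x /=; rewrite !ipDl (quad_real x M1.1) (quad_real x M2.1).
    rewrite (quad_real x N1.1) (quad_real x N2.1) -!realD; congr (_%:C); have := H x; lra.
have := congr1 dix_trace E; rewrite !twD//; lra.
Qed.

Lemma RT_uniq b v v' : has_dix_trace b v -> has_dix_trace b v' -> v = v'.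
Proof.
move=> [P1 [P2 [P3 [P4 [[A1 A2] [A3 A4] HP ->]]]]].
move=> [Q1 [Q2 [Q3 [Q4 [[B1 B2] [B3 B4] HQ ->]]]]].
have H x : (qf P1 x - qf P2 x = qf Q1 x - qf Q2 x) /\ (qf P3 x - qf P4 x = qf Q3 x - qf Q4 x).
  have := HP x; rewrite HQ => /(congr1 (ip ^~ x)).
  rewrite !(ipDl, ipNl, ipZl) (quad_real x A1.1) (quad_real x A2.1) (quad_real x A3.1) (quad_real x A4.1).
  rewrite (quad_real x B1.1) (quad_real x B2.1) (quad_real x B3.1) (quad_real x B4.1) => E.
  have := congr1 Re E; have := congr1 Im E; rewrite !cE /=; lra.
by congr (_ +i* _); apply: Mp_cancel => // x; case: (H x).
Qed.

Lemma RT_add a b u v : has_dix_trace a u -> has_dix_trace b v -> has_dix_trace (a \+ b) (u + v).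
Proof.
move=> [P1 [P2 [P3 [P4 [[A1 A2] [A3 A4] HP ->]]]]].
move=> [Q1 [Q2 [Q3 [Q4 [[B1 B2] [B3 B4] HQ ->]]]]].
exists (P1 \+ Q1), (P2 \+ Q2), (P3 \+ Q3), (P4 \+ Q4); split.
- by split; exact: MpD.
- by split; exact: MpD.
- by move=> x /=; rewrite HP HQ !opprD addrACA -scalerDr; congr (_ + 'i *: _); rewrite addrACA.
- by rewrite !twD//; apply: complex_ext; rewrite !cE /=; ring.
Qed.

Lemma RT_pos (r : R) a u : 0 <= r -> has_dix_trace a u -> has_dix_trace (r%:C \*: a) (r%:C * u).
Proof.
move=> r0 [P1 [P2 [P3 [P4 [[A1 A2] [A3 A4] HP ->]]]]].
exists (r%:C \*: P1), (r%:C \*: P2), (r%:C \*: P3), (r%:C \*: P4); split.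
- by split; exact: MpZ.
- by split; exact: MpZ.
- by move=> x /=; rewrite HP scalerDr -!scalerBr !scalerA mulrC.
- by rewrite !twZ//; apply: complex_ext; rewrite !cE /=; ring.
Qed.

Lemma RT_opp a u : has_dix_trace a u -> has_dix_trace (-1 \*: a) (- 1 * u).
Proof.
move=> [P1 [P2 [P3 [P4 [[A1 A2] [A3 A4] HP ->]]]]].
exists P2, P1, P4, P3; split => //.
- by move=> x /=; rewrite HP scaleN1r opprD -scalerN !opprB.
- by apply: complex_ext; rewrite !cE /=; ring.
Qed.

Lemma RT_i a u : has_dix_trace a u -> has_dix_trace ('i \*: a) ('i * u).
Proof.
move=> [P1 [P2 [P3 [P4 [[A1 A2] [A3 A4] HP ->]]]]].
exists P4, P3, P1, P2; split => //.
- move=> x /=; rewrite HP scalerDr scalerA -expr2 sqr_i scaleN1r opprB addrC //.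
- by apply: complex_ext; rewrite !cE /=; ring.
Qed.

Lemma RT_real (r : R) a u : has_dix_trace a u -> has_dix_trace (r%:C \*: a) (r%:C * u).
Proof.
move=> Ha; have [r0|r0] := leP 0 r; first exact: RT_pos.
have := RT_opp (RT_pos (r := - r) _ Ha); rewrite oppr_ge0 (ltW r0) => /(_ erefl).
have -> : -1 * ((- r)%:C * u) = r%:C * u by apply: complex_ext; rewrite !cE /=; ring.
congr has_dix_trace; apply/funext => x /=; rewrite scalerA; congr (_ *: _).
by apply: complex_ext; rewrite !cE /=; ring.
Qed.

Lemma RT_scale c a u : has_dix_trace a u -> has_dix_trace (c \*: a) (c * u).
Proof.
move=> Ha; have := RT_add (RT_real (Re c) Ha) (RT_real (Im c) (RT_i Ha)).
have -> : (Re c)%:C * u + (Im c)%:C * ('i * u) = c * u.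
  by apply: complex_ext; rewrite !cE /=; ring.
congr has_dix_trace; apply/funext => x /=; rewrite scalerA -scalerDl; congr (_ *: _).
by apply: complex_ext; rewrite !cE /=; ring.
Qed.

Lemma RT_lin c a b u v : has_dix_trace a u -> has_dix_trace b v -> has_dix_trace ((c \*: a) \+ b) (c * u + v).
Proof. by move=> Ha Hb; apply: RT_add Hb; exact: RT_scale. Qed.

Lemma Mp0 : pos_macaev (fun=> 0).
Proof.
have d0 : diag (fun=> 0) (fun=> 0) (fun=> 0).
  split => //; [|exact: cvg_cst|].
    by split => //; split => [i j _|i]; [rewrite ip0l|right].
  by move=> x; have := @hcv_cst _ _ (0 : h); congr hcv; apply/funext => N; rewrite big1// => n _; rewrite scaler0.
by apply: (MpI (C := 0) d0) => N _; rewrite /sig big1// mul0r.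
Qed.

Lemma tw0 : dix_trace (fun=> 0) = 0.
Proof.
have := twZ (lexx 0) Mp0; rewrite mul0r; congr (dix_trace _ = _).
by apply/funext => x /=; rewrite scaler0.
Qed.

Lemma RT_Mp X : pos_macaev X -> has_dix_trace X (dix_trace X)%:C.
Proof.
move=> MX; exists X, (fun=> 0), (fun=> 0), (fun=> 0); split => //.
- by split => //; exact: Mp0.
- by split; exact: Mp0.
- by move=> x; rewrite !subr0 scaler0 addr0.
- by rewrite tw0 !subr0.
Qed.

End DixmierTrace.

(** * Linear extension of the Dixmier trace to the dual Macaev ideal *)

Section DixmierTrace2.
Context (R : realType) (h : completeNormedModType R[i])
        (ip : {dot h for Num.conj}) (hilb : is_hilbert ip).
Implicit Types (x y z : h) (c : R[i]) (b K X Y P Q W V : h -> h).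
Implicit Types (mu nu ka : nat -> R) (e f g : nat -> h) (u v : R[i]).
Local Notation Re := (@complex.Re R).
Local Notation Im := (@complex.Im R).
Local Notation sq := (sqnorm ip).
Local Notation qf := (qform ip).
Local Notation diag := (diagonal ip).
Local Notation lm := (log_mean_sv ip).
Local Notation Mp := (pos_macaev ip).
Local Notation "b ^+*" := (adjoint ip b) (at level 2, format "b ^+*").

Lemma positive_Re_le X x y : positive_op ip X -> 2 * `|Re (ip (X x) y)| <= qf X x + qf X y.
Proof.
move=> pX; have lX := bounded_lin pX.1.
have := qf_ge0 (x + y) pX; have := qf_ge0 (x - y) pX.
rewrite !qf_ip (linB lX) (linD lX) !(ipDl, ipDr, ipNl, ipNr) !cE.
rewrite [ip (X y) x](positive_sym pX) (ipC ip y) !cE.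
by case: (ger0P (Re (ip (X x) y))) => ? ? ?; lra.
Qed.

Lemma qf_i X x : linear X -> qf X ('i *: x) = qf X x.
Proof. by move=> lX; rewrite !qf_ip (linZ lX) ipZl ipZr !cE /=; ring. Qed.

(** The normalized images [f n] of the eigenvectors [g n] of the absolute value are orthonormal, and
    the singular values of [b] are the numbers [Re (ip (b (g n)) (f n))]. The hypothesis bounds
    their sum by forms of [X] on two orthonormal families, to which Ky Fan applies. *)
Lemma macaev_crit b X : compact_op b -> Mp X ->
  (forall x y, Re (ip (b x) y) <= qf X x + qf X y) -> dual_macaev ip b.
Proof.
move=> cb MX HX; split => //.
have [ka [g [dP PP]]] := op_abs_diag hilb cb; have bb := compact_bounded cb.
have [C C0 HC] := Mp_bound MX; have [mu [e dX]] := Mp_diag hilb MX.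
exists (C + C) => N N2; have [[og ez] k0 _ _ _] := dP.
pose f n := (ka n)^-1%:C *: b (g n).
have bgg i j : ip (b (g i)) (b (g j)) = ((ka i) ^+ 2)%:C * ip (g i) (g j).
  rewrite adjointPr//; have := congr1 (@^~ (g i)) PP => /= <-.
  have lP := bounded_lin (diag_pos hilb dP).1.
  by rewrite (diag_eig hilb i dP) (linZ lP) (diag_eig hilb i dP) scalerA -realM ipZl.
have of_ : osys ip f.
  split; first by move=> i j ij; rewrite /f ipZl ipZr bgg (proj1 og)// !mulr0.
  move=> i; have [ki|ki] := eqVneq (ka i) 0; first by right; rewrite /f ki invr0 scale0r.
  left; rewrite /f sqZ nsqR /sqnorm bgg sqE !cE /= mulr0 subr0.
  case: (og) => _ /(_ i)[->|/ez k]; first by field.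
  by rewrite k eqxx in ki.
have skE : sig ka N = \sum_(n < N) Re (ip (b (g n)) (f n)).
  apply: eq_bigr => n _; rewrite /f ipZr conjR bgg sqE !cE /= !mulr0 !mul0r !subr0.
  have [kn|kn] := eqVneq (ka n) 0; first by rewrite kn invr0 mul0r.
  case: (og) => _ /(_ n)[->|/ez k]; first by field.
  by rewrite k eqxx in kn.
have lnN : 0 < ln (N%:R : R) by rewrite ln_gt0// ltr1n.
have HS : sig ka N <= sig mu N + sig mu N.
  rewrite skE; apply: (@le_trans _ _ (\sum_(n < N) (qf X (g n) + qf X (f n)))).
    by apply: ler_sum => n _; exact: HX.
  rewrite big_split/=; apply: lerD; apply: (kyfan_le hilb dX); exact: osys_besselN.
have -> : lm b N = sig ka N / ln N%:R.
  by rewrite /log_mean_sv (singular_value_diag hilb dP).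
apply: (@le_trans _ _ ((sig mu N + sig mu N) / ln N%:R)).
  by rewrite ler_wpM2r// invr_ge0 ltW.
by rewrite mulrDl -(lm_diag hilb N dX) lerD.
Qed.

Context (w : (R -> R) -> R) (hw : dixmier_ultrafilter w).
Local Notation tw := (dix_trace ip w).
Local Notation RT := (has_dix_trace ip w).

Lemma RT_macaev b v : RT b v -> dual_macaev ip b.
Proof.
move=> [P1 [P2 [P3 [P4 [[A1 A2] [A3 A4] HP _]]]]].
have E : b = (P1 \- P2) \+ ('i \*: (P3 \- P4)) by apply/funext => x /=; rewrite HP.
apply: (@macaev_crit _ ((P1 \+ P2) \+ (P3 \+ P4))).
- rewrite E; apply: compactD; first exact: compactB A1.2.1 A2.2.1.
  by apply: compactZ; exact: compactB A3.2.1 A4.2.1.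
- by apply: MpD => //; exact: MpD.
move=> x y; rewrite E !qfD /=.
have l3 := Mp_lin A3; have l4 := Mp_lin A4.
rewrite scalerBr -(linZ l3) -(linZ l4) !(ipDl, ipNl) !cE.
have H1 := positive_Re_le x y A1.1; have H2 := positive_Re_le x y A2.1.
have H3 := positive_Re_le ('i *: x) y A3.1; have H4 := positive_Re_le ('i *: x) y A4.1.
rewrite !qf_i// in H3 H4.
have N1 := ler_norm (Re (ip (P1 x) y)); have N3 := ler_norm (Re (ip (P3 ('i *: x)) y)).
have N2 := ler_norm (- Re (ip (P2 x) y)); rewrite normrN in N2.
have N4 := ler_norm (- Re (ip (P4 ('i *: x)) y)); rewrite normrN in N4.
move: (qf_ge0 x A1.1) (qf_ge0 y A1.1) (qf_ge0 x A2.1) (qf_ge0 y A2.1)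
  (qf_ge0 x A3.1) (qf_ge0 y A3.1) (qf_ge0 x A4.1) (qf_ge0 y A4.1); lra.
Qed.

Definition shift_op V c : h -> h := V \+ (c \*: id).
Definition sandwich W X : h -> h := W \o X \o W^+*.

Lemma shift_bounded V c : bounded_op V -> bounded_op (shift_op V c).
Proof. by move=> bV; apply: boundedD => //; apply: boundedZ; exact: bounded_id. Qed.

Lemma shift_adj V c : bounded_op V -> (shift_op V c)^+* = shift_op V^+* (cj c).
Proof.
move=> bV; apply: (adjointE hilb); first exact: shift_bounded.
by move=> x y; rewrite /shift_op /= ipDl ipDr ipZl ipZr cjK adjointP.
Qed.

Lemma sandwichE V X c x : bounded_op V -> linear X ->
  sandwich (shift_op V c) X x =
    (V (X (V^+* x)) + (nsq c)%:C *: X x) + (cj c *: V (X x) + c *: X (V^+* x)).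
Proof.
move=> bV lX; rewrite /sandwich /= shift_adj// /shift_op /=; have lV := bounded_lin bV.
rewrite (linD lX) (linZ lX) (linD lV) (linZ lV) scalerDr scalerA nsqE.
by apply: (ip_inj (ip := ip)) => z; rewrite !(ipDl, ipZl); ring.
Qed.

Definition polar_value V X : R[i] :=
  (4^-1 * (tw (sandwich (shift_op V 1) X) - tw (sandwich (shift_op V (-1)) X))) +i*
  (4^-1 * (tw (sandwich (shift_op V 'i) X) - tw (sandwich (shift_op V (-'i)) X))).

(* Polarization in the bounded factor:
   [4 V X = sum_(k < 4) i^k (V + i^k) X (V + i^k)^*]. *)
Lemma RT_comp V X : bounded_op V -> Mp X -> RT (V \o X) (polar_value V X).
Proof.
move=> bV MX; pose S c := 4^-1%:C \*: sandwich (shift_op V c) X.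
have q0 : 0 <= 4^-1 :> R by [].
have M0 c : Mp (sandwich (shift_op V c) X) by apply: Mp_conj => //; exact: shift_bounded.
have MS c : Mp (S c) by exact: MpZ.
exists (S 1), (S (-1)), (S 'i), (S (-'i)); split => //; last first.
  by rewrite /polar_value /S !twZ//; congr (_ +i* _); ring.
move=> x; have lX := Mp_lin MX; rewrite /S /= -!scalerBr scalerA !sandwichE//.
set A := V (X (V^+* x)); set B := V (X x); set D := X (V^+* x).
apply: (ip_inj (ip := ip)) => z; rewrite -/B !(ipDl, ipNl, ipZl).
by apply: complex_ext; rewrite /nsq !cE /=; field.
Qed.

(** Polar decomposition: [V] is the partial isometry sending [e n] to [g n], and [RT_comp] applies
    to [V] times the absolute value. *)
Lemma macaev_RT b : dual_macaev ip b -> exists v, RT b v.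
Proof.
move=> [cb bnd]; have bb := compact_bounded cb.
have [mu [e [dP PP]]] := op_abs_diag hilb cb; set P := op_abs ip b in dP PP.
have [[oe ez] m0 md ml HP] := dP.
have MP : Mp P.
  have [C HC] := bnd; apply: (MpI hilb (C := C) dP) => N N2.
  by have := HC N N2; rewrite /log_mean_sv (singular_value_diag hilb dP).
have bee i j : ip (b (e i)) (b (e j)) = ((mu i) ^+ 2)%:C * ip (e i) (e j).
  rewrite adjointPr//; have := congr1 (@^~ (e i)) PP => /= <-.
  have lP := Mp_lin MP.
  by rewrite (diag_eig hilb i dP) (linZ lP) (diag_eig hilb i dP) scalerA -realM ipZl.
pose g n := (mu n)^-1%:C *: b (e n).
have og : osys ip g.
  split; first by move=> i j ij; rewrite /g ipZl ipZr bee (proj1 oe)// !mulr0.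
  move=> i; have [ki|ki] := eqVneq (mu i) 0; first by right; rewrite /g ki invr0 scale0r.
  left; rewrite /g sqZ nsqR /sqnorm bee sqE !cE /= mulr0 subr0.
  case: (oe) => _ /(_ i)[->|/ez k]; first by field.
  by rewrite k eqxx in ki.
have be n : b (e n) = (mu n)%:C *: g n.
  rewrite /g scalerA -realM; have [mn|mn] := eqVneq (mu n) 0; last by rewrite mulfV// scale1r.
  rewrite mn mul0r scale0r; apply: (sq_eq0 (ip := ip)).
  by rewrite /sqnorm bee mn expr0n mul0r.
have d1 (n : nat) : nsq (1 : R[i]) <= 1 by rewrite (_ : nsq 1 = 1)// /nsq /=; ring.
pose V := dop ip e g (fun=> 1).
have bV : bounded_op V := dop_bounded hilb oe og d1.
suff -> : b = V \o P by exists (polar_value V P); exact: RT_comp.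
have Pnull x : P x = 0 -> b x = 0.
  move=> Px; apply: (sq_eq0 (ip := ip)); rewrite /sqnorm adjointPr//.
  by have := congr1 (@^~ x) PP => /= <-; rewrite Px (lin0 (Mp_lin MP)) ip0l.
(* [x'] is the projection of [x] on the closed span of the [e n]; the difference is killed by the
   absolute value, hence by [b]. *)
apply/funext => x; pose x' := dop ip e e (fun=> 1) x.
have lb := bounded_lin bb.
have -> : b x = b x'.
  apply/eqP; rewrite -subr_eq0 -(linB lb); apply/eqP/Pnull/(diag_null hilb dP) => n.
  rewrite ipBl (dop_coef hilb oe oe d1) mul1r.
  by case: (oe) => _ /(_ n)[->|->]; rewrite ?mulr1 ?subrr// !ip0r mul0r subrr.
apply: (hcv_uniq (bounded_hcv bb (dop_cvg hilb oe oe d1 x))).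
have := bounded_hcv bV (HP x); congr hcv; apply/funext => N /=.
rewrite !(lin_sum _ _ _ (bounded_lin bV)) !(lin_sum _ _ _ lb); apply: eq_bigr => n _.
rewrite (linZ (bounded_lin bV)) (linZ lb) be [V _](dop_eig hilb oe og d1) [LHS]scalerA [RHS]scalerA.
case: (oe) => _ /(_ n)[->|en].
  by congr (_ *: _); apply: complex_ext; rewrite !cE /=; ring.
by rewrite en ip0r !(mulr0, mul0r).
Qed.

Lemma dixmier_trace_exists : is_dixmier_trace ip w (dixmier_trace ip w).
Proof.
pose Tr b := xget 0 [set v | RT b v].
have TrP b v : RT b v -> Tr b = v.
  move=> Hb; have : RT b (Tr b) by apply: (@xgetPex _ 0 [set v | RT b v]); exists v.
  by move=> H; apply: RT_uniq H Hb.
suff : is_dixmier_trace ip w Tr by move=> H; apply: (@xgetPex _ _ (is_dixmier_trace ip w)); exists Tr.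
split=> [c a b Ma Mb|b Mb pb].
  have [u Hu] := macaev_RT Ma; have [v Hv] := macaev_RT Mb.
  by rewrite (TrP _ _ Hu) (TrP _ _ Hv); apply: TrP; exact: RT_lin.
by apply: TrP; exact: RT_Mp.
Qed.

(** Linearity is available on the ideal, so the decomposition is peeled off one positive term at a
    time, each remainder being in the ideal by [RT_macaev]. *)
Lemma dixmier_traceE b v : RT b v -> dixmier_trace ip w b = v.
Proof.
have [lTr pTr] := dixmier_trace_exists; set Tr := dixmier_trace ip w in lTr pTr *.
move=> [P1 [P2 [P3 [P4 [[A1 A2] [A3 A4] HP ->]]]]].
have R0 : RT (fun=> 0) 0 by have := RT_Mp hilb hw (Mp0 hilb); rewrite tw0.
have M0 := RT_macaev R0.
have T0 : Tr (fun=> 0) = 0.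
  have := lTr (-1) _ _ M0 M0; rewrite mulN1r addNr => <-.
  by congr Tr; apply/funext => x /=; rewrite scaler0 addr0.
have R4 := RT_lin hilb hw (- 'i) (RT_Mp hilb hw A4) R0.
have R3 := RT_lin hilb hw 'i (RT_Mp hilb hw A3) R4.
have R2 := RT_lin hilb hw (- 1) (RT_Mp hilb hw A2) R3.
have -> : b = (1 \*: P1) \+ ((-1 \*: P2) \+ (('i \*: P3) \+ ((-'i \*: P4) \+ (fun=> 0)))).
  apply/funext => x; apply: (ip_inj (ip := ip)) => z.
  by rewrite /= HP !(ipDl, ipNl, ipZl) ip0l; ring.
rewrite lTr; [|exact: A1.2|exact: RT_macaev R2].
rewrite lTr; [|exact: A2.2|exact: RT_macaev R3].
rewrite lTr; [|exact: A3.2|exact: RT_macaev R4].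
rewrite lTr; [|exact: A4.2|exact: M0].
rewrite T0 (pTr _ A1.2 A1.1) (pTr _ A2.2 A2.1) (pTr _ A3.2 A3.1) (pTr _ A4.2 A4.1).
by rewrite /dix_trace; apply: complex_ext; rewrite !cE /=; ring.
Qed.

End DixmierTrace2.

(** * The Dixmier trace of [b \o rho_op] as a limit of weighted means *)

Section VolumeForm.
Context (R : realType) (h : completeNormedModType R[i])
        (ip : {dot h for Num.conj}) (hilb : is_hilbert ip).
Implicit Types (x y z : h) (c : R[i]) (b K X Y P Q W V : h -> h).
Implicit Types (mu nu ka : nat -> R) (f g : nat -> h) (u v : R[i]).
Local Notation Re := (@complex.Re R).
Local Notation Im := (@complex.Im R).
Local Notation sq := (sqnorm ip).
Local Notation qf := (qform ip).
Local Notation diag := (diagonal ip).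
Local Notation lm := (log_mean_sv ip).
Local Notation Mp := (pos_macaev ip).

Lemma rdop_sqrt mu e : osys ip e -> (forall n, e n = 0 -> mu n = 0) ->
  (forall n, 0 <= mu n) -> (forall m n, (m <= n)%N -> mu n <= mu m) ->
  mu @ \oo --> (0 : R) ->
  diag (rdop ip e (fun n => Num.sqrt (mu n))) (fun n => Num.sqrt (mu n)) e /\
  rdop ip e (fun n => Num.sqrt (mu n)) \o rdop ip e (fun n => Num.sqrt (mu n)) = rdop ip e mu.
Proof.
move=> oe ez m0 md ml.
have dP : diag (rdop ip e (fun n => Num.sqrt (mu n))) (fun n => Num.sqrt (mu n)) e.
  apply: diag_rdop => //.
  - by move=> n /ez /= ->; rewrite sqrtr0.
  - by move=> m n mn /=; rewrite ler_wsqrtr// md.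
  - rewrite -(@sqrtr0 R); apply: continuous_cvg => //; exact: sqrt_continuous.
split => //.
have dB := diag_rdop hilb oe ez m0 md ml.
have bP := (diag_pos hilb dP).1; have lP := bounded_lin bP.
apply/funext => x; have [_ _ _ _ HB] := dB; apply: (hcv_uniq _ (HB x)) => /=.
have [_ _ _ _ HP] := dP; have := bounded_hcv bP (HP x); congr hcv.
apply/funext => N /=; rewrite (lin_sum _ _ _ lP); apply: eq_bigr => n _.
rewrite (linZ lP) (diag_eig hilb n dP) scalerA; congr (_ *: _).
by rewrite mulrAC -realM -expr2 sqr_sqrtr.
Qed.

Variables (rho_op : h -> h) (rho : nat -> R) (e : nat -> h).
Hypotheses (drho : diag rho_op rho e) (rho1 : forall n, rho n <= n.+1%:R^-1).

Lemma sandwich_sig W C nu f N : bounded_op W -> 0 < C -> bounded_by W C ->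
  diag (sandwich ip W rho_op) nu f ->
  \sum_(n < N) rho n * sq (W (e n)) <= sig nu N <= \sum_(n < N) rho n * sq (W (e n)) + C ^+ 2.
Proof.
move=> bW C0 WC dY; have [[oe ez] r0 rd rl _] := drho.
have [dq qq] := rdop_sqrt oe ez r0 rd rl.
set q := rdop ip e _ in dq qq; rewrite -(diagE hilb drho) in qq.
have pq := diag_pos hilb dq; have bq := pq.1; have lq := bounded_lin bq.
have lW := bounded_lin bW; have bWa := adjoint_bounded hilb bW.
pose Z := W \o q; have bZ : bounded_op Z := bounded_comp bW bq.
have Zadj : adjoint ip Z = q \o adjoint ip W.
  apply: (adjointE hilb) => // x y; by rewrite /Z /= adjointP// (positive_sym pq).
have bZa : bounded_op (adjoint ip Z) := adjoint_bounded hilb bZ.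
have Zaa : adjoint ip (adjoint ip Z) = Z.
  by apply: (adjointE hilb) => // x y; rewrite -adjointPr.
have ZZ : Z \o adjoint ip Z = sandwich ip W rho_op.
  by apply/funext => x; rewrite Zadj /Z /sandwich /=; have := congr1 (@^~ (adjoint ip W x)) qq => /= ->.
have cq : compact_op q := diag_compact hilb dq.
pose A := adjoint ip Z \o Z.
have pA : positive_op ip A := adj_comp_pos hilb bZ.
have cA : compact_op A by apply: compact_compl => //; exact: compact_compl bW cq.
pose B := ((C ^+ 2)%:C \*: rho_op) \- A.
have crho : compact_op rho_op := diag_compact hilb drho.
have cB : compact_op B by apply: compactB => //; exact: compactZ.
have qfA x : ip (A x) x = (sq (W (q x)))%:C.
  by rewrite /A /= -adjointPr// sqE.
have rhoE x : rho_op x = q (q x) by have := congr1 (@^~ x) qq => /= ->.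
have qfB x : ip (B x) x = (C ^+ 2 * sq (q x) - sq (W (q x)))%:C.
  rewrite /B /= ipBl qfA ipZl rhoE (positive_sym pq) sqE -realM.
  by apply: complex_ext; rewrite !cE /=; ring.
have pB : positive_op ip B.
  split; first exact: compact_bounded.
  by move=> x; rewrite qfB ler0c subr_ge0; exact: bounded_by_sq (ltW C0) WC _.
have [al [a dA]] := diag_exists hilb cA pA.
have [be [b dB]] := diag_exists hilb cB pB.
have AB : A \+ B = (C ^+ 2)%:C \*: rho_op.
  by apply/funext => x; rewrite /B /= addrC subrK.
have dAB : diag (A \+ B) (fun n => C ^+ 2 * rho n) e.
  by rewrite AB; apply: diagZ => //; rewrite sqr_ge0.
have sup := sig_superadd hilb N dA dB dAB.
have qe n : q (e n) = (Num.sqrt (rho n))%:C *: e n := diag_eig hilb n dq.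
have bes := osys_besselN N oe.
have LA : \sum_(n < N) rho n * sq (W (e n)) <= sig al N.
  apply: le_trans (kyfan_le hilb dA bes); rewrite le_eqVlt; apply/orP; left; apply/eqP.
  by apply: eq_bigr => n _; rewrite qf_ip qfA qe (linZ lW) sqZ nsqR sqr_sqrtr.
have rs n : rho n * sq (e n) = rho n.
  by case: (oe) => _ /(_ n)[->|/ez ->]; rewrite ?mulr1 ?mul0r.
have LB : \sum_(n < N) (C ^+ 2 * rho n - rho n * sq (W (e n))) <= sig be N.
  apply: le_trans (kyfan_le hilb dB bes); rewrite le_eqVlt; apply/orP; left; apply/eqP.
  apply: eq_bigr => n _; rewrite qf_ip qfB qe (linZ lW) !sqZ !nsqR sqr_sqrtr//= rs //.
have dY' : diag (Z \o adjoint ip Z) nu f by rewrite ZZ.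
have E : sig nu N = sig al N.
  apply/eqP; rewrite eq_le (sig_star hilb N bZ dA dY') andbT.
  have dA' : diag (adjoint ip Z \o adjoint ip (adjoint ip Z)) al a by rewrite Zaa.
  have dY'' : diag (adjoint ip (adjoint ip Z) \o adjoint ip Z) nu f by rewrite Zaa.
  exact: (sig_star hilb N bZa dY'' dA').
rewrite E LA /=; move: LB sup; rewrite sumrB.
have -> : sig (fun n => C ^+ 2 * rho n) (N + N) =
  \sum_(n < N) C ^+ 2 * rho n + \sum_(N <= n < N + N) C ^+ 2 * rho n.
  rewrite /sig -!(big_mkord xpredT (fun n => C ^+ 2 * rho n)).
  by rewrite (big_cat_nat (m := 0%N) (n := N) (p := N + N))//= leq_addr.
have tail : \sum_(N <= n < N + N) C ^+ 2 * rho n <= C ^+ 2.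
  rewrite -mulr_sumr ler_piMr ?sqr_ge0//.
  have [N0|N0] := posnP N; first by rewrite N0 big_geq.
  apply: (@le_trans _ _ (\sum_(N <= n < N + N) N%:R^-1)).
    rewrite big_nat_cond [leRHS]big_nat_cond; apply: ler_sum => n /andP[/andP[Nn _] _].
    apply: le_trans (rho1 n) _; rewrite lef_pV2 ?posrE ?ltr0n// ler_nat.
    exact: leq_trans Nn _.
  rewrite sumr_const_nat addnK (_ : N%:R^-1 *+ N = 1)// -[LHS]mulr_natr mulVf//.
  by rewrite pnatr_eq0 -lt0n.
lra.
Qed.

Context (w : (R -> R) -> R) (hw : dixmier_ultrafilter w).
Hypothesis Mrho : Mp rho_op.

Definition log_mean (a : nat -> R) (N : nat) : R := (\sum_(n < N) rho n * a n) / ln N%:R.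

Lemma log_mean_bseq (a : nat -> R) C : (forall n, `|a n| <= C) -> bseq (log_mean a).
Proof.
move=> aC; have [D D0 HD] := Mp_bound Mrho; exists (C * D) => N.
have [_ r0 _ _ _] := drho.
have C0 : 0 <= C by exact: le_trans (normr_ge0 _) (aC 0%N).
rewrite /log_mean normrM [`|_^-1|]ger0_norm ?invr_ge0 ?lnN_ge0//.
apply: (@le_trans _ _ (C * lm rho_op N)); last by rewrite ler_wpM2l.
rewrite (lm_diag hilb N drho) mulrA ler_wpM2r ?invr_ge0 ?lnN_ge0//.
apply: le_trans (ler_norm_sum _ _ _) _; rewrite mulr_sumr; apply: ler_sum => n _.
by rewrite normrM ger0_norm// mulrC ler_wpM2r.
Qed.

(** Divided by [ln N], the bounded error of [sandwich_sig] tends to 0. *)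
Lemma tw_sandwich W : bounded_op W ->
  dix_trace ip w (sandwich ip W rho_op) = seq_limit w (log_mean (fun n => sq (W (e n)))) /\
  bseq (log_mean (fun n => sq (W (e n)))).
Proof.
move=> bW; have [C C0 WC] := bounded_opE bW; have [[oe _] _ _ _ _] := drho.
have bs : bseq (log_mean (fun n => sq (W (e n)))).
  apply: (@log_mean_bseq _ (C ^+ 2)) => n; rewrite ger0_norm ?sq_ge0//.
  apply: le_trans (bounded_by_sq hilb (ltW C0) WC _) _.
  by rewrite ler_piMr ?sqr_ge0// osys_le1.
split => //.
have MS := Mp_conj hilb bW Mrho; have [nu [f dY]] := Mp_diag hilb MS.
have H : (fun N => lm (sandwich ip W rho_op) N - log_mean (fun n => sq (W (e n))) N) @ \oo --> (0 : R).
  apply: (@squeeze_cvgr _ _ _ _ (fun=> 0) (fun N => C ^+ 2 / ln N%:R)); last 2 first.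
  - exact: cvg_cst.
  - exact: cvg_lnV.
  exists 0%N => // N _ /=; rewrite (lm_diag hilb N dY) /log_mean -mulrBl.
  have /andP[h1 h2] := sandwich_sig N bW C0 WC dY.
  rewrite mulr_ge0 ?invr_ge0 ?lnN_ge0 ?subr_ge0//= ler_wpM2r ?invr_ge0 ?lnN_ge0//.
  by rewrite lerBlDl.
by have [_] := seq_limit_diff hw bs H; rewrite addr0.
Qed.

(** Polarization expresses both parts of [ip (b (e n)) (e n)] through the squares
    [sq (shift_op b c (e n))], whose means are the values found in [tw_sandwich]. *)
Theorem dixmier_trace_comp b : bounded_op b -> dixmier_trace ip w (b \o rho_op) =
  seq_limit w (log_mean (fun n => Re (ip (b (e n)) (e n)))) +i*
  seq_limit w (log_mean (fun n => Im (ip (b (e n)) (e n)))).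
Proof.
move=> bb; rewrite (dixmier_traceE hilb hw (RT_comp hilb hw bb Mrho)) /polar_value.
have D c c' : 4^-1 * (dix_trace ip w (sandwich ip (shift_op b c) rho_op) - dix_trace ip w (sandwich ip (shift_op b c') rho_op))
   = seq_limit w (log_mean (fun n => 4^-1 * (sq (shift_op b c (e n)) - sq (shift_op b c' (e n))))).
  have [-> b1] := tw_sandwich (shift_bounded c bb); have [-> b2] := tw_sandwich (shift_bounded c' bb).
  rewrite -mulN1r -(seq_limitZ hw)// -(seq_limitD hw)//; last exact: bseqZ.
  rewrite -(seq_limitZ hw); last by apply: bseqD => //; exact: bseqZ.
  congr (seq_limit w _); apply/funext => N; rewrite /log_mean mulN1r -mulrBl mulrA; congr (_ / _).
  by rewrite -sumrB mulr_sumr; apply: eq_bigr => n _; ring.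
rewrite !D; congr (seq_limit w (log_mean _) +i* seq_limit w (log_mean _)); apply/funext => n.
  by rewrite /shift_op /= scale1r scaleN1r sqB sqD; field.
by rewrite /shift_op /= scaleNr sqB sqD ipZr !cE /=; field.
Qed.

End VolumeForm.

(** * Integrals against set functions and discrete measures *)

Section RawIntegral.
Context d (T : measurableType d) (R : realType).
Local Open Scope ereal_scope.
Import HBNNSimple.

(* The first argument of [integral] is a bare set function, whose values at
   nonmeasurable sets are irrelevant. *)
Lemma integral_raw (mu : set T -> \bar R) (m : {measure set T -> \bar R}) (f : T -> \bar R) :
  (forall A, measurable A -> mu A = m A) -> integral mu setT f = \int[m]_x f x.
Proof.
move=> H; have E (h : {nnsfun T >-> R}) : sintegral mu h = sintegral m h.
  rewrite /sintegral; apply: eq_fsbigr => r _; congr (_ * _); apply: H.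
  exact: measurable_sfunP.
rewrite /integral; congr (ereal_sup _ - ereal_sup _); apply/seteqP; split => z [h hf <-];
  by exists h.
Qed.
End RawIntegral.

Section Discrete.
Context (R : realType).
Variables (a : nat -> R) (a0 : forall k, (0 <= a k)%R) (p : nat -> R).

(** Mass [a k] at the point [p k]: the shape of the vector measures of a diagonal operator. *)
Definition disc : set R -> \bar R :=
  mseries (fun k => mscale (NngNum (a0 k)) (dirac (p k))) 0.

(** [f] is nonnegative at the atoms only, so its negative part has integral 0 without vanishing
    identically. *)
Lemma disc_int (f : R -> R) : measurable_fun setT f -> (forall k, 0 <= f (p k)) ->
  integral disc setT (EFin \o f) = (\sum_(k <oo) (a k * f (p k))%:E)%E.
Proof.
move=> mf f0.
have main (g : R -> R) : measurable_fun setT g -> (forall x, 0 <= g x) ->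
    integral disc setT (EFin \o g) = (\sum_(k <oo) (a k * g (p k))%:E)%E.
  move=> mg g0; rewrite /disc ge0_integral_measure_series//; last 2 first.
  - by move=> t _; rewrite lee_fin.
  - exact/measurable_EFinP.
  apply: eq_eseriesr => k _; rewrite ge0_integral_mscale//; last 2 first.
  - exact/measurable_EFinP.
  - by move=> t _; rewrite lee_fin.
  by rewrite integral_dirac// ?diracT ?mul1e//; exact/measurable_EFinP.
have E1 : (EFin \o f)^\+%E = EFin \o (fun x => Num.max (f x) 0).
  by apply/funext => x; rewrite funeposE /= EFin_max.
have E2 : (EFin \o f)^\-%E = EFin \o (fun x => Num.max (- f x) 0).
  by apply/funext => x; rewrite funenegE /= EFin_max EFinN.
have -> : integral disc setT (EFin \o f) =
   (integral disc setT (EFin \o f)^\+%E - integral disc setT (EFin \o f)^\-%E)%E.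
  exact: (@integralE _ _ _ disc setT (EFin \o f)).
rewrite E1 E2 !main; first last.
- by move=> x; rewrite le_max lexx orbT.
- exact: measurable_maxr.
- by move=> x; rewrite le_max lexx orbT.
- by apply: measurable_maxr => //; exact: measurableT_comp.
rewrite [X in (_ - X)%E]eseries0 ?sube0.
  by apply: eq_eseriesr => k _; rewrite (max_idPl _).
by move=> k _ _; rewrite (max_idPr _) ?mulr0// oppr_le0.
Qed.

Lemma discE (A : set R) : measurable A ->
  disc A = (\sum_(k <oo) (a k * \1_A (p k))%:E)%E.
Proof.
by move=> mA; rewrite /disc /mseries; apply: eq_eseriesr => k _; rewrite /mscale /= /dirac EFinM.
Qed.
End Discrete.

(** * Spectral projections of a diagonal operator *)

Section SpectralMeasure.
Context (R : realType) (h : completeNormedModType R[i])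
        (ip : {dot h for Num.conj}) (hilb : is_hilbert ip).
Implicit Types (x y z v : h) (c : R[i]) (b : h -> h) (A B : set R).
Local Notation Re := (@complex.Re R).
Local Notation Im := (@complex.Im R).
Local Notation sq := (sqnorm ip).
Variable (e : nat -> h).
Hypotheses (oe : osys ip e) (e1 : forall n, sq (e n) = 1).

(** For the eigenvectors of [L] with nonzero eigenvalue this is the kernel of [L]; [p0] below
    projects on it. *)
Definition null v := forall n, ip v (e n) = 0.

Lemma vec_ext x y : (forall n, ip x (e n) = ip y (e n)) ->
  (forall v, null v -> ip x v = ip y v) -> x = y.
Proof.
move=> H1 H2; apply/eqP; rewrite -subr_eq0; apply/eqP/(sq_eq0 (ip := ip)).
have nz : null (x - y) by move=> n; rewrite ipBl H1 subrr.
by rewrite /sqnorm ipBl H2// subrr.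
Qed.

Let d1 (n : nat) : nsq (1 : R[i]) <= 1.
Proof. by rewrite (_ : nsq 1 = 1)// /nsq /=; ring. Qed.

Definition p0 x := x - dop ip e e (fun=> 1) x.

Lemma p0_null x : null (p0 x).
Proof.
by move=> n; rewrite /p0 ipBl (dop_coef hilb oe oe d1) e1 mul1r mulr1 subrr.
Qed.

Lemma p0_ip x v : null v -> ip (p0 x) v = ip x v.
Proof.
move=> nv; rewrite /p0 ipBl (dop_orth hilb oe oe d1) ?subr0// => n.
by rewrite ipC nv cj0.
Qed.

Definition ind A (t : R) : R := (t \in A)%:R.

Lemma ind_bound A (dd : nat -> R) n : nsq (ind A (dd n))%:C <= 1.
Proof. by rewrite nsqR /ind; case: (_ \in _); rewrite ?expr1n ?expr0n. Qed.

(** The spectral projection at [A] of the operator with eigenvalue [dd n] at [e n] and 0 on the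
    orthogonal complement of the system. *)
Definition Ed (dd : nat -> R) A x : h :=
  dop ip e e (fun n => (ind A (dd n))%:C) x + (ind A 0)%:C *: p0 x.

Arguments Ed : simpl never.
Section Fixed.
Variable (dd : nat -> R).

Lemma Ed_coef A x n : ip (Ed dd A x) (e n) = (ind A (dd n))%:C * ip x (e n).
Proof.
rewrite /Ed ipDl ipZl p0_null mulr0 addr0.
by rewrite (dop_coef hilb oe oe (ind_bound A dd)) e1 mulr1.
Qed.

Lemma Ed_null A x v : null v -> ip (Ed dd A x) v = (ind A 0)%:C * ip x v.
Proof.
move=> nv; rewrite /Ed ipDl ipZl p0_ip//.
by rewrite (dop_orth hilb oe oe (ind_bound A dd)) ?add0r// => n; rewrite ipC nv cj0.
Qed.

Lemma indI A B t : (ind (A `&` B) t)%:C = (ind A t)%:C * (ind B t)%:C :> R[i].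
Proof.
rewrite -realM /ind in_setI; congr (_%:C).
by case: (t \in A); case: (t \in B); rewrite ?mulr1 ?mulr0 ?mul0r.
Qed.

Lemma Ed_linear A : linear (Ed dd A).
Proof.
move=> c x y; apply: vec_ext => [n|v nv].
  by rewrite Ed_coef ipDl ipZl [RHS]ipDl ipZl !Ed_coef; ring.
by rewrite Ed_null// ipDl ipZl [RHS]ipDl ipZl !Ed_null//; ring.
Qed.

Lemma EdI A B : Ed dd (A `&` B) = Ed dd A \o Ed dd B.
Proof.
apply/funext => x; apply: vec_ext => [n|v nv] /=.
  by rewrite !Ed_coef indI mulrA.
by rewrite !Ed_null// indI mulrA.
Qed.

Lemma dop_real_sym (g : nat -> R) (g1 : forall n, nsq (g n)%:C <= 1) x y :
  ip (dop ip e e (fun n => (g n)%:C) x) y = ip x (dop ip e e (fun n => (g n)%:C) y).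
Proof.
have -> := dop_adj hilb oe oe g1 x y.
have -> : (fun n => cj (g n)%:C) = (fun n => (g n)%:C) by apply/funext => n; rewrite conjR.
by [].
Qed.

Lemma p0_sym x y : ip (p0 x) y = ip x (p0 y).
Proof.
by rewrite /p0 ipBl ipBr; have -> := @dop_real_sym (fun=> 1) d1 x y.
Qed.

Lemma Ed_sym A x y : ip (Ed dd A x) y = ip x (Ed dd A y).
Proof.
have E : ip (Ed dd A x) y = ip (dop ip e e (fun n => (ind A (dd n))%:C) x) y + (ind A 0)%:C * ip (p0 x) y.
  by rewrite /Ed ipDl ipZl.
have E' : ip x (Ed dd A y) = ip x (dop ip e e (fun n => (ind A (dd n))%:C) y) + (ind A 0)%:C * ip x (p0 y).
  by rewrite /Ed ipDr ipZr conjR.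
by rewrite E E' p0_sym (dop_real_sym (ind_bound A dd)).
Qed.

Lemma Ed_proj A : orthogonal_projection ip (Ed dd A).
Proof.
split; [exact: Ed_linear | | exact: Ed_sym].
by rewrite -EdI setIid.
Qed.

Lemma EdT : Ed dd setT = id.
Proof.
apply/funext => x; apply: vec_ext => [n|v nv].
  by rewrite Ed_coef /ind in_setT mul1r.
by rewrite Ed_null// /ind in_setT mul1r.
Qed.

(** Index 0 is reserved for the kernel, whose atom in [pt] is the point 0; index [n.+1] belongs to
    [e n]. *)
Definition wt x (k : nat) : R := if k is n.+1 then nsq (ip x (e n)) else sq (p0 x).
Definition pt (k : nat) : R := if k is n.+1 then dd n else 0.
Lemma wt_ge0 x k : 0 <= wt x k.
Proof. by case: k => [|n]; [exact: sq_ge0|exact: nsq_ge0]. Qed.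

Definition mud x := disc (wt_ge0 x) pt.

Lemma series_lim_EFin (r : nat -> R) (l : R) :
  (fun N => \sum_(n < N) r n) @ \oo --> l -> (\sum_(n <oo) (r n)%:E = l%:E)%E.
Proof.
move=> rl; apply/cvg_lim => //.
under eq_fun => N do rewrite sumEFin big_mkord.
by apply: cvg_EFin; [near=> n | exact: rl].
Unshelve. all: by end_near. Qed.

Lemma Ed_vm A x : measurable A -> vector_measure ip (Ed dd) x A = mud x A.
Proof.
move=> mA; rewrite /vector_measure /mud discE//; apply/esym/series_lim_EFin.
have [cR _] := dop_ip hilb oe oe (ind_bound A dd) x x.
rewrite -(cvg_shiftS (fun N => \sum_(n < N) wt x n * \1_A (pt n))).
have E N : \sum_(n < N.+1) wt x n * \1_A (pt n) =
   ind A 0 * sq (p0 x) + Re (\sum_(n < N) (ind A (dd n))%:C * ip x (e n) * ip (e n) x).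
  rewrite big_ord_recl Re_sum /= indicE mulrC; congr (_ + _); apply: eq_bigr => n _.
  by rewrite (ipC ip (e n)) -mulrA -nsqE -realM /= indicE mulrC.
have -> : Re (ip (Ed dd A x) x) = ind A 0 * sq (p0 x) +
    Re (ip (dop ip e e (fun n => (ind A (dd n))%:C) x) x).
  rewrite /Ed ipDl ipZl !cE /= mul0r subr0 addrC; congr (_ * _ + _).
  by rewrite /sqnorm (p0_ip x (p0_null x)) -p0_sym.
under eq_fun do rewrite E; apply: cvgD; [exact: cvg_cst|exact: cR].
Qed.

End Fixed.
End SpectralMeasure.

(** * A measure lying on one side of its mean is zero *)

Section Concentrated.
Context (R : realType) (m : {measure set R -> \bar R}).

(** The function [c * (t - l)] is positive almost everywhere but has integral 0. The finite second
    moment makes it integrable. *)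
Lemma concentrated_null (B : set R) (l c : R) : (m setT < +oo)%E ->
  (integral m setT (fun t => (t ^+ 2)%:E) < +oo)%E ->
  measurable B -> m (~` B) = 0%E -> (forall t, B t -> 0 < c * (t - l)) ->
  fine (integral m setT (fun t => t%:E)) = l * fine (m setT) -> m setT = 0%E.
Proof.
move=> mT m2 mB mB0 cB ml.
have mfin : m setT \is a fin_num by rewrite ge0_fin_numE.
have ic k : m.-integrable setT (EFin \o cst k).
  apply/integrableP; split; first exact/measurable_EFinP.
  under eq_integral do rewrite /=.
  by rewrite integral_cst// lte_mul_pinfty.
have i1 : m.-integrable setT (fun t : R => (1 + t ^+ 2)%:E).
  have i2 : m.-integrable setT (fun t : R => (t ^+ 2)%:E).
    apply/integrableP; split; first exact/measurable_EFinP/measurable_funX.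
    by under eq_integral do rewrite gee0_abs ?lee_fin ?sqr_ge0//.
  exact: (integrableD measurableT (ic 1) i2).
have it : m.-integrable setT (EFin \o (fun t : R => t)).
  apply: le_integrable i1 => //; first exact/measurable_EFinP.
  move=> t _ /=; rewrite lee_fin [leRHS]ger0_norm ?addr_ge0 ?sqr_ge0//.
  rewrite ler_norml; apply/andP; split; nra.
pose g (t : R) := c * (t - l).
have mg : measurable_fun setT (EFin \o g).
  by apply/measurable_EFinP/measurable_funM => //; apply: measurable_funB.
have itl : m.-integrable setT (fun t : R => (t%:E - l%:E)%E).
  by apply: (integrableB measurableT it (ic l)).
have ig : (integral m setT (EFin \o g) = 0)%E.
  rewrite (_ : EFin \o g = fun t => (c%:E * (t%:E - l%:E))%E); last by apply/funext.
  rewrite integralZl// (integralB_EFin measurableT it (ic l)) /= integral_cst//.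
  have ti : integral m setT (fun t => t%:E) \is a fin_num by exact: integrable_fin_num it.
  have -> : integral m setT (fun t => t%:E) = (l * fine (m setT))%:E by rewrite -ml fineK.
  have -> : (l%:E * m setT = (l * fine (m setT))%:E)%E by rewrite EFinM fineK.
  by rewrite -EFinB subrr mule0.
have aB : {ae m, forall t, B t}.
  by exists (~` B); split => //; exact: measurableC.
have iag : (integral m setT (fun t => `|(EFin \o g) t|) = 0)%E.
  rewrite -ig; apply: ae_eq_integral => //; first exact: measurableT_comp.
  apply: filterS aB => t Bt _ /=; rewrite ger0_norm//; exact/ltW/cB.
have /(ae_eq_integral_abs _ measurableT mg) g0 := iag.
have : {ae m, forall t, False}.
  apply: filterS2 aB g0 => t Bt /(_ I) [] /eqP; have := cB t Bt; rewrite /g => + /eqP h0.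
  by rewrite h0 ltxx.
move=> [N [mN N0 HN]]; apply/eqP; rewrite eq_le measure_ge0 andbT -N0.
by apply: le_measure; rewrite ?inE// => t _; apply: HN => /=.
Qed.
End Concentrated.

Section RealSeries.
Context (R : realType).
Implicit Types r : nat -> R.

Lemma rlim_uniq (u : nat -> R) (a b : R) : u @ \oo --> a -> u @ \oo --> b -> a = b.
Proof. by move=> ua ub; rewrite -(cvg_lim _ ua)// -(cvg_lim _ ub). Qed.

Lemma nneg_series_cvg r C : (forall n, 0 <= r n) -> (forall N, \sum_(n < N) r n <= C) ->
  exists l : R, (fun N => \sum_(n < N) r n) @ \oo --> l.
Proof.
move=> r0 rC; exists (sup (range (fun N => \sum_(n < N) r n))); apply: nondecreasing_cvgn.
  apply/nondecreasing_seqP => n; rewrite big_ord_recr/= lerDl; exact: r0.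
by exists C => _ [N _ <-].
Qed.

Lemma nneg_series_fin r : (forall n, 0 <= r n) ->
  (\sum_(n <oo) (r n)%:E < +oo)%E <-> exists C, forall N, \sum_(n < N) r n <= C.
Proof.
move=> r0; split=> [fin|[C rC]]; last first.
  by have [l rl] := nneg_series_cvg r0 rC; rewrite (series_lim_EFin rl) ltry.
exists (fine (\sum_(n <oo) (r n)%:E)) => N.
rewrite -lee_fin fineK; last by rewrite ge0_fin_numE// nneseries_ge0// => n _ _; rewrite lee_fin.
have := @nneseries_lim_ge R (fun n => (r n)%:E) xpredT 0%N N (ltac:(by move=> n _ _; rewrite lee_fin)).
by rewrite sumEFin big_mkord.
Qed.
End RealSeries.

(** * Diagonal operators, possibly unbounded, and spectral integrals *)

Section SpectralCalculus.
Context (R : realType) (h : completeNormedModType R[i])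
        (ip : {dot h for Num.conj}) (hilb : is_hilbert ip).
Implicit Types (x y z v : h) (c : R[i]) (b : h -> h) (A B : set R) (S T : partial_op h).
Local Notation Re := (@complex.Re R).
Local Notation Im := (@complex.Im R).
Local Notation sq := (sqnorm ip).
Variable (e : nat -> h).
Hypotheses (oe : osys ip e) (e1 : forall n, sq (e n) = 1).

(** Prescribes the domain and the quadratic form, as [is_spectral_integral] does; the vectors [S x]
    are recovered by polarization in [is_diag_coef] and [is_diag_null]. *)
Definition is_diag (dl : nat -> R) S : Prop :=
  [/\ forall x, pdom S x <-> exists C, forall N, \sum_(n < N) dl n ^+ 2 * nsq (ip x (e n)) <= C,
      partial_linear S &
      forall x, pdom S x -> exists q : R,
        (fun N => \sum_(n < N) dl n * nsq (ip x (e n))) @ \oo --> q /\ ip (S x) x = q%:C].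

Lemma sq_hcv (u : nat -> h) x : (fun n => sq (u n - x)) @ \oo --> (0 : R) -> hcv u x.
Proof.
move=> /cvgrPdist_lt H eps e0; have [N _ HN] := H (eps ^+ 2) (exprn_gt0 _ e0).
exists N => n Nn; have := HN n Nn; rewrite /= sub0r normrN ger0_norm ?sq_ge0//.
by rewrite -(hnormE hilb) ltr_pXn2r// ?nnegrE ?hnorm_ge0// ltW.
Qed.

Section Integral.
Variable (dd : nat -> R).

Lemma mud_int x (f : R -> R) : measurable_fun setT f -> f 0 = 0 ->
  (forall n, 0 <= f (dd n)) ->
  integral (mud ip e dd x) setT (EFin \o f) = (\sum_(n <oo) (f (dd n) * nsq (ip x (e n)))%:E)%E.
Proof.
move=> mf f0 fd; have fpt k : 0 <= f (pt dd k) by case: k => //=; rewrite f0.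
have nn k : (0 <= (wt ip e x k * f (pt dd k))%:E)%E by rewrite lee_fin mulr_ge0// wt_ge0.
rewrite /mud disc_int// nneseries_recl//= f0 mulr0 add0e -(nneseries_addn _ nn).
by apply: eq_eseriesr => k _; rewrite addn1 /= mulrC.
Qed.

Lemma Ed_ip A B x y : ip (Ed ip e dd A x) (Ed ip e dd B y) = ip (Ed ip e dd (A `&` B) x) y.
Proof. by rewrite setIC EdI//= (Ed_sym hilb oe dd B (Ed ip e dd A x)). Qed.

(** Norm countable additivity comes from the scalar measure: the pieces are orthogonal, so the
    squared distance from a partial sum to the total is the mass still missing. *)
Lemma Ed_pvm : projection_valued_measure ip (Ed ip e dd).
Proof.
split.
- by move=> A _; exact: Ed_proj.
- exact: EdT.
- by move=> A B _ _; exact: EdI.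
move=> F x mF tF; apply/hcvP.
have mU : measurable (\bigcup_k F k) by exact: bigcupT_measurable.
pose m A := sq (Ed ip e dd A x).
have mE A : measurable A -> mud ip e dd x A = (m A)%:E.
  move=> mA; rewrite -(Ed_vm hilb oe e1 dd x mA) /vector_measure /m /sqnorm.
  by rewrite Ed_ip setIid.
have cm : (fun n => \sum_(k < n) m (F k)) @ \oo --> m (\bigcup_k F k).
  have : (fun n => (\sum_(0 <= i < n) mud ip e dd x (F i))%E) @ \oo -->
      mud ip e dd x (\bigcup_k F k).
    exact: measure_semi_sigma_additive.
  rewrite (mE _ mU) => /fine_cvgP[_]; apply: cvg_trans; apply: near_eq_cvg.
  near=> n => /=; rewrite (eq_bigr (fun k => (m (F k))%:E)); last by move=> i _; rewrite mE.
  by rewrite sumEFin /= big_mkord.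
have EE A B : ip (Ed ip e dd A x) (Ed ip e dd B x) = (m (A `&` B))%:C.
  by rewrite Ed_ip /m -sqE Ed_ip setIid.
have m0 : m set0 = 0.
  have mu0 : mud ip e dd x set0 = 0%E by exact: measure0.
  by have := mE set0 measurable0; rewrite mu0 => -[<-].
have EU n : ip (\sum_(k < n) Ed ip e dd (F k) x) (Ed ip e dd (\bigcup_k F k) x) =
    (\sum_(k < n) m (F k))%:C.
  rewrite ip_suml rmorph_sum; apply: eq_bigr => k _ /=; rewrite EE setIidl//.
  exact: bigcup_sup.
have ES n : sq (\sum_(k < n) Ed ip e dd (F k) x) = \sum_(k < n) m (F k).
  rewrite /sqnorm ip_suml Re_sum; apply: eq_bigr => k _.
  rewrite ip_sumr (bigD1 k)//= EE setIid big1 ?addr0// => j jk; rewrite EE.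
  have /trivIsetP /(_ k j I I) -> := tF; first by rewrite m0.
  by rewrite eq_sym; apply: contra jk => /eqP H; apply/eqP/val_inj.
apply: sq_hcv.
under eq_fun do rewrite sqB ES EU /=.
have : (fun n => \sum_(k < n) m (F k) + m (\bigcup_k F k) - 2 * \sum_(k < n) m (F k)) @ \oo -->
    m (\bigcup_k F k) + m (\bigcup_k F k) - 2 * m (\bigcup_k F k).
  by apply: cvgB; [apply: cvgD; [exact: cm|exact: cvg_cst] | apply: cvgM; [exact: cvg_cst|exact: cm]].
by rewrite (_ : _ + _ - _ * _ = 0)//; ring.
Unshelve. all: by end_near. Qed.

(** The vector measures are discrete, so the domain condition and the form become series. The form
    converges on the domain because [f] is dominated by [f ^+ 2 + 1] at the eigenvalues. *)
Lemma spectral_diag E (f : R -> R) S :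
  (forall A, measurable A -> E A = Ed ip e dd A) -> measurable_fun setT f -> f 0 = 0 ->
  (forall n, 0 <= f (dd n)) ->
  is_spectral_integral ip E f S <-> is_diag (fun n => f (dd n)) S.
Proof.
move=> HE mf f0 fd.
have vm x A : measurable A -> vector_measure ip E x A = mud ip e dd x A.
  by move=> mA; rewrite -(Ed_vm hilb oe e1 dd x mA) /vector_measure HE.
have I1 x : integral (vector_measure ip E x) setT (fun t => (f t)%:E) =
    (\sum_(n <oo) (f (dd n) * nsq (ip x (e n)))%:E)%E.
  by rewrite -mud_int//; exact: integral_raw (vm x).
have I2 x : integral (vector_measure ip E x) setT (fun t => (f t ^+ 2)%:E) =
    (\sum_(n <oo) (f (dd n) ^+ 2 * nsq (ip x (e n)))%:E)%E.
  rewrite -(@mud_int x (fun t => f t ^+ 2)).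
  - exact: integral_raw (vm x).
  - exact: measurable_funX.
  - by rewrite f0 expr0n.
  - by move=> n; exact: sqr_ge0.
have dom x : (integral (vector_measure ip E x) setT (fun t => (f t ^+ 2)%:E) < +oo)%E <->
    exists C, forall N, \sum_(n < N) f (dd n) ^+ 2 * nsq (ip x (e n)) <= C.
  by rewrite I2; apply: nneg_series_fin => n; rewrite mulr_ge0 ?sqr_ge0 ?nsq_ge0.
have q x : (exists C, forall N, \sum_(n < N) f (dd n) ^+ 2 * nsq (ip x (e n)) <= C) ->
    exists l : R, (fun N => \sum_(n < N) f (dd n) * nsq (ip x (e n))) @ \oo --> l /\
      fine (integral (vector_measure ip E x) setT (fun t => (f t)%:E)) = l.
  move=> [C HC]; have [|N|l cl] := @nneg_series_cvg R (fun n => f (dd n) * nsq (ip x (e n))) (C + sq x).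
  - by move=> n; rewrite mulr_ge0 ?nsq_ge0.
  - apply: le_trans (lerD (HC N) (osys_bessel x N oe)); rewrite -big_split/=.
    apply: ler_sum => n _; set u := nsq _; have u0 : 0 <= u by exact: nsq_ge0.
    have := mulr_ge0 (sqr_ge0 (f (dd n) - 1)) u0; have := mulr_ge0 (fd n) u0.
    by rewrite sqrrB1 mulrDl mulrBl mul1r mulrnAl; move: (f (dd n) * u) (f (dd n) ^+ 2 * u) => p r; lra.
  by exists l; split => //; rewrite I1 (series_lim_EFin cl).
split=> [[dS lS qS]|[dS lS qS]]; split => //.
- by move=> x; rewrite dS /=; exact: dom.
- move=> x Sx; have /dom/q[l [cl El]] : (integral (vector_measure ip E x) setT (fun t => (f t ^+ 2)%:E) < +oo)%E.
    by move: Sx; rewrite dS.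
  by exists l; split => //; rewrite qS// El.
- by apply/seteqP; split => x /= H; [apply/(dom x)/dS|apply/dS/(dom x)].
- move=> x Sx; have [l [cl ->]] := qS x Sx; have [l' [cl' ->]] := q x ((dS x).1 Sx).
  by congr (_%:C); exact: rlim_uniq cl cl'.
Qed.
End Integral.

Section Diagonal.
Variable (dl : nat -> R).

Definition diag_op : partial_op h :=
  PartialOp [set x | exists C, forall N, \sum_(n < N) dl n ^+ 2 * nsq (ip x (e n)) <= C]
    (fun x => hsum e (fun n => (dl n)%:C * ip x (e n))).

Lemma diag_op_cvg x : pdom diag_op x ->
  hcv (fun N => \sum_(n < N) ((dl n)%:C * ip x (e n)) *: e n) (diag_op x).
Proof.
move=> [C HC]; apply: (hsumP hilb oe) => N; apply: le_trans (HC N).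
by apply: ler_sum => n _; rewrite nsqM nsqR.
Qed.

Lemma diag_op_diag : is_diag dl diag_op.
Proof.
split=> //; first split.
- by exists 0 => N; rewrite big1// => n _; rewrite ip0l nsq0 mulr0.
- move=> c x y Sx Sy.
  have Sxy : pdom diag_op (c *: x + y).
    move: Sx Sy => [C HC] [D HD]; exists (2 * (nsq c * C + D)) => N.
    have H : \sum_(n < N) dl n ^+ 2 * nsq (ip (c *: x + y) (e n)) <=
       2 * (nsq c * (\sum_(n < N) dl n ^+ 2 * nsq (ip x (e n))) + \sum_(n < N) dl n ^+ 2 * nsq (ip y (e n))).
      rewrite mulr_sumr -big_split mulr_sumr /=; apply: ler_sum => n _.
      rewrite ipDl ipZl; set a := ip x _; set b := ip y _.
      have : nsq (c * a + b) <= 2 * (nsq (c * a) + nsq b).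
        by rewrite mulrDr; exact: nsqD_le.
      rewrite nsqM => H; apply: (le_trans (ler_wpM2l (sqr_ge0 (dl n)) H)).
      by rewrite le_eqVlt; apply/orP; left; apply/eqP; ring.
    apply: le_trans H _; apply: ler_wpM2l => //; apply: lerD => //.
    by apply: ler_wpM2l => //; exact: nsq_ge0.
  split=> //; apply: hcv_uniq (diag_op_cvg Sxy) _.
  have := hcvD (hcvZ c (diag_op_cvg Sx)) (diag_op_cvg Sy); congr hcv.
  apply/funext => N; rewrite scaler_sumr -big_split; apply: eq_bigr => n _ /=.
  by rewrite ipDl ipZl scalerA -scalerDl; congr (_ *: _); ring.
move=> x Sx; have [cR cI] := hcv_ip hilb x (diag_op_cvg Sx).
have E N : ip (\sum_(n < N) ((dl n)%:C * ip x (e n)) *: e n) x =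
    (\sum_(n < N) dl n * nsq (ip x (e n)))%:C.
  rewrite ip_suml rmorph_sum; apply: eq_bigr => n _.
  by rewrite ipZl (ipC ip (e n)) -mulrA -nsqE -realM.
exists (Re (ip (diag_op x) x)); split.
  by apply: cvg_eq cR => N; rewrite E.
apply: complex_ext => //=; apply: rlim_uniq cI _.
by apply: cvg_eq (cvg_cst 0) => N; rewrite E.
Qed.

Variable S : partial_op h.
Hypothesis Sd : is_diag dl S.

Lemma is_diag_lin c x y : pdom S x -> pdom S y ->
  pdom S (c *: x + y) /\ S (c *: x + y) = c *: S x + S y.
Proof. by case: Sd => _ [_ lS] _; exact: lS. Qed.

Lemma is_diag_e n : pdom S (e n).
Proof.
case: Sd => dS _ _; apply/dS; exists (dl n ^+ 2) => N.
have [nN|Nn] := ltnP n N; last first.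
  rewrite big1 ?sqr_ge0// => i _; case: oe => o _; rewrite o ?nsq0 ?mulr0//.
  by rewrite gtn_eqF// (leq_trans (ltn_ord i)).
rewrite (bigD1 (Ordinal nN))//= big1 ?addr0.
  by rewrite sqE e1 nsqR expr1n mulr1.
move=> i im; case: oe => o _; rewrite o ?nsq0 ?mulr0// eq_sym.
by apply: contra im => /eqP H; apply/eqP/val_inj.
Qed.

Lemma is_diag_null_dom v : null ip e v -> pdom S v.
Proof.
case: Sd => dS _ _ nv; apply/dS; exists 0 => N.
by rewrite big1// => i _; rewrite nv nsq0 mulr0.
Qed.

Lemma quad_expand x y c : pdom S x -> pdom S y ->
  ip (S (c *: y + x)) (c *: y + x) =
  ip (S x) x + cj c * ip (S x) y + c * ip (S y) x + (nsq c)%:C * ip (S y) y.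
Proof.
move=> Sx Sy; have [_ ->] := is_diag_lin c Sy Sx.
by rewrite !(ipDl, ipDr, ipZl, ipZr) nsqE; ring.
Qed.

Lemma polar_solve (P Q z : R[i]) : P + Q = (2 * Re z)%:C ->
  - 'i%C * P + 'i%C * Q = (2 * Im z)%:C -> P = z.
Proof.
case: P Q z => [p1 p2] [q1 q2] [z1 z2] /= [a1 a2] [b1 b2].
by apply: complex_ext => /=; lra.
Qed.

(** Polarization: the value of [ip (S x) y] is determined by the form at [c *: y + x], through the
    cases [c = 1] and [c = 'i]. *)
Lemma is_diag_polar x y (t : R[i]) : pdom S x -> pdom S y ->
  (forall c q r s, (fun N => \sum_(n < N) dl n * nsq (ip x (e n))) @ \oo --> q ->
     (fun N => \sum_(n < N) dl n * nsq (ip y (e n))) @ \oo --> r ->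
     (fun N => \sum_(n < N) dl n * nsq (ip (c *: y + x) (e n))) @ \oo --> s ->
     s = q + nsq c * r + 2 * Re (t * cj c)) ->
  ip (S x) y = t.
Proof.
move=> Sx Sy H; have [_ _ qS] := Sd.
have [q [cq Eq]] := qS x Sx; have [r [cr Er]] := qS y Sy.
have K c : cj c * ip (S x) y + c * ip (S y) x = (2 * Re (t * cj c))%:C.
  have [Sxy _] := is_diag_lin c Sy Sx; have [s [cs Es]] := qS _ Sxy.
  have := quad_expand c Sx Sy; rewrite Es Eq Er (H c q r s cq cr cs).
  rewrite -realM; set u := cj c * _; set v := c * _ => Q.
  have := congr1 Re Q; have := congr1 Im Q; rewrite !cE /= => A B.
  by apply: complex_ext; rewrite !cE /=; lra.
apply: (@polar_solve _ (ip (S y) x)).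
  by have := K 1; rewrite cj1 !mul1r mulr1.
have := K 'i%C; have -> : cj 'i%C = - 'i%C :> R[i] by apply: complex_ext; rewrite /cj /= ?oppr0.
by move=> ->; congr (_%:C); rewrite !cE /=; ring.
Qed.

Lemma is_diag_coef x n : pdom S x -> ip (S x) (e n) = (dl n)%:C * ip x (e n).
Proof.
move=> Sx; apply: is_diag_polar => //; first exact: is_diag_e.
move=> c q r s cq cr cs.
have ein (i : nat) : ip (e n) (e i) = (i == n)%:R.
  by have [->|im] := eqVneq i n; [rewrite sqE e1|case: oe => o _; rewrite o// eq_sym].
(* Adding [c *: e n] to [x] changes the n-th term of the series only, and changes it by [u]. *)
pose u := dl n * (nsq c + 2 * Re (ip x (e n) * cj c)).
have Es : s = q + u.
  apply: rlim_uniq cs _; apply: cvg_trans (cvgD cq (cvg_cst u)).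
  apply: near_eq_cvg; exists n.+1 => // N /= nN.
  rewrite -[LHS]/(\sum_(i < N) dl i * nsq (ip x (e i)) + u).
  rewrite (bigD1 (Ordinal nN))//= [RHS](bigD1 (Ordinal nN))//= addrAC; congr (_ + _).
    by rewrite ipDl ipZl ein eqxx mulr1 /u /nsq !cE; ring.
  apply: eq_bigr => i im; rewrite ipDl ipZl ein (_ : (i == n :> nat) = false) ?mulr0 ?add0r//.
  by apply/negbTE; apply: contra im => /eqP H; apply/eqP/val_inj.
have -> : r = dl n.
  apply: rlim_uniq cr _; apply: cvg_trans (cvg_cst (dl n)).
  apply: near_eq_cvg; exists n.+1 => // N /= nN.
  rewrite (bigD1 (Ordinal nN))//= big1 ?addr0 ?ein ?eqxx ?nsqR ?expr1n ?mulr1//.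
  move=> i im; rewrite ein (_ : (i == n :> nat) = false) ?nsq0 ?mulr0//.
  by apply/negbTE; apply: contra im => /eqP H; apply/eqP/val_inj.
  exact: eventually_filter.
by rewrite Es /u -mulrA !cE /=; ring.
Qed.

Lemma is_diag_null x v : null ip e v -> pdom S x -> ip (S x) v = 0.
Proof.
move=> nv Sx; apply: is_diag_polar => //; first exact: is_diag_null_dom.
move=> c q r s cq cr cs.
have -> : r = 0.
  apply: rlim_uniq cr _; apply: cvg_eq (cvg_cst 0) => N.
  by rewrite big1// => i _; rewrite nv nsq0 mulr0.
rewrite mulr0 mul0r mulr0 !addr0; apply: rlim_uniq cs _; apply: cvg_eq cq => N.
by apply: eq_bigr => i _; rewrite ipDl ipZl nv mulr0 add0r.
Qed.

Lemma is_diag_eig n : S (e n) = (dl n)%:C *: e n.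
Proof.
apply: (vec_ext (ip := ip) (e := e)) => [i|v nv].
  rewrite (is_diag_coef i (is_diag_e n)) ipZl.
  by have [->//|im] := eqVneq i n; case: oe => o _; rewrite o ?mulr0// eq_sym.
by rewrite (is_diag_null nv (is_diag_e n)) ipZl (ipC _ (e n)) nv cj0 mulr0.
Qed.

Lemma is_diag_null0 v : null ip e v -> S v = 0.
Proof.
move=> nv; apply: (vec_ext (ip := ip) (e := e)) => [i|w nw].
  by rewrite (is_diag_coef i (is_diag_null_dom nv)) nv mulr0 ip0l.
by rewrite (is_diag_null nw (is_diag_null_dom nv)) ip0l.
Qed.

Lemma is_diag_bounded D : (forall n, nsq (dl n)%:C <= D) ->
  pdom S = setT /\ S = dop ip e e (fun n => (dl n)%:C) :> (h -> h).
Proof.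
move=> b1; have dT x : pdom S x.
  case: Sd => dS _ _; apply/dS; exists (D * sq x) => N.
  have D0 : 0 <= D by apply: le_trans (b1 0%N); exact: nsq_ge0.
  apply: le_trans (ler_wpM2l D0 (osys_bessel x N oe)); rewrite mulr_sumr.
  by apply: ler_sum => n _; rewrite ler_wpM2r ?nsq_ge0//; have := b1 n; rewrite nsqR.
split; first by apply/seteqP; split.
apply/funext => x; apply: (vec_ext (ip := ip) (e := e)) => [n|v nv].
  by rewrite is_diag_coef// (dop_coef hilb oe oe b1) e1 mulr1.
by rewrite is_diag_null// (dop_orth hilb oe oe b1)// => n; rewrite ipC nv cj0.
Qed.
End Diagonal.
End SpectralCalculus.

(** * Uniqueness of the spectral measure of a diagonal operator *)

Section SpectralUniqueness.
Context (R : realType) (h : completeNormedModType R[i])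
        (ip : {dot h for Num.conj}) (hilb : is_hilbert ip).
Implicit Types (x y z v : h) (c : R[i]) (b : h -> h) (A B : set R).
Local Notation Re := (@complex.Re R).
Local Notation Im := (@complex.Im R).
Local Notation sq := (sqnorm ip).

Section Measure.
Variables (E : set R -> h -> h).
Hypothesis pvm : projection_valued_measure ip E.

Lemma pvm_lin A : measurable A -> linear (E A).
Proof. by case: pvm => H _ _ _ /H[]. Qed.

Lemma pvm_sym A x y : measurable A -> ip (E A x) y = ip x (E A y).
Proof. by case: pvm => H _ _ _ /H[]. Qed.

Lemma pvmI A B x : measurable A -> measurable B -> E A (E B x) = E (A `&` B) x.
Proof. by case: pvm => _ _ H _ mA mB; rewrite H. Qed.

Lemma pvm0 x : E set0 x = 0.
Proof.
case: pvm => _ _ _ sa.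
have /hcvP H : (fun n => \sum_(k < n) E ((fun=> set0) k) x) @ \oo --> E (\bigcup_(k : nat) set0) x.
  by apply: sa => // i j _ _ /set0P; rewrite setI0 eqxx.
rewrite bigcup0// in H; apply: (@addrI _ (E set0 x)); rewrite addr0.
have H1 : hcv (fun n => \sum_(k < n) E set0 x + E set0 x) (E set0 x + E set0 x).
  by apply: hcvD => //; exact: hcv_cst.
apply: hcv_uniq H1 _ => eps e0; have [N HN] := H eps e0.
by exists N => n Nn; have := HN n.+1 (leqW Nn); rewrite big_ord_recr.
Qed.

Lemma pvmU A B x : measurable A -> measurable B -> A `&` B = set0 ->
  E (A `|` B) x = E A x + E B x.
Proof.
move=> mA mB AB; case: pvm => _ _ _ sa.
have /hcvP H : (fun n => \sum_(k < n) E (bigcup2 A B k) x) @ \oo --> E (\bigcup_k (bigcup2 A B k)) x.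
  apply: sa; first by move=> [|[|k]] //=.
  by apply/trivIsetP => -[|[|i]] [|[|j]] //= _ _ _; rewrite ?setI0 ?set0I// setIC.
rewrite bigcup2E in H; apply: hcv_uniq H _ => eps e0; exists 2%N => n n2.
rewrite (_ : \sum_(k < n) _ = E A x + E B x) ?subrr ?hnorm0//.
rewrite -(big_mkord xpredT (fun k => E (bigcup2 A B k) x)) (big_cat_nat (n := 2%N))//=.
rewrite [X in _ + X]big1_seq ?addr0.
  by rewrite big_nat_recr//= big_nat1.
by move=> i; rewrite mem_index_iota => /andP[_ /andP[+ _]]; case: i => [|[|i]] //=; rewrite pvm0.
Qed.

Lemma pvm_ip A B x y : measurable A -> measurable B ->
  ip (E A x) (E B y) = ip (E (A `&` B) x) y.
Proof. by move=> mA mB; rewrite -pvm_sym// setIC -pvmI. Qed.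

Lemma pvm_sqE A x : measurable A -> Re (ip (E A x) x) = sq (E A x).
Proof. by move=> mA; rewrite /sqnorm pvm_ip// setIid. Qed.

Section Packed.
Variable x : h.
(** The vector measure as a genuine measure: the value 0 off the measurable sets secures
    nonnegativity everywhere. *)
Definition packed A : \bar R :=
  if pselect (measurable A) then vector_measure ip E x A else 0%E.

Lemma packedE A : measurable A -> packed A = vector_measure ip E x A.
Proof. by rewrite /packed; case: pselect. Qed.
Lemma packed0 : packed set0 = 0%E.
Proof. by rewrite packedE// /vector_measure pvm0 ip0l. Qed.
Lemma packed_ge0 A : (0 <= packed A)%E.
Proof.
rewrite /packed; case: pselect => // mA.
by rewrite /vector_measure lee_fin pvm_sqE// sq_ge0.
Qed.
Lemma packed_sigma : semi_sigma_additive packed.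
Proof.
move=> F mF tF mU; rewrite packedE//; case: pvm => _ _ _ sa.
have /hcvP/hcv_Re cR := sa F x mF tF.
rewrite (_ : (fun n => _) = EFin \o (fun n => Re (ip (\sum_(k < n) E (F k) x) x))).
  by apply: cvg_EFin; [near=> n|exact: cR].
apply/funext => n /=; rewrite ip_suml Re_sum -sumEFin big_mkord.
by apply: eq_bigr => k _; rewrite packedE.
Unshelve. all: by end_near. Qed.

HB.instance Definition _ := isMeasure.Build _ _ _ packed packed0 packed_ge0 packed_sigma.
End Packed.

Section Eigenvector.
Variable T : partial_op h.
Hypothesis sT : is_spectral_integral ip E id T.
Variables (l : R) (v : h).
Hypotheses (dv : pdom T v) (Tv : T v = l%:C *: v).

(** Split [v] into [w] on [B] and [u] off it. For [nsq c = 1] the vector [c *: u + w] has the vector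
    measure of [v], so the form of [T] does not depend on [c] and the cross term [ip (T u) w]
    vanishes. Hence [ip (T w) w] is [l] times the squared norm of [w]: the measure of [w] is carried
    by [B], on one side of [l], and has mean [l], so it is null. *)
Lemma pvm_eigen_half B (k : R) : measurable B -> (forall t, B t -> 0 < k * (t - l)) -> E B v = 0.
Proof.
move=> mB kB; have mBC : measurable (~` B) by exact: measurableC.
set w := E B v; set u := E (~` B) v.
have vwu : v = w + u.
  rewrite /w /u -pvmU ?setICr// setUv; by case: pvm => _ ->.
have vmE c A : nsq c = 1 -> measurable A ->
    vector_measure ip E (c *: u + w) A = vector_measure ip E v A.
  move=> c1 mA; rewrite /vector_measure; congr (_%:E).
  rewrite pvm_sqE// pvm_sqE//.
  have lE := pvm_lin mA; rewrite [in RHS]vwu lE (linD lE) !sqD sqZ c1 mul1r.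
  have Z : ip (E A u) (E A w) = 0.
    by rewrite pvm_ip// /u pvmI// /w ?pvm_ip//; [rewrite -setIA setICl setI0 pvm0 ip0l | do 2?apply: measurableI | apply: measurableI].
  by rewrite ipZl Z (ipC _ (E A w)) Z cj0 mulr0 /= mulr0 !addr0 addrC.
have intE c (f : R -> R) : nsq c = 1 ->
    integral (vector_measure ip E (c *: u + w)) setT (fun t => (f t)%:E) =
    integral (packed v) setT (fun t => (f t)%:E).
  by move=> c1; apply: integral_raw => A mA; rewrite vmE//; exact/esym/packedE.
have intv (f : R -> R) : integral (vector_measure ip E v) setT (fun t => (f t)%:E) =
    integral (packed v) setT (fun t => (f t)%:E).
  by apply: integral_raw => A mA; exact/esym/packedE.
case: sT => dT [d0 lT] qT.
have dcu c : nsq c = 1 -> pdom T (c *: u + w).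
  by move=> c1; move: dv; rewrite dT /= (intE c (fun t => t ^+ 2) c1) (intv (fun t => t ^+ 2)).
have qcu c : nsq c = 1 -> ip (T (c *: u + w)) (c *: u + w) = ip (T v) v.
  by move=> c1; rewrite qT ?qT//; [rewrite (intE c id c1) (intv id)|exact: dcu].
have n1 : nsq (1 : R[i]) = 1 by rewrite /nsq /=; ring.
have nN1 : nsq (- 1 : R[i]) = 1 by rewrite nsqN.
have ni : nsq ('i%C : R[i]) = 1 by rewrite /nsq /=; ring.
have nNi : nsq (- 'i%C : R[i]) = 1 by rewrite nsqN.
(* [w] is the half-sum of [u + w] and [- u + w], both in the domain because it depends on the vector
   measure alone. *)
have dw : pdom T w.
  have [H _] := lT (2^-1)%:C (1 *: u + w) 0 (dcu 1 n1) d0.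
  have [H' _] := lT (2^-1)%:C (- 1 *: u + w) _ (dcu _ nN1) H.
  suff E0 : w = (2^-1)%:C *: (- 1 *: u + w) + ((2^-1)%:C *: (1 *: u + w) + 0) by rewrite E0.
  by apply: (ip_inj (ip := ip)) => z; rewrite !(ipDl,ipZl,ip0l); apply: complex_ext; rewrite !cE /=; field.
have du : pdom T u.
  have [H _] := lT (-1) w (1 *: u + w) dw (dcu 1 n1).
  by move: H; rewrite scaleN1r scale1r addrCA addNr addr0.
have Tcu c : T (c *: u + w) = c *: T u + T w by case: (lT c u w du dw).
have wu0 : ip w u = 0.
  by rewrite /w /u pvm_ip// setICr pvm0 ip0l.
have Z : ip (T w) w = l%:C * (sq w)%:C /\ ip (T u) w = 0.
  have Q c : nsq c = 1 -> c * ip (T u) w + cj c * ip (T w) u = ip (T v) v - ip (T u) u - ip (T w) w.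
    move=> c1; rewrite -(qcu c c1) Tcu !(ipDl, ipDr, ipZl, ipZr).
    have nc : c * cj c = 1 by rewrite -nsqE c1.
    apply/eqP; rewrite -subr_eq0; apply/eqP.
    transitivity ((1 - c * cj c) * ip (T u) u); last by rewrite nc subrr mul0r.
    by ring.
  have Q1 := Q _ n1; have Q2 := Q _ nN1; have Q3 := Q _ ni; have Q4 := Q _ nNi.
  have Tuw : ip (T u) w = 0.
    move: Q1 Q2 Q3 Q4; rewrite !conjN cj1.
    case: (ip (T u) w) => [p1 p2]; case: (ip (T w) u) => [q1 q2]; case: (_ - _ - _) => r1 r2.
    rewrite /cj /= => -[a1 a2] [b1 b2] [c1 c2] [d1 d2]; apply: complex_ext => /=; lra.
  split=> //.
  have : ip (T v) w = l%:C * ip v w by rewrite Tv ipZl.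
  have -> : T v = T u + T w by rewrite vwu addrC -{1}(scale1r u) Tcu scale1r.
  by rewrite ipDl Tuw add0r vwu ipDl (ipC _ u) wu0 cj0 addr0 sqE.
have wT : E setT w = w by case: pvm => _ ->.
have pw A : measurable A -> packed w A = (sq (E A w))%:E.
  by move=> mA; rewrite packedE// /vector_measure pvm_sqE.
pose M : {measure set R -> \bar R} := packed w.
have {}pw A : measurable A -> M A = (sq (E A w))%:E by move=> mA; exact: pw.
have : M setT = 0%E.
  apply: (@concentrated_null R M B l k) => //.
  - by rewrite pw// ltry.
  - move: dw; rewrite dT /= (_ : integral _ _ _ = integral M setT (fun t => (t ^+ 2)%:E))//.
    by apply: integral_raw => A mA; exact/esym/packedE.
  - by rewrite pw// /w pvmI// setICl pvm0 sq0.
  rewrite pw// wT /=; have := qT w dw; rewrite Z.1 -realM => -[->].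
  by congr (fine _); apply/esym/integral_raw => A mA; exact/esym/packedE.
by rewrite pw// wT => -[]; exact: sq_eq0.
Qed.

(** The two open half-lines ending at [l] kill [v], so its mass sits at the point [l]. *)
Lemma pvm_eigen A : measurable A -> E A v = (ind A l)%:C *: v.
Proof.
have H1 : E `]l, +oo[%classic v = 0.
  apply: (@pvm_eigen_half _ 1); first exact: measurable_itv.
  by move=> t /=; rewrite in_itv /= andbT mul1r subr_gt0.
have H2 : E `]-oo, l[%classic v = 0.
  apply: (@pvm_eigen_half _ (-1)); first exact: measurable_itv.
  by move=> t /=; rewrite in_itv /= mulN1r opprB subr_gt0.
have Ev : E [set l] v = v.
  have ET : E setT v = v by case: pvm => _ ->.
  rewrite -{2}ET (_ : setT = `]l, +oo[%classic `|` (`]-oo, l[%classic `|` [set l])); last first.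
    apply/esym/seteqP; split => // t _ /=; rewrite !in_itv /= andbT.
    by have [|tl|->] := ltgtP t l; [right; left|left|right; right].
  rewrite pvmU//; last 2 first.
  - exact: measurableU.
  - apply/seteqP; split => // t /=; rewrite !in_itv /= andbT => -[lt [tl|tl]].
      by move: (lt_trans lt tl); rewrite ltxx.
    by rewrite tl ltxx in lt.
  rewrite pvmU// ?H1 ?H2 ?add0r//.
  by apply/seteqP; split => // t /=; rewrite !in_itv /= => -[tl te]; rewrite te ltxx in tl.
move=> mA; rewrite -{1}Ev pvmI// /ind; have [/set_mem lA|lA] := boolP (l \in A).
  by rewrite setIidr ?Ev ?scale1r// => t ->.
rewrite scale0r (_ : A `&` _ = set0) ?pvm0//.
by apply/seteqP; split => // t /= [At te]; move: lA; rewrite notin_setE; apply; rewrite -te.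
Qed.
End Eigenvector.
End Measure.

Variable (e : nat -> h).
Hypotheses (oe : osys ip e) (e1 : forall n, sq (e n) = 1).
Variables (dd : nat -> R) (T : partial_op h).
Hypotheses (dd0 : forall n, 0 <= dd n) (Td : is_diag ip e dd T).

(** The spectral measure is picked by choice; [pvm_eigen] dictates its action on each [e n] and on
    the null vectors, which determines it. *)
Lemma spectral_measure_diag A : measurable A -> spectral_measure ip T A = Ed ip e dd A.
Proof.
have [pvm sT] : is_spectral_measure ip T (spectral_measure ip T).
  apply: xgetPex; exists (Ed ip e dd); split; first exact: Ed_pvm.
  by apply/(spectral_diag hilb oe e1) => //; exact: measurable_id.
move=> mA; apply/funext => x; apply: (vec_ext (ip := ip) (e := e)) => [n|v nv].
  rewrite Ed_coef// (pvm_sym pvm)//.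
  have -> := pvm_eigen pvm sT (is_diag_e oe e1 Td n) (is_diag_eig oe e1 Td n) mA.
  by rewrite ipZr conjR.
rewrite Ed_null// (pvm_sym pvm)//.
have Tv : T v = (0 : R)%:C *: v by rewrite (is_diag_null0 oe e1 Td nv) scale0r.
have -> := pvm_eigen pvm sT (is_diag_null_dom Td nv) Tv mA.
by rewrite ipZr conjR.
Qed.

Lemma functional_calculus_diag (f : R -> R) :
  measurable_fun setT (fun t : R => if 0 < t then f t else 0) -> (forall t, 0 < t -> 0 <= f t) ->
  is_diag ip e (fun n => if 0 < dd n then f (dd n) else 0) (functional_calculus ip T f).
Proof.
move=> mf f0; have D := @spectral_diag _ _ _ hilb _ oe e1 dd (spectral_measure ip T) (fun t : R => if 0 < t then f t else 0).
have {}D S := D S spectral_measure_diag mf (ltac:(by rewrite ltxx)) (ltac:(by move=> n; case: ifP => // /f0)).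
apply/D; apply: (@xgetPex _ (PartialOp set0 id) (is_spectral_integral _ _ _)).
by exists (diag_op ip e (fun n => if 0 < dd n then f (dd n) else 0)); apply/D; exact: diag_op_diag.
Qed.
End SpectralUniqueness.

(** * Eigenbasis of [L] from its compact inverse *)

Section Eigenbasis.
Context (R : realType) (h : completeNormedModType R[i])
        (ip : {dot h for Num.conj}) (hilb : is_hilbert ip).
Implicit Types (x y z v : h) (c : R[i]) (b : h -> h).
Local Notation Re := (@complex.Re R).
Local Notation Im := (@complex.Im R).
Local Notation sq := (sqnorm ip).
Variables (L : partial_op h).
Hypotheses (Lsa : selfadjoint ip L) (Lnn : nonnegative ip L) (Lub : unbounded L).

Lemma sa_lin c x y : pdom L x -> pdom L y ->
  pdom L (c *: x + y) /\ L (c *: x + y) = c *: L x + L y.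
Proof. by case: Lsa => -[_ lL] _ _; exact: lL. Qed.

Lemma sa_dom0 : pdom L 0. Proof. by case: Lsa => -[]. Qed.

Lemma sa_sym x y : pdom L x -> pdom L y -> ip (L x) y = ip x (L y).
Proof. by case: Lsa => _ _ H dx dy; exact: (H y (L y)).2. Qed.

Local Notation kernel := Defs.kernel.

(** Self-adjointness with domains puts every vector orthogonal to the range into the domain; the
    kernel is therefore closed. *)
Lemma kernelP v : kernel L v <-> forall x, pdom L x -> ip (L x) v = 0.
Proof.
case: Lsa => _ _ H; split=> [[dv Lv] x dx|H0]; first by rewrite sa_sym// Lv ip0r.
by apply/H => x dx; rewrite H0// ip0r.
Qed.

Lemma kernel_sub : subspace (kernel L).
Proof.
split=> [|c x y [dx Lx] [dy Ly]].
  by apply/kernelP => x _; rewrite ip0r.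
by have [d E] := sa_lin c dx dy; split => //; rewrite E Lx Ly scaler0 addr0.
Qed.

Lemma kernel_decomp x : exists x0 y, [/\ x = x0 + y, kernel L x0 & orthogonal_to ip (kernel L) y].
Proof.
have [y [u [uk uy xy]]] := projection hilb x kernel_sub.
exists y, (x - y); split; [by rewrite addrC subrK| |exact: xy].
apply/kernelP => z dz; have cz := hcv_ip hilb (L z) uy.
rewrite ipC (_ : ip y (L z) = 0) ?cj0//; apply: ccv_uniq cz _.
apply: ccv_near (ccv_cst 0); exists 0%N => n _; rewrite ipC.
by have /kernelP -> := uk n; rewrite ?cj0.
Qed.

Section Inverse.
Variable K : h -> h.
Hypotheses (cK : compact_op K) (iK : inverse_off_kernel ip L K).
Local Notation perp := (orthogonal_to ip (kernel L)).

Let lK : linear K. Proof. exact: compact_linear cK. Qed.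

Lemma inverse_decomp x x0 y : x = x0 + y -> kernel L x0 -> K x = K y.
Proof. by move=> -> k0; rewrite (linD lK); case: iK => -> //; rewrite add0r. Qed.

Lemma inverse_perp x : perp (K x) /\ pdom L (K x).
Proof.
have [x0 [y [E k0 py]]] := kernel_decomp x; rewrite (inverse_decomp E k0).
by case: iK => _ /(_ y py)[].
Qed.

(** For [y] orthogonal to the kernel, [ip (K y) y] is the form of [L] at [K y], up to symmetry. *)
Lemma inverse_pos : positive_op ip K.
Proof.
split; first exact: (compact_bounded cK).
move=> x; have [x0 [y [E k0 py]]] := kernel_decomp x.
case: iK => _ /(_ y py)[pK dK LK]; rewrite (inverse_decomp E k0) E ipDr (pK _ k0) add0r.
by rewrite -{2}LK -sa_sym//; exact: Lnn.
Qed.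

Lemma perp_range x : pdom L x -> perp (L x).
Proof. by move=> dx v /kernelP; apply. Qed.

Section Diagonalized.
Variables (mu : nat -> R) (e : nat -> h).
Hypothesis dK : diagonal ip K mu e.

Lemma perp_basis n : 0 < mu n -> [/\ sq (e n) = 1, perp (e n), pdom L (e n) & L (e n) = ((mu n)^-1)%:C *: e n].
Proof.
move=> m0; have [[[_ oe] ez] _ _ _ _] := dK.
have ne : e n <> 0 by move=> /ez E; rewrite E ltxx in m0.
have Ke : e n = ((mu n)^-1)%:C *: K (e n) + 0.
  by rewrite addr0 (diag_eig hilb n dK) scalerA -realM mulVf ?gt_eqF// scale1r.
have [pK dKe] := inverse_perp (e n).
have pe : perp (e n) by move=> v kv; rewrite Ke addr0 ipZl pK// mulr0.
have [de _] := sa_lin ((mu n)^-1)%:C dKe sa_dom0; rewrite -Ke in de.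
split => //; first by have [] := oe n.
case: iK => _ /(_ _ pe)[_ _ LK]; move: LK; rewrite (diag_eig hilb n dK).
have [_] := sa_lin (mu n)%:C de sa_dom0; rewrite addr0 => -> E.
have L0 : L 0 = 0.
  by have [_] := sa_lin (-1) sa_dom0 sa_dom0; rewrite scaleN1r scaleN1r addNr addNr.
by rewrite -{2}E L0 addr0 scalerA -realM mulVf ?gt_eqF// scale1r.
Qed.

Lemma perp_eq0 y : perp y -> (forall n, 0 < mu n -> ip y (e n) = 0) -> y = 0.
Proof.
move=> py H; have L0 : L 0 = 0.
  by have [_] := sa_lin (-1) sa_dom0 sa_dom0; rewrite scaleN1r scaleN1r addNr addNr.
case: iK => _ /(_ y py)[_ _ <-]; rewrite (_ : K y = 0)//.
have [_ m0 _ _ HK] := dK; apply: hcv_uniq (HK y) _ => eps e0; exists 0%N => N _.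
rewrite big1 ?subrr ?hnorm0// => n _.
have := m0 n; rewrite le_eqVlt => /orP[/eqP <-|/H ->]; first by rewrite mul0r scale0r.
by rewrite mulr0 scale0r.
Qed.

(** If [mu n = 0], the range of [L] is spanned by finitely many eigenvectors and [L] is bounded by
    their eigenvalues, against unboundedness. So the nonzero eigenvalues, with multiplicity, are
    infinitely many and [e] is orthonormal. *)
Lemma inverse_eig_pos n : 0 < mu n.
Proof.
have [[[oo oe] ez] m0 md _ HK] := dK.
rewrite lt_neqAle m0 andbT; apply/negP => /eqP mn0; apply: Lub.
have mz i : (n <= i)%N -> mu i = 0 by move=> ni; apply/eqP; rewrite eq_le m0 andbT mn0; exact: md.
have key x : pdom L x -> sq (L x) <= \sum_(i < n) (mu i)^-1 ^+ 2 * sq x.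
  move=> dx.
  pose c i := if 0 < mu i then ip (L x) (e i) else 0.
  have E : L x = \sum_(i < n) c i *: e i.
    apply/eqP; rewrite -subr_eq0; apply/eqP/perp_eq0.
      move=> v kv; rewrite ipBl (perp_range dx kv) ip_suml big1 ?subrr// => i _.
      rewrite ipZl /c; case: ifPn => [mi|]; last by rewrite mul0r.
      by have [_ pe _ _] := perp_basis mi; rewrite (pe v kv) mulr0.
    move=> k mk; have kn : (k < n)%N by rewrite ltnNge; apply/negP => /mz E; rewrite E ltxx in mk.
    rewrite ipBl (ip_sum_osys c)// /c mk.
    by have [-> _ _ _] := perp_basis mk; rewrite mulr1 subrr.
  rewrite {1}E -(big_mkord xpredT (fun i => c i *: e i)) sq_sum_ortho; last 2 first.
  - exact: iota_uniq.
  - by move=> i j _ _; exact: oo.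
  rewrite big_mkord; apply: ler_sum => i _; rewrite /c.
  case: ifPn => [mi|]; last by rewrite nsq0 mul0r mulr_ge0 ?sqr_ge0 ?sq_ge0.
  have [-> _ de Le] := perp_basis mi.
  rewrite mulr1 sa_sym// Le ipZr conjR nsqM nsqR ler_wpM2l ?sqr_ge0//.
  have := osys_bessel x i.+1 (conj oo oe); apply: le_trans; rewrite big_ord_recr/= lerDr.
  by apply: sumr_ge0 => j _; exact: nsq_ge0.
exists (Num.sqrt (\sum_(i < n) (mu i)^-1 ^+ 2)) => x dx.
have S0 : 0 <= \sum_(i < n) (mu i)^-1 ^+ 2 by apply: sumr_ge0 => i _; exact: sqr_ge0.
rewrite !(hnorm_sqrt hilb) -sqrtrM// ler_sqrt ?mulr_ge0 ?sq_ge0// mulr_suml.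
exact: key.
Qed.

Lemma kernel_null v : null ip e v <-> kernel L v.
Proof.
split=> [nv|kv n]; last first.
  by have [_ pe _ _] := perp_basis (inverse_eig_pos n); rewrite ipC (pe v kv) cj0.
have [v0 [y [E k0 py]]] := kernel_decomp v.
rewrite E (@perp_eq0 y py) ?addr0// => n mn.
have [_ pe _ _] := perp_basis mn; have := nv n.
by rewrite E ipDl (ipC _ v0) (pe v0 k0) cj0 add0r.
Qed.

Lemma inverse_is_diag : is_diag ip e (fun n => (mu n)^-1) L.
Proof.
have [[oe ez] m0 md _ HK] := dK; have mp := inverse_eig_pos.
have e1 n : sq (e n) = 1 by have [] := perp_basis (mp n).
have de n : pdom L (e n) by have [] := perp_basis (mp n).
have Le n : L (e n) = ((mu n)^-1)%:C *: e n by have [] := perp_basis (mp n).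
have coefL x n : pdom L x -> ip (L x) (e n) = ((mu n)^-1)%:C * ip x (e n).
  by move=> dx; rewrite sa_sym// Le ipZr conjR.
split; last 2 first.
- by split; [exact: sa_dom0|move=> c x y; exact: sa_lin].
- move=> x dx; have d1 (n : nat) : nsq (1 : R[i]) <= 1 by rewrite (_ : nsq 1 = 1)// /nsq /=; ring.
  have E : L x = dop ip e e (fun=> 1) (L x).
    apply/eqP; rewrite -subr_eq0; apply/eqP/perp_eq0.
      move=> v kv; rewrite ipBl (perp_range dx kv) (dop_orth hilb oe oe d1) ?subrr// => n.
      by have [_ pe _ _] := perp_basis (mp n); exact: pe.
    by move=> n _; rewrite ipBl (dop_coef hilb oe oe d1) e1 mul1r mulr1 subrr.
  have [cR cI] := dop_ip hilb oe oe d1 (L x) x; rewrite -E in cR cI.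
  have ES N : \sum_(n < N) 1 * ip (L x) (e n) * ip (e n) x =
      (\sum_(n < N) (mu n)^-1 * nsq (ip x (e n)))%:C.
    rewrite rmorph_sum; apply: eq_bigr => n _; rewrite mul1r coefL// (ipC _ (e n)) -mulrA -nsqE.
    by rewrite -realM.
  exists (Re (ip (L x) x)); split; first by apply: cvg_eq cR => N; rewrite ES.
  by apply: complex_ext => //=; apply: rlim_uniq cI _; apply: cvg_eq (cvg_cst 0) => N; rewrite ES.
move=> x; split=> [dx|[C HC]].
  exists (sq (L x)) => N; apply: le_trans (osys_bessel (L x) N oe).
  by apply: ler_sum => n _; rewrite coefL// nsqM nsqR.
(* The remaining inclusion of domains: with [y] the sum of this series, [K y] has the coefficients
   of [x], so [x - K y] is in the kernel, and [x] is a sum of two vectors of the domain. *)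
have cy : hcv (fun N => \sum_(n < N) (((mu n)^-1)%:C * ip x (e n)) *: e n)
    (hsum e (fun n => ((mu n)^-1)%:C * ip x (e n))).
  apply: (hsumP hilb oe) => N; apply: le_trans (HC N).
  by apply: ler_sum => n _; rewrite nsqM nsqR.
set y := hsum _ _ in cy.
have yc n : ip y (e n) = ((mu n)^-1)%:C * ip x (e n).
  apply: ccv_uniq (hcv_ip hilb (e n) cy) _; apply: ccv_near (ccv_cst _).
  exists n.+1 => N nN; rewrite (ip_sum_osys (fun i => ((mu i)^-1)%:C * ip x (e i)))//.
  by rewrite e1 mulr1.
have Kc n : ip (K y) (e n) = ip x (e n).
  rewrite (diagE hilb dK) (dop_coef hilb oe oe (rdop_bound m0 md)) e1 mulr1 yc mulrA -realM.
  by rewrite mulfV ?gt_eqF// mul1r.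
have nx : null ip e (x - K y) by move=> n; rewrite ipBl Kc subrr.
have [dx _] := (kernel_null _).1 nx; have [_ dKy] := inverse_perp y.
by have [] := sa_lin 1 dx dKy; rewrite scale1r subrK.
Qed.
End Diagonalized.
End Inverse.

Lemma discrete_eigenbasis : discrete_off_kernel ip L -> exists e (lam : nat -> R),
  [/\ osys ip e, forall n, sq (e n) = 1, forall n, 0 < lam n,
      forall m n, (m <= n)%N -> lam m <= lam n &
      lam @ \oo --> +oo /\ is_diag ip e lam L].
Proof.
move=> [K [cK iK]]; have [mu [e dK]] := diag_exists hilb cK (inverse_pos cK iK).
have mp n : 0 < mu n := inverse_eig_pos cK iK dK n.
have [[oe ez] m0 md ml _] := dK.
exists e, (fun n => (mu n)^-1); split => //.
- by move=> n; have [] := perp_basis cK iK dK (mp n).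
- by move=> n; rewrite invr_gt0.
- by move=> m n mn; rewrite lef_pV2 ?posrE//; exact: md.
split; last exact: inverse_is_diag dK.
apply/cvgryPge => A; have A1 : 0 < Num.max A 1 by rewrite lt_max ltr01 orbT.
have /cvgrPdist_lt/(_ (Num.max A 1)^-1 (ltac:(by rewrite invr_gt0)))[N _ HN] := ml.
exists N => // n Nn /=; have := HN n Nn; rewrite /= sub0r normrN ger0_norm// => H.
have : Num.max A 1 <= (mu n)^-1 by rewrite -[leLHS]invrK lef_pV2 ?posrE ?invr_gt0// ltW.
by rewrite ge_max => /andP[].
Qed.
End Eigenbasis.

(** * Quadratic splines used as test functions *)

Section SmoothStep.
Context (R : realType).
Implicit Types (t u k a d : R).

Definition pos t : R := Num.max t 0.

Lemma posP t : (0 <= t /\ pos t = t) \/ (t <= 0 /\ pos t = 0).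
Proof.
case: (leP 0 t) => t0; rewrite /pos; [left|right]; split; rewrite ?(ltW t0)//.
  exact/max_idPl.
exact/max_idPr/ltW.
Qed.

Lemma sqr_pos_rem u k : 0 <= pos (u + k) ^+ 2 - pos u ^+ 2 - k * (2 * pos u) <= k ^+ 2.
Proof.
by case: (posP u) => -[h1 ->]; case: (posP (u + k)) => -[h2 ->]; apply/andP; split; nra.
Qed.

(** A quadratic bound on the remainder gives differentiability at the knots of a spline and between
    them alike. *)
Lemma is_derive_rem (f : R -> R) t df (C : R) :
  (forall k, `|f (t + k) - f t - k * df| <= C * k ^+ 2) -> is_derive t 1 f df.
Proof.
move=> H; have cf : (fun k => k^-1 *: ((f \o shift t) (k *: (1 : R)) - f t)) @ 0^' --> df.
  apply/cvgrPdist_le => eps e0; pose D := eps / (`|C| + 1).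
  have D0 : 0 < D by rewrite divr_gt0// ltr_wpDl.
  near=> k.
  have k0 : k != 0 by near: k; exact: nbhs_dnbhs_neq.
  have kD : `|k| <= D by near: k; apply: dnbhs0_le.
  have -> : df - k^-1 *: ((f \o shift t) (k *: (1 : R)) - f t) = - k^-1 * (f (t + k) - f t - k * df).
    by rewrite /= -[k *: 1]/(k * 1) mulr1 -[_ *: _]/(_ * _) [k + t]addrC; field.
  rewrite normrM normrN normfV ler_pdivrMl ?normr_gt0//; apply: le_trans (H k) _.
  have CD : `|C| * D <= eps.
    rewrite /D mulrA ler_pdivrMr; last by rewrite ltr_wpDl.
    by have := normr_ge0 C; move: `|C| => c c0; nra.
  have : C * k ^+ 2 <= `|k| * (`|C| * `|k|).
    rewrite -(real_normK (num_real k)) expr2 [C * _]mulrCA ler_wpM2l//.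
    by rewrite ler_wpM2r// ler_norm.
  move/le_trans; apply; rewrite ler_wpM2l//; apply: le_trans CD.
  by rewrite ler_wpM2l.
split; first by apply/cvg_ex; exists df.
exact: cvg_lim cf.
Unshelve. all: by end_near. Qed.

(** Rises from 0 at [a] to 1 at [a + 2 d]; it is the primitive of the tent function [dstep], hence
    C^1 as test functions must be. *)
Definition step a d t : R :=
  (pos ((t - a) / d) ^+ 2 - 2 * pos ((t - a) / d - 1) ^+ 2 + pos ((t - a) / d - 2) ^+ 2) / 2.
Definition dstep a d t : R :=
  (pos ((t - a) / d) - 2 * pos ((t - a) / d - 1) + pos ((t - a) / d - 2)) / d.

Lemma step_derive a d t : 0 < d -> is_derive t 1 (step a d) (dstep a d t).
Proof.
move=> d0; apply: (@is_derive_rem _ _ _ (2 / d ^+ 2)) => k.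
have E : (t + k - a) / d = (t - a) / d + k / d by field; rewrite gt_eqF.
rewrite /step /dstep E; set u := (t - a) / d.
have /andP[a1 a2] := sqr_pos_rem u (k / d).
have /andP[b1 b2] := sqr_pos_rem (u - 1) (k / d).
have /andP[c1 c2] := sqr_pos_rem (u - 2) (k / d).
have e1 : u + k / d - 1 = u - 1 + k / d by ring.
have e2 : u + k / d - 2 = u - 2 + k / d by ring.
rewrite e1 e2.
have -> : 2 / d ^+ 2 * k ^+ 2 = 2 * (k / d) ^+ 2 by field; rewrite gt_eqF.
move: a1 a2 b1 b2 c1 c2; set K := k / d.
have -> : forall r, k * (r / d) = K * r by move=> r; rewrite /K; field; rewrite gt_eqF.
move: (K ^+ 2) => K2.
set p1 := pos u; set p2 := pos (u - 1); set p3 := pos (u - 2).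
set q1 := pos (u + K) ^+ 2; set q2 := pos (u - 1 + K) ^+ 2; set q3 := pos (u - 2 + K) ^+ 2.
move: q1 q2 q3 (p1 ^+ 2) (p2 ^+ 2) (p3 ^+ 2) => q1 q2 q3 r1 r2 r3.
rewrite !mulrDr ![K * (2 * _)]mulrCA mulrN ![K * (2 * _)]mulrCA.
move: (K * p1) (K * p2) (K * p3) => s1 s2 s3 *.
by rewrite ler_norml; apply/andP; split; lra.
Qed.

Lemma step_lt a d t : 0 < d -> t <= a -> step a d t = 0 /\ dstep a d t = 0.
Proof.
move=> d0 ta; rewrite /step /dstep.
have : (t - a) / d <= 0 by rewrite pmulr_lle0 ?invr_gt0// subr_le0.
move: (_ / d) => u u0; case: (posP u) => -[h1 ->]; case: (posP (u - 1)) => -[h2 ->];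
  case: (posP (u - 2)) => -[h3 ->]; first [by exfalso; lra | (have -> : u = 0 by lra) | idtac]; split; rewrite ?expr0n /=; ring.
Qed.

Lemma step_gt a d t : 0 < d -> a + 2 * d <= t -> step a d t = 1 /\ dstep a d t = 0.
Proof.
move=> d0 ta; rewrite /step /dstep.
have : 2 <= (t - a) / d by rewrite ler_pdivlMr//; lra.
move: (_ / d) => u u0; case: (posP u) => -[h1 ->]; case: (posP (u - 1)) => -[h2 ->];
  case: (posP (u - 2)) => -[h3 ->]; first [by exfalso; lra | (have -> : u = 2 by lra) | idtac]; split; rewrite ?expr0n /=;
  by field; rewrite ?gt_eqF.
Qed.

Lemma step_01 a d t : 0 < d -> 0 <= step a d t <= 1.
Proof.
move=> d0; rewrite /step.
move: (_ / d) => u; case: (posP u) => -[h1 ->]; case: (posP (u - 1)) => -[h2 ->];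
  case: (posP (u - 2)) => -[h3 ->]; apply/andP; split; nra.
Qed.

Lemma dstep_01 a d t : 0 < d -> 0 <= dstep a d t <= d^-1.
Proof.
move=> d0; have dV : 0 <= d^-1 by rewrite invr_ge0 ltW.
have H u : 0 <= pos u - 2 * pos (u - 1) + pos (u - 2) <= 1.
  case: (posP u) => -[h1 ->]; case: (posP (u - 1)) => -[h2 ->];
    case: (posP (u - 2)) => -[h3 ->]; apply/andP; split; lra.
by rewrite /dstep; have /andP[p0 p1] := H ((t - a) / d); rewrite mulr_ge0//= ler_piMl.
Qed.

Lemma pos_continuous : continuous pos.
Proof.
move=> t; have -> : pos = fun t => (t + `|t|) / 2.
  apply/funext => u; case: (posP u) => -[u0 ->].
    by rewrite ger0_norm//; field.
  by rewrite ler0_norm//; field.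
apply: cvgM; last exact: cvg_cst.
by apply: cvgD => //; exact: norm_continuous.
Qed.

Lemma dstep_continuous a d : continuous (dstep a d).
Proof.
have aff c : continuous (fun t => pos ((t - a) / d - c)).
  move=> t; apply: (@continuous_comp _ _ _ (fun t => (t - a) / d - c) pos); last exact: pos_continuous.
  apply: cvgB; last exact: cvg_cst.
  by apply: cvgM; [apply: cvgB => //; exact: cvg_cst|exact: cvg_cst].
move=> t; apply: cvgM; last exact: cvg_cst.
apply: cvgD; last exact: aff.
apply: cvgB; last by apply: cvgM; [exact: cvg_cst|exact: aff].
have -> : (fun t => pos ((t - a) / d)) = (fun t => pos ((t - a) / d - 0)).
  by apply/funext => u; rewrite subr0.
by have := @aff 0 t; rewrite /continuous_at subr0.
Qed.
End SmoothStep.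

(** * From the weak derivative to increments of [phi] *)

Section WeakGrowth.
Context (R : realType) (phi dphi : R -> R).
Hypotheses (phi_ge0 : forall x : R, 0 <= x -> 0 <= phi x)
  (phi_cont : {within `[0, +oo[, continuous phi})
  (phi_incr : forall x y : R, 0 <= x -> x <= y -> phi x <= phi y)
  (dphiE : weak_derivative phi dphi)
  (mdphi : measurable_fun (`[0, +oo[ : set R) dphi).
Local Notation mu := (@lebesgue_measure R).

Lemma phi_continuous (x : R) : 0 < x -> {for x, continuous phi}.
Proof.
by move=> x0; have /continuous_within_itvcyP[+ _] := phi_cont; apply; rewrite in_itv/= andbT.
Qed.

Lemma phi_trunc_measurable : measurable_fun setT (fun t : R => if 0 < t then phi t else 0).
Proof.
apply: nondecreasing_measurable => // s t st.
case: ifPn => s0; case: ifPn => t0 //; last by rewrite phi_ge0// ltW.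
  exact/phi_incr/st/ltW.
by rewrite (lt_le_trans s0 st) in t0.
Qed.

Lemma Rintegral_supp (x v : R) (f : R -> R) : 0 < x -> (forall t, ~ (x <= t <= v) -> f t = 0) ->
  Rintegral mu `]0, +oo[ f = Rintegral mu `[x, v] f.
Proof.
move=> x0 H; rewrite Rintegral_mkcond [RHS]Rintegral_mkcond; congr (Rintegral _ _ _).
apply/funext => t; rewrite !patchE.
have [xtv|nxtv] := pselect (x <= t <= v).
  rewrite !mem_set//= in_itv/= ?andbT//.
  by case/andP: xtv => xt _; exact: lt_le_trans x0 xt.
by rewrite H//; do 2!case: ifP.
Qed.

(** The weak derivative is tested against [psi], which rises after [x] and falls after [y].
    Monotonicity of [phi] bounds the integral of [phi * psi'] by [phi (x + 2 * d) - phi y], and the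
    almost everywhere bound on [dphi] controls the integral of [dphi * psi]. *)
Lemma growth_step (T eps x y d : R) : 0 <= T -> 0 <= eps ->
  {ae mu, forall t, T < t -> dphi t <= eps * phi t} ->
  T < x -> 0 < d -> x + 2 * d <= y ->
  phi y - phi (x + 2 * d) <= eps * phi (y + 2 * d) * (y + 2 * d - x).
Proof.
move=> T0 eps0 aeT Tx d0 xy; set v := y + 2 * d.
have x0 : 0 < x by exact: le_lt_trans Tx.
have xv : x < v by rewrite /v; lra.
pose psi (t : R) := step x d t - step y d t; pose dpsi (t : R) := dstep x d t - dstep y d t.
have Dpsi (t : R) : is_derive t 1 psi (dpsi t).
  by apply: is_deriveB; exact: step_derive.
have psi' : derive1 psi = dpsi by apply/funext => t; rewrite derive1E derive_val.
have out t : ~ (x <= t <= v) -> psi t = 0 /\ dpsi t = 0.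
  move=> /negP; rewrite negb_and -!ltNge /psi /dpsi => /orP[tx|tv].
    have tx' : t <= x by exact: ltW.
    have ty : t <= y by lra.
    by have [-> ->] := step_lt d0 tx'; have [-> ->] := step_lt d0 ty; rewrite subrr.
  have tx' : x + 2 * d <= t by rewrite /v in tv; lra.
  have ty : y + 2 * d <= t by rewrite /v in tv; lra.
  by have [-> ->] := step_gt d0 tx'; have [-> ->] := step_gt d0 ty; rewrite !subrr.
have psi01 t : 0 <= psi t <= 1.
  have /andP[p0 p1] := step_01 x t d0; have /andP[q0 q1] := step_01 y t d0.
  rewrite /psi; have [ty|yt] := leP t y.
    by have [-> _] := step_lt d0 ty; rewrite subr0 p0 p1.
  have tx' : x + 2 * d <= t by lra.
  by have [-> _] := step_gt d0 tx'; apply/andP; split; lra.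
have cpsi : continuous psi.
  by move=> t; apply/differentiable_continuous/derivable1_diffP; have [] := Dpsi t.
have mxv : measurable (`[x, v]%classic : set R) by exact: measurable_itv.
have finxv : (mu `[x, v] = (v - x)%:E)%E.
  by rewrite lebesgue_measure_itv/= lte_fin xv.
have finlt : (mu `[x, v] < +oo)%E by rewrite finxv ltry.
have W : Rintegral mu `[x, v] (fun t => phi t * dpsi t) =
    - Rintegral mu `[x, v] (fun t => dphi t * psi t).
  have := dphiE (psi := psi); rewrite psi' => /(_ _).
  rewrite (Rintegral_supp (v := v) x0); last by move=> t /out[_ ->]; rewrite mulr0.
  rewrite (Rintegral_supp (v := v) x0); last by move=> t /out[-> _]; rewrite mulr0.
  apply; split; first by move=> t; have [] := Dpsi t.
    by rewrite psi' => t; apply: cvgB; exact: dstep_continuous.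
  by exists x, v; split => // t /out[].
have A1 : Rintegral mu `[x, v] (fun t => phi t * dpsi t) <= phi (x + 2 * d) - phi y.
  (* On each ramp [phi] is replaced by its extreme value of the favourable side; [g] is the
     derivative of [G], so its integral is explicit. *)
  pose g (t : R) := phi (x + 2 * d) * dstep x d t - phi y * dstep y d t.
  pose G (t : R) := phi (x + 2 * d) * step x d t - phi y * step y d t.
  have cg : continuous g.
    by move=> t; apply: cvgB; (apply: cvgM; first exact: cvg_cst); exact: dstep_continuous.
  have DG (t : R) : is_derive t 1 G (g t).
    by apply: is_deriveB; apply: (@is_deriveZ _ _ _ (step _ d)); exact: step_derive.
  have cG : continuous G.
    by move=> t; apply/differentiable_continuous/derivable1_diffP; have [] := DG t.
  have -> : phi (x + 2 * d) - phi y = Rintegral mu `[x, v] g.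
    rewrite /Rintegral (@continuous_FTC2 _ g G)//=.
    - rewrite /G; have xx := lexx x; have vy : y + 2 * d <= v by [].
      have vx : x + 2 * d <= v by rewrite /v; lra.
      have [-> _] := step_lt d0 xx; have [-> _] := step_gt d0 vx.
      have [-> _] := step_gt d0 vy; have xy' : x <= y by lra.
      by have [-> _] := step_lt d0 xy'; ring.
    - exact: continuous_subspaceT.
    - by split; [move=> t _; have [] := DG t|exact/cvg_at_right_filter/cG|exact/cvg_at_left_filter/cG].
    - by move=> t _; rewrite derive1E derive_val.
  apply: le_Rintegral => //.
  - apply: measurable_bounded_integrable => //.
    + apply: measurable_funM; last first.
        by apply: measurable_funTS; apply: continuous_measurable_fun => t; apply: cvgB; exact: dstep_continuous.
      apply: eq_measurable_fun (measurable_funTS phi_trunc_measurable) => t.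
      by rewrite inE/= in_itv/= => /andP[xt _]; rewrite (lt_le_trans x0 xt).
    exists (phi v * (2 * d^-1)); split; first exact: num_real.
    move=> M vM t /=; rewrite in_itv/= => /andP[xt tv]; apply: le_trans (ltW vM).
    have t0 : 0 <= t by exact/ltW/(lt_le_trans x0).
    rewrite normrM; apply: ler_pM => //.
      by rewrite ger0_norm ?phi_ge0//; exact: phi_incr.
    have /andP[p0 p1] := dstep_01 x t d0; have /andP[q0 q1] := dstep_01 y t d0.
    by rewrite /dpsi; move: (d^-1) p1 q1 => dv p1 q1; rewrite ler_norml; apply/andP; split; lra.
  - apply: continuous_compact_integrable; first exact: segment_compact.
    exact: continuous_subspaceT.
  move=> t /=; rewrite in_itv/= => /andP[xt tv].
  have t0 : 0 <= t by exact/ltW/(lt_le_trans x0).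
  have /andP[p0 p1] := dstep_01 x t d0; have /andP[q0 q1] := dstep_01 y t d0.
  rewrite /g /dpsi mulrBr; apply: lerB.
    have [tx|tx] := leP t (x + 2 * d); first by rewrite ler_wpM2r// phi_incr.
    by have [_ ->] := step_gt d0 (ltW tx); rewrite !mulr0.
  have [ty|ty] := leP t y; first by have [_ ->] := step_lt d0 ty; rewrite !mulr0.
  by rewrite ler_wpM2r// phi_incr ?ltW//; lra.
have A2 : Rintegral mu `[x, v] (fun t => dphi t * psi t) <= eps * phi v * (v - x).
  have K0 : 0 <= eps * phi v by rewrite mulr_ge0// phi_ge0// ltW// (lt_trans x0).
  have mf : measurable_fun `[x, v] (fun t => (dphi t * psi t)%:E).
    apply/measurable_EFinP/measurable_funM.
      apply: measurable_funS mdphi => //= t /=; rewrite !in_itv/= andbT => /andP[xt _].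
      exact/ltW/(lt_le_trans x0).
    by apply: measurable_funTS; exact: continuous_measurable_fun.
  (* Only the positive part is bounded from above; the negative part has a favourable sign, and if
     its integral is infinite [fine] returns 0. *)
  rewrite /Rintegral integralE.
  have P0 : (0 <= \int[mu]_(t in `[x, v]) ((fun t => (dphi t * psi t)%:E)^\+)%E t)%E.
    by apply: integral_ge0 => t _.
  have N0 : (0 <= \int[mu]_(t in `[x, v]) ((fun t => (dphi t * psi t)%:E)^\-)%E t)%E.
    by apply: integral_ge0 => t _.
  have P1 : (\int[mu]_(t in `[x, v]) ((fun t => (dphi t * psi t)%:E)^\+)%E t <= (eps * phi v * (v - x))%:E)%E.
    have -> : (eps * phi v * (v - x))%:E = (\int[mu]_(t in `[x, v]) (eps * phi v)%:E)%E.
      by rewrite integral_cst// EFinM -finxv.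
    apply: ae_ge0_le_integral => //.
    - exact: measurable_funepos.
    - apply: filterS aeT; first exact: (ae_filter_ringOfSetsType mu).
      move=> t Ht; rewrite /= in_itv/= => /andP[xt tv].
      rewrite funeposE /maxe; case: ifP => // _; rewrite lee_fin.
      have /andP[p0 p1] := psi01 t; have t0 : 0 <= t by exact/ltW/(lt_le_trans x0).
      have h1 := Ht (lt_le_trans Tx xt); have h2 := phi_incr t0 tv.
      apply: (@le_trans _ _ (eps * phi t * psi t)); first by rewrite ler_wpM2r.
      apply: (@le_trans _ _ (eps * phi t)); first by rewrite ler_piMr// mulr_ge0// phi_ge0.
      by rewrite ler_wpM2l.
  have K1 : 0 <= eps * phi v * (v - x) by rewrite mulr_ge0// subr_ge0 ltW.
  move: P0 N0 P1; move: (integral _ _ _) (integral _ _ _) => [p| |] [n| |]//=; rewrite !lee_fin.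
  by move=> p0 n0 p1; lra.
by move: W A1 A2 => ->; lra.
Qed.
End WeakGrowth.

(** * Growth of [phi] and its values at the eigenvalues *)

Section Asymptotics.
Context (R : realType) (phi dphi Nf : R -> R) (lam : nat -> R).
Hypotheses (phi_ge0 : forall x : R, 0 <= x -> 0 <= phi x)
  (phi_cont : {within `[0, +oo[, continuous phi})
  (phi_incr : forall x y : R, 0 <= x -> x <= y -> phi x <= phi y)
  (dphiE : weak_derivative phi dphi)
  (mdphi : measurable_fun (`[0, +oo[ : set R) dphi)
  (dphi_lim : ess_limsup (fun x => dphi x / phi x) = 0%E)
  (N_equiv : Nf x / phi x @[x --> +oo] --> (1 : R))
  (lam0 : forall n, 0 < lam n) (lam_inf : lam @ \oo --> +oo)
  (N_ge : forall n r, lam n <= r -> n.+1%:R <= Nf r)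
  (N_le : forall n r, r < lam n -> Nf r <= n%:R).
Local Notation mu := (@lebesgue_measure R).

Lemma N_near (e : R) : 0 < e -> e < 1 ->
  exists T, 0 <= T /\ forall x, T < x -> 0 < phi x /\ (1 - e) * phi x <= Nf x <= (1 + e) * phi x.
Proof.
move=> e0 e1; move/cvgrPdist_le/(_ e e0) : N_equiv => [T [_ HT]].
exists (Num.max T 0); split; first by rewrite le_max lexx orbT.
move=> x; rewrite gt_max => /andP[Tx x0]; have := HT x Tx; rewrite /= ler_norml => /andP[h1 h2].
have px : 0 < phi x.
  rewrite lt_neqAle phi_ge0 ?ltW// andbT; apply/negP => /eqP E.
  by move: h2; rewrite -E invr0 mulr0 subr0 leNgt e1.
split=> //; apply/andP; split; [rewrite -ler_pdivlMr//|rewrite -ler_pdivrMr//];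
  by move: h1 h2; move: (_ / _) => q h1 h2; lra.
Qed.

(** [growth_step] with [d] so small that continuity of [phi] absorbs the displacements by
    [2 * d]. *)
Lemma phi_growth (eps : R) : 0 < eps -> exists T, 0 <= T /\
  forall x y, T < x -> x <= y -> phi y - phi x <= eps * phi y * (y - x).
Proof.
(* The displacements at most double [phi y] and the length [y - x], so [eps / 8] becomes [eps / 2];
   the error [eta] at [x] costs another quarter of [eps]. *)
move=> eps0; have e8 : 0 < eps / 8 by rewrite divr_gt0.
have [T1 [T10 HT1]] := @N_near (1/2) (ltac:(lra)) (ltac:(lra)).
have [t aet] : exists t, {ae lebesgue_above t, forall x, dphi x / phi x <= eps / 8}.
  have : (ess_limsup (fun x => (dphi x / phi x)%R) < (eps / 8)%:E)%E by rewrite dphi_lim lte_fin.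
  move=> /ereal_inf_lt[_ [t _ <-]] H; exists t.
  have /ess_supP[M [mM M0 HM]] := ltW H; exists M; split; [exact: mM|exact: M0|].
  by move=> x nx; apply: (HM x); move: nx => /= nx hx; apply: nx; move: hx; rewrite lee_fin.
pose T := Num.max t T1; have TT1 : T1 <= T by rewrite le_max lexx orbT.
have T0 : 0 <= T by exact: le_trans TT1.
have aeT : {ae mu, forall x, T < x -> dphi x <= eps / 8 * phi x}.
  move: aet => [M [mM M0 HM]]; exists (M `&` `]t, +oo[); split.
  - exact: measurableI.
  - exact: M0.
  move=> x /= /not_implyP[Tx /negP]; rewrite -ltNge => H.
  have [px _] := HT1 x (le_lt_trans TT1 Tx); split; last first.
    by rewrite /= in_itv/= andbT (le_lt_trans _ Tx)// le_max lexx.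
  by apply: HM => /=; apply/negP; rewrite -ltNge ltr_pdivlMr.
exists T; split => // x y Tx; rewrite le_eqVlt => /orP[/eqP <-|xy]; first by rewrite !subrr mulr0.
have x0 : 0 < x by exact: le_lt_trans Tx. have y0 : 0 < y by exact: lt_trans xy.
have [py _] := HT1 y (le_lt_trans TT1 (lt_trans Tx xy)).
pose eta := Num.min (phi y) (Num.min (y - x) (eps / 4 * phi y * (y - x))).
have yx0 : 0 < y - x by rewrite subr_gt0.
have pyx : 0 < phi y * (y - x) by exact: mulr_gt0.
have eta0 : 0 < eta by rewrite !lt_min py yx0 -mulrA mulr_gt0// divr_gt0.
have [eta1 eta2 eta3] : [/\ eta <= phi y, eta <= y - x & eta <= eps / 4 * phi y * (y - x)].
  by rewrite /eta !ge_min !lexx !orbT.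
clearbody eta.
have mod z : 0 < z -> exists d, 0 < d /\ forall k, 0 <= k -> k < d -> phi (z + k) <= phi z + eta.
  move=> z0; have /cvgrPdist_le/(_ eta eta0) := phi_continuous phi_cont z0.
  move=> [d /= d0 Hd]; exists d; split => // k k0 kd.
  have := Hd (z + k); rewrite /= opprD addNKr normrN ger0_norm// => /(_ kd).
  by rewrite ler_norml => /andP[]; lra.
have [dx [dx0 Hx]] := mod x x0; have [dy [dy0 Hy]] := mod y y0.
pose d := Num.min (Num.min dx dy) eta / 4.
have d0 : 0 < d by rewrite divr_gt0// !lt_min dx0 dy0 eta0.
have [d1 d2 d3] : [/\ 2 * d < dx, 2 * d < dy & 2 * d <= eta].
  have m1 : Num.min (Num.min dx dy) eta <= dx by rewrite !ge_min lexx.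
  have m2 : Num.min (Num.min dx dy) eta <= dy by rewrite !ge_min lexx orbT.
  have m3 : Num.min (Num.min dx dy) eta <= eta by rewrite !ge_min lexx !orbT.
  by move: m1 m2 m3 d0; rewrite /d; move: (Num.min _ _) => m m1 m2 m3 d0; split; lra.
have dd : 0 <= 2 * d by lra.
have := growth_step phi_ge0 phi_incr dphiE mdphi T0 (ltW e8) aeT Tx d0 (ltac:(lra) : x + 2 * d <= y).
have := Hx _ dd d1; have := Hy _ dd d2.
move: (phi (x + 2 * d)) (phi (y + 2 * d)) => p q hq hp H.
have : eps / 8 * q * (y + 2 * d - x) <= eps / 8 * (2 * phi y) * (2 * (y - x)).
  have D0 : 0 <= y + 2 * d - x by lra.
  have D1 : y + 2 * d - x <= 2 * (y - x) by lra.
  have q1 : q <= 2 * phi y by lra.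
  have p0 : 0 <= eps / 8 * (2 * phi y) by rewrite mulr_ge0// ?ltW// mulr_gt0.
  apply: le_trans (ler_wpM2l p0 D1); rewrite ler_wpM2r// ler_wpM2l// ltW//.
have E1 : eps / 8 * (2 * phi y) * (2 * (y - x)) = eps * phi y * (y - x) / 2 by field.
have E2 : eps / 4 * phi y * (y - x) = eps * phi y * (y - x) / 4 by field.
have E3 : 0 < eps * phi y * (y - x) by rewrite -mulrA mulr_gt0.
rewrite E1; move: eta3 H; rewrite E2; move: (eps * phi y * _) E3 (eps / 8 * _ * _) => w w0 z; lra.
Qed.

(** [Nf] is at least [n + 1] at [lam n] and at most [n] below it. Since [phi] is continuous and
    equivalent to [Nf], both values are squeezed together: multiplicities are negligible. *)
Lemma phi_eigen (eps : R) : 0 < eps -> exists n0, forall n, (n0 <= n)%N ->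
  [/\ 0 < phi (lam n), `|phi (lam n) - n.+1%:R| <= eps * n.+1%:R &
      `|Nf (lam n) - n.+1%:R| <= eps * n.+1%:R].
Proof.
wlog : eps / eps < 1/2 => [H|eps2 eps0].
  have [e1|e1] := ltP eps (1/2); first exact: H.
  move=> e0; have [n0 Hn] := H (1/4) (ltac:(lra)) (ltac:(lra)); exists n0 => n /Hn[p1 p2 p3].
  by split => //; [apply: le_trans p2 _|apply: le_trans p3 _]; rewrite ler_wpM2r//; lra.
pose e := eps / 8.
have [T [T0 HT]] := @N_near e (ltac:(rewrite /e; lra)) (ltac:(rewrite /e; lra)).
have /cvgryPgt/(_ T)[n0 _ Hn0] := lam_inf.
exists n0 => n /Hn0 /= Tl; have [pl /andP[l1 l2]] := HT _ Tl.
have Nn := N_ge (lexx (lam n)); set ph := phi (lam n) in pl l1 l2 *; set N := Nf (lam n) in l1 l2 Nn *.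
(* Obtained at the point [lam n - k], where the counting function is at most [n], with [k] so small
   that [phi] has hardly changed. *)
have ub : (1 - e) * ph <= n%:R.
  apply/ler_addgt0Pr => eta eta0.
  have /cvgrPdist_le/(_ eta eta0)[d /= d0 Hd] := phi_continuous phi_cont (lam0 n).
  pose k := Num.min d (lam n - T) / 2.
  have lT : 0 < lam n - T by rewrite subr_gt0.
  have k0 : 0 < k by rewrite divr_gt0// lt_min d0.
  have [kd kT] : k < d /\ k < lam n - T.
    have m1 : Num.min d (lam n - T) <= d by rewrite ge_min lexx.
    have m2 : Num.min d (lam n - T) <= lam n - T by rewrite ge_min lexx orbT.
    by move: m1 m2 k0; rewrite /k; move: (Num.min _ _) => m; split; lra.
  have [_ /andP[r1 _]] := HT (lam n - k) (ltac:(lra)).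
  have := Hd (lam n - k); rewrite /= opprB addrCA subrr addr0 gtr0_norm// => /(_ kd).
  rewrite -/ph ler_norml => /andP[_ h].
  have := N_le (ltac:(lra) : lam n - k < lam n).
  have : (1 - e) * (ph - phi (lam n - k)) <= (1 - e) * eta.
    by rewrite ler_wpM2l// /e; lra.
  have : (1 - e) * eta <= eta by rewrite ler_piMl ?ltW// /e; lra.
  rewrite mulrBr; lra.
have nn : n%:R <= n.+1%:R :> R by rewrite ler_nat.
have n1 : 1 <= n.+1%:R :> R by rewrite ler1n.
move: n.+1%:R n%:R nn n1 ub Nn => m m' nn n1 ub Nn.
have e18 : e <= 1/16 by rewrite /e; lra.
have e0 : 0 < e by rewrite /e; lra.
have ph2 : ph <= 2 * m by nra.
have Ee : eps = 8 * e by rewrite /e; lra.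
have eph : e * ph <= 2 * (e * m) by nra.
split=> //; rewrite Ee -mulrA ler_norml; apply/andP; split; lra.
Qed.
End Asymptotics.

(** * Sums of powers, uniformly for [s] between 1 and 2 *)

Section Weights.
Context (R : realType).
Implicit Types (s t r : R) (n N : nat).

Definition pw s n : R := n.+1%:R `^ (- s).

Lemma pw_ge0 s n : 0 <= pw s n. Proof. exact: powR_ge0. Qed.
Lemma pw1 n : pw 1 n = n.+1%:R^-1. Proof. by rewrite /pw powR_inv1. Qed.

Lemma ln_step n : n.+2%:R^-1 <= ln (n.+2%:R : R) - ln n.+1%:R <= n.+1%:R^-1.
Proof.
have p1 : (n.+1%:R : R) \in Num.pos by rewrite posrE ltr0n.
have p2 : (n.+2%:R : R) \in Num.pos by rewrite posrE ltr0n.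
have m1 : (0 : R) < n.+1%:R by rewrite ltr0n.
have m2 : (0 : R) < n.+2%:R by rewrite ltr0n.
have E : n.+2%:R = n.+1%:R + 1 :> R by rewrite -natr1.
apply/andP; split.
  have H : n.+1%:R / n.+2%:R = 1 + (- n.+2%:R^-1) :> R.
    by rewrite E; move: (n.+1%:R : R) m1 => m m1; field; rewrite gt_eqF//; lra.
  have := @le_ln1Dx R (- n.+2%:R^-1); rewrite -H ln_div// ltrN2 invf_lt1//.
  by move=> /(_ (ltac:(by rewrite ltr1n))) H'; rewrite -lerN2 opprB.
have H : n.+2%:R / n.+1%:R = 1 + n.+1%:R^-1 :> R.
  by rewrite E; move: (n.+1%:R : R) m1 => m m1; field; rewrite gt_eqF.
by rewrite -ln_div// H le_ln1Dx// (@lt_trans _ _ 0)// ?invr_gt0// ltrN10.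
Qed.

Let w t n : R := expR (- (t * ln n.+1%:R)).

Lemma pwE s n : pw s n = w (s - 1) n / n.+1%:R.
Proof.
rewrite /pw /w /powR gt_eqF ?ltr0n// -[X in _ = _ / X](@lnK R n.+1%:R) ?posrE ?ltr0n//.
by rewrite -expRN -expRD; congr expR; ring.
Qed.

(** [w t n] is the power [- t] of [n + 1]; its consecutive differences bracket the terms of the zeta
    sum at [t + 1], so the bounds on [pw] telescope. This replaces comparison with an integral. *)
Lemma w_step t n : 0 <= t ->
  t * (w t n.+1 / n.+2%:R) <= w t n - w t n.+1 <= t * (w t n / n.+1%:R).
Proof.
move=> t0; have /andP[l1 l2] := ln_step n.
set D := ln _ - _ in l1 l2; have w0 : 0 < w t n.+1 by exact: expR_gt0.
have w1 : 0 < w t n by exact: expR_gt0.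
have E1 : w t n = w t n.+1 * expR (t * D).
  by rewrite /w -expRD; congr expR; rewrite /D; ring.
have E2 : w t n.+1 = w t n * expR (- (t * D)).
  by rewrite /w -expRD; congr expR; rewrite /D; ring.
have g1 := expR_ge1Dx (t * D); have g2 := expR_ge1Dx (- (t * D)).
have h1 := ler_wpM2l t0 l1; have h2 := ler_wpM2l t0 l2.
apply/andP; split.
  have h1' : t / n.+2%:R <= expR (t * D) - 1 by apply: (le_trans h1); rewrite lerBrDl.
  by have := ler_wpM2l (ltW w0) h1'; rewrite mulrBr mulr1 mulrCA -E1.
have h2' : 1 - expR (- (t * D)) <= t / n.+1%:R by apply: le_trans h2; rewrite lerBlDr -lerBlDl.
by have := ler_wpM2l (ltW w1) h2'; rewrite mulrBr mulr1 mulrCA -E2.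
Qed.

Lemma w0E t : w t 0 = 1. Proof. by rewrite /w ln1 mulr0 oppr0 expR0. Qed.

Lemma zeta_ge s N : 1 <= s -> 1 - w (s - 1) N <= (s - 1) * \sum_(n < N) pw s n.
Proof.
move=> s1; have t0 : 0 <= s - 1 by rewrite subr_ge0.
elim: N => [|N IH]; first by rewrite big_ord0 w0E subrr mulr0.
rewrite big_ord_recr /= mulrDr pwE; have /andP[_] := w_step N t0; move: IH.
by move: (_ * \sum_(_ < _) _) (_ * (_ / _)) => *; lra.
Qed.

Lemma zeta_le s N : 1 <= s -> (s - 1) * \sum_(n < N) pw s n <= s.
Proof.
move=> s1; have t0 : 0 <= s - 1 by rewrite subr_ge0.
case: N => [|N]; first by rewrite big_ord0 mulr0 (le_trans ler01).
have w0 : 0 < w (s - 1) N by exact: expR_gt0.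
suff : (s - 1) * \sum_(n < N.+1) pw s n <= s - w (s - 1) N by lra.
clear w0.
elim: N => [|N IH].
  by rewrite big_ord_recl big_ord0 /= addr0 pwE w0E; lra.
rewrite big_ord_recr /= mulrDr pwE; have /andP[+ _] := w_step N t0; move: IH.
by move: (_ * \sum_(_ < _) _) (_ * (_ / _)) => *; lra.
Qed.

Lemma harmonic_le N : \sum_(n < N) pw 1 n <= 1 + ln (N%:R : R).
Proof.
case: N => [|N]; first by rewrite big_ord0 ln0// addr0.
elim: N => [|N IH]; first by rewrite big_ord_recl big_ord0 /= pw1 invr1 ln1.
rewrite big_ord_recr /= pw1; have /andP[+ _] := ln_step N; move: IH.
by move: (N.+2%:R^-1) => *; lra.
Qed.

Lemma harmonic_ge N : ln (N%:R : R) <= \sum_(n < N) pw 1 n.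
Proof.
case: N => [|N]; first by rewrite big_ord0 ln0.
suff H : ln (N.+2%:R : R) <= \sum_(n < N.+1) pw 1 n.
  by apply: le_trans H; rewrite ler_ln ?posrE ?ltr0n// ler_nat.
elim: N => [|N IH].
  have /andP[_] := ln_step 0; rewrite ln1 subr0.
  by rewrite big_ord_recl big_ord0 /= pw1 addr0.
rewrite big_ord_recr /= pw1; have /andP[_] := ln_step N.+1; move: IH.
by move: (N.+2%:R^-1) => *; lra.
Qed.

(** The power lies between those of exponents 0 and - 2, which makes the bound uniform in [s]. *)
Lemma pow_ratio r dl s : 0 <= dl -> dl <= 1/4 -> `|r - 1| <= dl -> 1 <= s -> s <= 2 ->
  `|r `^ (- s) - 1| <= 8 * dl.
Proof.
move=> d0 d4; rewrite ler_norml => /andP[r1 r2] s1 s2.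
have r0 : 0 < r by lra.
have sq0 : r `^ (- (2 : R)) = (r ^+ 2)^-1 by rewrite (powR_invn 2) ?ltW.
have z0 : r `^ 0 = 1 :> R by exact: powRr0.
have q0 : 0 < r ^+ 2 by rewrite exprn_gt0.
rewrite ler_norml; have [rr|rr] := leP 1 r.
  have a1 : r `^ (- s) <= 1 by rewrite -z0; apply: ler_powR => //; lra.
  have a2 : r `^ (- (2 : R)) <= r `^ (- s) by apply: ler_powR => //; lra.
  have a3 : 1 - 8 * dl <= (r ^+ 2)^-1.
    have [d8|d8] := leP (8 * dl) 1; last by apply: (@le_trans _ _ 0); [lra | rewrite invr_ge0 ltW].
    by rewrite -[leRHS]mul1r ler_pdivlMr//; nra.
  by apply/andP; split; lra.
have r01 : 0 < r <= 1 by rewrite r0 ltW.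
have a1 : 1 <= r `^ (- s) by rewrite -z0; apply: ger_powR => //; lra.
have a2 : r `^ (- s) <= r `^ (- (2 : R)) by apply: ger_powR => //; lra.
have a3 : (r ^+ 2)^-1 <= 1 + 8 * dl.
  have r2' : 1 - 2 * dl <= r ^+ 2 by nra.
  by rewrite -[leLHS]mul1r ler_pdivrMr//; nra.
by apply/andP; split; lra.
Qed.

(** An estimate valid from [n0] on is summed at the price of a constant, which is independent of
    [N]. *)
Lemma sum_head (u v hb : nat -> R) n0 N : (forall n, (n0 <= n)%N -> u n <= v n) ->
  (forall n, u n <= hb n) -> (forall n, 0 <= v n) -> (forall n, 0 <= hb n) ->
  \sum_(n < N) u n <= \sum_(n < N) v n + \sum_(n < n0) hb n.
Proof.
move=> uv uh v0 h0.
suff H : \sum_(n < N) u n <= \sum_(n < N) v n + \sum_(n < minn N n0) hb n.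
  apply: le_trans H _; rewrite lerD2l; have [Nn|nN] := leqP N n0 => //.
  rewrite -(big_mkord xpredT hb) -[leRHS](big_mkord xpredT hb).
  by rewrite [leRHS](big_cat_nat (n := N))//= lerDl sumr_ge0.
elim: N => [|N IH]; first by rewrite min0n !big_ord0 addr0.
rewrite !big_ord_recr /=; have [n0N|Nn0] := leqP n0 N.
  have -> : minn N.+1 n0 = minn N n0 by rewrite (minn_idPr n0N) (minn_idPr (leqW n0N)).
  by have := uv _ n0N; move: IH; lra.
have -> : minn N.+1 n0 = (minn N n0).+1 by rewrite (minn_idPl Nn0) (minn_idPl (ltnW Nn0)).
rewrite (minn_idPl (ltnW Nn0)) in IH *.
by rewrite big_ord_recr /=; have := uh N; have := v0 N; move: IH; lra.
Qed.

(** The constant [C] stands for the errors independent of [s], which the factor [s - 1] makes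
    negligible. *)
Lemma right_lim0 (G : R -> R) :
  (forall eps, 0 < eps -> exists C, forall s, 1 < s -> s <= 2 -> `|G s| <= eps + C * (s - 1)) ->
  G s @[s --> 1^'+] --> (0 : R).
Proof.
move=> H; apply/cvgrPdist_le => eps eps0; have [C HC] := H (eps / 2) (divr_gt0 eps0 (ltr0n _ 2)).
near=> s; rewrite sub0r normrN.
have s1 : 1 < s by near: s; exact: nbhs_right_gt.
have s2 : s <= 2 by near: s; apply: nbhs_right_le; lra.
have s3 : s <= 1 + eps / 2 / (`|C| + 1).
  by near: s; apply: nbhs_right_le; rewrite ltrDl !divr_gt0// ltr_wpDl.
apply: le_trans (HC s s1 s2) _.
have C1 : 0 < `|C| + 1 by rewrite ltr_wpDl.
have : (s - 1) * (`|C| + 1) <= eps / 2 by rewrite -ler_pdivlMr//; lra.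
have : C * (s - 1) <= `|C| * (s - 1) by rewrite ler_wpM2r ?ler_norm//; lra.
rewrite (_ : (s - 1) * (`|C| + 1) = `|C| * (s - 1) + (s - 1)); last by ring.
by move: (C * _) (`|C| * _) => *; lra.
Unshelve. all: by end_near. Qed.

Section Asymptotic.
Variable f : nat -> R.
Hypotheses (fas : forall eps, 0 < eps -> exists n0, forall n, (n0 <= n)%N ->
  0 < f n /\ `|f n - n.+1%:R| <= eps * n.+1%:R).

(** With [f n = phi (lam n)], the eigenvalues of the negative power; the value 0 where [f n]
    vanishes is the convention on the kernel of the operator being raised. *)
Definition tt s n : R := if 0 < f n then f n `^ (- s) else 0.
(** A bound for [tt s n] valid for all [s] in [[1, 2]] at once. *)
Definition hb n : R := if 0 < f n then (f n)^-1 + (f n) ^- 2 else 0.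

Lemma tt_ge0 s n : 0 <= tt s n. Proof. by rewrite /tt; case: ifP => // _; exact: powR_ge0. Qed.
Lemma hb_ge0 n : 0 <= hb n.
Proof. by rewrite /hb; case: ifP => // fn; rewrite addr_ge0// invr_ge0 ?sqr_ge0 ?ltW. Qed.

Lemma tt_head s n : 1 <= s -> s <= 2 -> tt s n <= hb n.
Proof.
move=> s1 s2; rewrite /tt /hb; case: ifP => // fn.
have i1 : f n `^ (- 1) = (f n)^-1 by rewrite powR_inv1 ?ltW.
have i2 : f n `^ (- (2 : R)) = (f n) ^- 2 by rewrite (powR_invn 2) ?ltW.
have v1 : 0 <= (f n)^-1 by rewrite invr_ge0 ltW.
have v2 : 0 <= (f n) ^- 2 by rewrite invr_ge0 sqr_ge0.
have [f1|f1] := leP 1 (f n).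
  have ns : - s <= - 1 by rewrite lerN2.
  by have := ler_powR f1 ns; rewrite i1 => /le_trans; apply; rewrite lerDl.
have f01 : 0 < f n <= 1 by rewrite fn (ltW f1).
have ns : - (2 : R) <= - s by rewrite lerN2.
by have := ger_powR f01 ns; rewrite i2 => /le_trans; apply; rewrite lerDr.
Qed.

Lemma tt_asym eps : 0 < eps -> exists n0, forall n, (n0 <= n)%N -> 0 < f n /\
  forall s, 1 <= s -> s <= 2 -> `|tt s n - pw s n| <= eps * pw s n.
Proof.
move=> e0; pose dl := Num.min (eps / 8) (1/4).
have d0 : 0 < dl by rewrite lt_min divr_gt0//=; lra.
have [d1 d2] : dl <= eps / 8 /\ dl <= 1/4 by rewrite /dl !ge_min !lexx orbT.
have [n0 H] := fas d0; exists n0 => n /H[fn fd]; split => // s s1 s2.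
have m0 : (0 : R) < n.+1%:R by rewrite ltr0n.
have E : tt s n = (f n / n.+1%:R) `^ (- s) * pw s n.
  by rewrite /tt fn /pw -powRM ?divr_ge0 ?ltW// divfK// gt_eqF.
rewrite E -{2}[pw s n]mul1r -mulrBl normrM [`|pw s n|]ger0_norm ?pw_ge0// ler_wpM2r ?pw_ge0//.
apply: (@le_trans _ _ (8 * dl)); last by lra.
apply: pow_ratio => //; first exact: ltW.
have -> : f n / n.+1%:R - 1 = (f n - n.+1%:R) / n.+1%:R by field; rewrite gt_eqF.
by rewrite normrM normfV (gtr0_norm m0) ler_pdivrMr.
Qed.

Lemma tt_sum_asym eps : 0 < eps -> exists C, forall s N, 1 <= s -> s <= 2 ->
  \sum_(n < N) `|tt s n - pw s n| <= eps * \sum_(n < N) pw s n + C.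
Proof.
move=> e0; have [n0 H] := tt_asym e0.
exists (\sum_(n < n0) (hb n + 1)) => s N s1 s2; rewrite mulr_sumr.
apply: (@sum_head (fun n => `|tt s n - pw s n|) (fun n => eps * pw s n) (fun n => hb n + 1)).
- by move=> n /H[_]; exact.
- move=> n; apply: le_trans (ler_normB _ _) _.
  rewrite !ger0_norm ?tt_ge0 ?pw_ge0// lerD ?tt_head//.
  rewrite /pw -[leRHS](powRr0 (n.+1%:R : R)); apply: ler_powR; first by rewrite ler1n.
  lra.
- by move=> n; rewrite mulr_ge0 ?pw_ge0 ?ltW.
- by move=> n; rewrite addr_ge0 ?hb_ge0.
Qed.

Lemma tt_sum_bounded s : 1 < s -> exists C, forall N, \sum_(n < N) tt s n <= C.
Proof.
move=> s1; have small s' : 1 < s' -> s' <= 2 -> exists C, forall N, \sum_(n < N) tt s' n <= C.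
  move=> s1' s2'; have [C HC] := tt_sum_asym ltr01.
  exists (2 * (s' / (s' - 1)) + C) => N.
  have z : \sum_(n < N) pw s' n <= s' / (s' - 1).
    by rewrite ler_pdivlMr ?subr_gt0// mulrC zeta_le// ltW.
  have := HC s' N (ltW s1') s2'; rewrite mul1r.
  have : \sum_(n < N) tt s' n <= \sum_(n < N) (`|tt s' n - pw s' n| + pw s' n).
    by apply: ler_sum => n _; have := ler_norm (tt s' n - pw s' n); lra.
  by rewrite big_split /=; lra.
have [s2|s2] := leP s 2; first exact: small.
have [C HC] := small 2 (ltac:(lra)) (lexx _).
have [n0 H] := fas (ltac:(lra) : (0 : R) < 1/2).
(* For [s > 2] the comparison is with exponent 2; the shift by 2 ensures [f n >= 1], where powers
   decrease in [s]. *)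
exists (C + \sum_(n < n0 + 2) tt s n) => N.
have : \sum_(n < N) tt s n <= \sum_(n < N) tt 2 n + \sum_(n < n0 + 2) tt s n.
  apply: sum_head => // [n nn| n|n]; try exact: tt_ge0.
  have [fn fd] := H n (leq_trans (leq_addr _ _) nn).
  rewrite /tt fn; apply: ler_powR; last lra.
  have n2 : (2 : R) <= n.+1%:R by rewrite ler_nat (leq_trans _ (leqW nn))// addn2.
  by move: fd n2; rewrite ler_norml => /andP[+ _]; move: n.+1%:R => m *; lra.
by have := HC N; lra.
Qed.

Lemma tt_cvg0 s : 0 < s -> (tt s @ \oo --> (0 : R)).
Proof.
move=> s0; apply/cvgrPdist_le => eps e0.
have K (m q F : R) : - (1 / 2 * (m + 1)) <= F - (m + 1) -> 2 * q <= m -> q <= F by lra.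
have [n0 H] := fas (ltac:(lra) : (0 : R) < 1/2).
have e1 : 0 < eps `^ (- s^-1) by exact: powR_gt0.
near=> n; rewrite sub0r normrN ger0_norm ?tt_ge0//.
have nn : (n0 <= n)%N by near: n; exact: nbhs_infty_ge.
have [fn fd] := H n nn; rewrite /tt fn.
have nb : 2 * eps `^ (- s^-1) <= n%:R by near: n; exact: nbhs_infty_ger.
have fb : eps `^ (- s^-1) <= f n.
  move: fd; rewrite ler_norml => /andP[h _].
  apply: (K n%:R); [by rewrite natr1|exact: nb].
rewrite powRN; have -> : eps = (eps `^ (- s^-1) `^ s)^-1.
  by rewrite -powRrM mulNr mulVf ?gt_eqF// powR_inv1 ?invrK// ltW.
rewrite lef_pV2 ?posrE ?powR_gt0//.
by apply: ge0_ler_powR => //; rewrite ?nnegrE; exact: ltW.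
Unshelve. all: by end_near. Qed.
End Asymptotic.
End Weights.

(** * The commutator estimate for truncated weights *)

Section Key.
Context (R : realType) (h : completeNormedModType R[i])
        (ip : {dot h for Num.conj}) (hilb : is_hilbert ip).
Implicit Types (x y z v : h) (c : R[i]) (a b d : h -> h).
Local Notation Re := (@complex.Re R).
Local Notation Im := (@complex.Im R).
Local Notation sq := (sqnorm ip).
Local Notation adj := (adjoint ip).
Variable (e : nat -> h).
Hypotheses (oe : osys ip e) (e1 : forall n, sq (e n) = 1).

Lemma ip_e i j : ip (e i) (e j) = (i == j)%:R.
Proof. by have [->|ij] := eqVneq i j; [rewrite sqE e1|case: oe => o _; rewrite o]. Qed.

Lemma parseval_e x :
  (fun N => sq (p0 ip e x) + \sum_(i < N) nsq (ip x (e i))) @ \oo --> sq x.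
Proof.
have d1 (n : nat) : nsq (1 : R[i]) <= 1 by rewrite (_ : nsq 1 = 1)// /nsq /=; ring.
have [cR _] := dop_ip hilb oe oe d1 x x.
have -> : sq x = sq (p0 ip e x) + Re (ip (dop ip e e (fun=> 1) x) x).
  have px : ip (p0 ip e x) (p0 ip e x) = ip (p0 ip e x) x.
    by rewrite (p0_ip hilb oe x (p0_null hilb oe e1 x)) -(p0_sym hilb oe).
  by rewrite /sqnorm px -raddfD -ipDl /p0 subrK.
apply: cvgD; first exact: cvg_cst.
apply: cvg_eq cR => N; rewrite Re_sum; apply: eq_bigr => i _.
by rewrite mul1r (ipC _ (e i)) -nsqE.
Qed.

(** Parseval turns bounds on coefficients into a bound on norms; the kernel component is treated
    apart, through the factor [k]. *)
Lemma sq_dominated (M : nat) (g k : R) (f : nat -> R) y z :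
  (forall i, nsq (ip y (e i)) <= g * nsq (ip z (e i)) + (if (i < M)%N then f i else 0)) ->
  p0 ip e y = k%:C *: p0 ip e z -> (forall i, 0 <= f i) -> 0 <= g ->
  sq y <= (g + k ^+ 2) * sq z + \sum_(i < M) f i.
Proof.
move=> H Hp f0 g0; have cy := @parseval_e y.
apply: (ler_cvg_to cy (cvg_cst ((g + k ^+ 2) * sq z + \sum_(i < M) f i))).
near=> N; rewrite Hp sqZ nsqR.
have z0 : sq (p0 ip e z) <= sq z.
  have cz := @parseval_e z; apply: (ler_cvg_to (cvg_cst _) cz); near=> n.
  by rewrite lerDl sumr_ge0// => i _; exact: nsq_ge0.
have fs : \sum_(i < N) (if (i < M)%N then f i else 0) <= \sum_(i < M) f i.
  rewrite -(big_mkord xpredT (fun i => if (i < M)%N then f i else 0)) -(big_mkord xpredT f).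
  rewrite -big_mkcond /= [leRHS](_ : _ = \sum_(0 <= i < M | true) f i)//.
  have [NM|MN] := leqP N M.
    rewrite [leRHS](big_cat_nat (n := N))//= ler_wpDr ?sumr_ge0//.
    rewrite big_mkcond /=; apply: ler_sum => i _; case: ifP => //.
  rewrite (big_cat_nat (n := M)) ?(ltnW MN)//= [X in _ + X]big1_seq ?addr0.
    by rewrite big_mkcond /=; apply: ler_sum => i _; case: ifP.
  by move=> i /andP[iM]; rewrite mem_index_iota leqNgt iM.
have S : \sum_(i < N) nsq (ip y (e i)) <= g * sq z + \sum_(i < M) f i.
  apply: (@le_trans _ _ (\sum_(i < N) (g * nsq (ip z (e i)) + (if (i < M)%N then f i else 0)))).
    by apply: ler_sum => i _; exact: H.
  rewrite big_split/= -mulr_sumr; apply: lerD => //.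
  by apply: ler_wpM2l => //; exact: osys_bessel.
have := ler_wpM2l (sqr_ge0 k) z0; rewrite mulrDl; move: S; lra.
Unshelve. all: by end_near. Qed.

Variables (lam p : nat -> R) (eps : R) (M : nat).
Hypotheses (lam0 : forall n, 0 < lam n) (eps0 : 0 <= eps)
  (pp : forall n, 0 <= p n) (pnd : forall m n, (m <= n)%N -> p n <= p m)
  (pg : forall n i, (n <= i)%N -> p n - p i <= eps * (lam i - lam n) * p n).

(** [d] is the commutator of [a] with [L], seen through its pairings with eigenvectors and null
    vectors, a form that passes to adjoints. *)
Definition comm_pair a d :=
  (forall n i, ip (d (e n)) (e i) = (lam n - lam i)%:C * ip (a (e n)) (e i)) /\
  (forall n v, null ip e v -> ip (d (e n)) v = (lam n)%:C * ip (a (e n)) v).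

(** Weights set to 0 from [M] on would jump by [p M] without a gap in [lam] to compensate. Lowered
    by [p M], they have finite support and still vary no more than [p], which is what [cut_diff]
    uses. *)
Definition cut n : R := if (n < M)%N then p n - p M else 0.
Local Notation q := cut.

Lemma cut_ge0 n : 0 <= q n.
Proof. by rewrite /cut; case: ifP => // /ltnW /pnd; rewrite subr_ge0. Qed.
Lemma cut_le n : q n <= p n.
Proof. by rewrite /cut; case: ifP => // _; rewrite lerBlDr lerDl. Qed.

(** The commutator of [a] with the finite-rank diagonal operator of eigenvalues [q i], applied to
    [e n]. *)
Definition Sv a n : h :=
  (q n)%:C *: a (e n) - \sum_(i < M) ((q i)%:C * ip (a (e n)) (e i)) *: e i.

Lemma Sv_coef a n i : ip (Sv a n) (e i) = (q n - q i)%:C * ip (a (e n)) (e i).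
Proof.
rewrite /Sv ipBl ipZl; have [iM|Mi] := ltnP i M.
  rewrite (ip_sum_osys (fun i => (q i)%:C * ip (a (e n)) (e i)))// e1 mulr1 -mulrBl; congr (_ * _).
  by apply: complex_ext; rewrite !cE /= ?subrr.
rewrite ip_suml big1 ?subr0.
  by have -> : q i = 0; [rewrite /cut ltnNge Mi | rewrite subr0].
move=> j _; rewrite ipZl ip_e (_ : (j == i :> nat) = false) ?mulr0//.
by rewrite ltn_eqF// (leq_trans (ltn_ord j)).
Qed.

Lemma Sv_null a n v : null ip e v -> ip (Sv a n) v = (q n)%:C * ip (a (e n)) v.
Proof.
move=> nv; rewrite /Sv ipBl ipZl ip_suml big1 ?subr0// => j _.
by rewrite ipZl (ipC _ (e j)) nv cj0 mulr0.
Qed.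

Lemma cut_diff n i : (n < M)%N -> (n <= i)%N ->
  (q n - q i) ^+ 2 <= (eps * p n) ^+ 2 * (lam n - lam i) ^+ 2.
Proof.
move=> nM ni; have H : 0 <= q n - q i <= p n - p i.
  rewrite /cut nM; case: ltnP => [iM|Mi]; have := pnd ni.
    by move=> ?; apply/andP; split; lra.
  by have := pnd Mi; have := pnd (ltnW nM); move=> *; apply/andP; split; lra.
have G := pg ni; case/andP: H => h1 h2; rewrite -exprMn -[leRHS]sqrrN.
rewrite ler_sqr ?nnegrE//.
  have -> : - (eps * p n * (lam n - lam i)) = eps * (lam i - lam n) * p n by ring.
  exact: le_trans h2 G.
have -> : - (eps * p n * (lam n - lam i)) = eps * (lam i - lam n) * p n by ring.
exact: le_trans (le_trans h1 h2) G.
Qed.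

(** The entry at [i] is an entry of [d] times at most [eps * p n] if [n <= i], and [eps * p i] if
    [i < n]. The second kind depends on [i] and is kept as a sum, to be handled after summation over
    [n]. On the kernel the factor is [q n / lam n], since [lam n] is the gap to the eigenvalue 0. *)
Lemma Sv_sq a d n : comm_pair a d -> (n < M)%N ->
  sq (Sv a n) <= ((eps * p n) ^+ 2 + (q n / lam n) ^+ 2) * sq (d (e n)) +
    \sum_(i < M) (eps * p i) ^+ 2 * nsq (ip (d (e n)) (e i)).
Proof.
move=> [H1 H2] nM; apply: (@sq_dominated M ((eps * p n) ^+ 2) (q n / lam n)
  (fun i => (eps * p i) ^+ 2 * nsq (ip (d (e n)) (e i)))).
- move=> i; rewrite Sv_coef H1 !nsqM !nsqR.
  have n0 := nsq_ge0 (ip (a (e n)) (e i)).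
  have [ni|im] := leqP n i.
    apply: ler_wpDr; first by case: ifP => // _; rewrite mulr_ge0 ?sqr_ge0// mulr_ge0 ?sqr_ge0.
    by rewrite mulrA ler_wpM2r// cut_diff.
  rewrite (ltn_trans im nM) /= ?H1 ?nsqM ?nsqR; apply: ler_wpDl.
    by rewrite mulr_ge0 ?sqr_ge0// mulr_ge0 ?sqr_ge0.
  rewrite mulrA ler_wpM2r// -sqrrN opprB -[(lam n - lam i) ^+ 2]sqrrN opprB.
  by apply: cut_diff (ltnW im); exact: ltn_trans nM.
- apply: (vec_ext (ip := ip) (e := e)) => [i|v nv].
    by rewrite ipZl !(p0_null hilb oe e1) mulr0.
  rewrite ipZl !(p0_ip hilb oe)// Sv_null// H2// mulrA -realM; congr (_%:C * _).
  by rewrite mulfVK// gt_eqF.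
- by move=> i; rewrite mulr_ge0 ?sqr_ge0 ?nsq_ge0.
exact: sqr_ge0.
Qed.

(** In the double sum [n] is summed first: for fixed [i] the entries are coefficients of the adjoint
    of [d] at [e i], bounded by Bessel. *)
Lemma Sv_sum a d (Cd : R) : comm_pair a d -> bounded_op d -> 0 <= Cd -> bounded_by d Cd ->
  \sum_(n < M) sq (Sv a n) <= Cd ^+ 2 * \sum_(n < M) (2 * eps ^+ 2 + (lam n) ^- 2) * p n ^+ 2.
Proof.
move=> cad bd C0 dC.
have dn n : sq (d (e n)) <= Cd ^+ 2.
  by apply: le_trans (bounded_by_sq hilb C0 dC _) _; rewrite e1 mulr1.
have an n : sq (adj d (e n)) <= Cd ^+ 2.
  have := bounded_by_sq hilb C0 (adjoint_bounded_by hilb C0 bd dC) (e n).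
  by rewrite e1 mulr1.
pose f (n i : nat) := (eps * p i) ^+ 2 * nsq (ip (d (e n)) (e i)).
apply: (@le_trans _ _ (\sum_(n < M) ((eps * p n) ^+ 2 + (q n / lam n) ^+ 2) * Cd ^+ 2 +
    \sum_(n < M) \sum_(i < M) f n i)).
  rewrite -big_split /=; apply: ler_sum => n _; apply: le_trans (Sv_sq cad (ltn_ord n)) _.
  by rewrite lerD2r ler_wpM2l// addr_ge0 ?sqr_ge0.
have F2 : \sum_(n < M) \sum_(i < M) f n i <= \sum_(i < M) (eps * p i) ^+ 2 * Cd ^+ 2.
  rewrite exchange_big /=; apply: ler_sum => i _; rewrite /f -mulr_sumr ler_wpM2l ?sqr_ge0//.
  apply: le_trans (an i); have := osys_bessel (adj d (e i)) M oe.
  apply: le_trans; apply: ler_sum => n _.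
  by rewrite -adjointPr// ipC nsqJ.
apply: le_trans (lerD (lexx _) F2) _; rewrite -big_split /= mulr_sumr; apply: ler_sum => n _.
have qp : (q n / lam n) ^+ 2 <= (lam n) ^- 2 * p n ^+ 2.
  rewrite exprMn exprVn mulrC ler_wpM2l ?invr_ge0 ?sqr_ge0//.
  by rewrite ler_sqr ?nnegrE ?cut_ge0 ?cut_le.
have C2 := sqr_ge0 Cd; rewrite !exprMn in qp *.
have := ler_wpM2r C2 qp; rewrite !mulrDl mulrDr; move: (lam n ^- 2 * _) => w; lra.
Qed.

(** Cyclicity of the trace in finite sums: one factor [q n] of the square is moved across [a], and
    the mixed terms in [q n * q i] cancel after exchanging the indices. *)
Lemma key_identity a b : bounded_op a -> linear b ->
  \sum_(n < M) (q n ^+ 2)%:C * ip (a (b (e n)) - b (a (e n))) (e n) =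
  \sum_(n < M) (q n)%:C * (ip (b (e n)) (Sv (adj a) n) - ip (b (Sv a n)) (e n)).
Proof.
move=> ba lb; pose A (n i : nat) := ip (a (e i)) (e n); pose B (n i : nat) := ip (b (e i)) (e n).
have E1 n : (q n)%:C * ip (b (e n)) (Sv (adj a) n) =
   (q n ^+ 2)%:C * ip (a (b (e n))) (e n) - \sum_(i < M) (q n)%:C * (q i)%:C * (A n i * B i n).
  rewrite /Sv ipBr ipZr conjR -adjointP// mulrBr mulrA -realM -expr2; congr (_ - _).
  rewrite ip_sumr mulr_sumr; apply: eq_bigr => i _.
  rewrite ipZr conjM conjR -adjointPr// -ipC /A /B; ring.
have E2 n : (q n)%:C * ip (b (Sv a n)) (e n) =
   (q n ^+ 2)%:C * ip (b (a (e n))) (e n) - \sum_(i < M) (q n)%:C * (q i)%:C * (A i n * B n i).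
  rewrite /Sv linB// linZ// lin_sum// ipBl ipZl mulrBr mulrA -realM -expr2; congr (_ - _).
  rewrite ip_suml mulr_sumr; apply: eq_bigr => i _.
  by rewrite linZ// ipZl /A /B; ring.
have X : \sum_(n < M) \sum_(i < M) (q n)%:C * (q i)%:C * (A n i * B i n) =
         \sum_(n < M) \sum_(i < M) (q n)%:C * (q i)%:C * (A i n * B n i).
  by rewrite exchange_big /=; apply: eq_bigr => n _; apply: eq_bigr => i _; ring.
under [RHS]eq_bigr do rewrite mulrBr E1 E2.
rewrite !sumrB X opprB addrA subrK -sumrB; apply: eq_bigr => n _.
by rewrite ipBl mulrBr.
Qed.

(** Each product of [q n] with a norm is split by the arithmetic-geometric inequality with parameter
    [eta]; the squares of norms are then summed by [Sv_sum]. *)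
Lemma key_bound a a' b (B Cd eta : R) d d' : bounded_op a -> a' = adj a ->
  comm_pair a d -> comm_pair a' d' -> bounded_op d -> bounded_op d' -> 0 <= Cd ->
  bounded_by d Cd -> bounded_by d' Cd -> linear b -> 0 <= B -> bounded_by b B -> 0 < eta ->
  Re (\sum_(n < M) (q n ^+ 2)%:C * ip (a (b (e n)) - b (a (e n))) (e n)) <=
  B * (2 * eta * \sum_(n < M) p n ^+ 2 +
       2 * Cd ^+ 2 / eta * \sum_(n < M) (2 * eps ^+ 2 + (lam n) ^- 2) * p n ^+ 2).
Proof.
move=> ba Ea c1 c2 bd bd' C0 dC dC' lb B0 bB eta0; rewrite (key_identity ba lb) -Ea Re_sum.
have S1 := Sv_sum c1 bd C0 dC; have S2 := Sv_sum c2 bd' C0 dC'.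
set W := \sum_(n < M) _ * p n ^+ 2 in S1 S2 *.
have amgm n y : q n * hnorm y <= eta * p n ^+ 2 + eta^-1 * sq y.
  rewrite -(hnormE hilb); have y0 := hnorm_ge0 y; have := cut_ge0 n; have := cut_le n.
  move: (hnorm y) (q n) (p n) y0 => t u r t0 ur u0.
  apply: (@le_trans _ _ (r * t)); first by rewrite ler_wpM2r.
  have := sqr_ge0 (eta * r - t / 2); have r0 : 0 <= r by exact: le_trans ur.
  have iv : eta^-1 * t ^+ 2 * eta = t ^+ 2 by rewrite mulrAC mulVf ?mul1r// gt_eqF.
  move=> H; rewrite -(ler_pM2r eta0) mulrDl iv; nra.
have e1' n : hnorm (e n) = 1 by rewrite (hnorm_sqrt hilb) e1 sqrtr1.
apply: (@le_trans _ _ (\sum_(n < M) B * ((eta * p n ^+ 2 + eta^-1 * sq (Sv a' n)) +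
    (eta * p n ^+ 2 + eta^-1 * sq (Sv a n))))).
  apply: ler_sum => n _; rewrite !cE /= mul0r subr0.
  have H1 : Re (ip (b (e n)) (Sv a' n)) <= B * hnorm (Sv a' n).
    apply: le_trans (le_trans (ler_norm _) (Re_ip_le_norm hilb (b (e n)) (Sv a' n))) _; rewrite ler_wpM2r ?hnorm_ge0//.
    by apply: le_trans (bB _) _; rewrite e1' mulr1.
  have H2 : - Re (ip (b (Sv a n)) (e n)) <= B * hnorm (Sv a n).
    have := le_trans (ler_norm _) (Re_ip_le_norm hilb (- b (Sv a n)) (e n)); rewrite ipNl cE => H.
    by apply: le_trans H _; rewrite hnormN e1' mulr1.
  apply: (@le_trans _ _ (q n * (B * hnorm (Sv a' n) + B * hnorm (Sv a n)))).
    by apply: ler_wpM2l; [exact: cut_ge0|lra].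
  have -> : q n * (B * hnorm (Sv a' n) + B * hnorm (Sv a n)) =
     B * (q n * hnorm (Sv a' n) + q n * hnorm (Sv a n)) by ring.
  by apply: ler_wpM2l => //; apply: lerD.
rewrite -mulr_sumr ler_wpM2l// !big_split /= -!mulr_sumr.
have V0 : 0 <= eta^-1 by rewrite invr_ge0 ltW.
have := ler_wpM2l V0 S1; have := ler_wpM2l V0 S2.
have -> : 2 * Cd ^+ 2 / eta * W = 2 * (eta^-1 * (Cd ^+ 2 * W)) by ring.
set P := \sum_(n < M) p n ^+ 2; rewrite -(mulrA 2 eta P).
move: (\sum_(n < M) sq _) (\sum_(n < M) sq _) (Cd ^+ 2 * W) => s1 s2 s3.
move: (eta * P) (eta^-1 * s1) (eta^-1 * s2) (eta^-1 * s3) => *; lra.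
Qed.
End Key.

(** * Powers of [f] as slowly varying weights *)

Section PowerCut.
Context (R : realType) (f lam : nat -> R) (n0 : nat) (eta s : R).
Hypotheses (fpos : forall n, (n0 <= n)%N -> 0 < f n)
  (fnd : forall m n, (m <= n)%N -> f m <= f n) (lnd : forall m n, (m <= n)%N -> lam m <= lam n)
  (fg : forall n i, (n0 <= n)%N -> (n <= i)%N -> f i - f n <= eta * f i * (lam i - lam n))
  (eta0 : 0 <= eta) (s0 : 0 <= s) (s2 : s <= 2).

(** Half the exponent, because the estimate concerns squares of weights; frozen below [n0], where
    [f] may vanish and its growth is not controlled. *)
Definition pcut n : R := f (maxn n n0) `^ (- (s / 2)).

Let fp n : 0 < f (maxn n n0). Proof. by apply: fpos; rewrite leq_maxr. Qed.

Lemma pcut_ge0 n : 0 <= pcut n. Proof. exact: powR_ge0. Qed.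

Lemma pcut_sqr n : pcut n ^+ 2 = f (maxn n n0) `^ (- s).
Proof.
rewrite -powR_mulrn ?powR_ge0// -powRrM; congr (_ `^ _).
by rewrite mulNr divfK.
Qed.

Lemma pcut_mono m n : (m <= n)%N -> pcut n <= pcut m.
Proof.
move=> mn; rewrite /pcut !powRN lef_pV2 ?posrE ?powR_gt0//.
apply: ge0_ler_powR; rewrite ?nnegrE ?(ltW (fp _)) ?divr_ge0//.
by apply: fnd; rewrite geq_max leq_maxr andbT (leq_trans mn) ?leq_maxl.
Qed.

(** With [r = f n' / f i'] at most 1, [pcut i] is [pcut n] times a power of [r] with exponent
    [s / 2 <= 1], hence at least [pcut n * r]; and [1 - r] is the relative growth of [f]. *)
Lemma pcut_growth n i : (n <= i)%N -> pcut n - pcut i <= eta * (lam i - lam n) * pcut n.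
Proof.
move=> ni; set n' := maxn n n0; set i' := maxn i n0.
have ni' : (n' <= i')%N by rewrite geq_max leq_maxr andbT (leq_trans ni) ?leq_maxl.
have fn := fp n; have fi := fp i; rewrite -/n' in fn; rewrite -/i' in fi.
have ll : lam i' - lam n' <= lam i - lam n.
  rewrite /i' /n'; have [i0|i0] := leqP i n0.
    by rewrite (maxn_idPr (leq_trans ni i0)) subrr subr_ge0 lnd.
  by rewrite lerD2l lerN2 lnd// leq_maxl.
pose r := f n' / f i'.
have r01 : 0 < r <= 1 by rewrite divr_gt0//= ler_pdivrMr// mul1r fnd.
have E : pcut i = pcut n * r `^ (s / 2).
  rewrite /pcut -/n' -/i' /r powRM ?invr_ge0 ?ltW// mulrA -powRD; last by rewrite (gt_eqF fn) implybT.
  by rewrite addNr powRr0 mul1r -(powR_inv1 (ltW fi)) -powRrM mulN1r.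
have rr : r <= r `^ (s / 2).
  have h1 : s / 2 <= 1 by rewrite ler_pdivrMr ?mul1r.
  have := ger_powR r01 h1; rewrite powRr1//.
  by case/andP: r01 => /ltW.
have g : 1 - r <= eta * (lam i' - lam n').
  have -> : 1 - r = (f i' - f n') / f i' by rewrite /r; field; rewrite gt_eqF.
  rewrite ler_pdivrMr//; apply: le_trans (fg _ ni') _; first by rewrite leq_maxr.
  by rewrite le_eqVlt; apply/orP; left; apply/eqP; ring.
rewrite E -[X in X - _]mulr1 -mulrBr mulrC ler_wpM2r ?pcut_ge0//.
apply: (@le_trans _ _ (1 - r)); first by rewrite lerD2l lerN2.
by apply: le_trans g _; rewrite ler_wpM2l.
Qed.
End PowerCut.

(** * Trace, counting function and spectral weight in the eigenbasis of [L] *)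

Section Concrete.
Context (R : realType) (h : completeNormedModType R[i])
        (ip : {dot h for Num.conj}) (hilb : is_hilbert ip).
Implicit Types (x y z v : h) (c : R[i]) (a b d : h -> h).
Local Notation Re := (@complex.Re R).
Local Notation Im := (@complex.Im R).
Local Notation sq := (sqnorm ip).

Lemma pos_trace_dop g (dl : nat -> R) (D : R) : osys ip g -> (forall n, 0 <= dl n) ->
  (forall n, nsq (dl n)%:C <= D) ->
  (pos_trace ip (dop ip g g (fun n => (dl n)%:C)) = \sum_(n <oo) (dl n * sq (g n))%:E)%E.
Proof.
move=> og d0 dD; rewrite -esum_onb_series//; apply: eq_esum => x _.
apply/esym/series_lim_EFin; have [cR _] := dop_ip hilb og og dD x x.
apply: cvg_eq cR => N; rewrite Re_sum; apply: eq_bigr => n _.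
by rewrite (ipC _ x) -mulrA [cj _ * _]mulrC -nsqE -realM.
Qed.

Variable (e : nat -> h).
Hypotheses (oe : osys ip e) (e1 : forall n, sq (e n) = 1).

(** [trace] is computed in a basis fixed by choice; [trace_series] brings it back to the
    eigenvectors. The imaginary part is the real part for [- 'i] times [b]. *)
Lemma trace_ccv b (dl : nat -> R) (C : R) : bounded_op b -> (forall n, 0 <= dl n) ->
  (forall N, \sum_(n < N) dl n <= C) ->
  ccv (fun N => \sum_(n < N) (dl n)%:C * ip (b (e n)) (e n))
      (trace ip (b \o dop ip e e (fun n => (dl n)%:C))).
Proof.
move=> bb d0 dC.
have dle n : dl n <= C by apply: le_trans (dC n.+1); rewrite big_ord_recr/= lerDr sumr_ge0.
have dD n : nsq (dl n)%:C <= C ^+ 2.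
  by rewrite nsqR ler_sqr ?nnegrE// (le_trans (d0 n)).
have sd : cvgn (series dl).
  have [l dl1] := nneg_series_cvg d0 dC; apply/cvg_ex; exists l.
  by apply: cvg_eq dl1 => N; rewrite /series /= big_mkord.
have main b' : bounded_op b' ->
    (fun N => \sum_(n < N) dl n * Re (ip (b' (e n)) (e n))) @ \oo -->
    real_sum (onb ip) (fun x => Re (ip (b' (dop ip e e (fun n => (dl n)%:C) x)) x)).
  move=> bb'; have [B B0 bB] := bounded_opE bb'; have lb := bounded_lin bb'.
  apply: (@trace_series _ _ _ hilb dl e (b' \o e) (1 + B ^+ 2)) => //.
  - by move=> n; rewrite e1 lerDl sqr_ge0.
  - move=> n; apply: le_trans (bounded_by_sq hilb (ltW B0) bB _) _.
    by rewrite e1 mulr1 lerDr.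
  move=> x _; have := hcv_Re hilb (y := x) (bounded_hcv bb' (dop_cvg hilb oe oe dD x)).
  apply: cvg_eq => N /=; rewrite lin_sum// ip_suml Re_sum; apply: eq_bigr => n _.
  by rewrite linZ// ipZl -mulrA cE /= mul0r subr0.
have bbi : bounded_op (fun x => - 'i%C *: b x) := boundedZ (- 'i%C) bb.
split.
  by apply: cvg_eq (main b bb) => N; rewrite Re_sum; apply: eq_bigr => n _; rewrite cE /= mul0r subr0.
have IE (z : R[i]) : Re (- 'i%C * z) = Im z by rewrite !cE /=; ring.
have := main _ bbi; rewrite /trace /=.
have -> : (fun x => Re (ip (- 'i%C *: b (dop ip e e (fun n => (dl n)%:C) x)) x)) =
          (fun x => Im (ip (b (dop ip e e (fun n => (dl n)%:C) x)) x)).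
  by apply/funext => x; rewrite ipZl IE.
apply: cvg_eq => N; rewrite Im_sum; apply: eq_bigr => n _.
by rewrite ipZl IE cE /= mul0r addr0.
Qed.

Variables (lam : nat -> R) (L : partial_op h).
Hypotheses (lam0 : forall n, 0 < lam n) (lnd : forall m n, (m <= n)%N -> lam m <= lam n)
  (lam_inf : lam @ \oo --> +oo) (Ld : is_diag ip e lam L).

Lemma counting_at n r : (forall i, (i < n)%N -> lam i <= r) -> r < lam n ->
  counting_function ip L r = (n%:R)%:E.
Proof.
move=> H1 H2; rewrite /counting_function.
have mA : measurable (`]0, r]%classic : set R) by exact: measurable_itv.
have -> : spectral_measure ip L `]0, r] = dop ip e e (fun k => (ind `]0, r] (lam k))%:C).
  rewrite (spectral_measure_diag hilb oe e1 (fun k => ltW (lam0 k)) Ld mA).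
  apply/funext => x; rewrite /Ed (_ : ind `]0, r] 0 = 0) ?scale0r ?addr0//.
  by rewrite /ind memNset//= in_itv/= ltxx.
have i0 k : 0 <= ind `]0, r] (lam k) by rewrite /ind ler0n.
have i1 k : nsq (ind `]0, r] (lam k))%:C <= 1 by exact: ind_bound.
rewrite (pos_trace_dop oe i0 i1).
have I k : ind `]0, r] (lam k) = (k < n)%N%:R.
  rewrite /ind; congr (_%:R); have [kn|nk] := ltnP k n.
    by rewrite mem_set//= in_itv/= lam0 H1.
  rewrite memNset//= in_itv/= => /andP[_]; apply/negP; rewrite -ltNge.
  exact: lt_le_trans H2 (lnd nk).
apply: series_lim_EFin; apply: cvg_trans (cvg_cst (n%:R : R)).
apply: near_eq_cvg; exists n => // N /= nN.
under eq_bigr do rewrite I e1 mulr1.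
rewrite -(big_mkord xpredT (fun k => (k < n)%N%:R)) (big_cat_nat (n := n))//=.
rewrite [X in _ + X]big1_seq ?addr0; last first.
  by move=> k /andP[_]; rewrite mem_index_iota => /andP[nk _]; rewrite ltnNge nk.
rewrite big_mkord (eq_bigr (fun=> 1)); last by move=> k _; rewrite ltn_ord.
by rewrite sumr_const card_ord.
exact: eventually_filter.
Qed.

Local Notation Nf := (fun r => fine (counting_function ip L r)).

Lemma counting_fine r : exists n, [/\ forall i, (i < n)%N -> lam i <= r, r < lam n & Nf r = n%:R].
Proof.
have ex : exists n, r < lam n.
  by have /cvgryPgt/(_ r)[n _ Hn] := lam_inf; exists n; apply: Hn => /=.
exists (ex_minn ex); case: ex_minnP => n rn mn.
have H i : (i < n)%N -> lam i <= r.
  by move=> i_n; rewrite leNgt; apply/negP => /mn; rewrite leqNgt i_n.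
by split => //; rewrite (counting_at H rn).
Qed.

Lemma counting_ge n r : lam n <= r -> n.+1%:R <= Nf r.
Proof.
move=> nr; have [m [H rm ->]] := counting_fine r; rewrite ler_nat ltnNge; apply/negP => /lnd mn.
by move: (lt_le_trans rm mn); rewrite ltNge nr.
Qed.

Lemma counting_le n r : r < lam n -> Nf r <= n%:R.
Proof.
move=> rn; have [m [H rm ->]] := counting_fine r; rewrite ler_nat leqNgt; apply/negP => /H nr.
by move: (lt_le_trans rn nr); rewrite ltxx.
Qed.

Lemma counting_mono r r' : r <= r' -> Nf r <= Nf r'.
Proof.
move=> rr; have [m [H rm ->]] := counting_fine r'.
exact: counting_le (le_lt_trans rr rm).
Qed.

Lemma counting_ge0 r : 0 <= Nf r.
Proof. by have [n [_ _ ->]] := counting_fine r; rewrite ler0n. Qed.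

(** The numbers [1 / M_k] repeated according to multiplicity, as [M_k] is the counting function at
    the k-th eigenvalue. *)
Definition wrho n : R := (Nf (lam n))^-1.

Lemma Nlam_ge n : n.+1%:R <= Nf (lam n). Proof. exact: counting_ge. Qed.
Lemma Nlam_gt0 n : 0 < Nf (lam n). Proof. by apply: lt_le_trans (Nlam_ge n); rewrite ltr0n. Qed.
Lemma wrho_gt0 n : 0 < wrho n. Proof. by rewrite invr_gt0 Nlam_gt0. Qed.
Lemma wrho_le n : wrho n <= n.+1%:R^-1.
Proof. by rewrite lef_pV2 ?posrE ?Nlam_gt0 ?ltr0n// Nlam_ge. Qed.

Lemma negative_power_fc (f : R -> R) (s : R) : (forall t : R, 0 <= t -> 0 <= f t) ->
  (forall x y : R, 0 <= x -> x <= y -> f x <= f y) ->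
  is_diag ip e (tt (fun n => f (lam n)) s) (negative_power ip (functional_calculus ip L f) s).
Proof.
move=> f0 fm.
have mf : measurable_fun setT (fun t : R => if 0 < t then f t else 0).
  apply: nondecreasing_measurable => // x y xy; case: ifPn => x0; case: ifPn => y0 //.
  - exact/fm/xy/ltW.
  - by rewrite (lt_le_trans x0 xy) in y0.
  - by rewrite f0// ltW.
have D1 := functional_calculus_diag hilb oe e1 (fun n => ltW (lam0 n)) Ld mf (fun t t0 => f0 t (ltW t0)).
have f1 n : 0 <= (if 0 < lam n then f (lam n) else 0) by rewrite lam0 f0 ?ltW.
have ms : measurable_fun setT (fun t : R => if 0 < t then t `^ (- s) else 0).
  apply: measurable_fun_ifT; [exact: measurable_fun_ltr| |exact: measurable_cst].
  exact: (measurable_powR (- s)).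
have := functional_calculus_diag hilb oe e1 f1 D1 ms (fun t _ => powR_ge0 t (- s)).
by congr is_diag; apply/funext => n; rewrite /tt lam0.
Qed.

Lemma tt_wrho n : tt (fun n => Nf (lam n)) 1 n = wrho n.
Proof. by rewrite /tt Nlam_gt0 powR_inv1// ltW ?Nlam_gt0. Qed.

Lemma weight_diag : diagonal ip (spectral_weight ip L) wrho e.
Proof.
have := @negative_power_fc Nf 1 (fun (t : R) _ => counting_ge0 t) (fun (x y : R) _ xy => counting_mono xy).
rewrite (_ : tt _ 1 = wrho); last by apply/funext => n; rewrite tt_wrho.
move=> D; have wd m n : (m <= n)%N -> wrho n <= wrho m.
  by move=> mn; rewrite lef_pV2 ?posrE ?Nlam_gt0// counting_mono// lnd.
have w0 n := ltW (wrho_gt0 n).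
have [_ E] := is_diag_bounded hilb oe e1 D (rdop_bound w0 wd).
rewrite /spectral_weight E; apply: (diag_rdop hilb) => //.
  by move=> n en; have := e1 n; rewrite en sq0 => /esym/eqP; rewrite oner_eq0.
apply: (@squeeze_cvgr _ _ _ _ (fun=> 0) (fun n => n.+1%:R^-1)).
- by near=> n; rewrite w0 wrho_le.
- exact: cvg_cst.
- exact: cvg_harmonic.
Unshelve. all: by end_near. Qed.

(** The commutator of the adjoint with [L] is minus the adjoint of [d]; it is established on
    pairings with eigenvectors and null vectors, which is what the estimate asks. *)
Lemma comm_pairs a : lipschitz_algebra L a -> exists d d' Cd, [/\ comm_pair ip e lam a d,
  comm_pair ip e lam (adjoint ip a) d', bounded_op d /\ bounded_op d', 0 <= Cd &
  bounded_by d Cd /\ bounded_by d' Cd].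
Proof.
move=> [ba da [d [bd dE]]]; have [Cd C0 dC] := bounded_opE bd; have la := bounded_lin ba.
have de n := is_diag_e oe e1 Ld n.
have Le n : L (e n) = (lam n)%:C *: e n := is_diag_eig oe e1 Ld n.
have cad : comm_pair ip e lam a d.
  split=> [n i|n v nv].
    rewrite dE// Le linZ// ipBl ipZl (is_diag_coef oe e1 Ld _ (da _ (de n))) -mulrBl; congr (_ * _).
    by apply: complex_ext; rewrite !cE /= ?subrr.
  by rewrite dE// Le linZ// ipBl ipZl (is_diag_null Ld nv (da _ (de n))) subr0.
exists d, (fun x => -1 *: adjoint ip d x), Cd; split => //; last 2 first.
- exact: ltW.
- split=> // x; rewrite scaleN1r hnormN.
  exact: (adjoint_bounded_by hilb (ltW C0) bd dC).
- have [c1 _] := cad; split=> [n i|n v nv].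
    rewrite scaleN1r ipNl -!adjointPr// (ipC _ (e n)) c1 conjM conjR -(ipC _ (e n)) -mulNr.
    by congr (_ * _); apply: complex_ext; rewrite !cE /= ?oppr0 ?subrr ?opprB ?oppr0.
  have dv := is_diag_null_dom Ld nv.
  rewrite scaleN1r ipNl -!adjointPr// (ipC _ (e n)) dE// (is_diag_null0 oe e1 Ld nv).
  rewrite lin0// sub0r ipNl conjN opprK (is_diag_coef oe e1 Ld _ (da _ dv)) conjM conjR.
  by rewrite -(ipC _ (e n)).
by split=> //; exact: boundedZ (adjoint_bounded hilb bd).
Qed.
End Concrete.

(** * Passing to the limit in inequalities and in complex values *)

Section Limits.
Context (R : realType).
Local Notation Re := (@complex.Re R).
Local Notation Im := (@complex.Im R).

Lemma rlim_le (u : nat -> R) (l X : R) : u @ \oo --> l -> (forall N, u N <= X) -> l <= X.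
Proof. by move=> ul uX; apply: (ler_cvg_to ul (cvg_cst X)); near=> N. Unshelve. all: by end_near. Qed.

Lemma rcvg_sum K (u : nat -> nat -> R) (l : nat -> R) : (forall k, (fun N => u k N) @ \oo --> l k) ->
  (fun N => \sum_(k < K) u k N) @ \oo --> \sum_(k < K) l k.
Proof.
move=> ul; elim: K => [|K IH].
  by rewrite big_ord0; under eq_fun do rewrite big_ord0; exact: cvg_cst.
by rewrite big_ord_recr; under eq_fun do rewrite big_ord_recr; apply: cvgD; [exact: IH|exact: ul].
Qed.

Lemma Re_realM (r : R) (z : R[i]) : Re (r%:C * z) = r * Re z.
Proof. by rewrite cE /= mul0r subr0. Qed.
Lemma Im_realM (r : R) (z : R[i]) : Im (r%:C * z) = r * Im z.
Proof. by rewrite cE /= mul0r addr0. Qed.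

Lemma clim (G : set_system R) {FG : Filter G} (F : R -> R[i]^o) (l : R[i]^o) :
  Re (F s) @[s --> G] --> Re l -> Im (F s) @[s --> G] --> Im l ->
  F s @[s --> G] --> l.
Proof.
move=> cR cI; apply/cvgrPdist_lt => eps e0; have [r r0' er'] := lt0_real e0.
have er : eps = (Re eps)%:C by rewrite er'.
have r0 : 0 < Re eps by rewrite er'.
have e2 : 0 < Re eps / 2 by rewrite divr_gt0.
move/cvgrPdist_lt/(_ _ e2) : cR => cR; move/cvgrPdist_lt/(_ _ e2) : cI => cI.
near=> s.
have h1 : `|Re l - Re (F s)| < Re eps / 2 by near: s; exact: cR.
have h2 : `|Im l - Im (F s)| < Re eps / 2 by near: s; exact: cI.
rewrite er norm_nsq ltcR -[ltRHS](ger0_norm (ltW r0)) -sqrtr_sqr ltr_sqrt ?exprn_gt0//.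
rewrite /nsq !cE; set x := Re l - _ in h1 *; set y := Im l - _ in h2 *.
rewrite -(real_normK (num_real x)) -(real_normK (num_real y)).
have := normr_ge0 x; have := normr_ge0 y; move: h1 h2 r0; move: `|x| `|y| (Re eps) => u v w *; nra.
Unshelve. all: by end_near. Qed.
End Limits.

(** * Uniform estimates and the limits at [s = 1] *)

Section Estimates.
Context (R : realType) (h : completeNormedModType R[i])
        (ip : {dot h for Num.conj}) (hilb : is_hilbert ip).
Implicit Types (x y z v : h) (c : R[i]) (a b d : h -> h).
Local Notation Re := (@complex.Re R).
Local Notation Im := (@complex.Im R).
Local Notation sq := (sqnorm ip).
Variable (e : nat -> h).
Hypotheses (oe : osys ip e) (e1 : forall n, sq (e n) = 1).
Variables (lam : nat -> R) (L : partial_op h).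
Hypotheses (lam0 : forall n, 0 < lam n) (lnd : forall m n, (m <= n)%N -> lam m <= lam n)
  (lam_inf : lam @ \oo --> +oo) (Ld : is_diag ip e lam L).
Variable (f : nat -> R).
Hypotheses (fnd : forall m n, (m <= n)%N -> f m <= f n)
  (fas : forall eps : R, 0 < eps -> exists n0, forall n, (n0 <= n)%N ->
     0 < f n /\ `|f n - n.+1%:R| <= eps * n.+1%:R)
  (fgr : forall eta : R, 0 < eta -> exists n0, forall n i, (n0 <= n)%N -> (n <= i)%N ->
     f i - f n <= eta * f i * (lam i - lam n)).

(** For [f n = phi (lam n)] and [s > 1] this is the negative power of [phi(L)]. *)
Definition Tp s : h -> h := dop ip e e (fun n => (tt f s n)%:C).

Lemma lam_tail (eta : R) : 0 < eta -> exists n0, forall n, (n0 <= n)%N -> (lam n) ^- 2 <= eta ^+ 2.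
Proof.
move=> eta0; have /cvgryPge/(_ eta^-1)[n0 _ H] := lam_inf; exists n0 => n /H /= hn.
have i0 : 0 < eta^-1 by rewrite invr_gt0.
rewrite -[leRHS]invrK lef_pV2 ?posrE ?exprn_gt0 ?invr_gt0 ?exprn_gt0// -exprVn.
by rewrite ler_sqr ?nnegrE ?(ltW i0) ?(ltW (lam0 n)).
Qed.

Lemma e_norm n : hnorm (e n) = 1. Proof. by rewrite (hnorm_sqrt hilb) e1 sqrtr1. Qed.

Lemma comm_coef_le a b (Ca B : R) n : 0 <= Ca -> bounded_by a Ca -> 0 <= B -> bounded_by b B ->
  `|Re (ip (a (b (e n)) - b (a (e n))) (e n))| <= 2 * Ca * B.
Proof.
move=> Ca0 aC B0 bB; apply: le_trans (Re_ip_le_norm hilb _ _) _; rewrite e_norm mulr1.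
apply: le_trans (hnormD _ _) _; rewrite hnormN.
have h1 : hnorm (a (b (e n))) <= Ca * B.
  by apply: le_trans (aC _) _; rewrite ler_wpM2l//; apply: le_trans (bB _) _; rewrite e_norm mulr1.
have h2 : hnorm (b (a (e n))) <= B * Ca.
  by apply: le_trans (bB _) _; rewrite ler_wpM2l//; apply: le_trans (aC _) _; rewrite e_norm mulr1.
by rewrite [B * Ca]mulrC in h2; rewrite -mulrA; move: (Ca * B) h1 h2 => w h1 h2; lra.
Qed.

(** The estimate behind all commutator statements. It bears on partial sums and includes [s = 1], so
    it serves the limits at 1 and the logarithmic means alike; [C] depends on [a] and [eps] but not
    on [s], [M] or [b], and the last point is what the trace norm of a commutator needs. *)
Lemma key_uniform a (eps : R) : lipschitz_algebra L a -> 0 < eps -> exists2 C, 0 <= C &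
  forall s M b B, 1 <= s -> s <= 2 -> linear b -> 0 <= B -> bounded_by b B ->
  Re (\sum_(n < M) (tt f s n)%:C * ip (a (b (e n)) - b (a (e n))) (e n)) <=
  B * (eps * \sum_(n < M) pw s n + C).
Proof.
move=> aL e0; have [ba _ _] := aL.
have [d [d' [Cd [c1 c2 [bd bd'] Cd0 [dC dC']]]]] := comm_pairs hilb oe e1 Ld aL.
have [Ca Ca0' aC] := bounded_opE ba; have Ca0 := ltW Ca0'.
(* [K] adds up the coefficients of [eta * P] in the errors below: 2 and [6 * Cd ^+ 2] from
   [key_bound], [2 * Ca] from replacing [tt] by the cut weights. As [P] is about twice the sum of
   the [pw], [K * eta] is set to [eps / 2]. *)
pose K := 2 + 6 * Cd ^+ 2 + 2 * Ca; pose eta := eps / (2 * K).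
have C20 : 0 <= Cd ^+ 2 by exact: sqr_ge0.
have K0 : 0 < K by rewrite /K; move: (Cd ^+ 2) C20 => w w0; lra.
have eta0 : 0 < eta by rewrite divr_gt0// mulr_gt0.
have etaK : K * eta = eps / 2 by rewrite /eta; field; rewrite gt_eqF.
have etaV : 0 <= eta^-1 by rewrite invr_ge0 ltW.
have [n1 H1] := fgr eta0; have [n2 H2] := tt_asym fas ltr01; have [n3 H3] := lam_tail eta0.
pose n0 := maxn n1 n2.
have fpos n : (n0 <= n)%N -> 0 < f n by rewrite geq_max => /andP[_ /H2[]].
have fg n i : (n0 <= n)%N -> (n <= i)%N -> f i - f n <= eta * f i * (lam i - lam n).
  by rewrite geq_max => /andP[+ _]; exact: H1.
pose G n := hb f n0 + hb f n.
have G0 n : 0 <= G n by rewrite addr_ge0 ?hb_ge0.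
pose C1 := \sum_(n < n0) G n; pose C2 := \sum_(n < n3) (lam n) ^- 2 * G n.
pose C3 := 2 + n0%:R * hb f n0.
have l0 n : 0 <= (lam n) ^- 2 by rewrite invr_ge0 sqr_ge0.
have C10 : 0 <= C1 by rewrite sumr_ge0.
have C2_0 : 0 <= C2 by apply: sumr_ge0 => n _; exact: mulr_ge0.
have C30 : 0 <= C3 by rewrite addr_ge0// mulr_ge0// hb_ge0.
pose c0 := 2 * (Cd ^+ 2 * (eta^-1 * C2)) + 2 * Ca * (eta^-1 * C3 + C1).
have c00 : 0 <= c0.
  by rewrite /c0; apply: addr_ge0; rewrite !mulr_ge0 ?addr_ge0 ?mulr_ge0.
exists (eps / 2 * C1 + c0) => [|s M b B s1 s2 lb B0 bB].
  by rewrite addr_ge0// mulr_ge0// divr_ge0 ?ltW.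
have s0 : 0 <= s by exact: le_trans s1.
pose p := pcut f n0 s.
have pp n : 0 <= p n by exact: pcut_ge0.
have pnd m n : (m <= n)%N -> p n <= p m by exact: (pcut_mono fpos fnd s0).
have pg n i : (n <= i)%N -> p n - p i <= eta * (lam i - lam n) * p n.
  by move=> ni; apply: (pcut_growth (s := s) (n0 := n0) (lam := lam)) => //; exact: ltW.
have psq n : p n ^+ 2 = tt f s (maxn n n0).
  by rewrite /p pcut_sqr /tt fpos// leq_maxr.
have pG n : p n ^+ 2 <= G n.
  rewrite psq /G; have [nn|nn] := leqP n n0.
    by apply: le_trans (tt_head _ _ s1 s2) _; rewrite lerDl hb_ge0.
  by apply: le_trans (tt_head _ _ s1 s2) _; rewrite lerDr hb_ge0.
have pt n : (n0 <= n)%N -> p n ^+ 2 <= 2 * pw s n.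
  move=> nn; rewrite psq (maxn_idPl nn).
  have [_ /(_ s s1 s2)] := H2 n (leq_trans (leq_maxr _ _) nn).
  by rewrite mul1r ler_norml => /andP[_]; lra.
set P := \sum_(n < M) p n ^+ 2.
have P0 : 0 <= P by apply: sumr_ge0 => n _; exact: sqr_ge0.
have PC : P <= 2 * \sum_(n < M) pw s n + C1.
  rewrite mulr_sumr; apply: (@sum_head _ (fun n => p n ^+ 2) (fun n => 2 * pw s n) G) => //.
  by move=> n; rewrite mulr_ge0 ?pw_ge0.
have W2 : \sum_(n < M) (lam n) ^- 2 * p n ^+ 2 <= eta ^+ 2 * P + C2.
  rewrite /P mulr_sumr; apply: (@sum_head _ (fun n => (lam n) ^- 2 * p n ^+ 2)
    (fun n => eta ^+ 2 * p n ^+ 2) (fun n => (lam n) ^- 2 * G n)).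
  - by move=> n nn; rewrite ler_wpM2r ?sqr_ge0// H3.
  - by move=> n; rewrite ler_wpM2l.
  - by move=> n; rewrite mulr_ge0 ?sqr_ge0.
  - by move=> n; exact: mulr_ge0.
(* The price of lowering [M] weights: [p M ^+ 2] is at most [2 / (M + 1)] from [n0] on, for every
   [s >= 1], so the product stays bounded. *)
have MP : M%:R * p M ^+ 2 <= C3.
  have m0 : 0 <= M%:R :> R by rewrite ler0n.
  have [nM|Mn] := leqP n0 M.
    apply: (@le_trans _ _ 2); last by rewrite /C3 lerDl mulr_ge0 ?hb_ge0.
    apply: le_trans (ler_wpM2l m0 (pt M nM)) _; rewrite mulrCA ler_piMr//.
    have pwM : pw s M <= M.+1%:R^-1.
      by rewrite -pw1 /pw; apply: ler_powR; [rewrite ler1n|rewrite lerN2].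
    apply: le_trans (ler_wpM2l m0 pwM) _; rewrite ler_pdivrMr ?ltr0n// mul1r ler_nat//.
  rewrite psq (maxn_idPr (ltnW Mn)) /C3; apply: ler_wpDl => //.
  apply: ler_pM => //; first exact: tt_ge0.
    by rewrite ler_nat ltnW.
  exact: tt_head.
pose q n := cut p M n.
(* The two weights differ below [n0] only, where [p] is frozen. *)
have D1 : \sum_(n < M) `|tt f s n - p n ^+ 2| <= C1.
  apply: (@le_trans _ _ (\sum_(n < M) (0 : R) + \sum_(n < n0) G n)); last by rewrite big1// add0r.
  apply: (@sum_head _ (fun n => `|tt f s n - p n ^+ 2|) (fun=> 0) G) => // n.
    by move=> nn; rewrite psq (maxn_idPl nn) subrr normr0.
  have := tt_head f n s1 s2; have := tt_ge0 f s n; have := pG n; have := sqr_ge0 (p n).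
  have := hb_ge0 f n0; have [nn|nn] := leqP n0 n.
    by rewrite psq (maxn_idPl nn) subrr normr0 => *; exact: G0.
  rewrite psq (maxn_idPr (ltnW nn)) /G => *.
  have := tt_head f n0 s1 s2.
  by rewrite ler_norml => *; apply/andP; split; lra.
(* The difference is at most [2 * p n * p M], split with parameter [eta]; the part in [p M ^+ 2]
   sums to [MP]. *)
have D2 : \sum_(n < M) `|p n ^+ 2 - q n ^+ 2| <= eta * P + eta^-1 * C3.
  apply: (@le_trans _ _ (\sum_(n < M) (eta * p n ^+ 2 + eta^-1 * p M ^+ 2))).
    apply: ler_sum => n _; rewrite /q /cut ltn_ord.
    have h1 := pp n; have h2 := pp M; have h3 := pnd _ _ (ltnW (ltn_ord n)).
    have -> : p n ^+ 2 - (p n - p M) ^+ 2 = 2 * (p n * p M) - p M ^+ 2 by ring.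
    have am : 2 * (p n * p M) <= eta * p n ^+ 2 + eta^-1 * p M ^+ 2.
      have -> : eta * p n ^+ 2 + eta^-1 * p M ^+ 2 = 2 * (p n * p M) + eta^-1 * (eta * p n - p M) ^+ 2.
        by move: (p n) (p M) => u w; field; rewrite gt_eqF.
      by rewrite lerDl mulr_ge0 ?sqr_ge0.
    have g0 : 0 <= 2 * (p n * p M) - p M ^+ 2 by move: h1 h2 h3; move: (p n) (p M) => u w; nra.
    by rewrite ger0_norm//; apply: le_trans am; rewrite lerBlDr lerDl sqr_ge0.
  rewrite big_split /= -mulr_sumr lerD2l sumr_const card_ord -mulr_natl mulrCA.
  by rewrite ler_wpM2l.
set X := fun n => ip (a (b (e n)) - b (a (e n))) (e n).
have XB n : `|Re (X n)| <= 2 * Ca * B by exact: (comm_coef_le n Ca0 aC B0 bB).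
have KB : Re (\sum_(n < M) (q n ^+ 2)%:C * X n) <= B * (2 * eta * P +
       2 * Cd ^+ 2 / eta * \sum_(n < M) (2 * eta ^+ 2 + (lam n) ^- 2) * p n ^+ 2).
  exact: (key_bound hilb oe e1 M lam0 pp pnd pg ba (erefl _) c1 c2 bd bd' Cd0 dC dC' lb B0 bB eta0).
have RE (r : nat -> R) : Re (\sum_(n < M) (r n)%:C * X n) = \sum_(n < M) r n * Re (X n).
  by rewrite Re_sum; apply: eq_bigr => n _; rewrite cE /= mul0r subr0.
have D : Re (\sum_(n < M) (tt f s n)%:C * X n) - Re (\sum_(n < M) (q n ^+ 2)%:C * X n) <=
    2 * Ca * B * (eta * P + eta^-1 * C3 + C1).
  rewrite !(RE (tt f s), RE (fun n => q n ^+ 2)) -sumrB.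
  apply: (@le_trans _ _ (\sum_(n < M) 2 * Ca * B * (`|tt f s n - p n ^+ 2| + `|p n ^+ 2 - q n ^+ 2|))).
    apply: ler_sum => n _; rewrite -mulrBl; apply: le_trans (ler_norm _) _.
    rewrite normrM mulrC; apply: ler_pM => //.
    by rewrite -[X in `|X|](subrKA (p n ^+ 2)) ler_normD.
  rewrite -mulr_sumr big_split /= ler_wpM2l ?mulr_ge0// addrC lerD//.
have WE : \sum_(n < M) (2 * eta ^+ 2 + (lam n) ^- 2) * p n ^+ 2 <= 3 * eta ^+ 2 * P + C2.
  rewrite (eq_bigr (fun n : 'I_M => 2 * eta ^+ 2 * p n ^+ 2 + (lam n) ^- 2 * p n ^+ 2)); last first.
    by move=> n _; rewrite mulrDl.
  rewrite big_split /= -mulr_sumr -/P; move: W2; rewrite -!mulrA.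
  by move: (eta ^+ 2 * P) => w; lra.
have KB2 : 2 * Cd ^+ 2 / eta * \sum_(n < M) (2 * eta ^+ 2 + (lam n) ^- 2) * p n ^+ 2 <=
    6 * Cd ^+ 2 * eta * P + 2 * (Cd ^+ 2 * (eta^-1 * C2)).
  have c2e : 0 <= 2 * Cd ^+ 2 / eta by rewrite !mulr_ge0.
  apply: le_trans (ler_wpM2l c2e WE) _; rewrite le_eqVlt; apply/orP; left; apply/eqP.
  by field; rewrite gt_eqF.
apply: (@le_trans _ _ (B * (2 * eta * P + (6 * Cd ^+ 2 * eta * P + 2 * (Cd ^+ 2 * (eta^-1 * C2)))) +
   2 * Ca * B * (eta * P + eta^-1 * C3 + C1))).
  have := ler_wpM2l B0 KB2; move: KB D; rewrite !mulrDr.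
  by move=> *; lra.
have -> : B * (2 * eta * P + (6 * Cd ^+ 2 * eta * P + 2 * (Cd ^+ 2 * (eta^-1 * C2)))) +
   2 * Ca * B * (eta * P + eta^-1 * C3 + C1) = B * (K * eta * P + c0) by rewrite /K /c0; ring.
rewrite ler_wpM2l// etaK.
have e20 : 0 <= eps / 2 by rewrite divr_ge0 ?ltW.
have := ler_wpM2l e20 PC.
have -> : eps / 2 * (2 * \sum_(n < M) pw s n + C1) = eps * \sum_(n < M) pw s n + eps / 2 * C1 by field.
have X0 (u v w x : R) : u <= v + w -> u + x <= v + (w + x) by rewrite addrA lerD2r.
exact: X0.
Qed.

(** The bound is unchanged when [b] is multiplied by a scalar of modulus 1; the four units 1, -1,
    ['i], [- 'i] give both signs of both parts. *)
Lemma key_rot a (eps : R) : lipschitz_algebra L a -> 0 < eps -> exists2 C, 0 <= C &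
  forall s M b B, 1 <= s -> s <= 2 -> linear b -> 0 <= B -> bounded_by b B ->
  `|Re (\sum_(n < M) (tt f s n)%:C * ip (commutator a b (e n)) (e n))| <=
    B * (eps * \sum_(n < M) pw s n + C) /\
  `|Im (\sum_(n < M) (tt f s n)%:C * ip (commutator a b (e n)) (e n))| <=
    B * (eps * \sum_(n < M) pw s n + C).
Proof.
move=> aL e0; have [C C0 HC] := key_uniform aL e0; exists C => // s M b B s1 s2 lb B0 bB.
have [[la _] _ _] := aL.
set S := \sum_(n < M) _.
have rot c : nsq c = 1 -> Re (c * S) <= B * (eps * \sum_(n < M) pw s n + C).
  move=> c1; have lcb : linear (fun x => c *: b x).
    by move=> k x y; rewrite lb scalerDr !scalerA [c * k]mulrC.
  have bcb : bounded_by (fun x => c *: b x) B.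
    by move=> x; rewrite (hnorm_sqrt hilb) sqZ c1 mul1r -(hnorm_sqrt hilb).
  have := HC s M _ B s1 s2 lcb B0 bcb; congr (Re _ <= _).
  rewrite /S mulr_sumr; apply: eq_bigr => n _; rewrite linZ// -scalerBr ipZl mulrCA.
  by [].
have h1 := rot 1 (ltac:(by rewrite /nsq /=; ring)).
have h2 := rot (-1) (ltac:(by rewrite /nsq /=; ring)).
have h3 := rot 'i%C (ltac:(by rewrite /nsq /=; ring)).
have h4 := rot (- 'i%C) (ltac:(by rewrite /nsq /=; ring)).
clear rot; clearbody S; move: h1 h2 h3 h4; case: S => u w; rewrite !cE /= => *.
by split; rewrite ler_norml; apply/andP; split; lra.
Qed.

Lemma tt_pw_le (s : R) N : 1 < s -> s <= 2 -> (s - 1) * \sum_(n < N) pw s n <= 2.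
Proof. by move=> s1 s2; apply: le_trans (zeta_le N (ltW s1)) s2. Qed.

Lemma Tp_bound s : 1 < s -> exists D, forall n, nsq (tt f s n)%:C <= D.
Proof.
move=> s1; have [C HC] := tt_sum_bounded fas s1; exists (C ^+ 2) => n.
have h1 : tt f s n <= C.
  by apply: le_trans (HC n.+1); rewrite big_ord_recr/= lerDr sumr_ge0// => i _; exact: tt_ge0.
by rewrite nsqR ler_sqr ?nnegrE ?tt_ge0// (le_trans (tt_ge0 f s n)).
Qed.

Lemma Tp_ccv s b : 1 < s -> bounded_op b ->
  ccv (fun N => \sum_(n < N) (tt f s n)%:C * ip (b (e n)) (e n)) (trace ip (b \o Tp s)).
Proof.
move=> s1 bb; have [C HC] := tt_sum_bounded fas s1.
exact: (trace_ccv hilb oe e1 bb (tt_ge0 f s) HC).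
Qed.

Lemma comm_bounded a b : bounded_op a -> bounded_op b -> bounded_op (commutator a b).
Proof. by move=> ba bb; apply: boundedB; exact: bounded_comp. Qed.

Lemma comm_trace_lim a b : lipschitz_algebra L a -> bounded_op b ->
  ((s - 1)%:C * trace ip (commutator a b \o Tp s) : R[i]^o) @[s --> 1^'+] --> (0 : R[i]^o).
Proof.
move=> aL bb; have [ba _ _] := aL; have [B B0 bB] := bounded_opE bb; have lb := bounded_lin bb.
have bc := comm_bounded ba bb.
have main (pr : R[i] -> R) : (forall z : R[i], pr z = Re z) \/ (forall z : R[i], pr z = Im z) ->
    (s - 1) * pr (trace ip (commutator a b \o Tp s)) @[s --> 1^'+] --> (0 : R).
  move=> prE; apply: right_lim0 => eps e0.
  (* The 2 is the bound of [tt_pw_le], and [B] the factor in [key_rot]. *)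
  have e2 : 0 < eps / (2 * B) by rewrite divr_gt0// mulr_gt0.
  have [C C0 HC] := key_rot aL e2; exists (B * C) => s s1 s2.
  have t0 : 0 <= s - 1 by rewrite subr_ge0 ltW.
  have bnd N : (s - 1) * `|pr (\sum_(n < N) (tt f s n)%:C * ip (commutator a b (e n)) (e n))| <=
      eps + B * C * (s - 1).
    have [hR hI] := HC s N b B (ltW s1) s2 lb (ltW B0) bB.
    have {hR hI} hp : `|pr (\sum_(n < N) (tt f s n)%:C * ip (commutator a b (e n)) (e n))| <=
       B * (eps / (2 * B) * \sum_(n < N) pw s n + C) by case: prE => ->.
    apply: le_trans (ler_wpM2l t0 hp) _.
    have := ler_wpM2l (ltW (divr_gt0 e0 (ltr0n R 2))) (tt_pw_le N s1 s2).
    have -> : (s - 1) * (B * (eps / (2 * B) * \sum_(n < N) pw s n + C)) =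
      eps / 2 * ((s - 1) * \sum_(n < N) pw s n) + B * C * (s - 1).
      by field; rewrite gt_eqF.
    by rewrite divfK//; lra.
  have cv : (fun N => pr (\sum_(n < N) (tt f s n)%:C * ip (commutator a b (e n)) (e n))) @ \oo -->
      pr (trace ip (commutator a b \o Tp s)).
    have [cR cI] := Tp_ccv s1 bc; case: prE => E; rewrite E.
      by apply: cvg_eq cR => N; rewrite E.
    by apply: cvg_eq cI => N; rewrite E.
  rewrite normrM (ger0_norm t0).
  apply: (@rlim_le _ (fun N => (s - 1) * `|pr (\sum_(n < N) (tt f s n)%:C * ip (commutator a b (e n)) (e n))|)) => //.
  by apply: cvgM; [exact: cvg_cst|exact: cvg_norm].
apply: clim.
  rewrite (_ : (fun s : R => _) = (fun s => (s - 1) * Re (trace ip (commutator a b \o Tp s)))).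
    exact: (main Re (or_introl (fun=> erefl))).
  by apply/funext => s; exact: Re_realM.
rewrite (_ : (fun s : R => _) = (fun s => (s - 1) * Im (trace ip (commutator a b \o Tp s)))).
  exact: (main Im (or_intror (fun=> erefl))).
by apply/funext => s; exact: Im_realM.
Qed.

Lemma pw_cvg0 (t : R) : 0 < t -> (fun n => pw t n : R) @ \oo --> (0 : R).
Proof.
move=> t0; pose g (n : nat) : R := n.+1%:R.
have gas (eps : R) : 0 < eps -> exists n0, forall n, (n0 <= n)%N ->
     0 < g n /\ `|g n - n.+1%:R| <= eps * n.+1%:R.
  by move=> ?; exists 0%N => n _; rewrite /g subrr normr0 ltr0n mulr_ge0// ltW.
by apply: cvg_eq (tt_cvg0 gas t0) => n; rewrite /tt /g ltr0n.
Qed.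

Lemma pw_w (t : R) n : expR (- (t * ln n.+1%:R)) = pw t n :> R.
Proof. by rewrite /pw /powR gt_eqF ?ltr0n// mulNr. Qed.

(** [tt] is replaced by [pw] up to a factor [eps] and a constant, and [zeta_ge], [zeta_le] bracket
    the sum of [pw]; the term [pw (s - 1) N] disappears as [N] grows. *)
Lemma trace_weight_bounds (eps : R) : 0 < eps -> eps <= 1 -> exists C, 0 <= C /\ forall s (l : R), 1 < s -> s <= 2 ->
  (fun N => \sum_(n < N) tt f s n) @ \oo --> l -> `|(s - 1) * l - 1| <= 2 * eps + (C + 2) * (s - 1).
Proof.
move=> e0 e1'; have [C HC] := tt_sum_asym fas e0; exists `|C|; split => // s l s1 s2 cl.
have t0 : 0 < s - 1 by rewrite subr_gt0.
have HN N : (1 - eps) * (1 - pw (s - 1) N) - `|C| * (s - 1) <= (s - 1) * \sum_(n < N) tt f s n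
    /\ (s - 1) * \sum_(n < N) tt f s n <= (1 + eps) * s + `|C| * (s - 1).
  have h1 := HC s N (ltW s1) s2; have h2 := zeta_ge N (ltW s1); have h3 := zeta_le N (ltW s1).
  rewrite pw_w in h2.
  have h4 : `|\sum_(n < N) tt f s n - \sum_(n < N) pw s n| <= eps * \sum_(n < N) pw s n + `|C|.
    rewrite -sumrB; apply: le_trans (ler_norm_sum _ _ _) _; apply: le_trans h1 _.
    by rewrite lerD2l ler_norm.
  move: h4 h2 h3; move: (\sum_(n < N) tt f s n) (\sum_(n < N) pw s n) (pw (s - 1) N) `|C| => a b w c.
  rewrite ler_norml => /andP[h4 h5] h2 h3.
  have k1 : (s - 1) * (b - a) <= (s - 1) * (eps * b + c) by rewrite ler_wpM2l ?(ltW t0)//; lra.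
  have k2 : (s - 1) * (a - b) <= (s - 1) * (eps * b + c) by rewrite ler_wpM2l ?(ltW t0).
  have k3 : (1 - eps) * (1 - w) <= (1 - eps) * ((s - 1) * b) by rewrite ler_wpM2l// subr_ge0.
  have k4 : (1 + eps) * ((s - 1) * b) <= (1 + eps) * s by rewrite ler_wpM2l// addr_ge0// ltW.
  have E1 : (s - 1) * (b - a) = (s - 1) * b - (s - 1) * a by ring.
  have E2 : (s - 1) * (a - b) = (s - 1) * a - (s - 1) * b by ring.
  have E3 : (s - 1) * (eps * b + c) = eps * ((s - 1) * b) + c * (s - 1) by ring.
  have E4 : (1 - eps) * ((s - 1) * b) = (s - 1) * b - eps * ((s - 1) * b) by ring.
  have E5 : (1 + eps) * ((s - 1) * b) = (s - 1) * b + eps * ((s - 1) * b) by ring.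
  move: k1 k2 k3 k4; rewrite E1 E2 E3 E4 E5.
  generalize (eps * ((s - 1) * b)); generalize ((s - 1) * a); generalize ((s - 1) * b).
  generalize (c * (s - 1)); generalize ((1 - eps) * (1 - w)); generalize ((1 + eps) * s).
  by intros; split; lra.
have cs : (fun N => (s - 1) * \sum_(n < N) tt f s n) @ \oo --> (s - 1) * l.
  by apply: cvgM => //; exact: cvg_cst.
have u1 : (s - 1) * l <= (1 + eps) * s + `|C| * (s - 1).
  by apply: rlim_le cs _ => N; have [] := HN N.
have u2 : (1 - eps) * (1 - 0) - `|C| * (s - 1) <= (s - 1) * l.
  have cw : (fun N => (1 - eps) * (1 - pw (s - 1) N) - `|C| * (s - 1)) @ \oo -->
      (1 - eps) * (1 - 0) - `|C| * (s - 1).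
    apply: cvgB; last exact: cvg_cst.
    apply: cvgM; first exact: cvg_cst.
    by apply: cvgB; [exact: cvg_cst|exact: pw_cvg0].
  by apply: (ler_cvg_to cw cs); near=> N; have [] := HN N.
have es : eps * (s - 1) <= s - 1 by rewrite ler_piMl// ltW.
have u1' : (1 + eps) * s = s + eps * (s - 1) + eps by ring.
have u2' : (1 - eps) * (1 - 0) = 1 - eps by ring.
have E : (`|C| + 2) * (s - 1) = `|C| * (s - 1) + 2 * (s - 1) by ring.
rewrite u1' in u1; rewrite u2' in u2; rewrite E ler_norml.
have Cs : 0 <= `|C| * (s - 1) by rewrite mulr_ge0// ltW.
move: u1 u2 es Cs; generalize ((s - 1) * l); generalize (`|C| * (s - 1)); generalize (eps * (s - 1)).
by intros; apply/andP; split; lra.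
Unshelve. all: by end_near. Qed.

Lemma id_coef n : ip (id (e n)) (e n) = 1. Proof. by rewrite sqE e1. Qed.

Lemma trace_lim :
  ((s - 1)%:C * trace ip (Tp s) : R[i]^o) @[s --> 1^'+] --> (1 : R[i]^o).
Proof.
have cc s (s1 : 1 < s) := Tp_ccv s1 (@bounded_id R h).
have E s N : \sum_(n < N) (tt f s n)%:C * ip (id (e n)) (e n) = (\sum_(n < N) tt f s n)%:C.
  by rewrite rmorph_sum; apply: eq_bigr => n _; rewrite id_coef mulr1.
apply: clim => /=.
  have H : (s - 1) * Re (trace ip (Tp s)) - 1 @[s --> 1^'+] --> (0 : R).
    apply: right_lim0 => eps e0; pose ep := Num.min (eps / 2) 1.
    have ep0 : 0 < ep by rewrite lt_min divr_gt0//= ltr01.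
    have [ep1 ep2] : ep <= eps / 2 /\ ep <= 1 by rewrite /ep !ge_min !lexx orbT.
    have [C [C0 HC]] := trace_weight_bounds ep0 ep2.
    exists (C + 2) => s s1 s2.
    have [cR _] := cc s s1; have cR' : (fun N => \sum_(n < N) tt f s n) @ \oo --> Re (trace ip (Tp s)).
      by apply: cvg_eq cR => N; rewrite E.
    by apply: le_trans (HC s _ s1 s2 cR') _; rewrite lerD2r; lra.
  have H' : (s - 1) * Re (trace ip (Tp s)) - 1 + 1 @[s --> 1^'+] --> (0 + 1 : R).
    by apply: cvgD; [exact: H|exact: cvg_cst].
  have FE : (fun s : R => (s - 1) * Re (trace ip (Tp s)) - 1 + 1) =
      (fun s => Re ((s - 1)%:C * trace ip (Tp s))).
    by apply/funext => s; rewrite subrK Re_realM.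
  by rewrite add0r FE in H'; exact: H'.
apply: (@cvg_trans _ ((fun=> 0 : R) @ 1^'+)); last exact: cvg_cst.
apply: near_eq_cvg; near=> s.
have s1 : 1 < s by near: s; exact: nbhs_right_gt.
have [_ cI] := cc s s1.
have I0 : Im (trace ip (Tp s)) = 0.
  by apply: rlim_uniq cI _; apply: cvg_eq (cvg_cst 0) => N; rewrite E.
by rewrite -[RHS]/(Im ((s - 1)%:C * trace ip (Tp s))) Im_realM I0 mulr0.
Unshelve. all: by end_near. Qed.

Lemma Tp_compact s : 1 < s -> compact_op (Tp s).
Proof.
move=> s1; apply: (dop_compact hilb oe oe) => eps e0.
have s0 : 0 < s by exact: lt_trans s1.
have /cvgrPdist_lt/(_ (Num.min 1 eps)) := tt_cvg0 fas s0.
rewrite lt_min ltr01 e0 => /(_ isT)[N _ HN]; exists N => n Nn; have := HN n Nn.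
rewrite /= sub0r normrN ger0_norm ?tt_ge0// lt_min nsqR => /andP[h1 h2].
apply: le_lt_trans h2; rewrite expr2 ler_piMl ?tt_ge0// ltW//.
Qed.

Lemma Tp_pos s : 1 < s -> positive_op ip (Tp s).
Proof. by move=> s1; have [D HD] := Tp_bound s1; exact: (rdop_pos hilb oe (tt_ge0 f s) HD). Qed.

Lemma Tp_trace_class s : 1 < s -> trace_class ip (Tp s).
Proof.
move=> s1; split; first by have [] := Tp_pos s1.
have [mu [g dT]] := diag_exists hilb (Tp_compact s1) (Tp_pos s1).
rewrite (op_abs_pos hilb dT); have [D HD] := Tp_bound s1.
rewrite (pos_trace_dop hilb oe (tt_ge0 f s) HD).
have [C HC] := tt_sum_bounded fas s1.
apply/nneg_series_fin; first by move=> n; rewrite e1 mulr1 tt_ge0.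
by exists C => N; under eq_bigr do rewrite e1 mulr1; exact: HC.
Qed.
Lemma comm_Tp_compact a s : 1 < s -> bounded_op a -> compact_op (commutator a (Tp s)).
Proof.
move=> s1 ba; have cT := Tp_compact s1; apply: (compactB (h := h)).
  exact: (compact_compl ba cT).
exact: (compact_compr cT ba).
Qed.

(* With [c f_k = mu_k g_k] the sum of the [mu_k] is the trace of [c V^*], where V
   maps f_k to g_k; so the bound on traces of commutators against contractions applies. *)
Lemma sing_sum_le a s (X : R) : 1 < s -> bounded_op a ->
  (forall N b, linear b -> bounded_by b 1 ->
     Re (\sum_(n < N) (tt f s n)%:C * ip (commutator a b (e n)) (e n)) <= X) ->
  forall mu (g : nat -> h), diagonal ip (op_abs ip (commutator a (Tp s))) mu g ->
    op_abs ip (commutator a (Tp s)) \o op_abs ip (commutator a (Tp s)) =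
      adjoint ip (commutator a (Tp s)) \o commutator a (Tp s) ->
  forall K, \sum_(k < K) mu k <= X.
Proof.
move=> s1 ba HX mu g; set c := commutator a (Tp s); set P := op_abs ip c => dP PP K.
have [[[oo og] gz] m0 md _ _] := dP; have osg : osys ip g by split.
have bT : bounded_op (Tp s) by have [] := Tp_pos s1.
have bc : bounded_op c by exact: comm_bounded.
have la := bounded_lin ba.
have cc k l : ip (c (g k)) (c (g l)) = (mu k * mu l)%:C * ip (g k) (g l).
  have -> : ip (c (g k)) (c (g l)) = ip (adjoint ip c (c (g k))) (g l) by rewrite -adjointPr.
  rewrite -[adjoint ip c _]/((adjoint ip c \o c) (g k)) -PP /= -[LHS]/(ip (P (P (g k))) (g l)).
  rewrite !(diag_eig hilb _ dP) linZ; last by have [[]] := diag_pos hilb dP.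
  rewrite (diag_eig hilb _ dP) scalerA ipZl -realM.
  have [->//|kl] := eqVneq k l.
  by rewrite oo// !mulr0.
(* Here [g] diagonalizes the absolute value of [c], and the [w k] are its normalized images under
   [c], zero when [mu k] is. *)
pose w k := ((mu k)^-1)%:C *: c (g k).
have ow : osys ip w.
  split=> [k l kl|k]; first by rewrite /w ipZl ipZr cc oo// !mulr0.
  have [mk|mk] := eqVneq (mu k) 0; first by right; rewrite /w mk invr0 scale0r.
  left; rewrite /w sqZ /sqnorm cc nsqR Re_realM sqE /=.
  have [->|gk] := og k; first by field.
  by move: mk; rewrite (gz _ gk) eqxx.
have cw k : ip (c (g k)) (w k) = (mu k)%:C.
  rewrite /w ipZr conjR cc; have [mk|mk] := eqVneq (mu k) 0; first by rewrite mk invr0 mul0r.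
  rewrite sqE -!realM; have [->|gk] := og k; first by congr (_%:C); field.
  by move: mk; rewrite (gz _ gk) eqxx.
pose V x := \sum_(k < K) ip x (w k) *: g k.
have lV : linear V.
  move=> r x y; rewrite /V scaler_sumr -big_split; apply: eq_bigr => k _ /=.
  by rewrite ipDl ipZl scalerDl scalerA.
(* The sign comes from cyclicity: the trace of [[a, b] T] is minus that of [b [a, T]]. *)
pose b x := -1 *: V x.
have lb : linear b by move=> r x y; rewrite /b lV scalerDr !scalerA [-1 * r]mulrC.
have bb : bounded_by b 1.
  move=> x; rewrite mul1r -[b x]/(-1 *: V x) scaleN1r hnormN !(hnorm_sqrt hilb) ler_wsqrtr//.
  rewrite /V -(big_mkord xpredT (fun k => ip x (w k) *: g k)) sq_sum_ortho; last 2 first.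
  - exact: iota_uniq.
  - by move=> i j _ _; exact: oo.
  rewrite big_mkord; apply: le_trans (osys_bessel x K ow).
  by apply: ler_sum => k _; rewrite ler_piMr ?nsq_ge0// osys_le1.
have [D HD] := Tp_bound s1.
have E N : \sum_(n < N) (tt f s n)%:C * ip (commutator a b (e n)) (e n) =
  \sum_(k < K) (ip (a (\sum_(n < N) ((tt f s n)%:C * ip (g k) (e n)) *: e n)) (w k) -
     \sum_(n < N) (tt f s n)%:C * ip (a (g k)) (e n) * ip (e n) (w k)).
  rewrite sumrB exchange_big /=.
  rewrite (eq_bigr (fun k : 'I_K => \sum_(n < N) (tt f s n)%:C * (ip (g k) (e n) * ip (a (e n)) (w k)))); last first.
    move=> k _; rewrite lin_sum// ip_suml; apply: eq_bigr => n _.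
    by rewrite linZ// ipZl mulrA.
  rewrite [X in _ = X - _]exchange_big /= -sumrB; apply: eq_bigr => n _.
  have H1 : ip (a (b (e n))) (e n) = - \sum_(k < K) ip (e n) (w k) * ip (a (g k)) (e n).
    rewrite /b linZ// /V lin_sum// ipZl mulN1r ip_suml; congr (- _); apply: eq_bigr => k _.
    by rewrite linZ// ipZl.
  have H2 : ip (b (a (e n))) (e n) = - \sum_(k < K) ip (a (e n)) (w k) * ip (g k) (e n).
    rewrite /b /V ipZl mulN1r ip_suml; congr (- _); apply: eq_bigr => k _.
    by rewrite ipZl.
  rewrite -[commutator a b (e n)]/(a (b (e n)) - b (a (e n))) ipBl H1 H2 opprK addrC mulrBr.
  rewrite !mulr_sumr; congr (_ - _); apply: eq_bigr => k _; ring.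
have cv k : ccv (fun N => ip (a (\sum_(n < N) ((tt f s n)%:C * ip (g k) (e n)) *: e n)) (w k) -
     \sum_(n < N) (tt f s n)%:C * ip (a (g k)) (e n) * ip (e n) (w k)) (mu k)%:C.
  rewrite -cw -[c (g k)]/(a (Tp s (g k)) - Tp s (a (g k))) ipBl.
  have [c1 c2] := hcv_ip hilb (w k) (bounded_hcv ba (dop_cvg hilb oe oe HD (g k))).
  have [c3 c4] := dop_ip hilb oe oe HD (a (g k)) (w k).
  split; rewrite !cE; under eq_fun do rewrite !cE.
    by apply: cvgB; [exact: c1|exact: c3].
  by apply: cvgB; [exact: c2|exact: c4].
have cR : (fun N => Re (\sum_(n < N) (tt f s n)%:C * ip (commutator a b (e n)) (e n))) @ \oo -->
    \sum_(k < K) mu k.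
  under eq_fun do rewrite E Re_sum.
  exact: (@rcvg_sum _ K (fun k N => Re (ip (a (\sum_(n < N) ((tt f s n)%:C * ip (g k) (e n)) *: e n)) (w k) -
     \sum_(n < N) (tt f s n)%:C * ip (a (g k)) (e n) * ip (e n) (w k))) mu (fun k => (cv k).1)).
by apply: rlim_le cR _ => N; exact: HX.
Qed.

Lemma comm_abs_lim a : lipschitz_algebra L a ->
  ((s - 1)%:E * pos_trace ip (op_abs ip (commutator a (Tp s))))%E @[s --> 1^'+] --> 0%E.
Proof.
move=> aL; have [ba _ _] := aL.
pose G s := fine (pos_trace ip (op_abs ip (commutator a (Tp s)))).
have key (eps : R) : 0 < eps -> exists2 C, 0 <= C & forall s, 1 < s -> s <= 2 ->
    exists v : R, [/\ pos_trace ip (op_abs ip (commutator a (Tp s))) = v%:E, 0 <= v &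
      (s - 1) * v <= 2 * eps + C * (s - 1)].
  move=> e0; have [C C0 HC] := key_rot aL e0; exists C => // s s1 s2.
  have t0 : 0 < s - 1 by rewrite subr_gt0.
  have [mu [g [dP PP]]] := op_abs_diag hilb (comm_Tp_compact s1 ba).
  have [[osg gz] m0 md _ _] := dP.
  have S : forall K, \sum_(k < K) mu k <= (2 * eps + C * (s - 1)) / (s - 1).
    apply: (sing_sum_le s1 ba _ dP PP) => N b lb b1.
    have [hh _] := HC s N b 1 (ltW s1) s2 lb ler01 b1.
    apply: le_trans (ler_norm _) _; apply: le_trans hh _; rewrite mul1r ler_pdivlMr//.
    have := ler_wpM2l (ltW e0) (tt_pw_le N s1 s2).
    have -> : (eps * (\sum_(n < N) pw s n) + C) * (s - 1) =
        eps * ((s - 1) * \sum_(n < N) pw s n) + C * (s - 1) by ring.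
    by rewrite lerD2r [2 * eps]mulrC.
  have PE : (pos_trace ip (op_abs ip (commutator a (Tp s))) = \sum_(n <oo) (mu n * sq (g n))%:E)%E.
    by rewrite (diagE hilb dP) /rdop (pos_trace_dop hilb osg m0 (rdop_bound m0 md)).
  have nn n : 0 <= mu n * sq (g n) by rewrite mulr_ge0 ?sq_ge0.
  have S' K : \sum_(k < K) mu k * sq (g k) <= (2 * eps + C * (s - 1)) / (s - 1).
    by apply: le_trans (S K); apply: ler_sum => k _; rewrite ler_piMr// osys_le1.
  have [l cl] := nneg_series_cvg nn S'.
  exists l; split; first by rewrite PE (series_lim_EFin cl).
    by apply: (ler_cvg_to (cvg_cst 0) cl); near=> N; exact: sumr_ge0.
  by rewrite mulrC -ler_pdivlMr//; exact: rlim_le cl S'.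
have H : (s - 1) * G s @[s --> 1^'+] --> (0 : R).
  apply: right_lim0 => eps e0; have [C C0 HC] := key (eps / 2) (divr_gt0 e0 (ltr0n _ 2)).
  exists C => s s1 s2; have [v [Ev v0 hv]] := HC s s1 s2.
  rewrite /G Ev /= ger0_norm ?mulr_ge0 ?subr_ge0 ?(ltW s1)//; apply: le_trans hv _.
  by rewrite lerD2r; lra.
have : ((s - 1) * G s)%:E @[s --> 1^'+] --> 0%:E by apply: cvg_EFin => //; near=> s.
apply: cvg_trans; apply: near_eq_cvg; near=> s.
have s1 : 1 < s by near: s; exact: nbhs_right_gt.
have s2 : s <= 2 by near: s; apply: nbhs_right_le; lra.
have [C C0 /(_ s s1 s2)[v [Ev _ _]]] := key 1 ltr01.
by rewrite /G Ev /= EFinM.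
Unshelve. all: by end_near. Qed.
End Estimates.

(** * Complex moduli and logarithmic quotients *)

Section ComplexNorm.
Context (R : realType).
Local Notation Re := (@complex.Re R).
Local Notation Im := (@complex.Im R).

Lemma cnorm_le (z : R[i]) (A : R) : `|Re z| <= A -> `|Im z| <= A -> `|z| <= (2 * A)%:C.
Proof.
move=> h1 h2; have A0 : 0 <= A by exact: le_trans h1.
rewrite norm_nsq lecR -[leRHS]ger0_norm ?mulr_ge0// -sqrtr_sqr ler_wsqrtr//.
rewrite /nsq -(real_normK (num_real (Re z))) -(real_normK (num_real (Im z))).
have := normr_ge0 (Re z); have := normr_ge0 (Im z); move: h1 h2.
by move: `|Re z| `|Im z| => u v *; nra.
Qed.

Lemma cnorm_ge (z : R[i]) (A : R) : `|z| <= A%:C -> `|Re z| <= A /\ `|Im z| <= A.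
Proof.
rewrite norm_nsq lecR => H; split; apply: le_trans H; rewrite -sqrtr_sqr ler_wsqrtr//.
  exact: Re_le_nsq.
exact: Im_le_nsq.
Qed.

Lemma cnorm_eq0 (z : R[i]) (K : R) : (forall eps : R, 0 < eps -> `|z| <= (K * eps)%:C) -> z = 0.
Proof.
move=> H; have K1 : 0 < `|K| + 1 by rewrite ltr_wpDl.
have small (eps : R) : 0 < eps -> `|Re z| <= eps /\ `|Im z| <= eps.
  move=> e0; have [h1 h2] := cnorm_ge (H _ (divr_gt0 e0 K1)).
  have Ke : K * (eps / (`|K| + 1)) <= eps.
    rewrite mulrA ler_pdivrMr//; have := ler_norm K; have := normr_ge0 K.
    by move: `|K| => k *; nra.
  by split; [apply: le_trans h1 Ke|apply: le_trans h2 Ke].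
apply: complex_ext; apply/eqP; rewrite -normr_le0; apply/ler_addgt0Pr => eps e0; rewrite add0r.
  by have [] := small eps e0.
by have [] := small eps e0.
Qed.

Lemma ccv_lin (c : R[i]) z w p q : ccv z p -> ccv w q -> ccv (fun n => c * z n + w n) (c * p + q).
Proof.
move=> [zR zI] [wR wI]; case: c => a b; split; rewrite !cE /=; under eq_fun do rewrite !cE /=.
  apply: cvgD => //; apply: cvgB; apply: cvgM => //; exact: cvg_cst.
apply: cvgD => //; apply: cvgD; apply: cvgM => //; exact: cvg_cst.
Qed.

(** The logarithmic counterpart of [right_lim0]: a constant is negligible against [ln N]. *)
Lemma log_ratio (x : nat -> R) :
  (forall eps : R, 0 < eps -> exists C, forall N, `|x N| <= eps * ln N%:R + C) ->
  (fun N => x N / ln N%:R) @ \oo --> (0 : R).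
Proof.
move=> H; apply/cvgrPdist_le => eps e0; have e2 : 0 < eps / 2 by rewrite divr_gt0.
have [C HC] := H _ e2; have /cvgrPdist_le/(_ _ e2) hl := cvg_lnV C.
near=> N; rewrite sub0r normrN.
have N2 : (2 <= N)%N by near: N; exact: nbhs_infty_ge.
have l0 : 0 < ln (N%:R : R) by rewrite ln_gt0// ltr1n.
have h2 : `|0 - C / ln (N%:R : R)| <= eps / 2 by near: N; exact: hl.
rewrite sub0r normrN in h2.
rewrite normrM normfV (gtr0_norm l0) ler_pdivrMr//; apply: le_trans (HC N) _.
have : C <= eps / 2 * ln N%:R.
  by rewrite -ler_pdivrMr//; apply: le_trans (ler_norm _) h2.
have -> : eps * ln N%:R = eps / 2 * ln N%:R + eps / 2 * ln N%:R by field.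
by rewrite lerD2l.
Unshelve. all: by end_near. Qed.
End ComplexNorm.

(** * Weak-* limit points and hypertraces *)

Section Functionals.
Context (R : realType) (h : completeNormedModType R[i])
        (ip : {dot h for Num.conj}) (hilb : is_hilbert ip).
Implicit Types (x y z v : h) (c : R[i]) (a b d K : h -> h).
Local Notation Re := (@complex.Re R).
Local Notation Im := (@complex.Im R).
Local Notation sq := (sqnorm ip).
Implicit Types (om : R -> (h -> h) -> R[i]) (tau : (h -> h) -> R[i]).

(** For fixed [b] the value of [tau] at the commutator is norm continuous in [a]: moving [a] by
    [eps] moves the commutator by at most [2 * opnorm b * eps]. *)
Lemma hypertrace_closure (AL : set (h -> h)) tau : AL `<=` @bounded_op R h -> bounded_functional tau ->
  (forall a b, AL a -> bounded_op b -> tau (commutator a b) = 0) ->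
  hypertrace_on (norm_closure AL) tau.
Proof.
move=> ALb [lt [C HC]] H a b [ba Ha] bb.
have bc a' : bounded_op a' -> bounded_op (commutator a' b) by move=> ?; exact: comm_bounded.
have tc a' : bounded_op a' -> tau (commutator a' b) = tau (a' \o b) - tau (b \o a').
  move=> ba'; have -> : commutator a' b = (-1 \*: (b \o a')) \+ (a' \o b).
    by apply/funext => x; rewrite /commutator /= scaleN1r addrC.
  rewrite lt; [|exact: bounded_comp|exact: bounded_comp].
  by rewrite mulN1r addrC.
suff : tau (commutator a b) = 0 by rewrite tc// => /eqP; rewrite subr_eq0 => /eqP.
apply: (@cnorm_eq0 _ _ (`|C| * (2 * opnorm b))) => eps e0.
have [a' [ALa' na']] := Ha eps e0; have ba' := ALb _ ALa'.
have bd : bounded_op (a \- a') by exact: boundedB.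
have -> : tau (commutator a b) = tau (commutator (a \- a') b).
  have -> : commutator (a \- a') b = (-1 \*: commutator a' b) \+ commutator a b.
    have lb := bounded_lin bb; apply/funext => x; rewrite /commutator /= linB// scaleN1r.
    by apply: (ip_inj (ip := ip)) => z; rewrite !(ipDl, ipNl); ring.
  by rewrite (lt _ _ _ (bc _ ba') (bc _ ba)) (H _ _ ALa' bb) mulr0 add0r.
apply: le_trans (HC _ (bc _ bd)) _; rewrite lecR.
have ob := opnorm_ge0 bb; have obd := opnorm_ge0 bd; have obc := opnorm_ge0 (bc _ bd).
have oc : opnorm (commutator (a \- a') b) <= 2 * opnorm b * eps.
  apply: opnorm_le; [exact: bc|by rewrite !mulr_ge0// ltW|].
  move=> x; rewrite /commutator /=; apply: le_trans (hnormD _ _) _; rewrite hnormN.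
  have h1 : hnorm ((a \- a') (b x)) <= opnorm (a \- a') * (opnorm b * hnorm x).
    have q1 : hnorm ((a \- a') (b x)) <= opnorm (a \- a') * hnorm (b x) by apply: opnormP.
    have q2 : hnorm (b x) <= opnorm b * hnorm x by apply: opnormP.
    by apply: le_trans q1 _; rewrite ler_wpM2l.
  have h2 : hnorm (b ((a \- a') x)) <= opnorm b * (opnorm (a \- a') * hnorm x).
    have q1 : hnorm (b ((a \- a') x)) <= opnorm b * hnorm ((a \- a') x) by apply: opnormP.
    have q2 : hnorm ((a \- a') x) <= opnorm (a \- a') * hnorm x by apply: opnormP.
    by apply: le_trans q1 _; rewrite ler_wpM2l.
  have nx := hnorm_ge0 x; have ox : 0 <= opnorm b * hnorm x by exact: mulr_ge0.
  have := ler_wpM2r ox (ltW na').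
  move=> h3; apply: (le_trans (lerD h1 h2)).
  have -> : opnorm b * (opnorm (a \- a') * hnorm x) = opnorm (a \- a') * (opnorm b * hnorm x) by ring.
  have -> : 2 * opnorm b * eps * hnorm x = eps * (opnorm b * hnorm x) + eps * (opnorm b * hnorm x) by ring.
  exact: lerD.
apply: (@le_trans _ _ (`|C| * opnorm (commutator (a \- a') b))).
  by rewrite ler_wpM2r// ler_norm.
by rewrite -mulrA ler_wpM2l.
Qed.

Lemma tracial_of_hyper (AL : set (h -> h)) tau : linear_on (@bounded_op R h) tau ->
  (forall b, positive_op ip b -> 0 <= tau b) -> tau id = 1 ->
  hypertrace_on (norm_closure AL) tau -> tracial_state_on ip (norm_closure AL) tau.
Proof.
move=> lt pt t1 ht; split; first split=> //.
- by move=> c a b [ba _] [bb _]; exact: lt.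
- by move=> b _; exact: pt.
by move=> a b Aa [bb _]; rewrite -ht.
Qed.

Local Notation BH := {b : h -> h | bounded_op b}.

(** Evaluation at a single [b] is continuous for pointwise convergence, so a limit point is
    approached at [b] by parameters satisfying any property that holds near 1. *)
Lemma limit_point_eval om tau b (eps : R) (P : R -> Prop) : weak_star_limit_point om tau ->
  bounded_op b -> 0 < eps -> (\forall s \near 1^'+, P s) ->
  exists s, P s /\ `|tau b - om s b| < eps%:C.
Proof.
move=> H bb e0 HP; pose bb' : BH := exist _ b bb.
pose ev (t : (h -> h) -> R[i]) : {ptws BH -> R[i]^o} := fun b : BH => t (sval b).
pose B := [set g : {ptws BH -> R[i]^o} | `|tau b - g bb'| < eps%:C].
have nB : nbhs (ev tau) B.
  have idc : nbhs (ev tau) --> ev tau by [].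
  have /cvg_sup/(_ bb') Hb := idc; apply: Hb.
  apply: (@initial_continuous _ _ (fun g : {ptws BH -> R[i]^o} => g bb') (ev tau) [set z | `|tau b - z| < eps%:C]).
  have : nbhs (tau b : R[i]^o) (ball (tau b : R[i]^o) (eps%:C)) by apply: nbhsx_ballx; rewrite ltcR.
  by rewrite -ball_normE.
have nA : ((fun s => ev (om s)) @ 1^'+) [set g | exists2 s, P s & g = ev (om s)].
  by rewrite /nbhs/=; apply: filterS HP => s Ps /=; exists s.
have [g [[s Ps ->] Bg]] := H _ _ nA nB.
by exists s.
Qed.

Lemma limit_point_lim om tau b (l : R[i]) : weak_star_limit_point om tau -> bounded_op b ->
  (om s b : R[i]^o) @[s --> 1^'+] --> (l : R[i]^o) -> tau b = l.
Proof.
move=> H bb ol; apply/eqP; rewrite -subr_eq0; apply/eqP/(@cnorm_eq0 _ _ 2) => eps e0.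
have ec : (0 : R[i]) < eps%:C by rewrite ltcR.
move/cvgrPdist_lt/(_ _ ec) : ol => ol.
have [s [h1 h2]] := limit_point_eval H bb e0 ol.
have -> : tau b - l = (tau b - om s b) - (l - om s b) by ring.
apply: le_trans (ler_normB _ _) _.
have -> : (2 * eps)%:C = eps%:C + eps%:C :> R[i] by apply: complex_ext; rewrite !cE /=; ring.
by apply: lerD; exact: ltW.
Qed.

Lemma limit_point_pos om tau b : weak_star_limit_point om tau -> bounded_op b ->
  (\forall s \near 1^'+, 0 <= om s b) -> 0 <= tau b.
Proof.
move=> H bb op; have K (eps : R) : 0 < eps -> `|Im (tau b)| <= eps /\ - Re (tau b) <= eps.
  move=> e0; have [s [ps /ltW/cnorm_ge]] := limit_point_eval H bb e0 op.
  rewrite !cE; move: ps; rewrite lecE /= => /andP[/eqP -> r0]; rewrite oppr0 addr0 => -[h1 h2].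
  by split => //; move: h1; rewrite ler_norml => /andP[]; lra.
rewrite lecE /=; apply/andP; split.
  by rewrite -normr_le0; apply/ler_addgt0Pr => eps e0; rewrite add0r; have [] := K eps e0.
by rewrite -oppr_le0; apply/ler_addgt0Pr => eps e0; rewrite add0r; have [] := K eps e0.
Qed.

Lemma ultra_lim (G : set_system R) (g : R -> R) (M : R) : UltraFilter G ->
  (\forall s \near G, `|g s| <= M) -> exists l : R, g @ G --> l.
Proof.
move=> UG HM; have := @segment_compact R (- M) M; move=> /(_ (g @ G)).
have PG : ProperFilter G by exact: ultra_proper.
case; first by apply: filterS HM => s /= ; rewrite in_itv/= ler_norml.
move=> l [_ cl]; exists l => A nA.
have [//|nG] := in_ultra_setVsetC (g @^-1` A) UG.
by have [y [nAy Ay]] := cl (~` A) A nG nA.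
Qed.

(** Weak-* compactness by hand: along an ultrafilter finer than the right neighbourhoods of 1 every
    bounded family [om s b] converges, and these limits form [tau]. *)
Lemma limit_point_exists om (K : R) : 0 <= K ->
  (forall s, 1 < s -> s <= 2 -> linear_on (@bounded_op R h) (om s)) ->
  (forall s b, 1 < s -> s <= 2 -> bounded_op b ->
     `|Re (om s b)| <= K * opnorm b /\ `|Im (om s b)| <= K * opnorm b) ->
  exists tau, bounded_functional tau /\ weak_star_limit_point om tau.
Proof.
move=> K0 lo bo; have [G [UG GF]] := @ultraFilterLemma R 1^'+ _.
have PG : ProperFilter G by exact: ultra_proper.
have n12 : \forall s \near G, 1 < s /\ s <= 2.
  apply: GF; near=> s; split; first by near: s; exact: nbhs_right_gt.
  by near: s; apply: nbhs_right_le; lra.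
pose lR b := xget (0 : R) [set l | (fun s => Re (om s b)) @ G --> l].
pose lI b := xget (0 : R) [set l | (fun s => Im (om s b)) @ G --> l].
have cR b : bounded_op b -> (fun s => Re (om s b)) @ G --> lR b.
  move=> bb; have [l cl] : exists l : R, (fun s => Re (om s b)) @ G --> l.
    apply: (@ultra_lim _ _ (K * opnorm b)) => //; apply: filterS n12 => s [s1 s2].
    by have [] := bo s b s1 s2 bb.
  exact: (@xgetPex _ (0 : R) [set l : R | (fun s => Re (om s b)) @ G --> l] (ex_intro _ l cl)).
have cI b : bounded_op b -> (fun s => Im (om s b)) @ G --> lI b.
  move=> bb; have [l cl] : exists l : R, (fun s => Im (om s b)) @ G --> l.
    apply: (@ultra_lim _ _ (K * opnorm b)) => //; apply: filterS n12 => s [s1 s2].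
    by have [] := bo s b s1 s2 bb.
  exact: (@xgetPex _ (0 : R) [set l : R | (fun s => Im (om s b)) @ G --> l] (ex_intro _ l cl)).
pose tau b := lR b +i* lI b.
have uniqG (g : R -> R) (l l' : R) : g @ G --> l -> g @ G --> l' -> l = l'.
  by move=> gl gl'; rewrite -(cvg_lim _ gl)// -(cvg_lim _ gl').
exists tau; split; last first.
  pose ev (t : (h -> h) -> R[i]) : {ptws BH -> R[i]^o} := fun b : BH => t (sval b).
  have cv : (fun s => ev (om s)) @ G --> ev tau.
    apply/cvg_sup => -[b bb] A; rewrite nbhsE /= => -[B [[C oC <-] Bt] sBA].
    apply: filterS sBA _.
    have cl : (fun s => om s b : R[i]^o) @ G --> (tau b : R[i]^o).
      by apply: clim; [exact: (cR b bb)|exact: (cI b bb)].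
    by apply: cl; apply: open_nbhs_nbhs; split.
  move=> A B nA nB; have GA : G [set s | A (ev (om s))] by exact: GF.
  have GB : G [set s | B (ev (om s))] by exact: cv.
  have [s [As Bs]] := filter_ex (filterI GA GB).
  by exists (ev (om s)).
split.
  move=> c a b ba bb; have bab : bounded_op ((c \*: a) \+ b) by exact: bounded_lincomb.
  have E : \forall s \near G, om s ((c \*: a) \+ b) = c * om s a + om s b.
    by apply: filterS n12 => s [s1 s2]; exact: lo.
  have [aR aI bR bI] := And4 (cR a ba) (cI a ba) (cR b bb) (cI b bb).
  apply: complex_ext; rewrite /tau !cE /=.
    have X : (fun s => Re c * Re (om s a) - Im c * Im (om s a) + Re (om s b)) @ G -->
        Re c * lR a - Im c * lI a + lR b.
      apply: cvgD; last exact: bR.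
      by apply: cvgB; (apply: cvgM; first exact: cvg_cst); [exact: aR|exact: aI].
    apply: uniqG (cR _ bab) _; apply: cvg_trans X; apply: near_eq_cvg.
    by apply: filterS E => s Es; rewrite Es !cE.
  have X : (fun s => Re c * Im (om s a) + Im c * Re (om s a) + Im (om s b)) @ G -->
      Re c * lI a + Im c * lR a + lI b.
    apply: cvgD; last exact: bI.
    by apply: cvgD; (apply: cvgM; first exact: cvg_cst); [exact: aI|exact: aR].
  apply: uniqG (cI _ bab) _; apply: cvg_trans X; apply: near_eq_cvg.
  by apply: filterS E => s Es; rewrite Es !cE.
exists (2 * K) => b bb; rewrite -mulrA.
apply: cnorm_le => /=.
  apply: (ler_cvg_to (cvg_norm (cR b bb)) (cvg_cst (K * opnorm b))).
  by apply: filterS n12 => s [s1 s2]; have [] := bo s b s1 s2 bb.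
apply: (ler_cvg_to (cvg_norm (cI b bb)) (cvg_cst (K * opnorm b))).
by apply: filterS n12 => s [s1 s2]; have [] := bo s b s1 s2 bb.
Unshelve. all: by end_near. Qed.
End Functionals.

(** * The limit states and the volume form *)

Section States.
Context (R : realType) (h : completeNormedModType R[i])
        (ip : {dot h for Num.conj}) (hilb : is_hilbert ip).
Implicit Types (x y z v : h) (c : R[i]) (a b d K : h -> h).
Local Notation Re := (@complex.Re R).
Local Notation Im := (@complex.Im R).
Local Notation sq := (sqnorm ip).
Variable (e : nat -> h).
Hypotheses (oe : osys ip e) (e1 : forall n, sq (e n) = 1).
Variables (lam : nat -> R) (L : partial_op h).
Hypotheses (lam0 : forall n, 0 < lam n) (lnd : forall m n, (m <= n)%N -> lam m <= lam n)
  (lam_inf : lam @ \oo --> +oo) (Ld : is_diag ip e lam L).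
Variable (f : nat -> R).
Hypotheses (fnd : forall m n, (m <= n)%N -> f m <= f n)
  (fas : forall eps : R, 0 < eps -> exists n0, forall n, (n0 <= n)%N ->
     0 < f n /\ `|f n - n.+1%:R| <= eps * n.+1%:R)
  (fgr : forall eta : R, 0 < eta -> exists n0, forall n i, (n0 <= n)%N -> (n <= i)%N ->
     f i - f n <= eta * f i * (lam i - lam n)).
Local Notation T := (Tp ip e f).

Lemma T_ccv s b : 1 < s -> bounded_op b ->
  ccv (fun N => \sum_(n < N) (tt f s n)%:C * ip (b (e n)) (e n)) (trace ip (b \o T s)).
Proof. by move=> s1 bb; eapply Tp_ccv; eassumption. Qed.

Lemma T_trace_lin s : 1 < s -> linear_on (@bounded_op R h) (fun b => trace ip (b \o T s)).
Proof.
move=> s1 c a b ba bb; apply: ccv_uniq (T_ccv s1 (bounded_lincomb c ba bb)) _.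
have := ccv_lin c (T_ccv s1 ba) (T_ccv s1 bb); congr ccv; apply/funext => N.
rewrite mulr_sumr -big_split; apply: eq_bigr => n _ /=.
by rewrite ipDl ipZl; ring.
Qed.

Lemma coef_le b n : bounded_op b ->
  `|Re (ip (b (e n)) (e n))| <= opnorm b /\ `|Im (ip (b (e n)) (e n))| <= opnorm b.
Proof.
move=> bb; have en : hnorm (e n) = 1 by rewrite (hnorm_sqrt hilb) e1 sqrtr1.
have q : hnorm (b (e n)) <= opnorm b * hnorm (e n) by apply: opnormP.
rewrite en mulr1 in q; split.
  by apply: le_trans (Re_ip_le_norm hilb _ _) _; rewrite en mulr1.
by apply: le_trans (Im_ip_le_norm hilb _ _) _; rewrite en mulr1.
Qed.

Lemma trace_part_le s b (z : nat -> R) (X : R) : 1 < s -> bounded_op b ->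
  (forall n, `|Re (ip (b (e n)) (e n))| <= z n /\ `|Im (ip (b (e n)) (e n))| <= z n) ->
  (forall N, \sum_(n < N) tt f s n * z n <= X) ->
  `|Re (trace ip (b \o T s))| <= X /\ `|Im (trace ip (b \o T s))| <= X.
Proof.
move=> s1 bb zb HX; have [cR cI] := T_ccv s1 bb.
split; [apply: (rlim_le (cvg_norm cR))|apply: (rlim_le (cvg_norm cI))] => N;
  apply: le_trans (HX N).
  rewrite Re_sum; apply: le_trans (ler_norm_sum _ _ _) _; apply: ler_sum => n _.
  rewrite Re_realM normrM (ger0_norm (tt_ge0 f s n)) ler_wpM2l ?tt_ge0//.
  by have [] := zb n.
rewrite Im_sum; apply: le_trans (ler_norm_sum _ _ _) _; apply: ler_sum => n _.
rewrite Im_realM normrM (ger0_norm (tt_ge0 f s n)) ler_wpM2l ?tt_ge0//.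
by have [] := zb n.
Qed.

Lemma T_trace_bounded s b C : 1 < s -> bounded_op b -> (forall N, \sum_(n < N) tt f s n <= C) ->
  `|Re (trace ip (b \o T s))| <= C * opnorm b /\ `|Im (trace ip (b \o T s))| <= C * opnorm b.
Proof.
move=> s1 bb HC; apply: (@trace_part_le _ _ (fun=> opnorm b)) => // [n|N]; first exact: coef_le.
by rewrite -mulr_suml ler_wpM2r//; exact: opnorm_ge0.
Qed.

Lemma tt_uniform : exists2 K0 : R, 0 <= K0 & forall s N, 1 < s -> s <= 2 ->
  (s - 1) * \sum_(n < N) tt f s n <= K0.
Proof.
have [C HC] := tt_sum_asym fas ltr01; exists (4 + `|C|); first by rewrite addr_ge0.
move=> s N s1 s2; have t0 : 0 <= s - 1 by rewrite subr_ge0 ltW.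
have h1 := HC s N (ltW s1) s2; rewrite mul1r in h1.
have h2 : \sum_(n < N) tt f s n <= 2 * \sum_(n < N) pw s n + `|C|.
  have h3 : \sum_(n < N) tt f s n <= \sum_(n < N) `|tt f s n - pw s n| + \sum_(n < N) pw s n.
    by rewrite -big_split; apply: ler_sum => n _ /=; have := ler_norm (tt f s n - pw s n); lra.
  by have := ler_norm C; move: h1 h3; lra.
apply: le_trans (ler_wpM2l t0 h2) _.
have := tt_pw_le N s1 s2; have -> : (s - 1) * (2 * \sum_(n < N) pw s n + `|C|) =
  2 * ((s - 1) * \sum_(n < N) pw s n) + (s - 1) * `|C| by ring.
have : (s - 1) * `|C| <= `|C| by rewrite ler_piMl//; lra.
by move: ((s - 1) * _) ((s - 1) * _) => u v; lra.
Qed.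

Lemma small_coefs (zs : seq h) (eps : R) : 0 < eps -> exists n0, forall n y, (n0 <= n)%N ->
  y \in zs -> nsq (ip y (e n)) <= eps.
Proof.
move=> e0; elim: zs => [|y zs [n0 H]]; first by exists 0%N.
have cy : (fun n => nsq (ip y (e n))) @ \oo --> (0 : R).
  have [l cl] := nneg_series_cvg (fun n => nsq_ge0 (ip y (e n))) (fun N => osys_bessel y N oe).
  have cl' := cl; rewrite -(cvg_shiftS (fun N => \sum_(n < N) nsq (ip y (e n)))) in cl'.
  have H' : (fun N => \sum_(n < N.+1) nsq (ip y (e n)) - \sum_(n < N) nsq (ip y (e n))) @ \oo --> l - l.
    by apply: cvgB; [exact: cl'|exact: cl].
  rewrite subrr in H'; apply: cvg_eq H' => N.
  by rewrite big_ord_recr /= addrAC subrr add0r.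
move/cvgrPdist_le/(_ _ e0) : cy => [n1 _ H1]; exists (maxn n0 n1) => n z.
rewrite geq_max => /andP[nn0 nn1]; rewrite in_cons => /orP[/eqP ->|]; last exact: H.
by have := H1 n nn1; rewrite /= sub0r normrN ger0_norm ?nsq_ge0.
Qed.

(** Each [K (e n)] is close to one of finitely many vectors, whose coefficients along [e n] tend to
    0 by Bessel. *)
Lemma compact_coefs K (eps : R) : compact_op K -> 0 < eps -> exists n0, forall n, (n0 <= n)%N ->
  `|Re (ip (K (e n)) (e n))| <= eps /\ `|Im (ip (K (e n)) (e n))| <= eps.
Proof.
move=> cK e0; have e2 : 0 < eps / 2 by rewrite divr_gt0.
have [zs Hz] := compact_net cK e2.
have [n0 H0] := small_coefs zs (exprn_gt0 2 e2); exists n0 => n nn.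
have en : hnorm (e n) = 1 by rewrite (hnorm_sqrt hilb) e1 sqrtr1.
have [|y yz Hy] := Hz (e n); first by rewrite en.
have ny := H0 n y nn yz.
have E : ip (K (e n)) (e n) = ip (K (e n) - y) (e n) + ip y (e n) by rewrite -ipDl subrK.
have part (r : R) (w : R[i]) : r ^+ 2 <= nsq w -> nsq w <= (eps / 2) ^+ 2 -> `|r| <= eps / 2.
  move=> h1 h2; rewrite -[leRHS](ger0_norm (ltW e2)) -ler_sqr ?nnegrE// !real_normK ?num_real//.
  exact: le_trans h1 h2.
have p1 := part _ _ (Re_le_nsq _) ny; have p2 := part _ _ (Im_le_nsq _) ny.
have q1 := Re_ip_le_norm hilb (K (e n) - y) (e n); have q2 := Im_ip_le_norm hilb (K (e n) - y) (e n).
rewrite en mulr1 in q1 q2.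
rewrite E !cE; split; (apply: le_trans (ler_normD _ _) _); rewrite (splitr eps); apply: lerD => //;
  by [exact: le_trans q1 (ltW Hy)|exact: le_trans q2 (ltW Hy)].
Qed.

Lemma compact_trace_lim K : compact_op K ->
  ((s - 1)%:C * trace ip (K \o T s) : R[i]^o) @[s --> 1^'+] --> (0 : R[i]^o).
Proof.
move=> cK; have bK := compact_bounded cK; have [K0 K00 HK] := tt_uniform.
have main (eps : R) : 0 < eps -> exists C, forall s, 1 < s -> s <= 2 ->
    `|(s - 1) * Re (trace ip (K \o T s))| <= eps + C * (s - 1) /\
    `|(s - 1) * Im (trace ip (K \o T s))| <= eps + C * (s - 1).
  move=> e0; have e2 : 0 < eps / (K0 + 1) by rewrite divr_gt0// ltr_wpDl.
  have [n0 H0] := compact_coefs cK e2.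
  exists (\sum_(n < n0) hb f n * opnorm K) => s s1 s2.
  have t0 : 0 < s - 1 by rewrite subr_gt0.
  have ok := opnorm_ge0 bK.
  pose z n := Num.min (opnorm K) (if (n0 <= n)%N then eps / (K0 + 1) else opnorm K).
  have zb n : `|Re (ip (K (e n)) (e n))| <= z n /\ `|Im (ip (K (e n)) (e n))| <= z n.
    have [c1 c2] := coef_le n bK; rewrite /z !le_min c1 c2 /=.
    by case: ifP => // /H0[].
  have zX N : \sum_(n < N) tt f s n * z n <= (eps + (\sum_(n < n0) hb f n * opnorm K) * (s - 1)) / (s - 1).
    have := @sum_head _ (fun n => tt f s n * z n) (fun n => tt f s n * (eps / (K0 + 1)))
      (fun n => hb f n * opnorm K) n0 N.
    move=> /(_ _ _ _ _)/le_trans; apply.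
    - by move=> n nn; rewrite ler_wpM2l ?tt_ge0// /z nn ge_min lexx orbT.
    - move=> n; apply: ler_pM => //; [exact: tt_ge0| |exact: tt_head (ltW s1) s2|by rewrite /z ge_min lexx].
      by rewrite /z le_min ok /=; case: ifP => // _; exact: ltW.
    - by move=> n; rewrite mulr_ge0 ?tt_ge0// ltW.
    - by move=> n; rewrite mulr_ge0 ?hb_ge0.
    rewrite -mulr_suml ler_pdivlMr// mulrDl lerD2r.
    have -> : (\sum_(n < N) tt f s n) * (eps / (K0 + 1)) * (s - 1) =
      ((s - 1) * \sum_(n < N) tt f s n) * eps / (K0 + 1) by ring.
    rewrite ler_pdivrMr ?ltr_wpDl// [leRHS]mulrC ler_wpM2r ?(ltW e0)//.
    by apply: (le_trans (HK s N s1 s2)); rewrite lerDl.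
  have [r1 r2] := trace_part_le s1 bK zb zX.
  by split; rewrite normrM (gtr0_norm t0) mulrC -ler_pdivlMr.
apply: clim.
  rewrite (_ : (fun s : R => _) = (fun s => (s - 1) * Re (trace ip (K \o T s)))).
    by apply: right_lim0 => eps /main[C HC]; exists C => s s1 s2; have [] := HC s s1 s2.
  by apply/funext => s; exact: Re_realM.
rewrite (_ : (fun s : R => _) = (fun s => (s - 1) * Im (trace ip (K \o T s)))).
  by apply: right_lim0 => eps /main[C HC]; exists C => s s1 s2; have [] := HC s s1 s2.
by apply/funext => s; exact: Im_realM.
Qed.

Lemma T_trace_pos s b : 1 < s -> positive_op ip b -> 0 <= trace ip (b \o T s).
Proof.
move=> s1 [bb pb]; have [cR cI] := T_ccv s1 bb.
have rp n : 0 <= Re (ip (b (e n)) (e n)) /\ Im (ip (b (e n)) (e n)) = 0.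
  by have := pb (e n); rewrite lecE /= => /andP[/eqP].
rewrite lecE /=; apply/andP; split.
  apply/eqP; apply: rlim_uniq cI _; apply: cvg_eq (cvg_cst 0) => N.
  by rewrite Im_sum big1// => n _; rewrite Im_realM (rp n).2 mulr0.
apply: (ler_cvg_to (cvg_cst 0) cR); near=> N.
by rewrite Re_sum sumr_ge0// => n _; rewrite Re_realM mulr_ge0 ?tt_ge0// (rp n).1.
Unshelve. all: by end_near. Qed.

Section Omega.
Local Notation rho_op := (spectral_weight ip L).
Local Notation rho := (wrho ip lam L).
Context (w : (R -> R) -> R) (hw : dixmier_ultrafilter w).
Hypothesis (gas : forall eps : R, 0 < eps -> exists n0, forall n, (n0 <= n)%N ->
     0 < fine (counting_function ip L (lam n)) /\
     `|fine (counting_function ip L (lam n)) - n.+1%:R| <= eps * n.+1%:R).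

Lemma weightP : [/\ diagonal ip rho_op rho e, forall n, rho n <= n.+1%:R^-1 & forall n, 0 < rho n].
Proof.
split; first by eapply weight_diag; eassumption.
  by move=> n; eapply wrho_le; eassumption.
by move=> n; eapply wrho_gt0; eassumption.
Qed.

(** The asymptotics of sums of powers, applied at [s = 1] to the counting function itself in place
    of [phi]. *)
Lemma rho_asym (eps : R) : 0 < eps -> exists C, forall N,
  \sum_(n < N) `|rho n - pw 1 n| <= eps * \sum_(n < N) pw 1 n + C.
Proof.
move=> e0; have [C HC] := tt_sum_asym gas e0; exists C => N.
have := HC 1 N (lexx _) (ltac:(lra)); congr (_ <= _); apply: eq_bigr => n _.
congr (`|_ - _|); rewrite /tt; have [_ _ /(_ n)] := weightP; rewrite /wrho invr_gt0 => Nn.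
by rewrite Nn powR_inv1// ltW.
Qed.

Lemma weight_Mp : pos_macaev ip rho_op.
Proof.
have [dr r1 r0] := weightP.
have l2 : 0 < ln (2 : R) by rewrite ln_gt0// ltr1n.
apply: (MpI hilb (C := (ln 2)^-1 + 1) dr) => N N2.
have lN : ln (2 : R) <= ln N%:R by rewrite ler_ln ?posrE ?ltr0n ?ler_nat// (leq_trans _ N2).
have lN0 : 0 < ln (N%:R : R) by exact: lt_le_trans lN.
rewrite ler_pdivrMr//; apply: (@le_trans _ _ (1 + ln N%:R)).
  apply: le_trans (harmonic_le R N); rewrite /sig; apply: ler_sum => n _.
  by rewrite pw1.
by rewrite mulrDl mul1r lerD2r mulrC ler_pdivlMr// mul1r.
Qed.

Definition Omega b : R[i] := dixmier_trace ip w (b \o rho_op).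

Lemma OmegaE b : bounded_op b -> Omega b =
  seq_limit w (log_mean rho (fun n => Re (ip (b (e n)) (e n)))) +i*
  seq_limit w (log_mean rho (fun n => Im (ip (b (e n)) (e n)))).
Proof.
by have [dr r1 _] := weightP; have M := weight_Mp => bb; eapply dixmier_trace_comp; eassumption.
Qed.

Lemma weight_mean_bseq (a : nat -> R) C : (forall n, `|a n| <= C) -> bseq (log_mean rho a).
Proof.
by have [dr r1 _] := weightP; have M := weight_Mp => aC; eapply log_mean_bseq; eassumption.
Qed.

Lemma Omega_linear : linear_on (@bounded_op R h) Omega.
Proof.
move=> c a b ba bb; have M := weight_Mp.
have [lD _] := dixmier_trace_exists hilb hw.
have -> : Omega ((c \*: a) \+ b) = dixmier_trace ip w ((c \*: (a \o rho_op)) \+ (b \o rho_op)) by [].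
rewrite lD//.
  exact: (RT_macaev hilb (RT_comp hilb hw ba M)).
exact: (RT_macaev hilb (RT_comp hilb hw bb M)).
Qed.

(** The weights [rho n] diverge logarithmically like the harmonic series, with the same coefficient
    1; this normalizes the volume form. *)
Lemma log_mean_const (B : R) : log_mean rho (fun=> B) @ \oo --> B.
Proof.
have K (x y l ey el r t : R) : y <= 1 + l -> l <= y -> `|x - y| <= ey + r -> ey <= t + el ->
    0 <= r -> `|x - l| <= el + (t + r + 1).
  by move=> h1 h2; rewrite !ler_norml => /andP[h3 h4] h5 h6; apply/andP; split; lra.
have H : (fun N => (\sum_(n < N) rho n - ln N%:R) / ln (N%:R : R)) @ \oo --> (0 : R).
  apply: log_ratio => eps e0; have [C HC] := rho_asym e0; exists (eps + `|C| + 1) => N.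
  have h1 := harmonic_le R N; have h2 := harmonic_ge R N.
  have h3 : `|\sum_(n < N) rho n - \sum_(n < N) pw 1 n| <= eps * \sum_(n < N) pw 1 n + `|C|.
    rewrite -sumrB; apply: le_trans (ler_norm_sum _ _ _) _; apply: le_trans (HC N) _.
    by rewrite lerD2l ler_norm.
  have h4 := ler_wpM2l (ltW e0) h1; rewrite mulrDr mulr1 in h4.
  exact: (K _ _ _ _ _ _ _ h1 h2 h3 h4 (normr_ge0 C)).
have : (fun N => B * ((\sum_(n < N) rho n - ln N%:R) / ln (N%:R : R) + 1)) @ \oo --> B * (0 + 1).
  by apply: cvgM; [exact: cvg_cst|apply: cvgD; [exact: H|exact: cvg_cst]].
rewrite add0r mulr1; apply: cvg_trans; apply: near_eq_cvg; exists 2%N => // N /= N2.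
have l0 : ln (N%:R : R) != 0 by rewrite gt_eqF// ln_gt0// ltr1n.
by rewrite /log_mean -mulr_suml; field.
Qed.

Lemma seq_limit_bound (a : nat -> R) B : (forall n, `|a n| <= B) ->
  `|seq_limit w (log_mean rho a)| <= B.
Proof.
move=> aB; have [_ _ r0] := weightP.
have b1 := weight_mean_bseq aB; have cB (r : R) : bseq (log_mean rho (fun=> r)) by exact: bseq_cvg (@log_mean_const r).
have mono (u v : nat -> R) : (forall n, u n <= v n) -> forall N, log_mean rho u N <= log_mean rho v N.
  move=> uv N; rewrite /log_mean ler_wpM2r ?invr_ge0 ?lnN_ge0//.
  by apply: ler_sum => n _; rewrite ler_wpM2l// ltW.
rewrite ler_norml; apply/andP; split.
  rewrite -(seq_limit_cvg hw (@log_mean_const (- B))); apply: (seq_limit_le hw) => //.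
  by apply: mono => n; have := aB n; rewrite ler_norml => /andP[].
rewrite -[leRHS](seq_limit_cvg hw (@log_mean_const B)); apply: (seq_limit_le hw) => //.
by apply: mono => n; have := aB n; rewrite ler_norml => /andP[].
Qed.

Lemma Omega_bounded : bounded_functional Omega.
Proof.
split; first exact: Omega_linear.
exists 2 => b bb; rewrite OmegaE//; apply: cnorm_le => /=; apply: seq_limit_bound => n.
  by have [] := coef_le n bb.
by have [] := coef_le n bb.
Qed.

Lemma Omega_pos b : positive_op ip b -> 0 <= Omega b.
Proof.
move=> [bb pb]; have [_ _ r0] := weightP.
have rp n : 0 <= Re (ip (b (e n)) (e n)) /\ Im (ip (b (e n)) (e n)) = 0.
  by have := pb (e n); rewrite lecE /= => /andP[/eqP].
have z0 : bseq (fun=> 0 : R) by exists 0 => n; rewrite normr0.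
rewrite OmegaE// lecE /=; apply/andP; split.
  rewrite (_ : log_mean _ _ = fun=> 0) ?(seq_limit0 hw)//.
  by apply/funext => N; rewrite /log_mean big1 ?mul0r// => n _; rewrite (rp n).2 mulr0.
rewrite -(seq_limit0 hw); apply: (seq_limit_le hw) => //.
  by apply: (@weight_mean_bseq _ (opnorm b)) => n; have [] := coef_le n bb.
move=> N; rewrite /log_mean mulr_ge0 ?invr_ge0 ?lnN_ge0// sumr_ge0// => n _.
by rewrite mulr_ge0 ?(rp n).1// ltW.
Qed.

Lemma Omega_id : Omega id = 1.
Proof.
rewrite OmegaE; last exact: bounded_id.
have -> : (fun n => Re (ip (e n) (e n))) = (fun=> 1) by apply/funext => n; rewrite sqE e1.
have -> : (fun n => Im (ip (e n) (e n))) = (fun=> 0) by apply/funext => n; rewrite sqE e1.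
by rewrite (seq_limit_cvg hw (@log_mean_const 1)) (seq_limit_cvg hw (@log_mean_const 0)).
Qed.

(** [key_rot] at [s = 1] bounds the partial sums with weights [tt f 1]. Passing to the weights [rho]
    costs a small multiple of [ln N], because both are close to [1 / (n + 1)] in the mean. *)
Lemma Omega_comm a b : lipschitz_algebra L a -> bounded_op b -> Omega (commutator a b) = 0.
Proof.
move=> aL bb; have [ba _ _] := aL; have [B B0 bB] := bounded_opE bb; have lb := bounded_lin bb.
have [Ca Ca0 aC] := bounded_opE ba; have bc := comm_bounded ba bb.
have oc := opnorm_ge0 bc; set Q := opnorm (commutator a b) in oc.
have Kadd (x y z c1 c2 : R) : x <= z + c1 -> y <= z + c2 -> x + y <= 2 * z + (c1 + c2) by lra.
have Kfin (x y z t u : R) : x <= t + y -> z <= u -> x + z <= y + (t + u) by lra.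
have main (pr : R[i] -> R) : (forall z : R[i], pr z = Re z) \/ (forall z : R[i], pr z = Im z) ->
    seq_limit w (log_mean rho (fun n => pr (ip (commutator a b (e n)) (e n)))) = 0.
  move=> prE; apply: (seq_limit_cvg hw); apply: log_ratio => eps e0.
  (* [B] is the factor of the commutator estimate and [2 * Q] that of the two changes of weights;
     dividing by [W] makes the errors add up to [eps]. *)
  pose W := B + 2 * Q; have W0 : 0 < W by rewrite ltr_wpDr ?mulr_ge0.
  have ew : 0 < eps / W by exact: divr_gt0.
  have [C C0 HC] : exists2 C, 0 <= C &
    forall s M b B, 1 <= s -> s <= 2 -> linear b -> 0 <= B -> bounded_by b B ->
    `|Re (\sum_(n < M) (tt f s n)%:C * ip (commutator a b (e n)) (e n))| <=
      B * (eps / W * \sum_(n < M) pw s n + C) /\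
    `|Im (\sum_(n < M) (tt f s n)%:C * ip (commutator a b (e n)) (e n))| <=
      B * (eps / W * \sum_(n < M) pw s n + C).
    by eapply key_rot; eassumption.
  have [C1 H1] := rho_asym ew; have [C2 H2] := tt_sum_asym fas ew.
  exists (eps + `|B * C + Q * (C1 + C2)|) => N.
  set p := fun n => pr (ip (commutator a b (e n)) (e n)).
  have pQ n : `|p n| <= Q by have [q1 q2] := coef_le n bc; rewrite /p; case: prE => ->.
  have k1 : `|\sum_(n < N) tt f 1 n * p n| <= B * (eps / W * \sum_(n < N) pw 1 n + C).
    have [hR hI] := HC 1 N b B (lexx _) (ltac:(lra)) lb (ltW B0) bB.
    rewrite Re_sum in hR; rewrite Im_sum in hI.
    have hR' : `|\sum_(n < N) tt f 1 n * Re (ip (commutator a b (e n)) (e n))| <=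
        B * (eps / W * \sum_(n < N) pw 1 n + C).
      by apply: le_trans hR; rewrite le_eqVlt; apply/orP; left; apply/eqP; congr (`|_|);
        apply: eq_bigr => n _; rewrite Re_realM.
    have hI' : `|\sum_(n < N) tt f 1 n * Im (ip (commutator a b (e n)) (e n))| <=
        B * (eps / W * \sum_(n < N) pw 1 n + C).
      by apply: le_trans hI; rewrite le_eqVlt; apply/orP; left; apply/eqP; congr (`|_|);
        apply: eq_bigr => n _; rewrite Im_realM.
    by rewrite /p; case: prE => E; under eq_bigr do rewrite E.
  have k2 : `|\sum_(n < N) rho n * p n - \sum_(n < N) tt f 1 n * p n| <=
      Q * (2 * (eps / W * \sum_(n < N) pw 1 n) + (C1 + C2)).
    rewrite -sumrB; apply: le_trans (ler_norm_sum _ _ _) _.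
    apply: (@le_trans _ _ (\sum_(n < N) Q * (`|rho n - pw 1 n| + `|tt f 1 n - pw 1 n|))).
      apply: ler_sum => n _; rewrite -mulrBl normrM mulrC; apply: ler_pM => //.
      have -> : rho n - tt f 1 n = (rho n - pw 1 n) - (tt f 1 n - pw 1 n) by ring.
      exact: ler_normB.
    rewrite -mulr_sumr ler_wpM2l// big_split /=.
    exact: (Kadd _ _ _ _ _ (H1 N) (H2 1 N (lexx _) (ltac:(lra)))).
  have h1 := harmonic_le R N.
  have h2 := ler_wpM2l (ltW e0) h1; rewrite mulrDr mulr1 in h2.
  have E : B * (eps / W * \sum_(n < N) pw 1 n + C) + Q * (2 * (eps / W * \sum_(n < N) pw 1 n) + (C1 + C2)) =
      eps * \sum_(n < N) pw 1 n + (B * C + Q * (C1 + C2)).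
    by rewrite /W; field; rewrite -/W gt_eqF.
  have k3 : `|\sum_(n < N) rho n * p n| <= eps * \sum_(n < N) pw 1 n + (B * C + Q * (C1 + C2)).
    rewrite -E -[X in `|X|](subrK (\sum_(n < N) tt f 1 n * p n)).
    by apply: le_trans (ler_normD _ _) _; rewrite addrC; apply: lerD.
  by apply: le_trans k3 _; exact: (Kfin _ _ _ _ _ h2 (ler_norm _)).
rewrite OmegaE//; apply: complex_ext => /=.
  exact: (main Re (or_introl (fun=> erefl))).
exact: (main Im (or_intror (fun=> erefl))).
Qed.

Lemma Omega_hypertrace : hypertrace_on (norm_closure (lipschitz_algebra L)) Omega.
Proof.
have HC a b : lipschitz_algebra L a -> bounded_op b -> Omega (commutator a b) = 0 by exact: Omega_comm.
have LB : lipschitz_algebra L `<=` @bounded_op R h by move=> a [].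
by have OB := Omega_bounded; eapply hypertrace_closure; eassumption.
Qed.
End Omega.
End States.

(** * Assembly on the eigenbasis of [L], with [f n = phi (lam n)] *)

Theorem theorem6p1 (R : realType) (h : completeNormedModType R[i])
  (ip : {dot h for Num.conj}) (hilb : is_hilbert ip)
  (L : partial_op h)
  (Lsa : selfadjoint ip L) (Lnn : nonnegative ip L) (Lub : unbounded L)
  (Ldisc : discrete_off_kernel ip L)
  (phi dphi : R -> R)
  (phi_ge0 : forall x : R, 0 <= x -> 0 <= phi x)
  (phi_cont : {within `[0, +oo[, continuous phi})
  (phi_incr : forall x y : R, 0 <= x -> x <= y -> phi x <= phi y)
  (dphiE : weak_derivative phi dphi)
  (dphi_loc : locally_ess_bounded dphi)
  (dphi_lim : ess_limsup (fun x => dphi x / phi x) = 0%E)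
  (N_equiv : fine (counting_function ip L x) / phi x @[x --> +oo] --> (1 : R)) :
  let AL := lipschitz_algebra L in
  let A := norm_closure AL in
  let phiLs := fun s : R => negative_power ip (functional_calculus ip L phi) s in
  let om := fun (s : R) (b : h -> h) => (s - 1)%:C * trace ip (b \o phiLs s) in
  (* (1.a) *)
  ((forall s : R, 1 < s ->
      pdom (phiLs s) = setT /\ trace_class ip (phiLs s)) /\
   ((s - 1)%:C * trace ip (phiLs s) : R[i]^o) @[s --> 1^'+] --> (1 : R[i]^o)) /\
  (* (1.b) *)
  (forall a : h -> h, AL a ->
     ((s - 1)%:E * pos_trace ip (op_abs ip (commutator a (phiLs s))))%E
       @[s --> 1^'+] --> 0%E) /\
  (* (1.c) *)
  (forall a b : h -> h, AL a -> bounded_op b ->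
     ((s - 1)%:C * trace ip (commutator a b \o phiLs s) : R[i]^o)
       @[s --> 1^'+] --> (0 : R[i]^o)) /\
  (* (2) *)
  ((forall s : R, 1 < s -> bounded_functional (om s)) /\
   (exists tau : (h -> h) -> R[i],
      bounded_functional tau /\ weak_star_limit_point om tau) /\
   (forall tau : (h -> h) -> R[i],
      bounded_functional tau -> weak_star_limit_point om tau ->
      [/\ state_on ip (@bounded_op R h) tau,
          forall K : h -> h, compact_op K -> tau K = 0,
          hypertrace_on A tau &
          tracial_state_on ip A tau])) /\
  (* (3) *)
  (forall w : (R -> R) -> R, dixmier_ultrafilter w ->
     let Omega := fun b : h -> h => dixmier_trace ip w (b \o spectral_weight ip L) in
     hypertrace_on A Omega /\ tracial_state_on ip A Omega).
Proof.
have [e [lam [oe e1 lam0 lnd [lam_inf Ld]]]] := discrete_eigenbasis hilb Lsa Lnn Lub Ldisc.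
pose f n := phi (lam n).
have fnd m n : (m <= n)%N -> f m <= f n by move=> /lnd mn; apply: phi_incr => //; exact: ltW.
have mdphi : measurable_fun (`[0, +oo[ : set R) dphi by case: dphi_loc.
have Nge n r : lam n <= r -> n.+1%:R <= fine (counting_function ip L r).
  by move=> nr; eapply counting_ge; eassumption.
have Nle n r : r < lam n -> fine (counting_function ip L r) <= n%:R.
  by move=> rn; eapply counting_le; eassumption.
have asy (eps : R) : 0 < eps -> exists n0, forall n, (n0 <= n)%N ->
  [/\ 0 < phi (lam n), `|phi (lam n) - n.+1%:R| <= eps * n.+1%:R &
      `|fine (counting_function ip L (lam n)) - n.+1%:R| <= eps * n.+1%:R].
  by move=> e0; apply: (phi_eigen (Nf := fun r => fine (counting_function ip L r))).
have fas (eps : R) : 0 < eps -> exists n0, forall n, (n0 <= n)%N ->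
     0 < f n /\ `|f n - n.+1%:R| <= eps * n.+1%:R.
  by move=> /asy[n0 H]; exists n0 => n /H[].
have gas (eps : R) : 0 < eps -> exists n0, forall n, (n0 <= n)%N ->
     0 < fine (counting_function ip L (lam n)) /\
     `|fine (counting_function ip L (lam n)) - n.+1%:R| <= eps * n.+1%:R.
  move=> /asy[n0 H]; exists n0 => n /H[_ _ ?]; split => //.
  by apply: lt_le_trans (Nge n _ (lexx _)); rewrite ltr0n.
have fgr (eta : R) : 0 < eta -> exists n0, forall n i, (n0 <= n)%N -> (n <= i)%N ->
     f i - f n <= eta * f i * (lam i - lam n).
  move=> eta0; have [T [T0 HT]] : exists T, 0 <= T /\
      forall x y, T < x -> x <= y -> phi y - phi x <= eta * phi y * (y - x).
    by apply: (phi_growth (Nf := fun r => fine (counting_function ip L r)) (dphi := dphi)).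
  have /cvgryPgt/(_ T)[n0 _ Hn0] := lam_inf; exists n0 => n i /Hn0 /= Tn ni.
  by apply: HT => //; exact: lnd.
move=> AL A phiLs om.
have pdiag s : is_diag ip e (tt f s) (phiLs s).
  by apply: negative_power_fc => //; eassumption.
have pE s : 1 < s -> pdom (phiLs s) = setT /\ phiLs s = Tp ip e f s :> (h -> h).
  by move=> s1; have [D HD] := Tp_bound fas s1; exact: (is_diag_bounded hilb oe e1 (pdiag s) HD).
have omE s b : 1 < s -> om s b = (s - 1)%:C * trace ip (b \o Tp ip e f s).
  by move=> s1; rewrite /om (pE s s1).2.
(* The operator [phiLs s] is identified with [Tp ip e f s] for [s > 1], which is enough for limits
   from the right at 1. *)
have near1 : \forall s \near (1 : R)^'+, 1 < s by exact: nbhs_right_gt.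
have trl : ((s - 1)%:C * trace ip (Tp ip e f s) : R[i]^o) @[s --> 1^'+] --> (1 : R[i]^o).
  by eapply trace_lim; eassumption.
have coml a b : AL a -> bounded_op b ->
   ((s - 1)%:C * trace ip (commutator a b \o Tp ip e f s) : R[i]^o) @[s --> 1^'+] --> (0 : R[i]^o).
  by move=> ? ?; eapply comm_trace_lim; eassumption.
have om_lim b (l : R[i]) : ((s - 1)%:C * trace ip (b \o Tp ip e f s) : R[i]^o) @[s --> 1^'+] --> (l : R[i]^o) ->
    (om s b : R[i]^o) @[s --> 1^'+] --> (l : R[i]^o).
  apply: cvg_trans; apply: near_eq_cvg; apply: filterS near1 => s s1.
  by rewrite (omE s b s1).
have om_lin s : 1 < s -> linear_on (@bounded_op R h) (om s).
  move=> s1 c a b ba bb; rewrite !omE//.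
  have lt : linear_on (@bounded_op R h) (fun b => trace ip (b \o Tp ip e f s)).
    by eapply T_trace_lin; eassumption.
  by rewrite lt// mulrDr mulrCA.
have om_bound s b C : 1 < s -> bounded_op b -> (forall N, (s - 1) * \sum_(n < N) tt f s n <= C) ->
    `|complex.Re (om s b)| <= C * opnorm b /\ `|complex.Im (om s b)| <= C * opnorm b.
  move=> s1 bb HC; have t0 : 0 < s - 1 by rewrite subr_gt0.
  have HC' N : \sum_(n < N) tt f s n <= C / (s - 1) by rewrite ler_pdivlMr// mulrC.
  have [r1 r2] : `|complex.Re (trace ip (b \o Tp ip e f s))| <= C / (s - 1) * opnorm b /\
      `|complex.Im (trace ip (b \o Tp ip e f s))| <= C / (s - 1) * opnorm b.
    by eapply T_trace_bounded; eassumption.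
  rewrite omE// Re_realM Im_realM !normrM (gtr0_norm t0).
  by split; rewrite mulrC -ler_pdivlMr// mulrAC.
have ALb : AL `<=` @bounded_op R h by move=> a [].
split; [split|split; [|split; [|split; [split; [|split]|]]]].
- move=> s s1; have [-> ->] := pE s s1; split => //.
  by eapply Tp_trace_class; eassumption.
- apply: cvg_trans trl; apply: near_eq_cvg; apply: filterS near1 => s s1.
  by rewrite (pE s s1).2.
- move=> a aL; have H : ((s - 1)%:E * pos_trace ip (op_abs ip (commutator a (Tp ip e f s))))%E @[s --> 1^'+] --> 0%E.
    by eapply comm_abs_lim; eassumption.
  apply: cvg_trans H; apply: near_eq_cvg; apply: filterS near1 => s s1.
  by rewrite (pE s s1).2.
- by move=> a b aL bb; apply: om_lim; exact: coml.
- move=> s s1; split; first exact: om_lin.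
  have [C HC] := tt_sum_bounded fas s1; exists (2 * ((s - 1) * C)) => b bb; rewrite -mulrA.
  have t0 : 0 <= s - 1 by rewrite subr_ge0 ltW.
  by have [r1 r2] := om_bound s b _ s1 bb (fun N => ler_wpM2l t0 (HC N)); exact: cnorm_le.
- have [K0 K00 HK] := tt_uniform fas.
  apply: (limit_point_exists K00) => [s s1 _|s b s1 s2 bb]; first exact: om_lin.
  by apply: om_bound => // N; exact: HK.
- move=> tau bt wt; have [lt _] := bt.
  have pos b : positive_op ip b -> 0 <= tau b.
    move=> pb; have [bb _] := pb; apply: (limit_point_pos wt bb).
    apply: filterS near1 => s s1; rewrite omE// mulr_ge0//.
      by rewrite ler0c subr_ge0 ltW.
    by eapply T_trace_pos; eassumption.
  have unit : tau id = 1 by apply: (limit_point_lim wt (@bounded_id R h)); exact: om_lim trl.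
  have hyp : hypertrace_on A tau.
    have HC a b : AL a -> bounded_op b -> tau (commutator a b) = 0.
      move=> aL bb; have bc : bounded_op (commutator a b) by apply: comm_bounded => //; exact: ALb.
      by apply: (limit_point_lim wt bc); apply: om_lim; exact: coml.
    by eapply hypertrace_closure; eassumption.
  split; [by split => // b _; exact: pos | | exact: hyp | exact: (tracial_of_hyper lt pos unit hyp)].
  move=> K cK; apply: (limit_point_lim wt (compact_bounded cK)); apply: om_lim.
  by eapply compact_trace_lim; eassumption.
move=> w hw Om.
have hyp : hypertrace_on A Om by eapply Omega_hypertrace; eassumption.
split => //.
have lO : linear_on (@bounded_op R h) Om by eapply Omega_linear; eassumption.
have pO b : positive_op ip b -> 0 <= Om b by move=> ?; eapply Omega_pos; eassumption.
have uO : Om id = 1 by eapply Omega_id; eassumption.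
exact: (tracial_of_hyper lO pO uO hyp).
Qed.
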